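(* Let $d\ge2$. Suppose that $\{G_1,\dots,G_m\}$ is a universal instruction set for $\mathrm{SU}(d)$, and that words of length at most $\ell_0$ over this instruction set form an $\varepsilon_0$-net for $\mathrm{SU}(d)$. Let $T_0$ and $S_0$ denote, respectively, the time and space costs of the corresponding depth-zero net-search routine (which, given $U\in\mathrm{SU}(d)$, returns a word of length at most $\ell_0$ within distance $\varepsilon_0$ of $U$ by searching the explicit net). Let $U_1,\dots,U_p\in\mathrm{SU}(d)$ be a list of unitaries and $\varepsilon>0$. Then, after a preprocessing step based on the usual Solovay--Kitaev algorithm, one can construct, for each $1\le i\le p$, a circuit over $\{G_1,\dots,G_m\}$ approximating $U_i$ up to operator-norm error at most $\varepsilon$, in total time $$O\left(d^2(T_0+d^3)\log^{k_t}d+p\,d^4\log^{k_t}(1/\varepsilon)\right),$$ using $O(S_0+d^4)$ additional working space excluding the storage needed for the output circuits. The expanded circuit lengths are $$O\left(\ell_0\,d^{19/2}\log^{k_\ell}(d)\,\log^{k_\ell}(1/\varepsilon)\right),$$ where $k_t=\log3/\log(3/2)$ and $k_\ell=\log5/\log(3/2)$.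
   Context: $\|\cdot\|$ is the operator norm. An instruction set is a finite set of gates in $\mathrm{SU}(d)$, assumed closed under inverses; it is universal if finite products of its gates are dense in $\mathrm{SU}(d)$. An $\varepsilon_0$-net is a set of elements such that every $U\in\mathrm{SU}(d)$ is within operator-norm distance $\varepsilon_0$ of some element of the set. Universal constants. $\mathfrak{su}(d)$ is the space of traceless Hermitian $d\times d$ matrices with $[X,Y]=i(XY-YX)$. $0<\delta_0<\pi$ and $C\ge1$ are universal constants (independent of $d$ and of the number of factors $r$) such that whenever $X_1,\dots,X_r\in\mathfrak{su}(d)$ with $\sum_j\|X_j\|\le\delta\le\delta_0$, $\log\prod_je^{iX_j}=\sum_jX_j+\frac12\sum_{i<j}[X_i,X_j]+R$ with $\|R\|\le C\delta^3$ (Baker--Campbell--Hausdorff; here $\log U$ denotes $H\in\mathfrak{su}(d)$ with $\exp(iH)=U$, the principal one when it is traceless). Put $c=8\sqrt{2\pi}+8\pi+13+(32\pi)^{3/2}C$; $\varepsilon_0$ is a fixed universal constant with $0<\varepsilon_0<\min\{1/c^2,\delta_0^2/(32\pi)\}$. The usual Solovay--Kitaev algorithm $\mathrm{SK}(U,t)$ is the recursion: for $t=0$ return the net-search result for $U$; for $t\ge1$ let $U_{t-1}=\mathrm{SK}(U,t-1)$, find $V,W\in\mathrm{SU}(d)$ with $[\log V,\log W]=\log(U^\dagger U_{t-1})$ and $\|\log V\|,\|\log W\|\le2\sqrt{\|\log(U^\dagger U_{t-1})\|}$, let $V_{t-1}=\mathrm{SK}(V,t-1)$, $W_{t-1}=\mathrm{SK}(W,t-1)$,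 and return $U_{t-1}W_{t-1}^\dagger V_{t-1}^\dagger W_{t-1}V_{t-1}$. With suitable $t=t(\varepsilon)$ it approximates one target to error $\varepsilon$ in time $O((d^3+T_0)\log^{k_t}(1/\varepsilon))$ with circuit length $O(\ell_0\log^{k_\ell}(1/\varepsilon))$. $T_0$ and $S_0$ are costs of searching an explicit net: they scale as $O(d^2N_{\varepsilon_0})$, where the number of net nodes $N_{\varepsilon_0}$ is at least $2^{\Omega(d^2)}$. Complexity conventions. Real-RAM model: arithmetic operations and comparisons on real numbers take unit time; numerical issues are ignored. Output circuits are represented as straight-line programs (sequences of references to previously constructed gates and subroutines); time and working space refer to constructing this representation, while expanded circuit length is the number of gates of the instruction set in the fully expanded word. $O(\cdot)$ refers to $\varepsilon\to0$ and varying $d,p$, with universal constants (including $\varepsilon_0$) absorbed. *)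

(* Defs.v *)
From HB Require Import structures.
From mathcomp Require Import all_boot all_order all_algebra.
From mathcomp Require Import spectral.
From mathcomp Require Import all_classical all_reals all_analysis.
From mathcomp Require Import complex.

Set Implicit Arguments.
Unset Strict Implicit.
Unset Printing Implicit Defensive.

Import Order.TTheory GRing.Theory Num.Theory.
Import numFieldNormedType.Exports.

Local Open Scope classical_set_scope.
Local Open Scope ring_scope.
Local Open Scope sesquilinear_scope.
Local Open Scope complex_scope.

Section LinearAlgebra.
Variable R : realType.

Definition l2norm n (v : 'cV[R[i]]_n) : R :=
  Num.sqrt (\sum_i (complex.Re (v i 0) ^+ 2 + complex.Im (v i 0) ^+ 2)).

Definition opnorm n (A : 'M[R[i]]_n) : R :=
  sup [set l2norm (A *m v) | v in [set v : 'cV[R[i]]_n | l2norm v <= 1]].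

Definition SU n (A : 'M[R[i]]_n) : Prop := A \is unitarymx /\ \det A = 1.

Definition hermitian_mx n (A : 'M[R[i]]_n) : Prop := A ^t* = A.

(* The physicists' convention: Hermitian, not anti-Hermitian, matrices. *)
Definition su n (A : 'M[R[i]]_n) : Prop := hermitian_mx A /\ \tr A = 0.

Definition bracket n (X Y : 'M[R[i]]_n) : 'M[R[i]]_n :=
  'i%C *: (X *m Y - Y *m X).

Definition exp_partial n (A : 'M[R[i]]_n) (k : nat) : 'M[R[i]]_n :=
  \sum_(j < k) (j`!%:R)^-1 *: A ^+ j.

(* The power series of the exponential, whose limit is taken separately in the
   real and imaginary part of each entry. *)
Definition expmx n (A : 'M[R[i]]_n) : 'M[R[i]]_n :=
  \matrix_(i, j) ((limn (fun k => complex.Re (exp_partial A k i j)))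
               +i* (limn (fun k => complex.Im (exp_partial A k i j)))).

Definition expi n (H : 'M[R[i]]_n) : 'M[R[i]]_n := expmx ('i%C *: H).

Definition principal_log n (U H : 'M[R[i]]_n) : Prop :=
  [/\ hermitian_mx H, expi H = U &
      forall a : R[i], eigenvalue H a -> - pi < complex.Re a <= pi].

(* "H is log U": a logarithm in su(n), which has to be the principal one
   whenever the principal one is traceless. *)
Definition is_log n (U H : 'M[R[i]]_n) : Prop :=
  [/\ su H, expi H = U &
      forall H', principal_log U H' -> \tr H' = 0 -> H = H'].

Definition bch_constants (delta0 C : R) : Prop :=
  [/\ 0 < delta0 < pi, 1 <= C &
    forall (d r : nat) (X : 'I_r -> 'M[R[i]]_d) (delta : R),
      (2 <= d)%N -> (forall j, su (X j)) ->
      \sum_j opnorm (X j) <= delta -> delta <= delta0 ->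
      exists2 H, is_log (\prod_j expi (X j)) H &
        opnorm (H - (\sum_j X j
          + 2%:R^-1 *: \sum_(j < r) \sum_(i < r | (i < j)%N) bracket (X i) (X j)))
        <= C * delta ^+ 3].

Definition sk_const (C : R) : R :=
  8 * Num.sqrt (2 * pi) + 8 * pi + 13 + (32 * pi) `^ (3 / 2) * C.

Definition k_time : R := ln 3 / ln (3 / 2).
Definition k_length : R := ln 5 / ln (3 / 2).

Definition eps_net n (e : R) (N : set 'M[R[i]]_n) : Prop :=
  N `<=` [set A | SU A] /\
  forall U, SU U -> exists2 A, N A & opnorm (U - A) <= e.

End LinearAlgebra.

Section Words.
Variables (R : realType) (d m : nat) (G : 'I_m -> 'M[R[i]]_d).

Definition word_eval (w : seq 'I_m) : 'M[R[i]]_d :=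
  foldr (fun j A => G j *m A) 1%:M w.

Definition words_upto (l : nat) : set 'M[R[i]]_d :=
  [set word_eval w | w in [set w : seq 'I_m | (size w <= l)%N]].

Definition instruction_set : Prop :=
  (forall j, SU (G j)) /\ (forall j, exists k, G k = (G j) ^t*).

Definition universal : Prop :=
  forall U, SU U -> forall e : R, 0 < e ->
    exists w, opnorm (U - word_eval w) < e.

(* For a set of gates closed under inverses this is the index of an inverse of
   gate j; the default j is then never used. *)
Definition inv_gate (j : 'I_m) : 'I_m := odflt j [pick k | G k == (G j) ^t*].

Definition inv_word (w : seq 'I_m) : seq 'I_m := rev (map inv_gate w).

End Words.

(* References occurring in a line of a straight-line program; the boolean says
   whether the referenced gate or line is to be inverted. *)
Inductive ref (T : Type) : Type :=
  | GateRef of bool & T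
  | LineRef of bool & T.

Definition line := seq (ref nat).

Definition ref_map T T' (f : T -> T') (r : ref T) : ref T' :=
  match r with
  | GateRef b x => GateRef b (f x)
  | LineRef b x => LineRef b (f x)
  end.

Definition ref_arg T (r : ref T) : T :=
  match r with GateRef _ x => x | LineRef _ x => x end.

Section StraightLine.
Variables (R : realType) (d m : nat) (G : 'I_m -> 'M[R[i]]_d).

Definition ref_ok (n : nat) (r : ref nat) : bool :=
  match r with GateRef _ j => (j < m)%N | LineRef _ k => (k < n)%N end.

Definition expand_ref (acc : seq (seq 'I_m)) (r : ref nat) : seq 'I_m :=
  match r with
  | GateRef b j =>
      let w := if insub j is Some k then [:: k] else [::] in
      if b then inv_word G w else w
  | LineRef b k =>
      let w := nth [::] acc k in
      if b then inv_word G w else w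
  end.

(* The i-th element is the full expansion of line i as a word over the gates. *)
Definition expand (s : seq line) : seq (seq 'I_m) :=
  foldl (fun acc l => rcons acc (flatten (map (expand_ref acc) l))) [::] s.

End StraightLine.

(* Programs for a real RAM with two indirectly addressed memories, one of natural
   numbers (addresses, counters, references) and one of reals.  The syntax is
   finite and contains no real constants other than natural numbers, so one
   program handles all dimensions, targets and precisions. *)

Inductive nexp : Type :=
  | NConst of nat
  | NDim
  | NGates
  | NTargets
  | NLoad of nexp
  | NAdd of nexp & nexp
  | NSub of nexp & nexp
  | NMul of nexp & nexp.

(* Numerical issues are ignored: besides the four arithmetic operations, the square
   root and the trigonometric functions needed for matrix logarithms and
   exponentials are exact and take unit time. *)
Inductive rfun : Type := Sqrt | Cos | Sin | Atan.

(* In REntryT i j k b and REntryG i j k b, b = false (true) selects the real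
   (imaginary) part of the entry (j, k) of the i-th target, resp. gate. *)
Inductive rexp : Type :=
  | RNat of nexp
  | RPrecision
  | REntryT of nexp & nexp & nexp & bool
  | REntryG of nexp & nexp & nexp & bool
  | RLoad of nexp
  | RAdd of rexp & rexp
  | RSub of rexp & rexp
  | RMul of rexp & rexp
  | RDiv of rexp & rexp
  | RFun of rfun & rexp.

Inductive bexp : Type :=
  | NLe of nexp & nexp
  | RLe of rexp & rexp
  | BNot of bexp
  | BAnd of bexp & bexp.

Inductive cmd : Type :=
  | Skip
  | NStore of nexp & nexp              (* address, value *)
  | RStore of nexp & rexp              (* address, value *)
  | Seq of cmd & cmd
  | If of bexp & cmd & cmd
  | While of bexp & cmd
  | Diag of nexp & nexp & nexp & nexp  (* size, source, eigenbasis, eigenvalues *)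
  | Search of nexp & nexp & nexp       (* source, found matrix, found line *)
  | Emit of nexp & seq (ref nexp)      (* address for the line number, line *)
  | Answer of nexp & nexp.             (* target, line *)

Fixpoint nexp_cost (e : nexp) : nat :=
  match e with
  | NConst _ | NDim | NGates | NTargets => 1
  | NLoad a => (nexp_cost a).+1
  | NAdd a b | NSub a b | NMul a b => (nexp_cost a + nexp_cost b).+1
  end.

Fixpoint rexp_cost (e : rexp) : nat :=
  match e with
  | RPrecision => 1
  | RNat a | RLoad a => (nexp_cost a).+1
  | REntryT a b c _ | REntryG a b c _ =>
      (nexp_cost a + nexp_cost b + nexp_cost c).+1
  | RAdd a b | RSub a b | RMul a b | RDiv a b => (rexp_cost a + rexp_cost b).+1
  | RFun _ a => (rexp_cost a).+1
  end.

Fixpoint bexp_cost (e : bexp) : nat :=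
  match e with
  | NLe a b => (nexp_cost a + nexp_cost b).+1
  | RLe a b => (rexp_cost a + rexp_cost b).+1
  | BNot a => (bexp_cost a).+1
  | BAnd a b => (bexp_cost a + bexp_cost b).+1
  end.

(* "The number, entries and precision of the targets are not consulted." *)

Fixpoint nexp_oblivious (e : nexp) : bool :=
  match e with
  | NTargets => false
  | NConst _ | NDim | NGates => true
  | NLoad a => nexp_oblivious a
  | NAdd a b | NSub a b | NMul a b => nexp_oblivious a && nexp_oblivious b
  end.

Fixpoint rexp_oblivious (e : rexp) : bool :=
  match e with
  | RPrecision | REntryT _ _ _ _ => false
  | RNat a | RLoad a => nexp_oblivious a
  | REntryG a b c _ =>
      [&& nexp_oblivious a, nexp_oblivious b & nexp_oblivious c]
  | RAdd a b | RSub a b | RMul a b | RDiv a b =>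
      rexp_oblivious a && rexp_oblivious b
  | RFun _ a => rexp_oblivious a
  end.

Fixpoint bexp_oblivious (e : bexp) : bool :=
  match e with
  | NLe a b => nexp_oblivious a && nexp_oblivious b
  | RLe a b => rexp_oblivious a && rexp_oblivious b
  | BNot a => bexp_oblivious a
  | BAnd a b => bexp_oblivious a && bexp_oblivious b
  end.

Fixpoint oblivious (c : cmd) : bool :=
  match c with
  | Skip => true
  | NStore a e => nexp_oblivious a && nexp_oblivious e
  | RStore a e => nexp_oblivious a && rexp_oblivious e
  | Seq c1 c2 => oblivious c1 && oblivious c2
  | If b c1 c2 => [&& bexp_oblivious b, oblivious c1 & oblivious c2]
  | While b c1 => bexp_oblivious b && oblivious c1
  | Diag n a v w => [&& nexp_oblivious n, nexp_oblivious a,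
                        nexp_oblivious v & nexp_oblivious w]
  | Search a v k =>
      [&& nexp_oblivious a, nexp_oblivious v & nexp_oblivious k]
  | Emit a l =>
      nexp_oblivious a && all (fun r => nexp_oblivious (ref_arg r)) l
  | Answer _ _ => false
  end.

Fixpoint search_free (c : cmd) : bool :=
  match c with
  | Search _ _ _ => false
  | Seq c1 c2 | If _ c1 c2 => search_free c1 && search_free c2
  | While _ c1 => search_free c1
  | _ => true
  end.

(* slp and ans are write-only output: no expression reads them. *)
Record state (R : Type) := State {
  nmem : nat -> nat;
  rmem : nat -> R;
  slp : seq line;
  ans : nat -> option nat }.

Definition upd (T : Type) (f : nat -> T) (a : nat) (x : T) : nat -> T :=
  fun k => if k == a then x else f k.

Section Semantics.
Variables (R : realType) (d m p : nat).
Variables (G : 'I_m -> 'M[R[i]]_d) (U : 'I_p -> 'M[R[i]]_d) (eps : R).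
(* The net-search routine, with its running time per call. *)
Variables (search : 'M[R[i]]_d -> seq 'I_m) (T0 : nat).
(* Size of each of the two memories. *)
Variable S : nat.

Definition entry n q (F : 'I_n -> 'M[R[i]]_q) (i j k : nat) (b : bool) : R :=
  match (insub i : option 'I_n), (insub j : option 'I_q),
        (insub k : option 'I_q) with
  | Some i', Some j', Some k' =>
      if b then complex.Im (F i' j' k') else complex.Re (F i' j' k')
  | _, _, _ => 0
  end.

Fixpoint neval (st : state R) (e : nexp) : nat :=
  match e with
  | NConst n => n
  | NDim => d
  | NGates => m
  | NTargets => p
  | NLoad a => nmem st (neval st a)
  | NAdd a b => (neval st a + neval st b)%N
  | NSub a b => (neval st a - neval st b)%N
  | NMul a b => (neval st a * neval st b)%N
  end.

Definition rfun_eval (f : rfun) : R -> R :=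
  match f with Sqrt => Num.sqrt | Cos => cos | Sin => sin | Atan => atan end.

Fixpoint reval (st : state R) (e : rexp) : R :=
  match e with
  | RNat a => (neval st a)%:R
  | RPrecision => eps
  | REntryT a j k b => entry U (neval st a) (neval st j) (neval st k) b
  | REntryG a j k b => entry G (neval st a) (neval st j) (neval st k) b
  | RLoad a => rmem st (neval st a)
  | RAdd a b => reval st a + reval st b
  | RSub a b => reval st a - reval st b
  | RMul a b => reval st a * reval st b
  | RDiv a b => reval st a / reval st b
  | RFun f a => rfun_eval f (reval st a)
  end.

Fixpoint beval (st : state R) (e : bexp) : bool :=
  match e with
  | NLe a b => (neval st a <= neval st b)%N
  | RLe a b => reval st a <= reval st b
  | BNot a => ~~ beval st a
  | BAnd a b => beval st a && beval st b
  end.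

(* Matrices are laid out row by row, each entry as its real part followed by its
   imaginary part. *)
Definition matrix_cells q r (A : 'M[R[i]]_(q, r)) : seq R :=
  flatten [seq [:: complex.Re (A jk.1 jk.2); complex.Im (A jk.1 jk.2)]
          | jk <- [seq (j, k) | j <- enum 'I_q, k <- enum 'I_r]].

Definition write_mx q r (f : nat -> R) (a : nat) (A : 'M[R[i]]_(q, r)) :
    nat -> R :=
  fun k => if (a <= k < a + size (matrix_cells A))%N
           then nth 0 (matrix_cells A) (k - a) else f k.

Definition read_mx n (f : nat -> R) (a : nat) : 'M[R[i]]_n :=
  \matrix_(j < n, k < n) (f (a + (j * n + k).*2)%N
                      +i* f (a + (j * n + k).*2.+1)%N).

Definition set_nmem (st : state R) (f : nat -> nat) := State f (rmem st) (slp st) (ans st).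
Definition set_rmem (st : state R) (f : nat -> R) := State (nmem st) f (slp st) (ans st).
Definition set_ans (st : state R) (f : nat -> option nat) := State (nmem st) (rmem st) (slp st) f.

Definition add_line (st : state R) (a : nat) (l : line) : state R :=
  State (upd (nmem st) a (size (slp st))) (rmem st) (rcons (slp st) l) (ans st).

(* [exec c st t st']: c leads from st to st' in time t, storing only at addresses
   below S and emitting only references to existing gates and lines.  Diag
   factors a normal n x n matrix A as P^-1 *m diag_mx D *m P with P unitary, in
   time n^3.  The net search returns its word as a new line of the output and
   also the matrix that this word evaluates to, all within T0. *)
Inductive exec : cmd -> state R -> nat -> state R -> Prop :=
  | ExecSkip st : exec Skip st 0 st
  | ExecNStore a e st :
      (neval st a < S)%N ->
      exec (NStore a e) st (nexp_cost a + nexp_cost e).+1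
        (set_nmem st (upd (nmem st) (neval st a) (neval st e)))
  | ExecRStore a e st :
      (neval st a < S)%N ->
      exec (RStore a e) st (nexp_cost a + rexp_cost e).+1
        (set_rmem st (upd (rmem st) (neval st a) (reval st e)))
  | ExecSeq c1 c2 t1 t2 st1 st2 st3 :
      exec c1 st1 t1 st2 -> exec c2 st2 t2 st3 ->
      exec (Seq c1 c2) st1 (t1 + t2) st3
  | ExecIf b c1 c2 t st st' :
      exec (if beval st b then c1 else c2) st t st' ->
      exec (If b c1 c2) st (bexp_cost b + t).+1 st'
  | ExecWhileEnd b c st :
      ~~ beval st b -> exec (While b c) st (bexp_cost b).+1 st
  | ExecWhileStep b c t1 t2 st1 st2 st3 :
      beval st1 b -> exec c st1 t1 st2 -> exec (While b c) st2 t2 st3 ->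
      exec (While b c) st1 (bexp_cost b + t1 + t2).+1 st3
  | ExecDiag n a v w st :
      let q := neval st n in
      let A := read_mx q (rmem st) (neval st a) in
      A \is normalmx ->
      (neval st v + (q ^ 2).*2 <= S)%N -> (neval st w + q.*2 <= S)%N ->
      exec (Diag n a v w) st
        (nexp_cost n + nexp_cost a + nexp_cost v + nexp_cost w + q ^ 3).+1
        (set_rmem st (write_mx (write_mx (rmem st)
          (neval st v) (spectralmx A)) (neval st w) (spectral_diag A)))
  | ExecSearch a v k st :
      let w := search (read_mx d (rmem st) (neval st a)) in
      (neval st v + (d ^ 2).*2 <= S)%N -> (neval st k < S)%N ->
      exec (Search a v k) st (nexp_cost a + nexp_cost v + nexp_cost k + T0).+1
        (set_rmem
          (add_line st (neval st k) [seq GateRef false (val j) | j <- w])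
          (write_mx (rmem st) (neval st v) (word_eval G w)))
  | ExecEmit a l st :
      let l' := [seq ref_map (neval st) r | r <- l] in
      (neval st a < S)%N -> all (ref_ok m (size (slp st))) l' ->
      exec (Emit a l) st
        (nexp_cost a + \sum_(r <- l) (nexp_cost (ref_arg r)).+1).+1
        (add_line st (neval st a) l')
  | ExecAnswer a e st :
      (neval st e < size (slp st))%N ->
      exec (Answer a e) st (nexp_cost a + nexp_cost e).+1
        (set_ans st (upd (ans st) (neval st a) (Some (neval st e)))).

Definition init_state : state R :=
  State (fun=> 0%N) (fun=> 0) [::] (fun=> None).

Definition runs (c : cmd) (t : nat) (st : state R) : Prop :=
  exec c init_state t st.

Definition circuit (st : state R) (i : nat) : option (seq 'I_m) :=
  omap (nth [::] (expand G (slp st))) (ans st i).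

End Semantics.

(* Main.v *)
Require Import Defs.
From HB Require Import structures.
From mathcomp Require Import all_boot all_order all_algebra.
From mathcomp Require Import spectral sesquilinear.
From mathcomp Require Import all_classical all_reals all_analysis.
From mathcomp Require Import complex.
From mathcomp Require Import ring lra zify.

Set Implicit Arguments.
Unset Strict Implicit.
Unset Printing Implicit Defensive.

Import Order.TTheory GRing.Theory Num.Theory.
Import numFieldNormedType.Exports.

Local Open Scope ring_scope.
Local Open Scope sesquilinear_scope.
Local Open Scope complex_scope.
Import Normc.

(* All approximations are taken up to a global phase.  This loses nothing, because
   group commutators do not see phases, and every U in SU(d) is one: diagonalise
   U = Q^* diag(u) Q; as the u_j have product 1, U = [V, W] with V conjugate to the
   diagonal matrix of the partial products of the u_j and W to the cyclic
   permutation.  It also removes the need for a traceless logarithm in the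
   Solovay-Kitaev step: the anti-Hermitian part of the phase-corrected residual,
   made traceless, is a commutator of two small Hermitian matrices, since the
   eigenvalues can be ordered so that their partial sums stay small.  The error
   then obeys e_{t+1} = 320 e_t^{3/2}, and the bound on eps0 gives e_0 <= 2^-18.

   For the depth-zero search at run time V is factored into O(d^2) rotations of
   adjacent coordinates, each angle being written with 40 digits in base d; the
   O(d^2) rotations by single digits are approximated once by the usual algorithm.
   Multiplying the approximants costs O(d^2) per factor when rows and columns are
   packed into single real numbers and rounded by y - atan(tan(pi y))/pi, and the
   same packing keeps the whole recursion stack in O(d^2) cells, so the space does
   not depend on the precision. *)

(** * The operator norm *)

(** Four budgets shape the construction. The preprocessing must not look at the precision, so its
    tolerance $2^{-25}/d^2$ depends on d alone: a depth-zero search spends fewer than $2d^2$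
    rotations at 41 tolerances each (40 digits and the truncated tail), in total at most $2^7
    d^2\cdot 2^{-25}/d^2=2^{-18}$, again the starting error of the recursion. The table has
    $80d(d-1)$ entries of $d^2$ complex numbers, which accounts for the space $d^4$. The time $d^4$
    per target leaves only $O(d^2)$ for each of the $O(d^2)$ products in a search; a plain product
    would cost $d^3$. Finally, rounded matrices only steer the recursion, while the error is
    certified for the emitted word: the distance between a stored matrix and its word grows at most
    twelvefold per level, and the integer scale B is computed from the depth so that this distance
    stays below $e_s^2$, which the step absorbs. Lengths multiply as $4\cdot5^{T}\cdot
    80d^2\cdot5^{T'}\ell_0$ for the depths $T$ of the main phase and $T'$ of the preprocessing. *)

HB.lock Definition dag (R : realType) m n (A : 'M[R[i]]_(m, n)) := A ^t*.
HB.lock Definition nrm (R : realType) n (A : 'M[R[i]]_n) := opnorm A.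

Definition unitary (R : realType) n (A : 'M[R[i]]_n) : Prop := A *m dag A = 1%:M.

Section OpNorm.
Variable R : realType.
Implicit Types (x y : R) (z w : R[i]).

(** Multiplying the defect by $B=\sum b_i^2$ turns it into $\sum_i (B a_i - S b_i)^2$, so nothing is
    divided; if B vanishes, so does every $b_i$. *)
Lemma sum_CS (I : finType) (a b : I -> R) :
  (\sum_i a i * b i) ^+ 2 <= (\sum_i a i ^+ 2) * (\sum_i b i ^+ 2).
Proof.
set S := \sum_i _ * _; set A := \sum_i a i ^+ 2; set B := \sum_i b i ^+ 2.
have B0 : 0 <= B by apply: sumr_ge0 => i _; exact: sqr_ge0.
have key : 0 <= B * (A * B - S ^+ 2).
  rewrite (_ : _ * _ = \sum_i (B * a i - S * b i) ^+ 2); last first.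
    rewrite (eq_bigr (fun i => B ^+ 2 * a i ^+ 2 + (- (2 * B * S)) * (a i * b i)
      + S ^+ 2 * b i ^+ 2)); last by move=> i _; ring.
    rewrite !big_split /= -!mulr_sumr -/A -/B -/S; ring.
  by apply: sumr_ge0 => i _; exact: sqr_ge0.
have [Bp|Bn] := ltrP 0 B.
  by rewrite -subr_ge0 -(pmulr_rge0 _ Bp).
have B00 : B = 0 by apply/eqP; rewrite eq_le Bn.
have b0 i : b i = 0.
  apply/eqP; rewrite -sqrf_eq0; apply/eqP.
  by apply: (psumr_eq0P _ B00) => // k _; exact: sqr_ge0.
rewrite /S big1 ?expr0n ?mulr_ge0 //; last by move=> i _; rewrite b0 mulr0.
by apply: sumr_ge0 => i _; exact: sqr_ge0.
Qed.

Lemma normc_ge0 z : 0 <= normc z. Proof. by case: z => a b; rewrite sqrtr_ge0. Qed.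
Hint Resolve normc_ge0 : core.

Lemma normc_sqr z : normc z ^+ 2 = complex.Re z ^+ 2 + complex.Im z ^+ 2.
Proof. by case: z => a b /=; rewrite sqr_sqrtr // addr_ge0 ?sqr_ge0. Qed.

Lemma normcE' z : (normc z)%:C = `|z|.
Proof. by case: z => a b; rewrite normc_def. Qed.

Lemma normc_real x : normc x%:C = `|x|.
Proof. by rewrite /= expr0n addr0 sqrtr_sqr. Qed.

Lemma normc_conj z : normc (z^*) = normc z.
Proof. by case: z => a b /=; rewrite sqrrN. Qed.

Lemma normc_i : normc ('i : R[i]) = 1.
Proof. by rewrite /= expr0n add0r expr1n sqrtr1. Qed.

Lemma normcD z w : normc (z + w) <= normc z + normc w.
Proof. exact: le_normcD. Qed.

Lemma normcNe z : normc (- z) = normc z.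
Proof. exact: normcN. Qed.

Lemma normcBC z w : normc (z - w) = normc (w - z).
Proof. by rewrite -normcNe opprB. Qed.

Lemma normc_sum (I : Type) (r : seq I) (P : pred I) (F : I -> R[i]) :
  normc (\sum_(i <- r | P i) F i) <= \sum_(i <- r | P i) normc (F i).
Proof.
elim/big_ind2: _ => [|z1 x1 z2 x2 h1 h2|//]; first by rewrite normc0.
by apply: le_trans (normcD _ _) _; rewrite lerD.
Qed.

Lemma conjCc z : Num.conj z = z^*%C.
Proof. by []. Qed.

Lemma mul_conjc z : z * z^* = (normc z ^+ 2)%:C.
Proof.
rewrite normc_sqr; case: z => a b /=; apply/eqP.
by rewrite eq_complex /=; apply/andP; split; apply/eqP; ring.
Qed.

Section Vec.
Variable n : nat.
Implicit Types (u v : 'cV[R[i]]_n).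

Lemma l2normE v : l2norm v = Num.sqrt (\sum_i normc (v i 0) ^+ 2).
Proof. by congr Num.sqrt; apply: eq_bigr => i _; rewrite normc_sqr. Qed.

Lemma l2norm_ge0 v : 0 <= l2norm v. Proof. exact: sqrtr_ge0. Qed.
Hint Resolve l2norm_ge0 : core.

Lemma l2norm_sqr v : l2norm v ^+ 2 = \sum_i normc (v i 0) ^+ 2.
Proof. by rewrite l2normE sqr_sqrtr // sumr_ge0 // => i _; exact: sqr_ge0. Qed.

Lemma l2norm_le x v : 0 <= x -> \sum_i normc (v i 0) ^+ 2 <= x ^+ 2 -> l2norm v <= x.
Proof.
by move=> x0 h; rewrite -(@ler_pXn2r _ 2) ?nnegrE // l2norm_sqr.
Qed.

Lemma sum_normc_CS u v : \sum_i normc (u i 0) * normc (v i 0) <= l2norm u * l2norm v.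
Proof.
have s0 : 0 <= \sum_i normc (u i 0) * normc (v i 0).
  by apply: sumr_ge0 => i _; rewrite mulr_ge0.
rewrite -(@ler_pXn2r _ 2) ?nnegrE ?mulr_ge0 // exprMn !l2norm_sqr.
exact: sum_CS.
Qed.

Lemma l2norm0 : l2norm (0 : 'cV[R[i]]_n) = 0.
Proof.
rewrite l2normE big1 ?sqrtr0 // => i _.
by rewrite mxE normc0 expr0n.
Qed.

Lemma l2normD u v : l2norm (u + v) <= l2norm u + l2norm v.
Proof.
apply: l2norm_le; first by rewrite addr_ge0.
apply: (@le_trans _ _ (\sum_i (normc (u i 0) + normc (v i 0)) ^+ 2)).
  apply: ler_sum => i _; rewrite mxE ler_pXn2r ?nnegrE ?addr_ge0 //.
  exact: normcD.
under eq_bigr => i _ do rewrite sqrrD.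
rewrite !big_split /= -!l2norm_sqr sqrrD lerD2r lerD2l.
by rewrite -mulr2n lerMn2r sum_normc_CS.
Qed.

Lemma l2normZ z v : l2norm (z *: v) = normc z * l2norm v.
Proof.
rewrite !l2normE.
under eq_bigr => i _ do rewrite mxE normcM exprMn.
by rewrite -mulr_sumr sqrtrM ?sqr_ge0 // sqrtr_sqr ger0_norm.
Qed.

Lemma normc_le_l2norm v i : normc (v i 0) <= l2norm v.
Proof.
rewrite -(@ler_pXn2r _ 2) ?nnegrE // l2norm_sqr (bigD1 i) //= lerDl.
by apply: sumr_ge0 => k _; exact: sqr_ge0.
Qed.

Lemma l2norm_le_sum v : l2norm v <= \sum_i normc (v i 0).
Proof.
apply: l2norm_le; first exact: sumr_ge0.
rewrite expr2 mulr_suml; apply: ler_sum => i _.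
by rewrite expr2 ler_wpM2l // (bigD1 i) //= lerDl sumr_ge0.
Qed.

Lemma l2norm_eq0 v : l2norm v = 0 -> v = 0.
Proof.
move=> h; apply/matrixP => i j; rewrite ord1 mxE.
apply/eqP; have := normc_le_l2norm v i; rewrite h => h1.
by apply/eqP/eq0_normc/eqP; rewrite eq_le h1 normc_ge0.
Qed.

Lemma l2norm_delta i : l2norm (delta_mx i 0 : 'cV[R[i]]_n) = 1.
Proof.
rewrite l2normE (bigD1 i) //= big1 => [|k /negPf ki].
  by rewrite mxE !eqxx normc1 expr1n addr0 sqrtr1.
by rewrite mxE ki normc0 expr0n.
Qed.

End Vec.
Hint Resolve l2norm_ge0 : core.

Section Op.
Variable n : nat.
Implicit Types (A B : 'M[R[i]]_n) (v : 'cV[R[i]]_n).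

(** Crude, but it shows that the set defining the operator norm is bounded, so that its [sup] is a
    genuine supremum. *)
Lemma l2norm_mul_entries A v :
  l2norm (A *m v) <= (\sum_i \sum_j normc (A i j)) * l2norm v.
Proof.
apply: le_trans (l2norm_le_sum _) _; rewrite mulr_suml; apply: ler_sum => i _.
rewrite mxE mulr_suml; apply: le_trans (normc_sum _ _ _) _.
by apply: ler_sum => j _; rewrite normcM ler_wpM2l // normc_le_l2norm.
Qed.

Lemma opnorm_has_sup A :
  has_sup [set l2norm (A *m v) | v in [set v : 'cV[R[i]]_n | l2norm v <= 1]]%classic.
Proof.
split; first by exists (l2norm (A *m 0)), 0 => //=; rewrite l2norm0.
exists (\sum_i \sum_j normc (A i j)) => _ [v /= v1 <-].
apply: le_trans (l2norm_mul_entries _ _) _.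
by apply: ler_piMr => //; apply: sumr_ge0 => i _; apply: sumr_ge0.
Qed.

Lemma nrm_ge0 A : 0 <= nrm A.
Proof.
have [_ ub] := opnorm_has_sup A; rewrite unlock.
apply: le_trans (l2norm_ge0 (A *m 0)) _.
by apply: (ub_le_sup ub); exists 0 => //=; rewrite l2norm0.
Qed.

Lemma l2norm_mul A v : l2norm (A *m v) <= nrm A * l2norm v.
Proof.
have [v0|vp] := leP (l2norm v) 0.
  have /l2norm_eq0 -> : l2norm v = 0 by apply/eqP; rewrite eq_le v0 l2norm_ge0.
  by rewrite mulmx0 l2norm0 mulr0.
have [_ ub] := opnorm_has_sup A.
have : l2norm (A *m (((l2norm v)^-1)%:C *: v)) <= nrm A.
  rewrite nrm.unlock; apply: (ub_le_sup ub); exists (((l2norm v)^-1)%:C *: v) => //=.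
  by rewrite l2normZ normc_real ger0_norm ?invr_ge0 // mulVf ?gt_eqF.
rewrite -scalemxAr l2normZ normc_real ger0_norm ?invr_ge0 //.
by rewrite mulrC ler_pdivrMr.
Qed.

Lemma nrm_le A x : 0 <= x -> (forall v, l2norm (A *m v) <= x * l2norm v) -> nrm A <= x.
Proof.
move=> x0 h; rewrite unlock; apply: ge_sup => [|_ [v /= v1 <-]].
  by have [] := opnorm_has_sup A.
by apply: le_trans (h v) _; rewrite ler_piMr.
Qed.

Lemma nrmD A B : nrm (A + B) <= nrm A + nrm B.
Proof.
apply: nrm_le => [|v]; first by rewrite addr_ge0 ?nrm_ge0.
rewrite mulmxDl mulrDl; apply: le_trans (l2normD _ _) _.
by rewrite lerD ?l2norm_mul.
Qed.

Lemma nrmM A B : nrm (A *m B) <= nrm A * nrm B.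
Proof.
apply: nrm_le => [|v]; first by rewrite mulr_ge0 ?nrm_ge0.
rewrite -mulmxA -mulrA; apply: le_trans (l2norm_mul _ _) _.
by rewrite ler_wpM2l ?nrm_ge0 ?l2norm_mul.
Qed.

Lemma nrmZ_le z A : nrm (z *: A) <= normc z * nrm A.
Proof.
apply: nrm_le => [|v]; first by rewrite mulr_ge0 ?nrm_ge0.
by rewrite -scalemxAl l2normZ -mulrA ler_wpM2l ?l2norm_mul.
Qed.

Lemma nrmN A : nrm (- A) = nrm A.
Proof.
have h B : nrm (- B) <= nrm B.
  rewrite -scaleN1r; apply: le_trans (nrmZ_le _ _) _.
  by rewrite normcNe normc1 mul1r.
by apply/eqP; rewrite eq_le h /= -{1}(opprK A) h.
Qed.

Lemma nrmB A B : nrm (A - B) <= nrm A + nrm B.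
Proof. by rewrite -(nrmN B) nrmD. Qed.

Lemma nrmBC A B : nrm (A - B) = nrm (B - A).
Proof. by rewrite -nrmN opprB. Qed.

Lemma nrm0 : nrm (0 : 'M[R[i]]_n) = 0.
Proof.
apply/eqP; rewrite eq_le nrm_ge0 andbT; apply: nrm_le => // v.
by rewrite mul0mx l2norm0 mul0r.
Qed.

Lemma nrm1_le : nrm (1%:M : 'M[R[i]]_n) <= 1.
Proof. by apply: nrm_le => // v; rewrite mul1mx mul1r. Qed.

Lemma nrm_tri (B A C : 'M[R[i]]_n) : nrm (A - C) <= nrm (A - B) + nrm (B - C).
Proof. by apply: le_trans (nrmD _ _); rewrite addrA subrK. Qed.

Lemma entry_le_nrm A i j : normc (A i j) <= nrm A.
Proof.
have -> : A i j = (A *m delta_mx j 0 : 'cV_n) i 0.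
  by rewrite -colE mxE.
apply: le_trans (normc_le_l2norm _ _) _.
by apply: le_trans (l2norm_mul _ _) _; rewrite l2norm_delta mulr1.
Qed.

(** Converts entrywise rounding errors into operator norm errors; the $d^2$ in the rounding error
    $d^2/B$ comes from here. *)
Lemma nrm_entries A x : (forall i j, normc (A i j) <= x) -> nrm A <= n%:R ^+ 2 * x.
Proof.
move=> h.
have s : \sum_i \sum_j normc (A i j) <= n%:R ^+ 2 * x.
  apply: (@le_trans _ _ (\sum_(i < n) \sum_(j < n) x)).
    by apply: ler_sum => i _; apply: ler_sum.
  by rewrite !sumr_const !card_ord -mulrnA -(mulr_natl x) natrM expr2.
apply: nrm_le => [|v].
  by apply: le_trans s; apply: sumr_ge0 => i _; apply: sumr_ge0.
by apply: le_trans (l2norm_mul_entries _ _) _; rewrite ler_wpM2r.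
Qed.

Lemma normc_trace A : normc (\tr A) <= n%:R * nrm A.
Proof.
apply: le_trans (normc_sum _ _ _) _.
apply: (@le_trans _ _ (\sum_(i < n) nrm A)).
  by apply: ler_sum => i _; exact: entry_le_nrm.
by rewrite sumr_const card_ord mulr_natl.
Qed.

Lemma dagE m p (A : 'M[R[i]]_(m, p)) : A ^t* = dag A.
Proof. by rewrite unlock. Qed.

Lemma dagK m p (A : 'M[R[i]]_(m, p)) : dag (dag A) = A.
Proof. by rewrite unlock trmxCK. Qed.

Lemma dag_entry m p (A : 'M[R[i]]_(m, p)) i j : dag A i j = (A j i)^*.
Proof. by rewrite unlock !mxE. Qed.

Lemma dagD m p (A B : 'M[R[i]]_(m, p)) : dag (A + B) = dag A + dag B.
Proof. by apply/matrixP => i j; rewrite !(dag_entry, mxE) raddfD. Qed.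

Lemma dagN m p (A : 'M[R[i]]_(m, p)) : dag (- A) = - dag A.
Proof. by apply/matrixP => i j; rewrite !(dag_entry, mxE) raddfN. Qed.

Lemma dagB m p (A B : 'M[R[i]]_(m, p)) : dag (A - B) = dag A - dag B.
Proof. by rewrite dagD dagN. Qed.

Lemma dagZ m p z (A : 'M[R[i]]_(m, p)) : dag (z *: A) = z^* *: dag A.
Proof. by apply/matrixP => i j; rewrite !(dag_entry, mxE) rmorphM. Qed.

Lemma dag1 : dag (1%:M : 'M[R[i]]_n) = 1%:M.
Proof. by rewrite unlock trmx1 map_mx1. Qed.

Lemma dag0 m p : dag (0 : 'M[R[i]]_(m, p)) = 0.
Proof. by apply/matrixP => i j; rewrite !(dag_entry, mxE) raddf0. Qed.

Lemma dagM m p q (A : 'M[R[i]]_(m, p)) (B : 'M[R[i]]_(p, q)) : dag (A *m B) = dag B *m dag A.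
Proof. by rewrite unlock trmx_mul map_mxM. Qed.

Lemma unitarymxE A : A \is unitarymx <-> unitary A.
Proof.
by rewrite -[unitary A]/(A *m dag A = 1%:M) -dagE; split => [/unitarymxP|h] //; apply/unitarymxP.
Qed.

Lemma unitaryI A : A *m dag A = 1%:M -> unitary A.
Proof. by []. Qed.

Lemma unitary_dagr A : unitary A -> A *m dag A = 1%:M.
Proof. by []. Qed.

Lemma unitary_dagl A : unitary A -> dag A *m A = 1%:M.
Proof. by move=> /mulmx1C. Qed.

Lemma unitary_dag A : unitary A -> unitary (dag A).
Proof. by rewrite /unitary dagK => /mulmx1C. Qed.

Lemma unitaryM A B : unitary A -> unitary B -> unitary (A *m B).
Proof.
by move=> uA uB; rewrite /unitary dagM mulmxA -(mulmxA A B) uB mulmx1.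
Qed.

Lemma l2norm_dot v : (l2norm v ^+ 2)%:C = (dag v *m v) 0 0.
Proof.
rewrite l2norm_sqr mxE raddf_sum; apply: eq_bigr => i _.
by rewrite dag_entry mulrC mul_conjc.
Qed.

Lemma normc_dot (u v : 'cV[R[i]]_n) : normc ((dag u *m v) 0 0) <= l2norm u * l2norm v.
Proof.
apply: le_trans (sum_normc_CS _ _); rewrite mxE.
apply: le_trans (normc_sum _ _ _) _; apply: ler_sum => i _.
by rewrite dag_entry normcM normc_conj.
Qed.

(** From $\|A^\dagger v\|^2=\langle v,AA^\dagger v\rangle\le\|v\|\,\|A\|\,\|A^\dagger v\|$ one
    factor cancels. *)
Lemma nrm_dag_le A : nrm (dag A) <= nrm A.
Proof.
apply: nrm_le => [|v]; first exact: nrm_ge0.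
have [v0|vp] := leP (l2norm (dag A *m v)) 0.
  by apply: le_trans v0 _; rewrite mulr_ge0 ?nrm_ge0.
rewrite -(ler_pM2l vp) -expr2.
have -> : l2norm (dag A *m v) ^+ 2 = normc ((dag v *m (A *m (dag A *m v))) 0 0).
  transitivity (normc ((l2norm (dag A *m v) ^+ 2)%:C)).
    by rewrite normc_real ger0_norm ?sqr_ge0.
  by rewrite l2norm_dot dagM dagK -mulmxA.
apply: le_trans (normc_dot _ _) _.
rewrite mulrC [X in _ <= X]mulrA ler_wpM2r // [X in _ <= X]mulrC.
exact: l2norm_mul.
Qed.

Lemma nrm_dag A : nrm (dag A) = nrm A.
Proof. by apply/eqP; rewrite eq_le nrm_dag_le /= -{1}(dagK A) nrm_dag_le. Qed.

Lemma l2norm_unitary A v : unitary A -> l2norm (A *m v) = l2norm v.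
Proof.
move=> uA; apply/eqP; rewrite -(@eqrXn2 _ 2) //; apply/eqP.
have := l2norm_dot (A *m v); rewrite dagM -mulmxA (mulmxA _ A) unitary_dagl //.
by rewrite mul1mx -l2norm_dot => /complexI.
Qed.

Lemma nrm_unitary A : unitary A -> nrm A <= 1.
Proof. by move=> uA; apply: nrm_le => // v; rewrite l2norm_unitary // mul1r. Qed.

Lemma nrm_mulU A B : unitary A -> nrm (A *m B) = nrm B.
Proof.
have h A' B' : unitary A' -> nrm (A' *m B') <= nrm B'.
  move=> uA; apply: le_trans (nrmM _ _) _.
  by rewrite ler_piMl ?nrm_ge0 ?nrm_unitary.
move=> uA; apply/eqP; rewrite eq_le h //=.
have {1}-> : B = dag A *m (A *m B) by rewrite mulmxA unitary_dagl // mul1mx.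
by apply: h; apply: unitary_dag.
Qed.

Lemma nrm_mulrU A B : unitary B -> nrm (A *m B) = nrm A.
Proof.
by move=> uB; rewrite -nrm_dag dagM nrm_mulU ?nrm_dag //; exact: unitary_dag.
Qed.

Lemma nrm_diag (v : 'rV[R[i]]_n) x : 0 <= x -> (forall i, normc (v 0 i) <= x) ->
  nrm (diag_mx v) <= x.
Proof.
move=> x0 h; apply: nrm_le => // w; apply: l2norm_le; first by rewrite mulr_ge0.
rewrite exprMn l2norm_sqr mulr_sumr; apply: ler_sum => i _.
rewrite mul_diag_mx mxE normcM exprMn ler_wpM2r ?sqr_ge0 //.
by rewrite ler_pXn2r ?nnegrE.
Qed.

Lemma unitary1 : unitary (1%:M : 'M[R[i]]_n).
Proof. by rewrite /unitary dag1 mulmx1. Qed.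

Lemma phase_unitary z A : normc z = 1 -> unitary A -> unitary (z *: A).
Proof.
rewrite /unitary => z1 uA.
rewrite dagZ -scalemxAl -scalemxAr uA scalerA.
by rewrite mul_conjc z1 expr1n scale1r.
Qed.

End Op.
End OpNorm.
#[global] Hint Resolve nrm_ge0 normc_ge0 l2norm_ge0 : core.
Create HintDb uni.
#[global] Hint Resolve unitaryM unitary_dag unitary1 phase_unitary : uni.
#[global] Opaque unitary.
Ltac uni := by auto 12 with uni.

(** * Perturbation of group commutators *)

Section MatrixIdentities.
Variables (K : comNzRingType).

Lemma mxDE m p (A B : 'M[K]_(m, p)) i j : (A + B) i j = A i j + B i j.
Proof. by rewrite mxE. Qed.
Lemma mxNE m p (A : 'M[K]_(m, p)) i j : (- A) i j = - A i j.
Proof. by rewrite mxE. Qed.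
Lemma mxZE m p z (A : 'M[K]_(m, p)) i j : (z *: A) i j = z * A i j.
Proof. by rewrite mxE. Qed.
Lemma mxZl m p q z (A : 'M[K]_(m, p)) (B : 'M[K]_(p, q)) :
  (z *: A) *m B = z *: (A *m B).
Proof. by rewrite scalemxAl. Qed.
Lemma mxZr m p q z (A : 'M[K]_(m, p)) (B : 'M[K]_(p, q)) :
  A *m (z *: B) = z *: (A *m B).
Proof. by rewrite scalemxAr. Qed.
Definition mxexpand := (mulmxDl, mulmxDr, mulNmx, mulmxN, mxZl, mxZr, mulmxA, mul1mx, mulmx1).
Definition mxentries := (mxDE, mxNE, mxZE).

(** After full expansion every noncommutative monomial is a single matrix; its entry at a fixed
    position is generalised to an atom, and only a linear identity is left to [ring]. *)
Ltac mxring := rewrite ?mxexpand; apply/matrixP => ? ?; rewrite ?mxentries;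
  repeat match goal with |- context [@fun_of_matrix ?T ?m ?n ?M ?i ?j] =>
    move: (@fun_of_matrix T m n M i j) => ? end;
  ring.

Variable n : nat.
Implicit Types (a b p q u v : 'M[K]_n) (z : K).

Lemma mxid_comm a b : (a - 1%:M) *m (b - 1%:M) - (b - 1%:M) *m (a - 1%:M) = a *m b - b *m a.
Proof. mxring. Qed.

Lemma mxid_mul_sub1 a b : a *m b - 1%:M = a *m (b - 1%:M) + (a - 1%:M).
Proof. mxring. Qed.

Lemma mxid_comm_scale z a b : (z *: a) *m (z *: b) - (z *: b) *m (z *: a) = (z * z) *: (a *m b - b *m a).
Proof. mxring. Qed.

Lemma mxid_comm_near x y e f u : ((x + e) *m (y + f) - (y + f) *m (x + e)) *m u - (x *m y - y *m x) =
  ((x + e) *m (y + f) - (y + f) *m (x + e)) *m (u - 1%:M) +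
  ((x *m f - f *m x) + (e *m y - y *m e) + (e *m f - f *m e)).
Proof. mxring. Qed.

Lemma mxid_comm_perturb a b p q u v : ((a - p) *m (b - q) - (b - q) *m (a - p)) *m u -
    (a *m b - b *m a) *m v =
  ((q *m a - a *m q) + (b *m p - p *m b) + (p *m q - q *m p)) *m u +
  (a *m b - b *m a) *m (u - v).
Proof. mxring. Qed.

Lemma mxid_mulB a b p q : p *m q - a *m b = p *m (- (b - q)) - (a - p) *m b.
Proof. mxring. Qed.

Lemma mxid_mul4B a b a' b' p q p' q' : a *m b *m a' *m b' - p *m q *m p' *m q' =
  (a - p) *m (b *m a' *m b') + p *m ((b - q) *m (a' *m b')) +
  p *m q *m ((a' - p') *m b') + p *m q *m p' *m (b' - q').
Proof. mxring. Qed.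

(** Used with $e_0=1+k$ and $g_0=1-k$: the third bracket then vanishes, so residual times corrector
    is 1 up to the two approximation errors and $k^2$. *)
Lemma mxid_step (e g e0 g0 k : 'M[K]_n) : e *m g - 1%:M =
  e *m (g - g0) + (e - e0) *m g0 + (e0 *m g0 - (1%:M - k *m k)) - k *m k.
Proof. mxring. Qed.

Lemma scid_phase (z wc ci : K) : z - z * wc * ci = z * ((1 - wc) + wc * (1 - ci)).
Proof. ring. Qed.

Lemma mxid_antiherm a b p q z : z *: ((a - p) - (b - q)) = z *: (a - b) - z *: (p - q).
Proof. mxring. Qed.

Lemma mxid_antiherm_near a b z : 2%:R * z = 1 ->
  a - 1%:M - z *: (a - b) = - (z *: (1%:M - a - b + 1%:M)).
Proof.
move=> z2; rewrite -[a - 1%:M]scale1r -z2; mxring.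
Qed.

Lemma mxid_1k a : (1%:M + a) *m (1%:M - a) = 1%:M - a *m a.
Proof. mxring. Qed.

Lemma mxid_left a p b g z : a *m p = 1%:M ->
  a - z *: (b *m g) = a *m (1%:M - (z *: (p *m b)) *m g).
Proof. by move=> ap; rewrite mulmxBr mulmx1 mxZl mxZr !mulmxA ap mul1mx. Qed.

Lemma scid_phase2 (wc c ci : K) : c * ci = 1 -> wc * (1 - ci) = wc * ci * (c - 1).
Proof. by move=> h; transitivity (wc * (c * ci) - wc * ci); [rewrite h|]; ring. Qed.

Lemma mxid_subscale a p q z : a - z *: p = (a - z *: q) - z *: (p - q).
Proof. mxring. Qed.

Lemma mxid_quadr a b (x y : K) :
  (x *: a + x *: b) *m (y *: a + - y *: b) - (y *: a + - y *: b) *m (x *: a + x *: b) =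
  (- (2%:R * (x * y))) *: (a *m b - b *m a).
Proof. mxring. Qed.

Lemma mxid_conj_comm p q a b : p *m q = 1%:M ->
  (q *m (a *m p)) *m (q *m (b *m p)) - (q *m (b *m p)) *m (q *m (a *m p)) =
  q *m ((a *m b - b *m a) *m p).
Proof.
move=> pq; have h c e : (q *m (c *m p)) *m (q *m (e *m p)) = q *m (c *m e *m p).
  by rewrite !mulmxA -(mulmxA (q *m c)) pq mulmx1.
by rewrite !h mulmxBl mulmxBr.
Qed.

Lemma mxid_conj_scale p q a z : q *m ((z *: a) *m p) = z *: (q *m a *m p).
Proof. by rewrite mxZl mxZr mulmxA. Qed.

Lemma scid_half (c z : K) : 2%:R * (c * c) = 1 -> - (2%:R * (c * (- z * c))) = z.
Proof. by move=> h; transitivity ((2%:R * (c * c)) * z); [ring|rewrite h mul1r]. Qed.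

Lemma mxid_unit a b : (a - 1%:M) *m (b - 1%:M) = a *m b - a - b + 1%:M.
Proof. mxring. Qed.

Lemma mxid_sub1sub a b : (a - 1%:M) - (a - b) = b - 1%:M.
Proof. mxring. Qed.

Lemma mxid_sub1sub1 a b : a - b = (a - 1%:M) - (b - 1%:M).
Proof. mxring. Qed.

End MatrixIdentities.

(** * The unit circle and trigonometric estimates *)

Section Scalars.
Variable R : realType.
Implicit Types (x y t : R) (z w : R[i]).

Definition cis t : R[i] := cos t +i* sin t.

Lemma cis0 : cis 0 = 1.
Proof. by rewrite /cis cos0 sin0. Qed.

Lemma cisD s t : cis (s + t) = cis s * cis t.
Proof.
by rewrite /cis cosD sinD; apply/eqP; rewrite eq_complex /=; apply/andP; split;
  apply/eqP; ring.
Qed.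

Lemma cis_conj t : (cis t)^* = cis (- t).
Proof. by rewrite /cis cosN sinN. Qed.

Lemma normc_cis t : normc (cis t) = 1.
Proof. by rewrite /= cos2Dsin2 sqrtr1. Qed.

Lemma cisN t : cis t * cis (- t) = 1.
Proof. by rewrite -cisD subrr cis0. Qed.

Lemma cis_2pi t : cis (t + 2 * pi) = cis t.
Proof. by rewrite /cis mulr_natl cosD2pi sinD2pi. Qed.

Lemma cis_sum (I : Type) (r : seq I) (P : pred I) (F : I -> R) :
  cis (\sum_(i <- r | P i) F i) = \prod_(i <- r | P i) cis (F i).
Proof. by elim/big_rec2: _ => [|i x y _ <-]; rewrite ?cis0 ?cisD. Qed.

(** The intermediate point is kept because it serves twice: for $|\sin t|\le|t|$ and, through $\sin
    t-t=(\cos c-1)t$, for a cubic estimate. *)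
Lemma sin_mvt t : exists2 c, `|c| <= `|t| & sin t = cos c * t.
Proof.
have [t0|t0|<-] := ltgtP 0 t; last by exists 0; rewrite ?mulr0 ?sin0.
- have [|c] := @MVT R sin cos 0 t t0 (fun x _ => is_derive_sin x).
  + by apply: continuous_subspaceT => x; exact: continuous_sin.
  + rewrite in_itv /= => /andP[c0 ct]; rewrite sin0 !subr0 => ->.
    by exists c => //; rewrite !gtr0_norm // ltW.
- have [|c] := @MVT R sin cos t 0 t0 (fun x _ => is_derive_sin x).
  + by apply: continuous_subspaceT => x; exact: continuous_sin.
  + rewrite in_itv /= => /andP[c0 ct]; rewrite sin0 !sub0r mulrN => /oppr_inj ->.
    by exists c => //; rewrite !ltr0_norm // lerN2 ltW.
Qed.

Lemma normr_sin_le t : `|sin t| <= `|t|.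
Proof.
have [c _ ->] := sin_mvt t; rewrite normrM ler_piMl //; exact: cos_max.
Qed.

Lemma one_sub_cos t : 1 - cos t = 2 * sin (t / 2) ^+ 2.
Proof.
have {1}-> : t = (t / 2) *+ 2 by rewrite -mulr_natl; field.
rewrite cos_mulr2n cos2sin2; ring.
Qed.

Lemma one_sub_cos_le t : 1 - cos t <= t ^+ 2 / 2.
Proof.
rewrite one_sub_cos; have := normr_sin_le (t / 2).
rewrite -(@ler_pXn2r _ 2) ?nnegrE // -!normrX !ger0_norm ?sqr_ge0 //; lra.
Qed.

Lemma normc_cis_sub1 t : normc (cis t - 1) <= `|t|.
Proof.
rewrite -(@ler_pXn2r _ 2) ?nnegrE // normc_sqr /= subr0 -normrX ger0_norm ?sqr_ge0 //.
have := cos2Dsin2 t; have := one_sub_cos_le t; nra.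
Qed.

Lemma normc_le_norms z : normc z <= `|complex.Re z| + `|complex.Im z|.
Proof.
have -> : z = (complex.Re z)%:C + 'i * (complex.Im z)%:C by rewrite -complexE.
apply: le_trans (normcD _ _) _; rewrite normcM normc_i mul1r !normc_real.
by rewrite -complexE.
Qed.

(** The real part contributes $t^2/2$ and the imaginary part $|t|^3/2$, which is at most $t^2/10$
    for $|t|\le1/5$; together 3/5. *)
Lemma normc_cis_sub1i t : `|t| <= 1 / 5 -> normc (cis t - 1 - 'i * t%:C) <= 3 / 5 * t ^+ 2.
Proof.
move=> t5; apply: le_trans (normc_le_norms _) _ => /=.
rewrite !(mul0r, mul1r, subr0, add0r, oppr0).
have -> : `|cos t - 1| = 1 - cos t.
  by rewrite distrC ger0_norm // subr_ge0 cos_le1.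
have h1 := one_sub_cos_le t.
rewrite addr0; suff : `|sin t - t| <= `|t| * (t ^+ 2 / 2).
  have := sqr_ge0 t; have := normr_ge0 t; nra.
have [c ct ->] := sin_mvt t.
have -> : cos c * t - t = (cos c - 1) * t by ring.
rewrite normrM mulrC ler_wpM2l // distrC ger0_norm ?subr_ge0 ?cos_le1 //.
apply: le_trans (one_sub_cos_le c) _; rewrite ler_pM2r ?invr_gt0 //.
by rewrite -(ger0_norm (sqr_ge0 c)) -(ger0_norm (sqr_ge0 t)) !normrX ler_pXn2r ?nnegrE.
Qed.

End Scalars.

(** * Group commutators near the identity *)

Section Commutators.
Variables (R : realType) (n : nat).
Implicit Types (A B V W X Y K : 'M[R[i]]_n) (x y e : R) (z : R[i]).

Definition gcomm V W := V *m W *m dag V *m dag W.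

Lemma gcomm_unitary V W : unitary V -> unitary W -> unitary (gcomm V W).
Proof. by move=> uV uW; rewrite /gcomm; uni. Qed.

(** In this form the commutator is visibly of second order in $V-1$ and $W-1$, up to a unitary
    factor. *)
Lemma gcommE V W : unitary V -> unitary W ->
  gcomm V W - 1%:M = ((V - 1%:M) *m (W - 1%:M) - (W - 1%:M) *m (V - 1%:M)) *m (dag V *m dag W).
Proof.
move=> uV uW.
rewrite mxid_comm mulmxBl /gcomm !mulmxA -(mulmxA W V) unitary_dagr // mulmx1 unitary_dagr //.
Qed.

Lemma gcomm_phase z w V W : normc z = 1 -> normc w = 1 ->
  gcomm (z *: V) (w *: W) = gcomm V W.
Proof.
move=> z1 w1; rewrite /gcomm !dagZ !(mxZl, mxZr) !scalerA.
have -> : w^*%C * z^*%C * z * w = (z * z^*%C) * (w * w^*%C).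
  by rewrite -mulrA [z * w]mulrC mulrACA mulrC; congr (_ * _); rewrite mulrC.
by rewrite !mul_conjc z1 w1 expr1n mulr1 scale1r.
Qed.

Lemma nrmM_le A B x y : nrm A <= x -> nrm B <= y -> nrm (A *m B) <= x * y.
Proof. by move=> hA hB; apply: le_trans (nrmM _ _) _; rewrite ler_pM ?nrm_ge0. Qed.

Lemma nrmD_le A B x y : nrm A <= x -> nrm B <= y -> nrm (A + B) <= x + y.
Proof. by move=> hA hB; apply: le_trans (nrmD _ _) _; rewrite lerD. Qed.

Lemma nrmB_le A B x y : nrm A <= x -> nrm B <= y -> nrm (A - B) <= x + y.
Proof. by move=> hA hB; apply: le_trans (nrmB _ _) _; rewrite lerD. Qed.

Lemma nrmi A : nrm ('i%C *: A) <= nrm A.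
Proof. by apply: le_trans (nrmZ_le _ _) _; rewrite normc_i mul1r. Qed.

Lemma nrm_sub1_dag V : nrm (dag V - 1%:M) = nrm (V - 1%:M).
Proof. by rewrite -nrm_dag dagB dagK dag1. Qed.

Lemma nrm_dagadj_sub1 V W x : unitary V ->
  nrm (V - 1%:M) <= x -> nrm (W - 1%:M) <= x -> nrm (dag V *m dag W - 1%:M) <= 2 * x.
Proof.
move=> uV hV hW.
rewrite mxid_mul_sub1 mulr_natl mulr2n; apply: nrmD_le; last by rewrite nrm_sub1_dag.
by rewrite nrm_mulU ?nrm_sub1_dag //; uni.
Qed.

(** Since V and W are close to $1+iX$ and $1+iY$, the factor $i^2$ produces the sign in $-(XY-YX)$.
    The cubic term is the cost of dropping the unitary factor $V^\dagger W^\dagger$, which is within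
    $2x$ of 1. *)
Lemma gcomm_near V W X Y x y : unitary V -> unitary W ->
  nrm X <= x -> nrm Y <= x -> nrm (V - 1%:M) <= x -> nrm (W - 1%:M) <= x ->
  nrm (V - 1%:M - 'i%C *: X) <= y -> nrm (W - 1%:M - 'i%C *: Y) <= y ->
  nrm (gcomm V W - 1%:M + (X *m Y - Y *m X)) <= 4 * x * y + 2 * y ^+ 2 + 4 * x ^+ 3.
Proof.
move=> uV uW hX hY hV hW hE hF; rewrite gcommE //.
set a := V - 1%:M in hV hE *; set b := W - 1%:M in hW hF *.
set E := a - _ in hE; set F := b - _ in hF.
pose iX := 'i%C *: X; pose iY := 'i%C *: Y.
have hiX : nrm iX <= x by apply: le_trans hX; exact: nrmi.
have hiY : nrm iY <= x by apply: le_trans hY; exact: nrmi.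
have XY : X *m Y - Y *m X = - (iX *m iY - iY *m iX).
  by rewrite mxid_comm_scale mulCii scaleN1r opprK.
have aE : a = iX + E by rewrite addrC subrK.
have bE : b = iY + F by rewrite addrC subrK.
rewrite XY {1 2}aE {1 2}bE mxid_comm_near -aE -bE.
have -> : 4 * x * y + 2 * y ^+ 2 + 4 * x ^+ 3 =
  (x * x + x * x) * (2 * x) + ((x * y + y * x) + (y * x + x * y) + (y * y + y * y)) by ring.
apply: nrmD_le; first by apply: nrmM_le; [apply: nrmB_le; apply: nrmM_le | exact: nrm_dagadj_sub1].
by apply: nrmD_le; [apply: nrmD_le|]; apply: nrmB_le; apply: nrmM_le.
Qed.

(** The factor x in the leading term $4xe$ is the gain that drives the recursion: with factors at
    distance x of order $\sqrt e$ from the identity, an error e in them becomes one of order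
    $e^{3/2}$ in the commutator. *)
Lemma gcomm_perturb V W V' W' x e : unitary V -> unitary W ->
  unitary V' -> unitary W' ->
  nrm (V - 1%:M) <= x -> nrm (W - 1%:M) <= x -> nrm (V - V') <= e -> nrm (W - W') <= e ->
  nrm (gcomm V' W' - gcomm V W) <= 4 * x * e + 2 * e ^+ 2 + 4 * x ^+ 2 * e.
Proof.
move=> uV uW uV' uW' hV hW hdV hdW.
rewrite mxid_sub1sub1 !gcommE //.
rewrite -(mxid_sub1sub V V') -(mxid_sub1sub W W').
have hU : nrm (dag V' *m dag W' - dag V *m dag W) <= e + e.
  rewrite mxid_mulB -!dagB.
  apply: nrmB_le.
    by rewrite nrm_mulU ?nrmN ?nrm_dag //; uni.
  by rewrite nrm_mulrU ?nrm_dag //; uni.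
have uVW : unitary (dag V' *m dag W') by uni.
set a := V - 1%:M in hV *; set b := W - 1%:M in hW *.
set p := V - V' in hdV *; set q := W - W' in hdW *.
rewrite mxid_comm_perturb.
have -> : 4 * x * e + 2 * e ^+ 2 + 4 * x ^+ 2 * e =
  ((e * x + x * e) + (x * e + e * x) + (e * e + e * e)) + (x * x + x * x) * (e + e) by ring.
apply: nrmD_le; last by apply: nrmM_le => //; apply: nrmB_le; apply: nrmM_le.
rewrite nrm_mulrU //.
by apply: nrmD_le; [apply: nrmD_le|]; apply: nrmB_le; apply: nrmM_le.
Qed.

(** No closeness to the identity is assumed and hence nothing is gained. This is for the outermost
    commutator, whose factors are arbitrary unitaries; the constant 4 is why the main recursion runs
    with tolerance [eps / 4]. *)
Lemma gcomm_lipschitz V W V' W' e : unitary V -> unitary W ->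
  unitary V' -> unitary W' ->
  nrm (V - V') <= e -> nrm (W - W') <= e -> nrm (gcomm V W - gcomm V' W') <= 4 * e.
Proof.
move=> uV uW uV' uW' hV hW.
rewrite /gcomm mxid_mul4B -!dagB.
have -> : 4 * e = e + e + e + e by ring.
apply: nrmD_le; [apply: nrmD_le; [apply: nrmD_le|]|].
- by rewrite nrm_mulrU //; uni.
- by rewrite nrm_mulU // nrm_mulrU //; uni.
- by rewrite nrm_mulU ?nrm_mulrU ?nrm_dag //; uni.
- by rewrite nrm_mulU ?nrm_dag //; uni.
Qed.

End Commutators.

(** * Error of one recursion step up to a global phase *)

Section SKStep.
Variables (R : realType) (n : nat).
Implicit Types (A B V W X Y K : 'M[R[i]]_n) (x y e h : R) (z u : R[i]).

Definition pclose e A B := exists2 u, normc u = 1 & nrm (A - u *: B) <= e.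

(** The anti-Hermitian part of A divided by i. It is Hermitian and, for a unitary A near 1, replaces
    the logarithm up to second order. *)
Definition antiherm A : 'M[R[i]]_n := (2%:R * 'i%C)^-1 *: (A - dag A).

(* The phase is the one that makes the trace real and nonnegative. *)
Definition unphase A : 'M[R[i]]_n := ((\tr A)^* / (normc (\tr A))%:C) *: A.

Definition detrace A : 'M[R[i]]_n := A - (\tr A / n%:R)%:M.

Lemma pclose_le e e' A B : e <= e' -> pclose e A B -> pclose e' A B.
Proof. by move=> h [u u1 hu]; exists u => //; exact: le_trans h. Qed.

Lemma pclose_phase_unitary A B e : unitary B -> pclose e A B ->
  exists B', [/\ unitary B', nrm (A - B') <= e & exists2 u, normc u = 1 & B' = u *: B].
Proof.
by move=> uB [u u1 h]; exists (u *: B); split => //; [exact: phase_unitary|exists u].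
Qed.

Lemma normc_unit_div z : normc z != 0 -> normc (z^* / (normc z)%:C) = 1.
Proof.
move=> z0; rewrite normcM normcV normc_conj normc_real ger0_norm ?normc_ge0 //.
exact: mulfV.
Qed.

Lemma normc_conj_sub1 z : normc (1 - z^*%C) = normc (z - 1).
Proof. by case: z => a b /=; congr Num.sqrt; ring. Qed.

Lemma trace_dag A : \tr (dag A) = (\tr A)^*%C.
Proof.
rewrite /mxtrace (raddf_sum (@conjc R)); apply: eq_bigr => i _.
by rewrite dag_entry.
Qed.

Lemma normc_norm_sub1 w e : normc (w - 1) <= e -> `|normc w - 1| <= e.
Proof.
move=> h; rewrite ler_norml; apply/andP; split.
- have := normcD (1 - w) w; rewrite subrK normc1 normcBC; lra.
- have := normcD (w - 1) 1; rewrite subrK normc1; lra.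
Qed.

(** With $w=uz$, both $1-\bar w$ and $1-|w|$ have modulus at most e, and the difference of the two
    phases is a combination of them; hence the factor 2. *)
Lemma phase_dist z u e : normc u = 1 -> normc (u * z - 1) <= e ->
  normc z != 0 -> normc (u - z^* / (normc z)%:C) <= 2 * e.
Proof.
move=> u1 h z0; set w := u * z in h.
have nw : normc w = normc z by rewrite normcM u1 mul1r.
have wC : (normc w)%:C != 0 :> R[i] by apply: contra z0 => /eqP /complexI <-; rewrite nw.
have -> : u - z^* / (normc z)%:C = u * ((1 - w^*) + w^* * (1 - (normc w)%:C^-1)).
  have zE : z^*%C = u * w^*%C.
    by rewrite -[RHS]/(u * (u * z)^*%C) -conjCc rmorphM /= mulrA !conjCc mul_conjc u1 expr1n mul1r.
  by rewrite ?conjCc zE nw scid_phase.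
rewrite normcM u1 mul1r; apply: le_trans (normcD _ _) _.
have -> : 2 * e = e + e by ring.
apply: lerD; first by rewrite ?conjCc normc_conj_sub1.
have -> : w^* * (1 - (normc w)%:C^-1) = (w^* / (normc w)%:C) * ((normc w)%:C - 1).
  by apply: scid_phase2; rewrite mulfV.
rewrite normcM normc_unit_div ?nw // mul1r -nw.
have -> : (normc w)%:C - 1 = (normc w - 1)%:C :> R[i] by rewrite rmorphB.
rewrite normc_real.
exact: normc_norm_sub1.
Qed.

Lemma nrm_scalar z : nrm (z%:M : 'M[R[i]]_n) <= normc z.
Proof.
rewrite -scalemx1; apply: le_trans (nrmZ_le _ _) _.
by rewrite ler_piMr ?nrm1_le ?normc_ge0.
Qed.

Lemma nrm_trace_mean A x : (0 < n)%N -> nrm A <= x -> normc (\tr A / n%:R) <= x.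
Proof.
move=> n0 hA; rewrite normcM normcV -(rmorph_nat (real_complex R)) normc_real normr_nat.
rewrite ler_pdivrMr ?ltr0n // mulrC; apply: le_trans (normc_trace _) _.
by rewrite ler_wpM2l.
Qed.

Lemma trace_mean_sub1 A x : (0 < n)%N -> nrm (A - 1%:M) <= x -> normc (\tr A / n%:R - 1) <= x.
Proof.
move=> n0 /(nrm_trace_mean n0); rewrite linearB /= mxtrace1 mulrBl divff //.
by rewrite pnatr_eq0 -lt0n.
Qed.

Lemma nrm_detrace A x : (0 < n)%N -> nrm A <= x -> nrm (detrace A) <= 2 * x.
Proof.
move=> n0 hA; rewrite mulr_natl mulr2n; apply: nrmB_le => //.
by apply: le_trans (nrm_scalar _) _; exact: nrm_trace_mean.
Qed.

Lemma antiherm_dag A : dag (antiherm A) = antiherm A.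
Proof.
rewrite /antiherm dagZ dagB dagK -opprB scalerN -scaleNr; congr (_ *: _).
rewrite fmorphV /= rmorphM rmorph_nat -invrN -mulrN; congr (_ * _)^-1.
by transitivity (- ('i%C)^*%C : R[i]) => //; apply/eqP; rewrite eq_complex /= opprK oppr0 !eqxx.
Qed.

Lemma normc_2i : normc (2%:R * 'i%C)^-1 = 2^-1 :> R.
Proof.
by rewrite normcV normcM normc_i mulr1 -(rmorph_nat (real_complex R)) normc_real normr_nat.
Qed.

Lemma nrm_antiherm A x : nrm A <= x -> nrm (antiherm A) <= x.
Proof.
move=> hA; apply: le_trans (nrmZ_le _ _) _; rewrite normc_2i.
rewrite mulrC ler_pdivrMr // [x * _]mulrC mulr_natl mulr2n.
by apply: nrmB_le; rewrite ?nrm_dag.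
Qed.

Lemma antihermB A B : antiherm (A - B) = antiherm A - antiherm B.
Proof. by rewrite /antiherm dagB mxid_antiherm. Qed.

Lemma antiherm1 : antiherm 1%:M = 0.
Proof. by rewrite /antiherm dag1 subrr scaler0. Qed.

(** For unitary A the difference is exactly $-\tfrac12(A-1)(A-1)^\dagger$, whence the quadratic
    bound. *)
Lemma antiherm_near A x : unitary A -> nrm (A - 1%:M) <= x ->
  nrm (A - 1%:M - 'i%C *: antiherm A) <= x ^+ 2 / 2.
Proof.
move=> uA hA.
have -> : A - 1%:M - 'i%C *: antiherm A = - (2%:R^-1 *: ((A - 1%:M) *m dag (A - 1%:M))).
  rewrite /antiherm scalerA invfM mulrCA mulfV ?mulr1; last first.
    by rewrite eq_complex /= oner_eq0 andbF.
  rewrite dagB dag1 mxid_unit (unitary_dagr uA); apply: mxid_antiherm_near.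
  by rewrite mulfV // pnatr_eq0.
rewrite nrmN; apply: le_trans (nrmZ_le _ _) _.
rewrite -(rmorph_nat (real_complex R)) -fmorphV normc_real ger0_norm ?invr_ge0 //.
rewrite mulrC ler_pM2r ?invr_gt0 // expr2; apply: nrmM_le => //.
by rewrite nrm_dag.
Qed.

(* [M] is a numerical value of [B]; the Hermitian matrix [K] computed from it
   generates the residual phase [A^-1 B] up to the center. *)
Lemma residual_near A B M Kq e r k : (0 < n)%N -> unitary A -> unitary B ->
  pclose e A B -> nrm (M - B) <= r -> e + r < 1 ->
  nrm (Kq - antiherm (unphase (dag A *m M))) <= k ->
  exists2 z, normc z = 1 &
    nrm (detrace Kq) <= 3 * e + 3 * r + 2 * k /\
    nrm (z *: (dag A *m B) - 1%:M - 'i%C *: detrace Kq) <=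
      (3 * e + 2 * r) ^+ 2 / 2 + r + 2 * k.
Proof.
move=> n0 uA uB [u u1 hu] hM er hK.
have e0 : 0 <= e by apply: le_trans hu; exact: nrm_ge0.
have r0 : 0 <= r by apply: le_trans hM; exact: nrm_ge0.
set E := dag A *m M in hK *; pose t := \tr E.
have uAB : nrm (u *: (dag A *m B) - 1%:M) <= e.
  have -> : u *: (dag A *m B) - 1%:M = dag A *m (u *: B - A).
    by rewrite mulmxBr unitary_dagl // -scalemxAr.
  by rewrite nrm_mulU 1?nrmBC; last by uni.
have dE : nrm (E - dag A *m B) <= r.
  by rewrite /E -mulmxBr nrm_mulU //; uni.
have uE : nrm (u *: E - 1%:M) <= e + r.
  apply: le_trans (nrm_tri (u *: (dag A *m B)) _ _) _; rewrite addrC; apply: lerD => //.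
  by rewrite -scalerBr; apply: le_trans (nrmZ_le _ _) _; rewrite u1 mul1r.
(* The phase u is not known to the program. But u times the mean diagonal entry is within e + r of
   1, so the phase of the trace is a computable substitute for it. *)
pose tm := t / n%:R.
have tmE : normc (u * tm - 1) <= e + r.
  by have := trace_mean_sub1 n0 uE; rewrite linearZ /= -mulrA.
have nR : (0 : R) < n%:R by rewrite ltr0n.
have ntm : normc tm = normc t / n%:R.
  by rewrite normcM normcV -(rmorph_nat (real_complex R)) normc_real normr_nat.
have tm0 : normc tm != 0.
  apply/eqP => h; have := normc_norm_sub1 tmE.
  rewrite normcM u1 mul1r h sub0r normrN normr1; lra.
have t0 : normc t != 0.
  by apply: contra tm0; rewrite ntm => /eqP ->; rewrite mul0r.
pose z := t^* / (normc t)%:C.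
have z1 : normc z = 1 by exact: normc_unit_div.
have zE : z = tm^* / (normc tm)%:C.
  rewrite ntm /tm rmorphM /= fmorphV /= rmorph_nat /= rmorphM /= fmorphV /= rmorph_nat.
  by rewrite /z invfM invrK mulrACA mulVf ?mulr1 // pnatr_eq0 -lt0n.
have hz : normc (u - z) <= 2 * (e + r) by rewrite zE; exact: phase_dist.
exists z => //.
set E0 := z *: (dag A *m B).
have uE0 : unitary E0 by rewrite /E0; uni.
have hE0 : nrm (E0 - 1%:M) <= 3 * e + 2 * r.
  apply: le_trans (nrm_tri (u *: (dag A *m B)) _ _) _.
  have -> : 3 * e + 2 * r = 2 * (e + r) * 1 + e by ring.
  apply: lerD => //; rewrite /E0 -scalerBl.
  apply: le_trans (nrmZ_le _ _) _; apply: ler_pM; rewrite ?normc_ge0 ?nrm_ge0 //.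
    by rewrite normcBC.
  by apply: nrm_unitary; uni.
set K := antiherm (unphase E) in hK.
(* After the phase correction the trace is real, so the anti-Hermitian part has trace zero. Making
   [Kq] traceless therefore removes only rounding error, which costs at most another k. *)
have trK : \tr K = 0.
  rewrite /K /antiherm linearZ /= linearB /= trace_dag /unphase -/t -/z linearZ /= -/t.
  have -> : z * t = (normc t)%:C.
    rewrite /z mulrAC [_ * t]mulrC ?conjCc mul_conjc rmorphXn expr2 mulfK //.
    by apply: contra t0 => /eqP /complexI ->.
  by rewrite conjc_real subrr mulr0.
have KK0 : nrm (K - antiherm E0) <= r.
  rewrite /K /unphase -/t -/z -antihermB; apply: nrm_antiherm.
  by rewrite /E0 -scalerBr; apply: le_trans (nrmZ_le _ _) _; rewrite z1 mul1r.
have dK : nrm (detrace Kq - K) <= 2 * k.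
  have -> : detrace Kq - K = detrace (Kq - K).
    by rewrite /detrace linearB /= trK subr0 addrAC.
  exact: nrm_detrace.
have dKK0 : nrm (detrace Kq - antiherm E0) <= 2 * k + r.
  by apply: le_trans (nrm_tri K _ _) _; exact: lerD.
split.
  have -> : detrace Kq = (detrace Kq - antiherm E0) + antiherm E0 by rewrite subrK.
  have -> : 3 * e + 3 * r + 2 * k = (2 * k + r) + (3 * e + 2 * r) by ring.
  apply: nrmD_le => //; rewrite -[antiherm E0]subr0 -antiherm1 -antihermB.
  exact: nrm_antiherm.
have -> : E0 - 1%:M - 'i%C *: detrace Kq =
   (E0 - 1%:M - 'i%C *: antiherm E0) - 'i%C *: (detrace Kq - antiherm E0).
  exact: mxid_subscale.
have -> : (3 * e + 2 * r) ^+ 2 / 2 + r + 2 * k =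
  (3 * e + 2 * r) ^+ 2 / 2 + (2 * k + r) by ring.
apply: nrmB_le; first exact: antiherm_near.
by apply: le_trans (nrmi _) _.
Qed.

(** The size x of the generators and the second-order error y are separate parameters;
    [balanced_spec] supplies $y=\tfrac35x^2$. *)
Definition generates_comm x y H V W : Prop := exists X Y : 'M[R[i]]_n,
  [/\ X *m Y - Y *m X = 'i%C *: H, nrm X <= x, nrm Y <= x
    & [/\ nrm (V - 1%:M) <= x, nrm (W - 1%:M) <= x,
        nrm (V - 1%:M - 'i%C *: X) <= y & nrm (W - 1%:M - 'i%C *: Y) <= y]].

(** The summands are, in order: the commutator of the exact factors against its second-order model,
    the replacement of these factors by approximants, the residual against $1+iH$ (multiplied by a
    bound for $1-iH$), and the square of H left over by $(1+iH)(1-iH)$. *)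
Lemma sk_step_bound A B M V W B1 B2 Kq e r k x y : (0 < n)%N ->
  unitary A -> unitary B -> unitary V -> unitary W -> unitary B1 -> unitary B2 ->
  pclose e A B -> nrm (M - B) <= r -> e + r < 1 ->
  nrm (Kq - antiherm (unphase (dag A *m M))) <= k ->
  generates_comm x y (detrace Kq) V W -> pclose e V B1 -> pclose e W B2 ->
  pclose ((4 * x * y + 2 * y ^+ 2 + 4 * x ^+ 3) +
     (4 * x * e + 2 * e ^+ 2 + 4 * x ^+ 2 * e) +
     ((3 * e + 2 * r) ^+ 2 / 2 + r + 2 * k) * (1 + (3 * e + 3 * r + 2 * k)) +
     (3 * e + 3 * r + 2 * k) ^+ 2) A (B *m gcomm B1 B2).
Proof.
move=> n0 uA uB uV uW uB1 uB2 pAB hM er hK [X [Y [XY hX hY [hV hW hVX hWY]]]] pV pW.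
have [z z1 [hh hE]] := residual_near n0 uA uB pAB hM er hK.
have [B1' [uB1' hB1 [u u1 eB1]]] := pclose_phase_unitary uB1 pV.
have [B2' [uB2' hB2 [w w1 eB2]]] := pclose_phase_unitary uB2 pW.
set h := 3 * e + 3 * r + 2 * k in hh *.
have h0 : 0 <= h by apply: le_trans hh; exact: nrm_ge0.
exists z => //; set H := detrace Kq in XY hh hE.
have gE : gcomm B1 B2 = gcomm B1' B2' by rewrite eB1 eB2 gcomm_phase.
have uG : unitary (gcomm B1' B2') by exact: gcomm_unitary.
have -> : A - z *: (B *m gcomm B1 B2) = A *m (1%:M - (z *: (dag A *m B)) *m gcomm B1' B2').
  by rewrite gE; apply: mxid_left; exact: unitary_dagr.
rewrite nrm_mulU // nrmBC; set E := z *: (dag A *m B) in hE *.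
set iH := 'i%C *: H in hE XY.
have niH : nrm iH <= h by apply: le_trans (nrmi _) _.
have uE : unitary E by rewrite /E; uni.
rewrite (mxid_step E (gcomm B1' B2') (1%:M + iH) (1%:M - iH) iH).
rewrite mxid_1k subrr addr0.
apply: nrmB_le; last by rewrite expr2; exact: nrmM_le.
apply: nrmD_le.
  rewrite nrm_mulU // [leRHS]addrC.
  apply: le_trans (nrm_tri (gcomm V W) _ _) _; apply: lerD.
    exact: gcomm_perturb.
  by rewrite opprB [iH - _]addrC addrA -XY; exact: gcomm_near.
apply: nrmM_le; first by rewrite opprD addrA.
by apply: nrmB_le => //; exact: nrm1_le.
Qed.

(** Origin of 320. From $x^2=4h\le\tfrac{49}{4}e$ one gets $x\le\tfrac72s$; then $\tfrac{64}{10}x^3$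
    contributes at most $274.4\,es$ and $4xe$ at most $14\,es$, and all remaining terms together
    stay below $es$. The starting value $s=1/512$ makes $320s=5/8$, so the recursion contracts. *)
Lemma sk_constants e s r k h x : 0 <= s -> e = s ^+ 2 -> s <= 1 / 512 ->
  0 <= r -> r <= e ^+ 2 -> 0 <= k -> k <= e ^+ 2 ->
  h = 3 * e + 3 * r + 2 * k -> 0 <= x -> x ^+ 2 = 4 * h ->
  (4 * x * (3 / 5 * x ^+ 2) + 2 * (3 / 5 * x ^+ 2) ^+ 2 + 4 * x ^+ 3) +
     (4 * x * e + 2 * e ^+ 2 + 4 * x ^+ 2 * e) +
     ((3 * e + 2 * r) ^+ 2 / 2 + r + 2 * k) * (1 + h) +
     h ^+ 2 <= 320 * (e * s).
Proof.
move=> s0 es s512 r0 re k0 ke hE x0 xE.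
have e0 : 0 <= e by rewrite es sqr_ge0.
have e1 : e <= 1 / 512 by rewrite es; nra.
have ee : e ^+ 2 <= e / 512 by rewrite expr2; nra.
have h4 : 4 * h <= 49 / 4 * e by lra.
have h0 : 0 <= h by lra.
have xs : x <= 7 / 2 * s.
  rewrite -(@ler_pXn2r _ 2) ?nnegrE ?mulr_ge0 // xE.
  by have -> : (7 / 2 * s) ^+ 2 = 49 / 4 * e; [rewrite es; field|].
have x1 : x <= 1 / 100 by lra.
have e2 : e ^+ 2 <= (e * s) / 512.
  have es5 : e <= s / 512 by rewrite es expr2; nra.
  by rewrite expr2 -mulrA ler_wpM2l.
have es0 : 0 <= e * s by rewrite mulr_ge0.
have x3 : x ^+ 3 <= 343 / 8 * (e * s).
  have -> : x ^+ 3 = x ^+ 2 * x by ring.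
  have -> : 343 / 8 * (e * s) = (49 / 4 * e) * (7 / 2 * s) by field.
  by rewrite xE; apply: ler_pM => //; lra.
have x4 : x ^+ 4 <= x ^+ 3 / 100.
  have -> : x ^+ 4 = x ^+ 3 * x by ring.
  by rewrite ler_wpM2l ?exprn_ge0 //; lra.
have xe : x * e <= 7 / 2 * (e * s).
  have -> : 7 / 2 * (e * s) = (7 / 2 * s) * e by ring.
  by rewrite ler_wpM2r.
have x2e : x ^+ 2 * e <= 13 * e ^+ 2.
  have -> : 13 * e ^+ 2 = (13 * e) * e by ring.
  by rewrite xE ler_wpM2r //; lra.
have h2 : h ^+ 2 <= 16 * e ^+ 2.
  have -> : 16 * e ^+ 2 = (4 * e) ^+ 2 by ring.
  by rewrite ler_pXn2r ?nnegrE //; lra.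
have q : (3 * e + 2 * r) ^+ 2 / 2 + r + 2 * k <= 11 * e ^+ 2.
  have : (3 * e + 2 * r) ^+ 2 <= (4 * e) ^+ 2.
    rewrite ler_pXn2r ?nnegrE //; lra.
  rewrite [(4 * e) ^+ 2]exprMn; lra.
have q' : ((3 * e + 2 * r) ^+ 2 / 2 + r + 2 * k) * (1 + h) <= (11 * e ^+ 2) * 2.
  apply: ler_pM => //; last by lra.
    have := sqr_ge0 (3 * e + 2 * r); lra.
  lra.
have -> : 4 * x * (3 / 5 * x ^+ 2) + 2 * (3 / 5 * x ^+ 2) ^+ 2 + 4 * x ^+ 3 =
  64 / 10 * x ^+ 3 + 18 / 25 * x ^+ 4 by field.
lra.
Qed.

End SKStep.

(** * Balanced commutators *)

Section SpectralExp.
Variables (R : realType) (n : nat).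
Implicit Types (A H Q X : 'M[R[i]]_n).

Lemma hermitian_normal H : dag H = H -> H \is normalmx.
Proof. by move=> h; apply/normalmxP; rewrite dagE h. Qed.

Lemma spectral_unitary H : unitary (spectralmx H).
Proof. by apply/unitarymxE; exact: spectral_unitarymx. Qed.

Lemma normal_spectral A : A \is normalmx ->
  A = dag (spectralmx A) *m diag_mx (spectral_diag A) *m spectralmx A.
Proof.
move=> /orthomx_spectralP {1}->.
by rewrite invmx_unitary ?spectral_unitarymx // dagE.
Qed.

Lemma dag_diag (v : 'rV[R[i]]_n) : dag (diag_mx v) = diag_mx (\row_j (v 0 j)^*%C).
Proof.
apply/matrixP => i j; rewrite dag_entry !mxE eq_sym.
by case: eqP => [->|_]; rewrite ?mulr1n // mulr0n conjc0.
Qed.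

Lemma conj_diag_entry Q A : unitary Q -> forall v : 'rV[R[i]]_n,
  A = dag Q *m diag_mx v *m Q -> diag_mx v = Q *m A *m dag Q.
Proof.
move=> uQ v ->; rewrite !mulmxA unitary_dagr // mul1mx -mulmxA unitary_dagr // mulmx1 //.
Qed.

Lemma hermitian_spectral_real H : dag H = H -> forall j,
  spectral_diag H 0 j = (complex.Re (spectral_diag H 0 j))%:C.
Proof.
move=> hH j; set v := spectral_diag H.
have e := conj_diag_entry (spectral_unitary H) (normal_spectral (hermitian_normal hH)).
have : dag (diag_mx v) = diag_mx v by rewrite e !dagM dagK hH mulmxA.
rewrite dag_diag => /matrixP /(_ j j); rewrite !mxE eqxx !mulr1n.
by case: (v 0 j) => a b [] /eqP; rewrite eqNr => /eqP ->.
Qed.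

Lemma diag_entry_nrm (v : 'rV[R[i]]_n) j : normc (v 0 j) <= nrm (diag_mx v).
Proof. by have := entry_le_nrm (diag_mx v) j j; rewrite !mxE eqxx mulr1n. Qed.

Lemma nrm_conjU Q A : unitary Q -> nrm (dag Q *m A *m Q) = nrm A.
Proof. by move=> uQ; rewrite nrm_mulrU // nrm_mulU //; uni. Qed.

Lemma hermitian_spectral_le H x j : dag H = H -> nrm H <= x ->
  `|complex.Re (spectral_diag H 0 j)| <= x.
Proof.
move=> hH hx; rewrite -normc_real -hermitian_spectral_real //.
apply: le_trans (diag_entry_nrm _ _) _.
rewrite -(nrm_conjU _ (spectral_unitary H)) -normal_spectral //.
exact: hermitian_normal.
Qed.

(** Only the real parts of the eigenvalues are read, so that the result is unitary for every
    argument; on Hermitian matrices it is $e^{iH}$. *)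
Definition expH H : 'M[R[i]]_n :=
  dag (spectralmx H) *m
  (diag_mx (\row_j cis (complex.Re (spectral_diag H 0 j))) *m spectralmx H).

Lemma unitary_diag (v : 'rV[R[i]]_n) : (forall j, normc (v 0 j) = 1) -> unitary (diag_mx v).
Proof.
move=> h; apply: unitaryI; rewrite dag_diag; apply/matrixP => i j.
rewrite mul_diag_mx !mxE; case: eqP => [->|_]; last by rewrite !mulr0n mulr0.
by rewrite !mulr1n mul_conjc h expr1n.
Qed.

Lemma expH_unitary H : unitary (expH H).
Proof.
have u := spectral_unitary H.
suff d : unitary (diag_mx (\row_j cis (complex.Re (spectral_diag H 0 j)))) by rewrite /expH; uni.
by apply: unitary_diag => j; rewrite mxE normc_cis.
Qed.

Lemma conjU1 Q : unitary Q -> dag Q *m 1%:M *m Q = 1%:M.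
Proof. by move=> uQ; rewrite mulmx1 unitary_dagl. Qed.

Lemma diag_const1 : diag_mx (\row_(j < n) 1) = 1%:M :> 'M[R[i]]_n.
Proof. by apply/matrixP => i j; rewrite !mxE. Qed.

Lemma expH_sub1 H x : dag H = H -> nrm H <= x -> nrm (expH H - 1%:M) <= x.
Proof.
move=> hH hx; set Q := spectralmx H.
have uQ : unitary Q by exact: spectral_unitary.
have x0 : 0 <= x by apply: le_trans hx; exact: nrm_ge0.
rewrite -(conjU1 uQ) /expH mulmxA -mulmxBl -mulmxBr nrm_conjU // -diag_const1.
rewrite -raddfB; apply: nrm_diag => // j; rewrite !mxE.
by apply: le_trans (normc_cis_sub1 _) _; exact: hermitian_spectral_le.
Qed.

Lemma expH_near H x : dag H = H -> nrm H <= x -> x <= 1 / 5 ->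
  nrm (expH H - 1%:M - 'i%C *: H) <= 3 / 5 * x ^+ 2.
Proof.
move=> hH hx x5; set Q := spectralmx H.
have uQ : unitary Q by exact: spectral_unitary.
have x0 : 0 <= x by apply: le_trans hx; exact: nrm_ge0.
rewrite {2}(normal_spectral (hermitian_normal hH)) -/Q scalemxAl scalemxAr.
rewrite -(conjU1 uQ) /expH mulmxA -!mulmxBl -!mulmxBr nrm_conjU // -diag_const1.
rewrite -linearZ -!raddfB; apply: nrm_diag => [|j].
  by rewrite mulr_ge0 ?sqr_ge0.
have hj := hermitian_spectral_le j hH hx.
rewrite !mxE hermitian_spectral_real //.
apply: le_trans (normc_cis_sub1i _) _; first exact: le_trans hj _.
rewrite ler_wpM2l // -[X in X <= _](ger0_norm (sqr_ge0 _)) normrX.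
by rewrite ler_pXn2r ?nnegrE.
Qed.

Lemma Re_sum (I : Type) (r : seq I) (P : pred I) (F : I -> R[i]) :
  complex.Re (\sum_(i <- r | P i) F i) = \sum_(i <- r | P i) complex.Re (F i).
Proof. by apply: (big_morph (@complex.Re R)) => // -[a b] [c d]. Qed.

Lemma hermitian_trace H : dag H = H ->
  complex.Re (\tr H) = \sum_j complex.Re (spectral_diag H 0 j).
Proof.
move=> hH; rewrite {1}(normal_spectral (hermitian_normal hH)) mxtrace_mulC mulmxA.
by rewrite (unitary_dagr (spectral_unitary H)) mul1mx mxtrace_diag Re_sum.
Qed.

Lemma expH_det H : dag H = H -> \tr H = 0 -> \det (expH H) = 1.
Proof.
move=> hH trH; have uQ := spectral_unitary H.
rewrite /expH !det_mulmx mulrC -mulrA -det_mulmx unitary_dagr // det1 mulr1.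
rewrite det_diag; under eq_bigr => j _ do rewrite mxE.
rewrite -cis_sum -[RHS](cis0 R); congr cis.
by rewrite -hermitian_trace // trH.
Qed.

End SpectralExp.

(** * An ordering of the eigenvalues with small partial sums *)

Section Selection.
Variables (R : realType) (n : nat) (lam : nat -> R).
Implicit Types (u : seq nat) (P : pred nat).

Definition psum u : R := \sum_(i <- u) lam i.

(** The value n means that no index qualifies. The last index is taken because a forward scan that
    overwrites a counter computes exactly this. *)
Definition lastsat P : nat := foldl (fun c i => if P i then i else c) n (iota 0 n).

(* Prefer a negative summand that keeps the partial sum nonnegative, so that
   the partial sums stay between 0 and twice the largest summand. *)
Definition negcand u : pred nat :=
  fun i => [&& i \notin u, lam i < 0 & 0 <= psum u + lam i].
Definition poscand u : pred nat := fun i => (i \notin u) && (0 <= lam i).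

Definition nextidx u : nat :=
  if (lastsat (negcand u) < n)%N then lastsat (negcand u) else lastsat (poscand u).

Definition greedy k : seq nat := iter k (fun u => rcons u (nextidx u)) [::].

Lemma lastsatP P : (lastsat P < n)%N /\ P (lastsat P) \/
  lastsat P = n /\ forall i, (i < n)%N -> ~~ P i.
Proof.
rewrite /lastsat.
suff h : forall k, (k <= n)%N ->
    let c := foldl (fun c i => if P i then i else c) n (iota 0 k) in
    (c < n)%N /\ P c \/ c = n /\ forall i, (i < k)%N -> ~~ P i by exact: h.
elim=> [|k IH] kn; first by right.
rewrite -addn1 iotaD foldl_cat /=; case: ifP => Pk; first by left.
have [[c1 c2]|[c1 c2]] := IH (ltnW kn); first by left.
right; split => // i; rewrite addn1 ltnS leq_eqVlt => /orP[/eqP ->|]; last exact: c2.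
by rewrite Pk.
Qed.

Lemma psum_rcons u i : psum (rcons u i) = psum u + lam i.
Proof. by rewrite /psum -cats1 big_cat big_seq1. Qed.

Lemma greedyS k : greedy k.+1 = rcons (greedy k) (nextidx (greedy k)).
Proof. by []. Qed.

Lemma size_greedy k : size (greedy k) = k.
Proof. by elim: k => // k IH; rewrite greedyS size_rcons IH. Qed.

Lemma nth_greedy k m : (k < m)%N -> nth 0%N (greedy m) k = nextidx (greedy k).
Proof.
elim: m => // m IH; rewrite ltnS leq_eqVlt greedyS nth_rcons size_greedy.
by case: ltngtP => // [km _|-> //]; exact: IH.
Qed.

Variable h : R.
Hypothesis lam_le : forall i, (i < n)%N -> `|lam i| <= h.
Hypothesis h_ge0 : 0 <= h.
Hypothesis lam_sum : \sum_(0 <= i < n) lam i = 0.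

Lemma psum_rest u : uniq u -> all (fun i => (i < n)%N) u ->
  \sum_(i <- iota 0 n | i \notin u) lam i = - psum u.
Proof.
move=> uu au; apply/eqP; rewrite -addr_eq0 addrC.
have -> : psum u = \sum_(i <- iota 0 n | i \in u) lam i.
  rewrite -big_filter /psum; apply: perm_big; apply: uniq_perm => //.
    by rewrite filter_uniq // iota_uniq.
  move=> i; rewrite mem_filter mem_iota /= add0n.
  by case ui : (i \in u) => //=; rewrite (allP au).
by rewrite -(bigID (fun i => i \in u) predT) /= -[X in _ == X]lam_sum /index_iota subn0.
Qed.

Lemma greedyP k : (k <= n)%N ->
  [/\ uniq (greedy k), all (fun i => (i < n)%N) (greedy k) & 0 <= psum (greedy k) <= 2 * h].
Proof.
elim: k => [|k IH] kn.
  split=> //=; rewrite /psum big_nil lexx /=.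
  by rewrite mulr_ge0.
have [uu au /andP[s0 s2]] := IH (ltnW kn).
set u := greedy k in uu au s0 s2 *.
have rest := psum_rest uu au.
suff [i1 [i2 [i3 i4]]] : (nextidx u < n)%N /\ nextidx u \notin u /\
    0 <= psum u + lam (nextidx u) /\ psum u + lam (nextidx u) <= 2 * h.
  by rewrite greedyS -/u psum_rcons rcons_uniq all_rcons i1 i2 uu au i3 i4.
rewrite /nextidx; have [[c1 /and3P[c2 c3 c4]]|[-> c2]] := lastsatP (negcand u).
  by rewrite c1; do !split => //; lra.
rewrite ltnn.
have negc i : (i < n)%N -> i \notin u -> lam i < 0 -> psum u + lam i < 0.
  move=> lti iu li; have := c2 i lti; rewrite /negcand iu li /=.
  by rewrite -ltNge.
have rest1 i : (i < n)%N -> i \notin u ->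
    - psum u = lam i + \sum_(j <- rem i (iota 0 n) | j \notin u) lam j.
  by move=> lti iu; rewrite -rest (big_rem i) /= ?mem_iota // iu.
have inrem i j : j \in rem i (iota 0 n) -> (j < n)%N.
  by move=> /mem_rem; rewrite mem_iota.
have [[d1 /andP[d2 d3]]|[_ d2]] := lastsatP (poscand u).
  do !split => //; first by rewrite addr_ge0.
  set j := lastsat _ in d1 d2 d3 *.
  have [[i [lti iu li]]|nex] := pselect (exists i, [/\ (i < n)%N, i \notin u & lam i < 0]).
    have := negc i lti iu li; have := lam_le lti; have := lam_le d1.
    by rewrite !ler_norml => /andP[? ?] /andP[? ?] ?; lra.
  have := rest1 j d1 d2.
  suff : 0 <= \sum_(i <- rem j (iota 0 n) | i \notin u) lam i by lra.
  rewrite big_seq_cond; apply: sumr_ge0 => i /andP[/inrem lti iu].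
  by rewrite leNgt; apply/negP => li; apply: nex; exists i.
exfalso.
have [i [lti iu]] : exists i, (i < n)%N /\ i \notin u.
  apply: contrapT => nex.
  have : (size (iota 0 n) <= size u)%N.
    apply: uniq_leq_size; first exact: iota_uniq.
    move=> i; rewrite mem_iota /= add0n => lti.
    by apply: contrapT => /negP iu; apply: nex; exists i.
  by rewrite size_iota size_greedy leqNgt kn.
have neg j : (j < n)%N -> j \notin u -> lam j < 0.
  by move=> ltj ju; have := d2 j ltj; rewrite /poscand ju /= -ltNge.
have := negc i lti iu (neg i lti iu); have := rest1 i lti iu.
suff : \sum_(j <- rem i (iota 0 n) | j \notin u) lam j <= 0 by lra.
rewrite big_seq_cond; apply: sumr_le0 => j /andP[/inrem ltj ju].
by apply: ltW; exact: neg.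
Qed.

End Selection.

(** * Hermitian matrices with a prescribed commutator *)

Section BalancedCommutator.
Variables (R : realType) (n : nat).
Implicit Types (H : 'M[R[i]]_n) (i j k : 'I_n).

Definition eigs (v : 'rV[R[i]]_n) (i : nat) : R :=
  if insub i is Some j then complex.Re (v 0 j) else 0.

Lemma eigsE (v : 'rV[R[i]]_n) i : eigs v i = complex.Re (v 0 i).
Proof. by rewrite /eigs valK. Qed.

Section Fixed.
Variables (Q : 'M[R[i]]_n) (v : 'rV[R[i]]_n).
Let lam := eigs v.

Definition pidx k : 'I_n := insubd k (nextidx n lam (greedy n lam k)).
Definition permrows : 'M[R[i]]_n := \matrix_(k, j) Q (pidx k) j.
Definition weight k : R := Num.sqrt (psum lam (greedy n lam k.+1)).
(** Entry of $cA+\bar cA^\dagger$, where A is the cyclic shift whose row k is scaled by [weight k],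
    the square root of the partial sum ending at k. The constants [cX] and [cY] select the two
    quadratures of A. *)
Definition shift_entry (c : R[i]) i j : R[i] :=
  c * (((i == ord_pred j)%:R : R) * weight i)%:C +
  c^*%C * (((j == ord_pred i)%:R : R) * weight j)%:C.
Definition shiftmx c : 'M[R[i]]_n := \matrix_(i, j) shift_entry c i j.
Definition comm_gen c : 'M[R[i]]_n := dag permrows *m (shiftmx c *m permrows).
End Fixed.

Definition cX : R[i] := ((Num.sqrt 2)^-1)%:C.
Definition cY : R[i] := - 'i%C * ((Num.sqrt 2)^-1)%:C.

Definition comm_herm c H : 'M[R[i]]_n :=
  comm_gen (spectralmx (detrace H)) (spectral_diag (detrace H)) c.

Lemma eigs_herm H x : dag H = H -> nrm H <= x ->
  (forall m : nat, (m < n)%N -> `|eigs (spectral_diag H) m| <= x).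
Proof.
move=> hH hx m ltm; rewrite -[m]/(val (Ordinal ltm)) eigsE.
exact: hermitian_spectral_le.
Qed.

Lemma eigs_sum H : dag H = H -> \tr H = 0 ->
  \sum_(0 <= m < n) eigs (spectral_diag H) m = 0.
Proof.
move=> hH trH; rewrite big_mkord; under eq_bigr => i _ do rewrite eigsE.
by rewrite -hermitian_trace // trH.
Qed.

Section Properties.
Variables (Q : 'M[R[i]]_n) (v : 'rV[R[i]]_n) (h : R).
Hypotheses (uQ : unitary Q) (h0 : 0 <= h).
Let lam := eigs v.
Hypotheses (lam_le : forall m : nat, (m < n)%N -> `|lam m| <= h)
  (lam_sum : \sum_(0 <= m < n) lam m = 0) (n1 : (1 < n)%N).

Let gr := greedy n lam.
Let grP (k : nat) := greedyP lam_le h0 lam_sum (k := k).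

Lemma pidxE k : pidx v k = nextidx n lam (gr k) :> nat.
Proof.
rewrite val_insubd; case: ifP => // /negP; case.
have [_ /allP au _] := grP (ltn_ord k).
by apply: au; rewrite -/(greedy n lam k.+1) greedyS mem_rcons inE eqxx.
Qed.

Lemma pidx_inj : injective (pidx v).
Proof.
move=> k l /(congr1 val); rewrite /= !pidxE -!(nth_greedy n lam (ltn_ord _)) => e.
have [uu _ _] := grP (leqnn n).
apply/val_inj/eqP; rewrite -(nth_uniq 0%N _ _ uu) ?size_greedy ?ltn_ord //; apply/eqP.
exact: e.
Qed.

Lemma permrows_unitary : unitary (permrows Q v).
Proof.
apply: unitaryI; apply/matrixP => k l.
have -> : (permrows Q v *m dag (permrows Q v)) k l = (Q *m dag Q) (pidx v k) (pidx v l).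
  by rewrite !mxE; apply: eq_bigr => j _; rewrite !dag_entry !mxE.
by rewrite (unitary_dagr uQ) !mxE (inj_eq pidx_inj).
Qed.

Lemma permrows_conj : dag (permrows Q v) *m diag_mx (\row_k v 0 (pidx v k)) *m permrows Q v =
  dag Q *m diag_mx v *m Q.
Proof.
apply/matrixP => a b; rewrite !mxE [RHS](reindex_inj pidx_inj) /=.
by apply: eq_bigr => k _; rewrite !mul_mx_diag !mxE !dag_entry !mxE.
Qed.

Lemma psum_total : psum lam (gr n) = 0.
Proof.
have [uu au _] := grP (leqnn n).
rewrite -lam_sum /index_iota subn0; apply: perm_big; apply: uniq_perm => //.
  exact: iota_uniq.
have sub : {subset gr n <= iota 0 n}.
  by move=> i /(allP au); rewrite mem_iota.
have [|_ //] := uniq_min_size uu sub; by rewrite size_iota size_greedy.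
Qed.

Lemma weight_sqr k : weight v k ^+ 2 = psum lam (gr k.+1).
Proof. by rewrite sqr_sqrtr //; have [_ _ /andP[]] := grP (ltn_ord k). Qed.

Lemma weight_ge0 k : 0 <= weight v k. Proof. exact: sqrtr_ge0. Qed.

Lemma weight_le k : weight v k <= Num.sqrt (2 * h).
Proof. by apply: ler_wsqrtr; have [_ _ /andP[]] := grP (ltn_ord k). Qed.

(** Consecutive partial sums differ by one eigenvalue. The cyclic wrap-around is consistent because
    the eigenvalues add up to zero: the last partial sum equals the empty one. *)
Lemma weight_diff k : weight v k ^+ 2 - weight v (ord_pred k) ^+ 2 = lam (pidx v k).
Proof.
rewrite !weight_sqr pidxE /gr greedyS psum_rcons -/gr.
suff -> : psum lam (gr (ord_pred k).+1) = psum lam (gr k) by rewrite addrAC subrr add0r.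
case ek : (val k) => [|m].
  have -> : (val (ord_pred k)).+1 = n.
    by rewrite /= ek add0n modn_small ?prednK ?ltn_predL ?(ltn_trans _ n1).
  by rewrite psum_total /psum big_nil.
suff -> : (val (ord_pred k)).+1 = m.+1 by [].
have e : (k : nat) = m.+1 := ek.
by rewrite /= e addSn /= modnDr modn_small // ltnW // -e.
Qed.

Definition cycmx : 'M[R[i]]_n := \matrix_(i, j) (i == ord_pred j)%:R.

Lemma cycmx_unitary : unitary cycmx.
Proof.
suff : unitary (dag cycmx) by move=> /unitary_dag; rewrite dagK.
apply: unitaryI; rewrite dagK; apply/matrixP => k l; rewrite !mxE.
under eq_bigr => j _ do rewrite dag_entry !mxE.
rewrite (bigD1 (ord_pred k)) //= big1 => [|j /negPf ->]; last by rewrite conjc0 mul0r.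
rewrite eqxx conjc1 mul1r addr0 (inj_eq (can_inj (@ord_predK n))) //.
Qed.

Definition wdiag : 'M[R[i]]_n := diag_mx (\row_k (weight v k)%:C).
Definition rais : 'M[R[i]]_n := wdiag *m cycmx.

Lemma nrm_rais : nrm rais <= Num.sqrt (2 * h).
Proof.
rewrite nrm_mulrU; last exact: cycmx_unitary.
apply: nrm_diag => [|j]; first exact: sqrtr_ge0.
by rewrite mxE normc_real ger0_norm ?weight_ge0 ?weight_le.
Qed.

Lemma raisE a b : rais a b = (((a == ord_pred b)%:R : R) * weight v a)%:C.
Proof. by rewrite /rais mul_diag_mx !mxE mulrC rmorphM /= rmorph_nat. Qed.

Lemma shiftmxE c : shiftmx v c = c *: rais + c^*%C *: dag rais.
Proof.
apply/matrixP => a b; rewrite mxDE !mxZE dag_entry !raisE conjc_real.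
by rewrite mxE.
Qed.

(** For a weighted cyclic shift both products with the adjoint are diagonal: one lists the squared
    weights, the other the same list shifted by one place. Their difference is the list of
    eigenvalues. *)
Lemma rais_comm : rais *m dag rais - dag rais *m rais =
  diag_mx (\row_k (lam (pidx v k))%:C).
Proof.
have dw : dag wdiag = wdiag.
  by rewrite dag_diag; congr diag_mx; apply/rowP => k; rewrite !mxE conjc_real.
have -> : rais *m dag rais = wdiag *m wdiag.
  by rewrite /rais dagM dw mulmxA -(mulmxA wdiag) (unitary_dagr cycmx_unitary) mulmx1.
rewrite mulmx_diag; apply/matrixP => a b; rewrite mxDE mxNE.
have -> : (dag rais *m rais) a b = ((weight v (ord_pred a) ^+ 2)%:C : R[i]) *+ (a == b).
  rewrite mxE; under eq_bigr => j _ do rewrite dag_entry !raisE conjc_real.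
  rewrite (bigD1 (ord_pred a)) //= big1 => [|j /negPf ->]; last by rewrite mul0r mul0r.
  rewrite eqxx mul1r addr0 (inj_eq (can_inj (@ord_predK n))).
  by case: eqP => _; rewrite ?mul1r ?mul0r ?mulr0 // expr2 rmorphM.
rewrite 2!mxE [diag_mx _ _ _]mxE [X in _ = X *+ _]mxE.
have [e|_] := eqVneq a b; last by rewrite !mulr0n subr0.
rewrite !mxE.
by rewrite !mulr1n -weight_diff rmorphB /= !rmorphXn /= !expr2.
Qed.

(** With $X=(A+A^\dagger)/\sqrt2$ and $Y=(-iA+iA^\dagger)/\sqrt2$ one has
    $XY-YX=i(AA^\dagger-A^\dagger A)$. The bound $\sqrt{2h}$ for the norm of A gives $2\sqrt h$ for
    X and Y, independently of the dimension. *)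
Lemma comm_gen_spec : v = \row_k (complex.Re (v 0 k))%:C ->
  let X := comm_gen Q v cX in let Y := comm_gen Q v cY in
  [/\ X *m Y - Y *m X = 'i%C *: (dag Q *m diag_mx v *m Q),
      dag X = X /\ dag Y = Y, \tr X = 0 /\ \tr Y = 0,
      nrm X <= 2 * Num.sqrt h & nrm Y <= 2 * Num.sqrt h].
Proof.
move=> vreal X Y; have uP := permrows_unitary.
set P := permrows Q v in uP.
have s2 : Num.sqrt 2 != 0 :> R by rewrite sqrtr_eq0 -ltNge.
have herm c : dag (comm_gen Q v c) = comm_gen Q v c.
  rewrite /comm_gen -/P !dagM dagK -mulmxA; congr (_ *m (_ *m _)).
  by rewrite shiftmxE dagD !dagZ dagK addrC -!conjCc conjCK.
have tr c : \tr (comm_gen Q v c) = 0.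
  rewrite /comm_gen -/P mxtrace_mulC -mulmxA (unitary_dagr uP) mulmx1.
  rewrite /mxtrace big1 // => k _; rewrite mxE /shift_entry.
  have -> : (k == ord_pred k) = false.
    apply/negP => /eqP /(congr1 val) /=; case: k => -[|m] ltm /=.
      rewrite add0n modn_small ?ltn_predL ?(ltn_trans _ n1) // => e.
      by move: n1; rewrite -(prednK (ltn_trans _ n1)) // -e.
    rewrite modnDr modn_small; last exact: ltnW.
    by move/eqP; rewrite (gtn_eqF (ltnSn m)).
  by rewrite !mul0r !mulr0 addr0.
have nc c : normc c = (Num.sqrt 2)^-1 -> nrm (comm_gen Q v c) <= 2 * Num.sqrt h.
  move=> hc; rewrite nrm_mulU; last by uni.
  rewrite nrm_mulrU // shiftmxE.
  have -> : 2 * Num.sqrt h = (Num.sqrt 2)^-1 * Num.sqrt (2 * h) + (Num.sqrt 2)^-1 * Num.sqrt (2 * h).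
    by rewrite sqrtrM // mulKf // mulr_natl mulr2n.
  by apply: nrmD_le; apply: le_trans (nrmZ_le _ _) _;
    rewrite ?normc_conj hc ler_wpM2l ?invr_ge0 ?sqrtr_ge0 ?nrm_dag ?nrm_rais.
have nX : normc cX = (Num.sqrt 2)^-1 :> R.
  by rewrite normc_real ger0_norm // invr_ge0 sqrtr_ge0.
have nY : normc cY = (Num.sqrt 2)^-1 :> R.
  by rewrite normcM normcNe normc_i mul1r normc_real ger0_norm // invr_ge0 sqrtr_ge0.
split; rewrite ?tr ?herm ?nc //.
have E := permrows_conj; rewrite -/P in E.
rewrite /X /Y /comm_gen -/P mxid_conj_comm ?(unitary_dagr uP) // -E -mxid_conj_scale.
congr (_ *m (_ *m _)).
have -> : diag_mx (\row_k v 0 (pidx v k)) = rais *m dag rais - dag rais *m rais.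
  by rewrite rais_comm; congr diag_mx; apply/rowP => k; rewrite !mxE /lam eigsE {1}vreal mxE.
have cXr : cX^*%C = cX :> R[i] by rewrite /cX conjc_real.
have cYr : cY^*%C = - cY :> R[i].
  by rewrite /cY -conjCc rmorphM rmorphN /= !conjCc conjc_real -mulNr; congr (_ * _);
     apply/eqP; rewrite eq_complex /= !opprK oppr0 !eqxx.
rewrite !shiftmxE cXr cYr mxid_quadr; congr (_ *: _).
apply: scid_half; rewrite -rmorphM -invfM -expr2 sqr_sqrtr // rmorphV /= ?unitfE //.
by rewrite rmorph_nat mulfV // pnatr_eq0.
Qed.

End Properties.

Lemma detrace_dag H : dag H = H -> dag (detrace H) = detrace H.
Proof.
move=> hH; rewrite dagB hH; congr (_ - _).
rewrite -scalemx1 dagZ dag1; congr (_ *: _).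
by rewrite rmorphM fmorphV /= rmorph_nat conjCc -trace_dag hH.
Qed.

Lemma detrace_trace H : (0 < n)%N -> \tr (detrace H) = 0.
Proof.
move=> n0; rewrite linearB /= mxtrace_scalar -(mulr_natr (_ / _)) divfK ?subrr //.
by rewrite pnatr_eq0 -lt0n.
Qed.

Definition balanced c H : 'M[R[i]]_n := expH (comm_herm c H).

(** The determinants are recorded because in the preprocessing the recursive calls end in the net
    search, which is specified on $\mathrm{SU}(d)$ only. *)
Theorem balanced_spec H h x : (1 < n)%N -> dag H = H -> nrm (detrace H) <= h ->
  x = 2 * Num.sqrt h -> x <= 1 / 5 ->
  [/\ generates_comm x (3 / 5 * x ^+ 2) (detrace H) (balanced cX H) (balanced cY H),
    unitary (balanced cX H) /\ unitary (balanced cY H)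
    & \det (balanced cX H) = 1 /\ \det (balanced cY H) = 1].
Proof.
move=> n1 hH hh xE x5; have n0 := ltnW n1.
have h0 : 0 <= h by apply: le_trans hh; exact: nrm_ge0.
have hD := detrace_dag hH; have tD := detrace_trace H n0.
set D := detrace H in hh hD tD *.
have := comm_gen_spec (spectral_unitary D) h0 (eigs_herm hD hh) (eigs_sum hD tD) n1.
have vreal : spectral_diag D = \row_k (complex.Re (spectral_diag D 0 k))%:C.
  by apply/rowP => k; rewrite mxE -hermitian_spectral_real.
move=> /(_ vreal) /= [XY [dX dY] [tX tY]].
rewrite -normal_spectral in XY; last exact: hermitian_normal.
rewrite -xE => nX nY; split; first last.
- by split; [exact: expH_det dX tX|exact: expH_det dY tY].
- by split; exact: expH_unitary.
exists (comm_herm cX H), (comm_herm cY H).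
exact: (And4 XY nX nY (And4 (expH_sub1 dX nX) (expH_sub1 dY nY)
  (expH_near dX nX x5) (expH_near dY nY x5))).
Qed.
End BalancedCommutator.

Section Identity.
Variables (K : comNzRingType) (n : nat).
Implicit Types a b p q : 'M[K]_n.
Lemma mxid_mul_sub a b p q : a *m b - p *m q = (a - p) *m (b - q) + (a - p) *m q + p *m (b - q).
Proof. by rewrite mulmxBr subrK mulmxBl mulmxBr addrA subrK. Qed.
End Identity.

(** * One level of the recursion with rounded data *)

Section Level.
Variables (R : realType) (n : nat).
Implicit Types (A B M V W : 'M[R[i]]_n) (e s r k x h : R).

(** Rounding errors up to $e^2$ are of smaller order than the error $e^{3/2}$ of the exact step, so
    they change neither the exponent nor the constant 320. *)
Lemma sk_level A B M Kq e s r k : (1 < n)%N -> 0 <= s -> e = s ^+ 2 -> s <= 1 / 512 ->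
  r <= e ^+ 2 -> k <= e ^+ 2 -> unitary A -> unitary B -> pclose e A B -> nrm (M - B) <= r ->
  dag Kq = Kq -> nrm (Kq - antiherm (unphase (dag A *m M))) <= k ->
  let V := balanced (cX R) Kq in let W := balanced (cY R) Kq in
  [/\ unitary V /\ \det V = 1, unitary W /\ \det W = 1 &
    forall B1 B2, unitary B1 -> unitary B2 -> pclose e V B1 -> pclose e W B2 ->
      pclose (320 * (e * s)) A (B *m gcomm B1 B2)].
Proof.
move=> n1 s0 es s512 hr hk uA uB pAB hM hK hKq V W.
have n0 := ltnW n1.
have r0 : 0 <= r by apply: le_trans hM; exact: nrm_ge0.
have k0 : 0 <= k by apply: le_trans hKq; exact: nrm_ge0.
have e0 : 0 <= e by rewrite es sqr_ge0.
have e1 : e <= s / 512 by rewrite es expr2; nra.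
have ee : e ^+ 2 <= e / 512 by rewrite expr2; nra.
have er : e + r < 1 by lra.
set h := 3 * e + 3 * r + 2 * k.
have h0 : 0 <= h by rewrite /h; lra.
have [_ _ [hh _]] := residual_near n0 uA uB pAB hM er hKq.
pose x := 2 * Num.sqrt h.
have x0 : 0 <= x by rewrite mulr_ge0 // sqrtr_ge0.
have xE : x ^+ 2 = 4 * h by rewrite exprMn sqr_sqrtr //; ring.
have x5 : x <= 1 / 5.
  rewrite -(@ler_pXn2r _ 2) ?nnegrE // xE expr2 /h; lra.
have [gc [uV uW] [dV dW]] := balanced_spec n1 hK hh erefl x5.
apply: (And3 (conj uV dV) (conj uW dW)) => B1 B2 uB1 uB2 p1 p2.
apply: pclose_le (sk_step_bound n0 uA uB uV uW uB1 uB2 pAB hM er hKq gc p1 p2).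
exact: (sk_constants s0 es s512 r0 hr k0 hk).
Qed.

(** The stored factors are only nearly unitary and are multiplied with adjoints in place of
    inverses, as the words are. Five factors with error r each cost 5r to first order; the
    second-order terms fit into one more r. *)
Lemma product_error (Q P C B0 B1 B2 : 'M[R[i]]_n) r : r <= 1 / 20 ->
  unitary B0 -> unitary B1 -> unitary B2 ->
  nrm (Q - B0) <= r -> nrm (P - B1) <= r -> nrm (C - B2) <= r ->
  nrm (Q *m ((P *m C) *m (dag P *m dag C)) - B0 *m gcomm B1 B2) <= 6 * r.
Proof.
move=> r1 u0 u1 u2 hQ hP hC.
have r0 : 0 <= r by apply: le_trans hQ; exact: nrm_ge0.
have mulB (X Y X' Y' : 'M[R[i]]_n) a : nrm (X - X') <= a -> nrm (Y - Y') <= a ->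
    nrm X' <= 1 -> nrm Y' <= 1 -> nrm (X *m Y - X' *m Y') <= a * a + a * 1 + 1 * a.
  move=> hX hY n1 n2; rewrite mxid_mul_sub.
  exact: (nrmD_le (nrmD_le (nrmM_le hX hY) (nrmM_le hX n2)) (nrmM_le n1 hY)).
have n0 := nrm_unitary u0; have n1 := nrm_unitary u1; have n2 := nrm_unitary u2.
have n12 : nrm (B1 *m B2) <= 1 by apply: nrm_unitary; uni.
have n34 : nrm (dag B1 *m dag B2) <= 1 by apply: nrm_unitary; uni.
have hg : nrm ((B1 *m B2) *m (dag B1 *m dag B2)) <= 1 by apply: nrm_unitary; uni.
have d1 : nrm (dag P - dag B1) <= r by rewrite -dagB nrm_dag.
have d2 : nrm (dag C - dag B2) <= r by rewrite -dagB nrm_dag.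
have h1 := mulB _ _ _ _ _ hP hC n1 n2.
have h2 : nrm (dag P *m dag C - dag B1 *m dag B2) <= r * r + r * 1 + 1 * r.
  by apply: mulB => //; rewrite nrm_dag.
have h3 := mulB _ _ _ _ _ h1 h2 n12 n34.
set w := r * r + r * 1 + 1 * r in h1 h2 h3.
have := nrmD_le (nrmD_le (nrmM_le hQ h3) (nrmM_le hQ hg)) (nrmM_le n0 h3).
rewrite -mxid_mul_sub => h.
have -> : gcomm B1 B2 = B1 *m B2 *m (dag B1 *m dag B2) by rewrite /gcomm !mulmxA.
apply: le_trans h _.
have r2 : r * r <= r / 20 by nra.
have r20 : 0 <= r * r by rewrite mulr_ge0.
have w1 : w <= 41 / 20 * r by rewrite /w; lra.
have w0 : 0 <= w by rewrite /w; lra.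
have w2 : 0 <= w * w by rewrite mulr_ge0.
have ww : w * w <= 41 / 400 * w by nra.
have : r * (w * w + w * 1 + 1 * w) <= 1 / 20 * (w * w + w * 1 + 1 * w) by apply: ler_wpM2r; lra.
lra.
Qed.
End Level.

(** * Programs and their cost *)

Local Open Scope nat_scope.

Definition NV k : nexp := NLoad (NConst k).
Definition RV k : rexp := RLoad (NConst k).
Definition SetN k e : cmd := NStore (NConst k) e.
Definition SetR k e : cmd := RStore (NConst k) e.
Definition For v n body : cmd :=
  Seq (SetN v (NConst 0))
    (While (NLe (NAdd (NV v) (NConst 1)) n) (Seq body (SetN v (NAdd (NV v) (NConst 1))))).

(* The real memory consists of 64 scalars followed by consecutive d x d
   complex matrix registers. *)
Definition nD2 : nexp := NMul (NConst 2) (NMul NDim NDim).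
Definition nRaddr (k i j : nexp) : nexp :=
  NAdd (NAdd (NConst 64) (NMul k nD2)) (NMul (NConst 2) (NAdd (NMul i NDim) j)).
Definition nRbase (k : nexp) : nexp := NAdd (NConst 64) (NMul k nD2).

Definition cexp := (rexp * rexp)%type.
Definition CE k i j : cexp := (RLoad (nRaddr k i j), RLoad (NAdd (nRaddr k i j) (NConst 1))).
Definition CS k : cexp := (RV k, RV k.+1).
Definition CR e : cexp := (e, RNat (NConst 0)).
Definition Cadd (a b : cexp) : cexp := (RAdd a.1 b.1, RAdd a.2 b.2).
Definition Csub (a b : cexp) : cexp := (RSub a.1 b.1, RSub a.2 b.2).
Definition Cmul (a b : cexp) : cexp :=
  (RSub (RMul a.1 b.1) (RMul a.2 b.2), RAdd (RMul a.1 b.2) (RMul a.2 b.1)).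
Definition Cconj (a : cexp) : cexp := (a.1, RSub (RNat (NConst 0)) a.2).
(** Both parts go through scalars 0 and 1 first, since [e] may read the cells that are about to be
    overwritten. *)
Definition SetC k (e : cexp) : cmd := Seq (SetR 0 e.1) (Seq (SetR 1 e.2) (Seq (SetR k (RV 0)) (SetR k.+1 (RV 1)))).
Definition PutE k i j : cmd :=
  Seq (RStore (nRaddr k i j) (RV 0)) (RStore (NAdd (nRaddr k i j) (NConst 1)) (RV 1)).
Definition MxFor k body : cmd :=
  For 0 NDim (For 1 NDim (Seq body (PutE k (NV 0) (NV 1)))).
Definition MxSet k (e : cexp) : cmd := MxFor k (Seq (SetR 0 e.1) (SetR 1 e.2)).
Definition Acc n (e : cexp) : cmd :=
  Seq (Seq (SetR 2 (RNat (NConst 0))) (SetR 3 (RNat (NConst 0))))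
      (For 2 n (SetC 2 e)).
Definition MulSet k (la lb : nexp -> nexp -> cexp) : cmd :=
  MxFor k (Seq (Acc NDim (Cadd (CS 2) (Cmul (la (NV 0) (NV 2)) (lb (NV 2) (NV 1)))))
               (Seq (SetR 0 (RV 2)) (SetR 1 (RV 3)))).

(** * Memory layout and frame conditions *)

Section Frame.
Variables (R : realType) (d : nat).
Implicit Types (st : state R) (N Sc M : seq nat).

Definition rsz : nat := 2 * (d * d).
Definition raddr (k i j : nat) : nat := 64 + k * rsz + 2 * (i * d + j).
Definition touched Sc M (a : nat) : bool :=
  if a < 64 then a \in Sc else (a - 64) %/ rsz \in M.

(** Writes are tracked by counter, by scalar and by whole register. As these are concrete lists,
    weakening a frame condition is a decidable inclusion that mostly reduces to computation. *)
Record frame N Sc M st st' : Prop := Frame {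
  frame_n : forall k, k \notin N -> nmem st' k = nmem st k;
  frame_r : forall a, ~~ touched Sc M a -> rmem st' a = rmem st a }.

Record same N Sc M st st' : Prop := Same {
  same_frame : frame N Sc M st st';
  same_slp : slp st' = slp st;
  same_ans : ans st' = ans st }.

Definition setn st k x := set_nmem st (upd (nmem st) k x).
Definition setr st k (x : R) := set_rmem st (upd (rmem st) k x).
Definition cell st a : R[i] := rmem st a +i* rmem st a.+1.
Definition regn st k i j : R[i] := cell st (raddr k i j).
Definition reg st k : 'M[R[i]]_d := \matrix_(i, j) regn st k i j.

Lemma touched_sub N Sc M N' Sc' M' a : {subset Sc <= Sc'} -> {subset M <= M'} ->
  ~~ touched Sc' M' a -> ~~ touched Sc M a.
Proof.
by move=> hS hM; rewrite /touched; case: ifP => _; apply: contra; [exact: hS|exact: hM].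
Qed.

Lemma frame_sub N Sc M N' Sc' M' st st' : {subset N <= N'} -> {subset Sc <= Sc'} ->
  {subset M <= M'} -> frame N Sc M st st' -> frame N' Sc' M' st st'.
Proof.
move=> hN hS hM [fn fr]; split=> [k kN|a ha].
  by apply: fn; apply: contra kN; exact: hN.
by apply: fr; apply: touched_sub ha => //; exact: N.
Qed.

Lemma frame_refl N Sc M st : frame N Sc M st st.
Proof. by split. Qed.

Lemma frame_trans N Sc M st1 st2 st3 : frame N Sc M st1 st2 -> frame N Sc M st2 st3 ->
  frame N Sc M st1 st3.
Proof.
by move=> [n1 r1] [n2 r2]; split=> [k h|a h]; [rewrite n2 ?n1|rewrite r2 ?r1].
Qed.

Lemma same_sub N Sc M N' Sc' M' st st' : {subset N <= N'} -> {subset Sc <= Sc'} ->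
  {subset M <= M'} -> same N Sc M st st' -> same N' Sc' M' st st'.
Proof. by move=> hN hS hM [f l a]; split => //; exact: frame_sub f. Qed.

Lemma same_refl N Sc M st : same N Sc M st st.
Proof. by split => //; exact: frame_refl. Qed.

Lemma same_trans N Sc M st1 st2 st3 : same N Sc M st1 st2 -> same N Sc M st2 st3 ->
  same N Sc M st1 st3.
Proof.
move=> [f1 l1 a1] [f2 l2 a2]; split; rewrite ?l2 ?a2 //.
exact: frame_trans f1 f2.
Qed.

Lemma same_trans_cat N Sc M N' Sc' M' st1 st2 st3 :
  same N Sc M st1 st2 -> same N' Sc' M' st2 st3 ->
  same (N ++ N') (Sc ++ Sc') (M ++ M') st1 st3.
Proof.
move=> h1 h2; apply: (@same_trans _ _ _ _ st2).
  by apply: same_sub h1 => k; rewrite mem_cat => ->.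
by apply: same_sub h2 => k; rewrite mem_cat => ->; rewrite orbT.
Qed.

Lemma same_setn st k x : same [:: k] [::] [::] st (setn st k x).
Proof. by split=> //; split=> // l; rewrite inE /= /upd => /negPf ->. Qed.

Lemma same_setr st k x : k < 64 -> same [::] [:: k] [::] st (setr st k x).
Proof.
move=> k64; split=> //; split=> // a; rewrite /touched /= /upd.
by case: eqP => // ->; rewrite k64 inE eqxx.
Qed.

Section Pos.
Hypothesis d0 : (0 < d)%N.

Lemma rsz_gt0 : (0 < rsz)%N. Proof. by rewrite /rsz !muln_gt0 d0. Qed.

Lemma offset_lt i j : (i < d)%N -> (j < d)%N -> (2 * (i * d + j)).+1 < rsz.
Proof. rewrite /rsz => hi hj; nia. Qed.

Lemma raddr_reg k i j b : (i < d)%N -> (j < d)%N ->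
  (raddr k i j + (b : bool) - 64) %/ rsz = k.
Proof.
move=> hi hj; have o := offset_lt hi hj.
have -> : (raddr k i j + b - 64 = k * rsz + (2 * (i * d + j) + b))%N by rewrite /raddr; lia.
by rewrite divnMDl ?rsz_gt0 // divn_small ?addn0 //; case: b; lia.
Qed.

Lemma raddr_ge k i j : 64 <= raddr k i j. Proof. by rewrite /raddr -addnA leq_addr. Qed.

Lemma raddr_inj k i j k' i' j' b b' : (i < d)%N -> (j < d)%N -> (i' < d)%N -> (j' < d)%N ->
  raddr k i j + (b : bool) = raddr k' i' j' + (b' : bool) -> [/\ k = k', i = i', j = j' & b = b'].
Proof.
move=> hi hj hi' hj' e.
have kk : k = k' by rewrite -(raddr_reg k b hi hj) e raddr_reg.
move: e; rewrite /raddr kk => e.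
have bb : b = b' by case: b e => e; case: b' e => // e; lia.
have e2 : i * d + j = i' * d + j' by rewrite bb in e; lia.
have ii : i = i'.
  by have := congr1 (divn^~ d) e2; rewrite /= !divnMDl // !divn_small // !addn0.
by split => //; rewrite ii in e2; lia.
Qed.

Lemma frame_regn N Sc M st st' k i j : frame N Sc M st st' -> k \notin M ->
  (i < d)%N -> (j < d)%N -> regn st' k i j = regn st k i j.
Proof.
move=> [_ fr] kM hi hj; rewrite /regn /cell !fr // /touched ltnNge.
  have h : 64 <= (raddr k i j).+1 by rewrite (leq_trans (raddr_ge k i j)).
  by rewrite h /= -addn1 (raddr_reg k true hi hj).
by rewrite raddr_ge /= -[raddr _ _ _]addn0 (raddr_reg k false hi hj).
Qed.

Lemma frame_reg N Sc M st st' k : frame N Sc M st st' -> k \notin M ->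
  reg st' k = reg st k.
Proof. by move=> f kM; apply/matrixP => i j; rewrite !mxE (frame_regn f). Qed.

Lemma frame_sc N Sc M st st' k : frame N Sc M st st' -> k < 64 -> k \notin Sc ->
  rmem st' k = rmem st k.
Proof. by move=> [_ fr] k64 kS; rewrite fr // /touched k64. Qed.

Lemma regE st k (i j : 'I_d) : regn st k i j = reg st k i j.
Proof. by rewrite mxE. Qed.

Lemma read_mxE st k : read_mx d (rmem st) (64 + k * rsz) = reg st k.
Proof. by apply/matrixP => i j; rewrite !mxE /regn /cell /raddr !mul2n !addnS. Qed.

Definition pute st k i j : state R :=
  set_rmem st (upd (upd (rmem st) (raddr k i j) (rmem st 0)) (raddr k i j).+1 (rmem st 1)).

Lemma same_pute st k i j : (i < d)%N -> (j < d)%N ->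
  same [::] [::] [:: k] st (pute st k i j).
Proof.
move=> hi hj; split=> //; split=> // a; rewrite /touched /= /upd.
have g := raddr_ge k i j.
have r1 := raddr_reg k true hi hj; have r0 := raddr_reg k false hi hj.
rewrite addn1 in r1; rewrite addn0 in r0.
case: eqP => [->|_]; first by rewrite ltnNge (leq_trans g) //= r1 inE eqxx.
case: eqP => [->|//]; by rewrite ltnNge g /= r0 inE eqxx.
Qed.

Lemma regn_pute st k i j i' j' : (i < d)%N -> (j < d)%N -> (i' < d)%N -> (j' < d)%N ->
  regn (pute st k i j) k i' j' =
  if (i' == i) && (j' == j) then rmem st 0 +i* rmem st 1 else regn st k i' j'.
Proof.
move=> hi hj hi' hj'; rewrite /regn /cell /= /upd.
have E b b' := @raddr_inj k i' j' k i j b b' hi' hj' hi hj.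
have [/andP[/eqP -> /eqP ->]|/negPf ne] := boolP ((i' == i) && (j' == j)).
  by rewrite !eqxx (ltn_eqF (ltnSn _)).
have n00 : (raddr k i' j' == raddr k i j) = false.
  apply/negP => /eqP e; have := E false false; rewrite !addn0 => /(_ e) [_ a b _].
  by move: ne; rewrite a b !eqxx.
have n01 : (raddr k i' j' == (raddr k i j).+1) = false.
  apply/negP => /eqP e; have := E false true; rewrite addn0 addn1 => /(_ e) [_ a b _].
  by move: ne; rewrite a b !eqxx.
have n10 : ((raddr k i' j').+1 == raddr k i j) = false.
  apply/negP => /eqP e; have := E true false; rewrite addn0 addn1 => /(_ e) [_ a b _].
  by move: ne; rewrite a b !eqxx.
by rewrite n01 n00 eqSS n00 n10.
Qed.

End Pos.
End Frame.

(** * Executions with an upper bound on time *)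

Section Exec.
Variables (R : realType) (d m p : nat).
Variables (G : 'I_m -> 'M[R[i]]_d) (U : 'I_p -> 'M[R[i]]_d) (eps : R).
Variables (search : 'M[R[i]]_d -> seq 'I_m) (T0 S : nat).
Implicit Types (st : state R) (c : cmd).
Local Notation ex := (exec G U eps search T0 S).
Local Notation nev := (@neval R d m p).
Local Notation rev := (@reval R d m p G U eps).
Local Notation bev := (@beval R d m p G U eps).

Definition T c st n st' : Prop := exists2 t, t <= n & ex c st t st'.

Definition ceval st (e : cexp) : R[i] := rev st e.1 +i* rev st e.2.

Lemma ceval_def st e : ceval st e = rev st e.1 +i* rev st e.2.
Proof. by []. Qed.

Lemma T_le c st n n' st' : n <= n' -> T c st n st' -> T c st n' st'.
Proof. by move=> h [t tn e]; exists t => //; exact: leq_trans h. Qed.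

Lemma T_seq c1 c2 st1 st2 st3 n1 n2 n : T c1 st1 n1 st2 -> T c2 st2 n2 st3 ->
  n1 + n2 <= n -> T (Seq c1 c2) st1 n st3.
Proof.
move=> [t1 h1 e1] [t2 h2 e2] h; exists (t1 + t2); first by lia.
exact: ExecSeq e1 e2.
Qed.

Lemma T_if b c1 c2 st n n' st' : T (if bev st b then c1 else c2) st n st' ->
  (bexp_cost b + n).+1 <= n' -> T (If b c1 c2) st n' st'.
Proof.
move=> [t h e] hn; exists (bexp_cost b + t).+1; first by lia.
exact: ExecIf.
Qed.

Lemma T_while_end b c st n : ~~ bev st b -> (bexp_cost b).+1 <= n -> T (While b c) st n st.
Proof. by move=> h hn; exists (bexp_cost b).+1 => //; exact: ExecWhileEnd. Qed.

Lemma T_while_step b c st1 st2 st3 n1 n2 n : bev st1 b -> T c st1 n1 st2 ->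
  T (While b c) st2 n2 st3 -> (bexp_cost b + n1 + n2).+1 <= n -> T (While b c) st1 n st3.
Proof.
move=> hb [t1 h1 e1] [t2 h2 e2] hn; exists (bexp_cost b + t1 + t2).+1; first by lia.
exact: ExecWhileStep e1 e2.
Qed.

Hypothesis S64 : 64 <= S.

Lemma T_setn k e st n : k < 64 -> (nexp_cost e + 2) <= n ->
  T (SetN k e) st n (setn st k (nev st e)).
Proof.
move=> k64 hn; exists (nexp_cost (NConst k) + nexp_cost e).+1; first by rewrite /=; lia.
by apply: ExecNStore => /=; exact: leq_trans S64.
Qed.

Lemma T_setr k e st n : k < 64 -> (rexp_cost e + 2) <= n ->
  T (SetR k e) st n (setr st k (rev st e)).
Proof.
move=> k64 hn; exists (nexp_cost (NConst k) + rexp_cost e).+1; first by rewrite /=; lia.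
by apply: ExecRStore => /=; exact: leq_trans S64.
Qed.

(* Straight-line code on scalars and counters. *)
Fixpoint sl c : bool :=
  match c with
  | Skip => true
  | NStore (NConst k) _ | RStore (NConst k) _ => k < 64
  | Seq c1 c2 | If _ c1 c2 => sl c1 && sl c2
  | _ => false
  end.

Fixpoint ev c st : state R :=
  match c with
  | NStore (NConst k) e => setn st k (nev st e)
  | RStore (NConst k) e => setr st k (rev st e)
  | Seq c1 c2 => ev c2 (ev c1 st)
  | If b c1 c2 => if bev st b then ev c1 st else ev c2 st
  | _ => st
  end.

Fixpoint slcost c : nat :=
  match c with
  | NStore _ e => nexp_cost e + 2
  | RStore _ e => rexp_cost e + 2
  | Seq c1 c2 => slcost c1 + slcost c2
  | If b c1 c2 => (bexp_cost b + (slcost c1 + slcost c2)).+1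
  | _ => 0
  end.

Fixpoint wn c : seq nat :=
  match c with
  | NStore (NConst k) _ => [:: k]
  | Seq c1 c2 | If _ c1 c2 => wn c1 ++ wn c2
  | _ => [::]
  end.

Fixpoint wr c : seq nat :=
  match c with
  | RStore (NConst k) _ => [:: k]
  | Seq c1 c2 | If _ c1 c2 => wr c1 ++ wr c2
  | _ => [::]
  end.

Lemma T_sl c st n : sl c -> slcost c <= n -> T c st n (ev c st).
Proof.
elim: c st n => //= [st n _ _|a e st n|a e st n|c1 IH1 c2 IH2 st n /andP[s1 s2] h|b c1 IH1 c2 IH2 st n /andP[s1 s2] h].
- by exists 0 => //; exact: ExecSkip.
- by case: a => //= k k64 h; exact: T_setn.
- by case: a => //= k k64 h; exact: T_setr.
- by apply: (T_seq (IH1 _ _ s1 (leqnn _)) (IH2 _ _ s2 (leqnn _))).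
- apply: (@T_if _ _ _ _ (slcost c1 + slcost c2)) => //.
  case: ifP => _; [apply: T_le (IH1 _ _ s1 (leqnn _))|apply: T_le (IH2 _ _ s2 (leqnn _))]; lia.
Qed.

Lemma same_ev c st : sl c -> same d (wn c) (wr c) [::] st (ev c st).
Proof.
elim: c st => //=.
- by case=> //= k e st k64; exact: same_setn.
- by case=> //= k e st k64; exact: same_setr.
- move=> c1 IH1 c2 IH2 st /andP[s1 s2].
  by rewrite -[[::] as X in same _ _ _ X]cats0; apply: same_trans_cat (IH1 _ s1) (IH2 _ s2).
- move=> b c1 IH1 c2 IH2 st /andP[s1 s2].
  case: ifP => _; [apply: same_sub (IH1 st s1)|apply: same_sub (IH2 st s2)] => // k;
    by rewrite mem_cat => ->; rewrite ?orbT.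
Qed.

(** The invariant has to be blind to the loop counter; the body learns its value from the separate
    premise. *)
Lemma T_for (I : nat -> state R -> Prop) v n body st K tb nb : v < 64 ->
  (forall i st' x, I i st' -> I i (setn st' v x)) ->
  (forall i st', I i st' -> nev st' n = K) ->
  I 0 st ->
  (forall i st', i < K -> I i st' -> nmem st' v = i ->
    exists2 st'', T body st' tb st'' & nmem st'' v = i /\ I i.+1 st'') ->
  20 + nexp_cost n + K * (tb + nexp_cost n + 20) <= nb ->
  exists2 st', T (For v n body) st nb st' & I K st'.
Proof.
move=> v64 Iv In I0 IS hnb.
pose cw := nexp_cost n + 6.
have loop : forall j i st', i + j = K -> I i st' -> nmem st' v = i ->
    exists2 st'', T (While (NLe (NAdd (NV v) (NConst 1)) n)
      (Seq body (SetN v (NAdd (NV v) (NConst 1))))) st' (cw + j * (tb + cw + 10)) st''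
      & I K st''.
  elim=> [|j IH] i st' ij Ii vi.
    exists st'; last by rewrite -ij addn0.
    apply: T_while_end => /=; last by rewrite /cw; lia.
    by rewrite (In _ _ Ii) vi -ij; lia.
  have iK : i < K by lia.
  have [st2 t2 [v2 I2]] := IS i st' iK Ii vi.
  have := IH i.+1 (setn st2 v i.+1) _ (Iv _ _ _ I2) _.
  rewrite /= /upd eqxx => -[||st3 t3 I3]; [lia|by []|].
  exists st3 => //.
  have ts := @T_setn v (NAdd (NV v) (NConst 1)) st2 6 v64 isT.
  apply: (@T_while_step _ _ _ (setn st2 v i.+1) _ (tb + 6) (cw + j * (tb + cw + 10))) => //.
  - by rewrite /= (In _ _ Ii) vi addn1.
  - by apply: T_seq t2 _ (leqnn _); move: ts; rewrite /= v2 addn1.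
  - by rewrite /= /cw; nia.
have := loop K 0 (setn st v 0) (add0n _) (Iv _ _ _ I0) _.
rewrite /= /upd eqxx => -[//|st' t' I'].
exists st' => //; apply: (T_seq (@T_setn v (NConst 0) st 3 v64 isT) t').
by rewrite /cw; nia.
Qed.

End Exec.

Notation same_n f := (frame_n (same_frame f)) (only parsing).
Notation same_sc f := (frame_sc (same_frame f)) (only parsing).
Notation same_reg d0 f := (frame_reg d0 (same_frame f)) (only parsing).
Notation same_regn d0 f := (frame_regn d0 (same_frame f)) (only parsing).

(** * Matrix loops and the primitive instructions *)

Section Macros.
Variables (R : realType) (d m p : nat).
Variables (G : 'I_m -> 'M[R[i]]_d) (U : 'I_p -> 'M[R[i]]_d) (eps : R).
Variables (search : 'M[R[i]]_d -> seq 'I_m) (T0 S : nat).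
Implicit Types (st : state R) (c : cmd).
Hypothesis d0 : (0 < d)%N.
Hypothesis S64 : 64 <= S.

Local Notation ex := (exec G U eps search T0 S).
Local Notation T := (T G U eps search T0 S).
Local Notation nev := (@neval R d m p).
Local Notation rev := (@reval R d m p G U eps).
Local Notation bev := (@beval R d m p G U eps).
Local Notation ceval := (ceval G U eps).
Local Notation ev := (ev G U eps).
Local Notation same := (same d).
Local Notation frame := (frame d).

Definition room k := 64 + k.+1 * rsz d <= S.

Lemma room_le k l : l <= k -> room k -> room l.
Proof. by rewrite /room => h; apply: leq_trans; rewrite leq_add2l leq_mul2r ltnS h orbT. Qed.

Lemma nev_set_rmem st f : nev (set_rmem st f) =1 nev st.
Proof. by elim=> //= [a ->|a -> b ->|a -> b ->|a -> b ->]. Qed.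

Lemma nev_nRaddr st k i j : nev st (nRaddr k i j) = raddr d (nev st k) (nev st i) (nev st j).
Proof. by rewrite /= /raddr /rsz. Qed.

Lemma ceval_CE st k i j : ceval st (CE k i j) = regn d st (nev st k) (nev st i) (nev st j).
Proof. by rewrite /ceval /regn /cell /= /raddr /rsz addn1. Qed.

Lemma ceval_CS st k : ceval st (CS k) = rmem st k +i* rmem st k.+1.
Proof. by []. Qed.

Lemma ceval_CR st e : ceval st (CR e) = (rev st e)%:C.
Proof. by []. Qed.

Lemma ceval_Cadd st a b : ceval st (Cadd a b) = (ceval st a + ceval st b)%R.
Proof. by []. Qed.

Lemma ceval_Csub st a b : ceval st (Csub a b) = (ceval st a - ceval st b)%R.
Proof. by []. Qed.

Lemma ceval_Cmul st a b : ceval st (Cmul a b) = (ceval st a * ceval st b)%R.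
Proof. by []. Qed.

Lemma ceval_Cconj st a : ceval st (Cconj a) = ((ceval st a)^*)%C.
Proof. by rewrite /ceval /= sub0r. Qed.

Definition cevalE := (ceval_CE, ceval_CR, ceval_Cadd, ceval_Csub, ceval_Cmul, ceval_Cconj).

Lemma room_addr k i j : room k -> (i < d)%N -> (j < d)%N -> (raddr d k i j).+1 < S.
Proof.
move=> rk hi hj; have := offset_lt d0 hi hj; move: rk; rewrite /room /raddr mulSn.
by lia.
Qed.

Lemma T_pute k i j st n : room (nev st k) -> (nev st i < d)%N -> (nev st j < d)%N ->
  2 * (nexp_cost k + nexp_cost i + nexp_cost j) + 60 <= n ->
  T (PutE k i j) st n (pute d st (nev st k) (nev st i) (nev st j)).
Proof.
move=> rk hi hj hn; have rm := room_addr rk hi hj.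
exists ((nexp_cost (nRaddr k i j) + rexp_cost (RV 0)).+1 +
  (nexp_cost (NAdd (nRaddr k i j) (NConst 1)) + rexp_cost (RV 1)).+1).
  by rewrite /=; lia.
have a64 := raddr_ge d (nev st k) (nev st i) (nev st j).
have aE st' : nev st' (NAdd (nRaddr k i j) (NConst 1)) =
    (raddr d (nev st' k) (nev st' i) (nev st' j)).+1.
  by rewrite -nev_nRaddr /= addn1.
apply: ExecSeq; first by apply: ExecRStore; rewrite nev_nRaddr; lia.
set st1 := set_rmem _ _.
have e1 : nev st1 (NAdd (nRaddr k i j) (NConst 1)) =
    (raddr d (nev st k) (nev st i) (nev st j)).+1 by rewrite /st1 aE !nev_set_rmem.
have -> : pute d st (nev st k) (nev st i) (nev st j) = set_rmem st1
   (upd (rmem st1) (nev st1 (NAdd (nRaddr k i j) (NConst 1))) (rev st1 (RV 1))).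
  rewrite e1 /pute /st1 nev_nRaddr; congr set_rmem; congr upd.
by apply: ExecRStore; rewrite e1.
Qed.

Lemma same_setn_in N Sc M st st' v x : v \in N -> same N Sc M st st' -> same N Sc M st (setn st' v x).
Proof.
move=> vN h; apply: same_trans h _; apply: same_sub (same_setn _ _ v x) => // k.
by rewrite inE => /eqP ->.
Qed.

Lemma same_setr_in N Sc M st st' v x : v < 64 -> v \in Sc -> same N Sc M st st' ->
  same N Sc M st (setr st' v x).
Proof.
move=> v64 vN h; apply: same_trans h _; apply: same_sub (same_setr _ _ _ v64) => // k.
by rewrite inE => /eqP ->.
Qed.

(** The body may rely on the current cell still having its old value. This permits updating a
    register in place, entry by entry, as pushing to and popping from a packed stack do. *)
Lemma T_mx k body st N Sc tb nb (f : nat -> nat -> R[i]) :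
  room (nev st k) -> 0 \notin N -> 1 \notin N ->
  (forall st', same (0 :: 1 :: N) Sc [:: nev st k] st st' -> nev st' k = nev st k) ->
  (forall i j st', i < d -> j < d -> same (0 :: 1 :: N) Sc [:: nev st k] st st' ->
     nmem st' 0 = i -> nmem st' 1 = j -> regn d st' (nev st k) i j = regn d st (nev st k) i j ->
     exists2 st'', T body st' tb st'' &
       same N Sc [::] st' st'' /\ ceval st'' (CS 0) = f i j) ->
  100 + d * (100 + d * (tb + 150 + 2 * nexp_cost k)) <= nb ->
  exists2 st', T (MxFor k body) st nb st' &
    same (0 :: 1 :: N) Sc [:: nev st k] st st' /\
    reg d st' (nev st k) = \matrix_(i, j) f i j.
Proof.
move=> rk N0 N1 kc H hnb; set kk := nev st k in rk kc H *.
set N' := 0 :: 1 :: N.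
pose I i st' := same N' Sc [:: kk] st st' /\ forall i' j', i' < d -> j' < d ->
  regn d st' kk i' j' = if i' < i then f i' j' else regn d st kk i' j'.
pose J i j st' := [/\ same N' Sc [:: kk] st st', nmem st' 0 = i & forall i' j', i' < d -> j' < d ->
  regn d st' kk i' j' = if (i' < i) || (i' == i) && (j' < j) then f i' j' else regn d st kk i' j'].
have [|||||st' t' [sI hI]] := @T_for R d m p G U eps search T0 S S64 I 0 NDim
   (For 1 NDim (Seq body (PutE k (NV 0) (NV 1)))) st d
   (40 + d * (tb + 120 + 2 * nexp_cost k)) nb isT.
- by move=> i st' x [s h]; split => //; apply: same_setn_in.
- by [].
- by split; [exact: same_refl|].
- move=> i st' id [s h] vi.
  have [|||||st2 t2 [s2 v2 h2]] := @T_for R d m p G U eps search T0 S S64 (J i) 1 NDim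
    (Seq body (PutE k (NV 0) (NV 1))) st' d (tb + 80 + 2 * nexp_cost k)
    (40 + d * (tb + 120 + 2 * nexp_cost k)) isT.
  + by move=> j st2 x [s2 v2 h2]; split => //; exact: same_setn_in.
  + by [].
  + split=> // i' j' hi hj; rewrite h // ltn0 andbF orbF //.
  + move=> j st2 jd [s2 v2 h2] vj.
    have e2 : regn d st2 kk i j = regn d st kk i j by rewrite h2 // ltnn eqxx ltnn.
    have [st3 t3 [s3 e3]] := H i j st2 id jd s2 v2 vj e2.
    have v03 : nmem st3 0 = i by rewrite (same_n s3).
    have v13 : nmem st3 1 = j by rewrite (same_n s3).
    have s3' : same N' Sc [:: kk] st2 st3.
      by apply: same_sub s3 => // x xN; rewrite !inE xN !orbT.
    have k3 : nev st3 k = kk by apply: kc; apply: same_trans s2 s3'.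
    have := @T_pute k (NV 0) (NV 1) st3 (2 * nexp_cost k + 75).
    rewrite /= v03 v13 k3 => /(_ rk id jd) tp.
    exists (pute d st3 kk i j).
      by apply: (T_seq t3 (tp _)); lia.
    split; first by rewrite /=.
    split; [|by rewrite /=|].
      apply: same_trans s2 (same_trans s3' _).
      by apply: same_sub (same_pute d0 st3 kk id jd).
    move=> i' j' hi hj; rewrite regn_pute // (same_regn d0 s3) // h2 //.
    case: (ltngtP i' i) => [//|//|->] /=; rewrite ltnS.
    by case: (ltngtP j' j) => [//|//|->] /=; rewrite -e3.
  + by rewrite /=; lia.
  exists st2 => //; split => //; split => // i' j' hi hj; rewrite h2 // hj andbT ltnS.
  by case: (ltngtP i' i).
- by rewrite /=; nia.
exists st' => //; split => //; apply/matrixP => i j.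
by rewrite !mxE hI // ltn_ord.
Qed.

Lemma T_mxset k e st N Sc nb (f : nat -> nat -> R[i]) :
  room (nev st k) -> 0 \notin N -> 1 \notin N -> 0 \in Sc -> 1 \in Sc ->
  (forall st', same (0 :: 1 :: N) Sc [:: nev st k] st st' -> nev st' k = nev st k) ->
  (forall i j st', i < d -> j < d -> same (0 :: 1 :: N) Sc [:: nev st k] st st' ->
     nmem st' 0 = i -> nmem st' 1 = j -> regn d st' (nev st k) i j = regn d st (nev st k) i j ->
     ceval st' e = f i j) ->
  100 + d * (100 + d * (rexp_cost e.1 + rexp_cost e.2 + 154 + 2 * nexp_cost k)) <= nb ->
  exists2 st', T (MxSet k e) st nb st' &
    same (0 :: 1 :: N) Sc [:: nev st k] st st' /\
    reg d st' (nev st k) = \matrix_(i, j) f i j.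
Proof.
move=> rk N0 N1 S0 S1 kc H hnb.
apply: (@T_mx _ _ _ N _ (rexp_cost e.1 + rexp_cost e.2 + 4)) => //; last by lia.
move=> i j st' hi hj s v0 v1 r.
exists (ev (Seq (SetR 0 e.1) (SetR 1 e.2)) st').
  by apply: T_sl => //=; lia.
have s1 : same N Sc [::] st' (setr st' 0 (rev st' e.1)).
  by apply: same_setr_in => //; exact: same_refl.
split; first exact: same_setr_in.
have e1 := H i j st' hi hj s v0 v1 r.
have e2 : ceval (setr st' 0 (rev st' e.1)) e = f i j.
  by apply: H => //; exact: same_setr_in.
have -> : f i j = complex.Re (f i j) +i* complex.Im (f i j) by case: (f i j).
by rewrite -{1}e1 -e2.
Qed.

Lemma iteri_sum N (g : nat -> R[i]) :
  iteri N (fun k a => a + g k)%R 0%R = (\sum_(0 <= k < N) g k)%R.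
Proof. by elim: N => [|N IH]; rewrite ?big_nil // big_nat_recr //= IH. Qed.

(** The recurrence phi is arbitrary because the same loop serves for sums (traces, inner products)
    and for Horner evaluation of packed rows. *)
Lemma T_acc n e st N Sc nb K (phi : nat -> R[i] -> R[i]) :
  2 \in N -> {subset [:: 0; 1; 2; 3] <= Sc} ->
  (forall st', same N Sc [::] st st' -> nev st' n = K) ->
  (forall i st', i < K -> same N Sc [::] st st' -> nmem st' 2 = i ->
     ceval st' e = phi i (rmem st' 2 +i* rmem st' 3)) ->
  100 + nexp_cost n + K * (rexp_cost e.1 + rexp_cost e.2 + nexp_cost n + 50) <= nb ->
  exists2 st', T (Acc n e) st nb st' &
    same N Sc [::] st st' /\ rmem st' 2 +i* rmem st' 3 = iteri K phi 0%R.
Proof.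
move=> N2 S03 nK H hnb.
have Sc0 : 0 \in Sc by apply: S03.
have Sc1 : 1 \in Sc by apply: S03.
have Sc2 : 2 \in Sc by apply: S03.
have Sc3 : 3 \in Sc by apply: S03.
pose c0 := Seq (SetR 2 (RNat (NConst 0))) (SetR 3 (RNat (NConst 0))).
pose I i st' := same N Sc [::] st st' /\ rmem st' 2 +i* rmem st' 3 = iteri i phi 0%R.
have [|||||st' t' [sI hI]] := @T_for R d m p G U eps search T0 S S64 I 2 n
   (SetC 2 e) (ev c0 st) K
   (rexp_cost e.1 + rexp_cost e.2 + 20) (nb - 20) isT.
- by move=> i st' x [s h]; split => //; apply: same_setn_in.
- by move=> i st' [s _]; exact: nK.
- split=> //; rewrite /c0 /=.
  by apply: same_setr_in => //; apply: same_setr_in => //; exact: same_refl.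
- move=> i st' iK [s h] vi.
  exists (ev (SetC 2 e) st'); first by apply: T_sl => //=; lia.
  set x1 := rev st' e.1; pose st1 := setr st' 0 x1; set x2 := rev st1 e.2.
  have s1 : same N Sc [::] st st1 by apply: same_setr_in.
  have e1 := H i st' iK s vi; have e2 := H i st1 iK s1 vi.
  split; first by rewrite /=.
  split.
    by rewrite /=; do !apply: same_setr_in => //.
  rewrite [RHS]/= -h.
  have -> : phi i (rmem st' 2 +i* rmem st' 3) = x1 +i* x2.
    have -> : phi i (rmem st' 2 +i* rmem st' 3) =
      complex.Re (phi i (rmem st' 2 +i* rmem st' 3)) +i* complex.Im (phi i (rmem st' 2 +i* rmem st' 3)).
      by case: (phi i _).
    by rewrite -{1}e1 -e2.
  by [].
- by lia.
exists st'; last by split.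
have tc : T c0 st 20 (ev c0 st) by apply: T_sl.
by apply: (T_seq tc t'); lia.
Qed.

Lemma T_mulset k la lb st N Sc nb (fa fb : nat -> nat -> R[i]) ca :
  room (nev st k) -> 0 \notin N -> 1 \notin N -> 2 \in N -> {subset [:: 0; 1; 2; 3] <= Sc} ->
  (forall st', same (0 :: 1 :: N) Sc [:: nev st k] st st' -> nev st' k = nev st k) ->
  (forall i l st', i < d -> l < d -> same (0 :: 1 :: N) Sc [:: nev st k] st st' ->
     nmem st' 0 = i -> nmem st' 2 = l -> ceval st' (la (NV 0) (NV 2)) = fa i l) ->
  (forall l j st', l < d -> j < d -> same (0 :: 1 :: N) Sc [:: nev st k] st st' ->
     nmem st' 2 = l -> nmem st' 1 = j -> ceval st' (lb (NV 2) (NV 1)) = fb l j) ->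
  (rexp_cost (la (NV 0) (NV 2)).1 + rexp_cost (la (NV 0) (NV 2)).2) * 2 +
  (rexp_cost (lb (NV 2) (NV 1)).1 + rexp_cost (lb (NV 2) (NV 1)).2) * 2 <= ca ->
  100 + d * (100 + d * (d * (ca + 70) + 400 + 2 * nexp_cost k)) <= nb ->
  exists2 st', T (MulSet k la lb) st nb st' &
    same (0 :: 1 :: N) Sc [:: nev st k] st st' /\
    reg d st' (nev st k) = \matrix_(i, j) (\sum_(l < d) fa i l * fb l j)%R.
Proof.
move=> rk N0 N1 N2 S03 kc Ha Hb hca hnb.
have Sc0 : 0 \in Sc by apply: S03.
have Sc1 : 1 \in Sc by apply: S03.
have [||st' t' [s' e']] := @T_mx k (Seq (Acc NDim (Cadd (CS 2) (Cmul (la (NV 0) (NV 2)) (lb (NV 2) (NV 1)))))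
               (Seq (SetR 0 (RV 2)) (SetR 1 (RV 3)))) st N Sc (d * (ca + 70) + 200) nb
    (fun i j => \sum_(0 <= l < d) fa i l * fb l j)%R rk N0 N1 kc; first last.
- exists st' => //; split => //; rewrite e'; apply/matrixP => i j; rewrite !mxE.
  by rewrite big_mkord.
- by lia.
move=> i j st1 hi hj s1 v0 v1 _.
have up st2 : same N Sc [::] st1 st2 -> same (0 :: 1 :: N) Sc [:: nev st k] st st2.
  move=> s2; apply: same_trans s1 _; apply: same_sub s2 => // x xN; by rewrite !inE xN !orbT.
have [|||st2 t2 [s2 e2]] := @T_acc NDim (Cadd (CS 2) (Cmul (la (NV 0) (NV 2)) (lb (NV 2) (NV 1))))
    st1 N Sc (d * (ca + 70) + 120) d (fun l a => a + fa i l * fb l j)%R N2 S03.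
- by [].
- move=> l st2 hl s2 v2; rewrite !cevalE; congr (_ + _ * _)%R.
    apply: Ha => //; first exact: up.
    by rewrite (same_n s2).
  apply: Hb => //; first exact: up.
  by rewrite (same_n s2).
- set q := (_ + nexp_cost NDim + 50).
  have hq : q <= ca + 70 by rewrite /q /=; lia.
  by rewrite /=; nia.
pose c1 := Seq (SetR 0 (RV 2)) (SetR 1 (RV 3)).
have tc : T c1 st2 20 (ev c1 st2) by apply: T_sl.
exists (ev c1 st2); first by apply: (T_seq t2 tc); lia.
split; last by rewrite -iteri_sum -e2.
by rewrite /=; do !apply: same_setr_in => //.
Qed.

Lemma nth_flatten2 (s : seq (R * R)) k (b : bool) : k < size s ->
  nth 0%R (flatten [seq [:: x.1; x.2] | x <- s]) (2 * k + b) =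
  if b then (nth (0, 0)%R s k).2 else (nth (0, 0)%R s k).1.
Proof.
elim: s k => // x s IH [|k] ks; first by rewrite /=; case: (b).
have -> : 2 * k.+1 + b = (2 * k + b).+2 by lia.
exact: IH.
Qed.

Lemma nth_allpairs (A B : Type) (s : seq A) (t : seq B) x0 y0 i j : i < size s -> j < size t ->
  nth (x0, y0) [seq (x, y) | x <- s, y <- t] (i * size t + j) = (nth x0 s i, nth y0 t j).
Proof.
elim: s i => // x s IH [|i] /= hi hj; rewrite nth_cat size_map.
  by rewrite mul0n add0n hj (nth_map y0).
rewrite ifF; last by apply/negP; rewrite mulSn; lia.
by rewrite mulSn -addnA addKn; exact: IH.
Qed.

Lemma matrix_cellsE q r (A : 'M[R[i]]_(q, r)) : matrix_cells A = flatten [seq [:: x.1; x.2] |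
   x <- [seq (complex.Re (A jk.1 jk.2), complex.Im (A jk.1 jk.2)) | jk <- [seq (j, k) | j <- enum 'I_q, k <- enum 'I_r]]].
Proof. by rewrite /matrix_cells -map_comp. Qed.

Lemma size_matrix_cells q r (A : 'M[R[i]]_(q, r)) : size (matrix_cells A) = (q * r).*2.
Proof.
rewrite matrix_cellsE size_flatten /shape -map_comp -mul2n.
have -> (T : Type) (s : seq T) (f : T -> R * R) : sumn [seq (size \o (fun x => [:: x.1; x.2])) x | x <- map f s] = 2 * size s.
  by elim: s => //= x s ->; rewrite mulnS.
by rewrite size_allpairs !size_enum_ord.
Qed.

Lemma nth_matrix_cells q r (A : 'M[R[i]]_(q, r)) (i : 'I_q) (j : 'I_r) (b : bool) :
  nth 0%R (matrix_cells A) (2 * (i * r + j) + b) =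
  if b then complex.Im (A i j) else complex.Re (A i j).
Proof.
rewrite matrix_cellsE.
have szE : size [seq (j, k) | j <- enum 'I_q, k <- enum 'I_r] = q * r.
  by rewrite size_allpairs !size_enum_ord.
have lt : i * r + j < q * r by have := ltn_ord i; have := ltn_ord j; nia.
rewrite nth_flatten2 ?size_map ?szE // (nth_map (i, j)) ?szE //.
have := @nth_allpairs _ _ (enum 'I_q) (enum 'I_r) i j i j; rewrite !size_enum_ord => -> //.
by rewrite !nth_ord_enum.
Qed.

Lemma write_mxE q r f a (A : 'M[R[i]]_(q, r)) (i : 'I_q) (j : 'I_r) (b : bool) :
  write_mx f a A (a + (2 * (i * r + j) + b)) = if b then complex.Im (A i j) else complex.Re (A i j).
Proof.
rewrite /write_mx size_matrix_cells addKn nth_matrix_cells ifT //.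
have := ltn_ord i; have := ltn_ord j; case: b => /=; nia.
Qed.

Lemma write_mx_out q r f a (A : 'M[R[i]]_(q, r)) k : ~~ (a <= k < a + 2 * (q * r)) ->
  write_mx f a A k = f k.
Proof. by rewrite /write_mx size_matrix_cells -mul2n => /negPf ->. Qed.

Definition regbase k := 64 + k * rsz d.

Lemma frame_write_mx q r N Sc M k st (A : 'M[R[i]]_(q, r)) : q * r <= d * d -> k \in M ->
  frame N Sc M st (set_rmem st (write_mx (rmem st) (regbase k) A)).
Proof.
move=> qr kM; split=> // a; rewrite /touched /=; case: ltnP => ha h;
  apply: write_mx_out; rewrite /regbase; first by lia.
apply: contra h => h; have -> : (a - 64) %/ rsz d = k; last by [].
apply/eqP; rewrite eqn_leq leq_divRL ?rsz_gt0 // -ltnS ltn_divLR ?rsz_gt0 //.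
have e : rsz d = 2 * (d * d) by [].
by move: h; rewrite mulSn e; lia.
Qed.

Definition put_mx st k (A : 'M[R[i]]_d) : state R :=
  set_rmem st (write_mx (rmem st) (regbase k) A).

Definition put_row st k (v : 'rV[R[i]]_d) : state R :=
  set_rmem st (write_mx (rmem st) (regbase k) v).

Lemma regn_write_mx st k (A : 'M[R[i]]_d) (i j : 'I_d) : regn d (put_mx st k A) k i j = A i j.
Proof.
rewrite /regn /cell /=.
have := write_mxE (rmem st) (regbase k) A i j true; rewrite addnA addn1.
have := write_mxE (rmem st) (regbase k) A i j false; rewrite addnA addn0.
by rewrite /raddr /regbase => -> ->; case: (A i j).
Qed.

Lemma reg_put_mx st k A : reg d (put_mx st k A) k = A.
Proof. by apply/matrixP => i j; rewrite mxE regn_write_mx. Qed.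

Lemma regn_put_row st k (v : 'rV[R[i]]_d) (j : 'I_d) : regn d (put_row st k v) k 0 j = v ord0 j.
Proof.
rewrite /regn /cell /= /raddr -/(regbase k).
have := write_mxE (rmem st) (regbase k) v ord0 j true; rewrite addnA addn1.
have := write_mxE (rmem st) (regbase k) v ord0 j false; rewrite addnA addn0.
by move=> -> ->; case: (v ord0 j).
Qed.

Lemma T_diag a v w st n : let A := reg d st (nev st a) in A \is normalmx ->
  room (nev st v) -> room (nev st w) -> nev st v != nev st w ->
  nexp_cost a + nexp_cost v + nexp_cost w + d ^ 3 + 40 <= n ->
  exists2 st', T (Diag NDim (nRbase a) (nRbase v) (nRbase w)) st n st' &
    [/\ same [::] [::] [:: nev st v; nev st w] st st', reg d st' (nev st v) = spectralmx A
      & forall j : 'I_d, regn d st' (nev st w) 0 j = spectral_diag A ord0 j].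
Proof.
move=> A nA rv rw vw hn.
have bE e : nev st (nRbase e) = regbase (nev st e) by rewrite /= /regbase /rsz.
have AE : read_mx (nev st NDim) (rmem st) (nev st (nRbase a)) = A by rewrite bE /regbase read_mxE.
pose st' := put_row (put_mx st (nev st v) (spectralmx A)) (nev st w) (spectral_diag A).
have s1 N Sc M : nev st v \in M -> frame N Sc M st (put_mx st (nev st v) (spectralmx A)).
  by move=> vM; apply: frame_write_mx.
have s2 N Sc M st1 : nev st w \in M -> frame N Sc M st1 (put_row st1 (nev st w) (spectral_diag A)).
  by move=> vM; apply: frame_write_mx => //; rewrite leq_pmul2r.
exists st'.
  exists (nexp_cost NDim + nexp_cost (nRbase a) + nexp_cost (nRbase v) + nexp_cost (nRbase w)
    + (nev st NDim) ^ 3).+1; first by rewrite /=; lia.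
  have := @ExecDiag R d m p G U eps search T0 S NDim (nRbase a) (nRbase v) (nRbase w) st.
  rewrite /= -/(nev st (nRbase a)) -/(nev st (nRbase v)) -/(nev st (nRbase w)).
  rewrite !(bE : forall e, 64 + nev st e * (2 * (d * d)) = regbase (nev st e)).
  rewrite [read_mx _ _ _]AE => /(_ nA) h; apply: h.
    move: rv; rewrite /room /regbase /rsz mulSn -mul2n -mulnn; lia.
  move: rw; rewrite /room /regbase /rsz mulSn -mul2n; nia.
split; last exact: regn_put_row.
  split=> //; apply: frame_trans (s1 _ _ _ _) (s2 _ _ _ _ _); by rewrite !inE eqxx ?orbT.
rewrite (frame_reg d0 (s2 [::] [::] [:: nev st w] _ _)) ?inE //.
exact: reg_put_mx.
Qed.

Lemma T_search a v k st n : room (nev st v) -> k < 64 ->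
  nexp_cost a + nexp_cost v + T0 + 40 <= n ->
  let w := search (reg d st (nev st a)) in
  exists2 st', T (Search (nRbase a) (nRbase v) (NConst k)) st n st' &
    [/\ frame [:: k] [::] [:: nev st v] st st', reg d st' (nev st v) = word_eval G w,
      nmem st' k = size (slp st) & slp st' = rcons (slp st) [seq GateRef false (val j) | j <- w]
      /\ ans st' = ans st].
Proof.
move=> rv k64 hn w.
have bE e : nev st (nRbase e) = regbase (nev st e) by rewrite /= /regbase /rsz.
have AE : read_mx d (rmem st) (nev st (nRbase a)) = reg d st (nev st a) by rewrite bE /regbase read_mxE.
have := @ExecSearch R d m p G U eps search T0 S (nRbase a) (nRbase v) (NConst k) st.
cbv zeta; rewrite AE !bE -/w [nev _ (NConst k)]/= => h.
pose st1 := add_line st k [seq GateRef false (val j) | j <- w].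
exists (put_mx st1 (nev st v) (word_eval G w)).
  exists (nexp_cost (nRbase a) + nexp_cost (nRbase v) + nexp_cost (NConst k) + T0).+1; first by rewrite /=; lia.
  apply: h; last exact: leq_trans S64.
  by move: rv; rewrite /room /regbase /rsz mulSn -mul2n -mulnn; lia.
split=> //.
- apply: (@frame_trans _ _ _ _ _ _ st1).
    by split=> // l; rewrite inE /= /upd => /negPf ->.
  by apply: frame_write_mx; rewrite ?inE.
- exact: reg_put_mx.
- by rewrite /= /upd eqxx.
Qed.

Lemma T_emit k l st n : k < 64 -> let l' := [seq ref_map (nev st) r | r <- l] in
  all (ref_ok m (size (slp st))) l' ->
  \sum_(r <- l) (nexp_cost (ref_arg r)).+1 + 2 <= n ->
  T (Emit (NConst k) l) st n (add_line st k l').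
Proof.
move=> k64 l' hl hn; exists (nexp_cost (NConst k) + \sum_(r <- l) (nexp_cost (ref_arg r)).+1).+1.
  by rewrite /=; lia.
by apply: ExecEmit => //; exact: leq_trans S64.
Qed.

Lemma T_answer a e st n : nev st e < size (slp st) -> nexp_cost a + nexp_cost e + 1 <= n ->
  T (Answer a e) st n (set_ans st (upd (ans st) (nev st a) (Some (nev st e)))).
Proof.
move=> hl hn; exists (nexp_cost a + nexp_cost e).+1; first by lia.
exact: ExecAnswer.
Qed.
End Macros.

(** * Code for the factors of a balanced commutator *)

Section Code.
Definition nlt a b := NLe (NAdd a (NConst 1)) b.
(* Truncated subtraction makes this the Kronecker delta. *)
Definition ndelta a b := NSub (NSub (NConst 1) (NSub a b)) (NSub b a).
Definition rn k : rexp := RNat (NConst k).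
Definition seqs (l : seq cmd) : cmd := foldr Seq Skip l.

Definition lamE i : rexp := RLoad (nRaddr (NConst 8) (NConst 0) i).
Definition flagE i : rexp := RLoad (nRaddr (NConst 10) (NConst 1) i).
Definition NegTest := BAnd (RLe (flagE (NV 4)) (rn 0))
  (BAnd (BNot (RLe (rn 0) (lamE (NV 4)))) (RLe (rn 0) (RAdd (RV 4) (lamE (NV 4))))).
Definition PosTest := BAnd (RLe (flagE (NV 4)) (rn 0)) (RLe (rn 0) (lamE (NV 4))).
Definition ScanBody := Seq (If NegTest (SetN 5 (NV 4)) Skip) (If PosTest (SetN 6 (NV 4)) Skip).
Definition Select := Seq (If (nlt (NV 5) NDim) Skip (SetN 5 (NV 6)))
  (SetR 4 (RAdd (RV 4) (lamE (NV 5)))).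
Definition PutSet k i j (e : cexp) := Seq (Seq (SetR 0 e.1) (SetR 1 e.2)) (PutE k i j).
Definition CopyRow := For 1 NDim (PutSet (NConst 9) (NV 3) (NV 1) (CE (NConst 7) (NV 5) (NV 1))).
Definition GreedyBody :=
  Seq (Seq (SetN 5 NDim) (SetN 6 NDim)) (Seq (For 4 NDim ScanBody) (Seq Select
  (Seq (PutSet (NConst 10) (NConst 0) (NV 3) (CR (RFun Sqrt (RV 4))))
  (Seq (PutSet (NConst 10) (NConst 1) (NV 5) (CR (rn 1))) CopyRow)))).
Definition Greedy := Seq (MxSet (NConst 10) (CR (rn 0)))
  (Seq (SetR 4 (rn 0)) (For 3 NDim GreedyBody)).

Definition Trace k := Acc NDim (Cadd (CS 2) (CE (NConst k) (NV 2) (NV 2))).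
Definition opnd (b : bool) a i l : cexp := if b then Cconj (CE (NConst a) l i) else CE (NConst a) i l.
Definition MulReg k b1 a1 b2 a2 := MulSet (NConst k) (opnd b1 a1) (opnd b2 a2).
(** Cyclic predecessor without a modulus: either i + 1 = j, or j = 0 and i is the last index. *)
Definition ndpred i j := NAdd (ndelta (NAdd i (NConst 1)) j)
  (NMul (ndelta j (NConst 0)) (ndelta (NAdd i (NConst 1)) NDim)).
Definition wE i := RLoad (nRaddr (NConst 10) (NConst 0) i).
(** Counter for the kind of target: 0 stands for the matrix in register 14, 1 and 2 for the two
    factors belonging to the Hermitian matrix in register 5. *)
Definition VG := 13.
Definition detraceE : cexp := Csub (CE (NConst 5) (NV 0) (NV 1))
  (Cmul (RDiv (RV 2) (RNat NDim), RDiv (RV 3) (RNat NDim)) (CR (RNat (ndelta (NV 0) (NV 1))))).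
Definition shiftE : cexp :=
  Cadd (Cmul (CS 6) (CR (RMul (RNat (ndpred (NV 0) (NV 1))) (wE (NV 0)))))
       (Cmul (Cconj (CS 6)) (CR (RMul (RNat (ndpred (NV 1) (NV 0))) (wE (NV 1))))).
Definition phaseE : cexp :=
  Cmul (RFun Cos (lamE (NV 0)), RFun Sin (lamE (NV 0))) (CE (NConst 7) (NV 0) (NV 1)).
Definition DiagReg := Diag NDim (nRbase (NConst 6)) (nRbase (NConst 7)) (nRbase (NConst 8)).
(** Arithmetic instead of a branch: the complex number left in scalars 6 and 7 is [cX] when [VG] is
    1 and [cY] when it is 2. *)
Definition SetAngle := Seq (SetR 6 (RDiv (RNat (NSub (NConst 2) (NV VG))) (RFun Sqrt (rn 2))))
  (SetR 7 (RDiv (RSub (rn 0) (RNat (NSub (NV VG) (NConst 1)))) (RFun Sqrt (rn 2)))).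
(** Register 6 holds first the traceless part and later the generator, 7 and 8 its eigenvectors and
    eigenvalues, 9 the eigenvectors in greedy order, and 10 the weights in row 0 and the flags of
    used indices in row 1. The exponential ends in register 0. *)
Definition Balanced :=
  Seq (Trace 5) (Seq (MxSet (NConst 6) detraceE) (Seq DiagReg (Seq Greedy (Seq SetAngle
  (Seq (MxSet (NConst 6) shiftE) (Seq (MulReg 7 false 6 false 9) (Seq (MulReg 6 true 9 false 7)
  (Seq DiagReg (Seq (MxSet (NConst 9) phaseE) (MulReg 0 true 7 false 9)))))))))).
Definition Target := If (NLe (NV VG) (NConst 0))
  (MxSet (NConst 0) (CE (NConst 14) (NV 0) (NV 1))) Balanced.
End Code.

Definition cMx (c n : nat) := 100 + n * (100 + n * (c + 160)).

Lemma cMx_le c c' n : c <= c' -> cMx c n <= cMx c' n.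
Proof. by move=> h; rewrite /cMx leq_add2l leq_mul2l leq_add2l leq_mul2l leq_add2r h !orbT. Qed.

Definition cMul (c n : nat) := 100 + n * (100 + n * (n * (c + 70) + 410)).

Ltac sub := by apply/allP.
Ltac same_via s h := apply: (same_trans (st2 := s)); first by apply: same_sub h; sub.

(** * Correctness of the commutator code *)

Section Target.
Variables (R : realType) (d m p : nat).
Variables (G : 'I_m -> 'M[R[i]]_d) (U : 'I_p -> 'M[R[i]]_d) (eps : R).
Variables (search : 'M[R[i]]_d -> seq 'I_m) (T0 S : nat).
Implicit Types (st : state R) (c : cmd).
Hypothesis d1 : 1 < d.
Let d0 : 0 < d := ltnW d1.
Hypothesis S64 : 64 <= S.
Hypothesis rm : room d S 14.

Local Notation ex := (exec G U eps search T0 S).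
Local Notation T := (T G U eps search T0 S).
Local Notation nev := (@neval R d m p).
Local Notation rev := (@reval R d m p G U eps).
Local Notation bev := (@beval R d m p G U eps).
Local Notation ceval := (ceval G U eps).
Local Notation ev := (ev G U eps).
Local Notation same := (same d).
Local Notation frame := (frame d).
Local Notation room := (room d S).

Lemma roomk k : k <= 14 -> room k.
Proof. by move=> h; exact: room_le rm. Qed.

Lemma delta_nat a b : 1 - (a - b) - (b - a) = (a == b).
Proof. case: eqP => h /=; lia. Qed.

Lemma regn_setr st k x l i j : k < 64 -> i < d -> j < d -> regn d (setr st k x) l i j = regn d st l i j.
Proof. by move=> k64 hi hj; apply: (frame_regn d0 (same_frame (same_setr d st x k64))). Qed.

(** The premise for an arbitrary scalar 0 is there because the imaginary part is evaluated after the
    real part has been stored in that scalar. *)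
Lemma T_putset k i j e st n z : room (nev st k) -> nev st i < d -> nev st j < d ->
  ceval st e = z -> (forall x, ceval (setr st 0 x) e = z) ->
  rexp_cost e.1 + rexp_cost e.2 + 2 * (nexp_cost k + nexp_cost i + nexp_cost j) + 70 <= n ->
  exists2 st', T (PutSet k i j e) st n st' & same [::] [:: 0; 1] [:: nev st k] st st' /\
    forall a b, a < d -> b < d -> regn d st' (nev st k) a b =
      if (a == nev st i) && (b == nev st j) then z else regn d st (nev st k) a b.
Proof.
move=> rk hi hj ez ez' hn.
set c := Seq (SetR 0 e.1) (SetR 1 e.2); set st1 := ev c st.
have tc : T c st (slcost c) st1 by apply: T_sl.
have s1 : same [::] [:: 0; 1] [:: nev st k] st st1.
  by do !apply: same_setr_in => //; exact: same_refl.
have tp := @T_pute R d m p G U eps search T0 S d0 S64 k i j st1 (2 * (nexp_cost k + nexp_cost i + nexp_cost j) + 60).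
rewrite !nev_set_rmem in tp.
exists (pute d st1 (nev st k) (nev st i) (nev st j)).
  by apply: (T_seq tc (tp rk hi hj (leqnn _))); rewrite /c /=; lia.
split.
  apply: same_trans s1 _; apply: same_sub (same_pute d0 st1 (nev st k) hi hj) => //.
move=> a b ad bd; rewrite regn_pute //; case: ifP => _.
  have -> : rmem st1 0 +i* rmem st1 1 = rev st e.1 +i* rev (setr st 0 (rev st e.1)) e.2 by [].
  by have := ez' (rev st e.1); move: ez; rewrite /ceval; case: (z) => zr zi [-> _] [_ ->].
by rewrite !regn_setr.
Qed.

Definition ccost (e : cexp) := rexp_cost e.1 + rexp_cost e.2.

Lemma mxset k e st nb (f : nat -> nat -> R[i]) : room k ->
  (forall i j st', i < d -> j < d -> same [:: 0; 1] [:: 0; 1] [:: k] st st' ->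
     nmem st' 0 = i -> nmem st' 1 = j -> regn d st' k i j = regn d st k i j ->
     ceval st' e = f i j) ->
  cMx (ccost e) d <= nb ->
  exists2 st', T (MxSet (NConst k) e) st nb st' &
    same [:: 0; 1] [:: 0; 1] [:: k] st st' /\ reg d st' k = \matrix_(i, j) f i j.
Proof.
move=> rk H hnb; apply: (@T_mxset R d m p G U eps search T0 S d0 S64 (NConst k) e st [::]) => //.
by apply: leq_trans hnb; rewrite /cMx /ccost /= leq_add2l leq_mul2l leq_add2l leq_mul2l; lia.
Qed.

Lemma mulset k la lb st nb ca (fa fb : nat -> nat -> R[i]) : room k ->
  (forall i l st', i < d -> l < d -> same [:: 0; 1; 2] [:: 0; 1; 2; 3] [:: k] st st' ->
     nmem st' 0 = i -> nmem st' 2 = l -> ceval st' (la (NV 0) (NV 2)) = fa i l) ->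
  (forall l j st', l < d -> j < d -> same [:: 0; 1; 2] [:: 0; 1; 2; 3] [:: k] st st' ->
     nmem st' 2 = l -> nmem st' 1 = j -> ceval st' (lb (NV 2) (NV 1)) = fb l j) ->
  ccost (la (NV 0) (NV 2)) * 2 + ccost (lb (NV 2) (NV 1)) * 2 <= ca -> cMul ca d <= nb ->
  exists2 st', T (MulSet (NConst k) la lb) st nb st' &
    same [:: 0; 1; 2] [:: 0; 1; 2; 3] [:: k] st st' /\
    reg d st' k = (\matrix_(i < d, l < d) fa i l) *m (\matrix_(l < d, j < d) fb l j).
Proof.
move=> rk Ha Hb hca hnb.
have [||||||||||st' t [s e]] := @T_mulset R d m p G U eps search T0 S d0 S64 (NConst k) la lb st [:: 2] [:: 0; 1; 2; 3] nb fa fb ca => //.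
  by apply: leq_trans hnb; rewrite /cMul /= leq_add2l leq_mul2l leq_add2l leq_mul2l; lia.
exists st' => //; split => //; rewrite e; apply/matrixP => i j; rewrite !mxE.
by apply: eq_bigr => l _; rewrite !mxE.
Qed.

Section GreedyLoop.
Variables (Q : 'M[R[i]]_d) (v : 'rV[R[i]]_d).
Let lam := eigs v.
Let gr := greedy d lam.
Hypothesis next_lt : forall k, k < d -> nextidx d lam (gr k) < d.

Lemma T_scan st u nb : (forall l, l < d -> regn d st 8 0 l = (lam l)%:C) ->
  (forall l, l < d -> regn d st 10 1 l = if l \in u then 1%R else 0%R) ->
  rmem st 4 = psum lam u -> nmem st 5 = d -> nmem st 6 = d ->
  50 + d * (slcost ScanBody + 50) <= nb ->
  exists2 st', T (For 4 NDim ScanBody) st nb st' &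
    [/\ same [:: 4; 5; 6] [::] [::] st st', nmem st' 5 = lastsat d (negcand lam u)
      & nmem st' 6 = lastsat d (poscand lam u)].
Proof.
move=> hl hf hp v5 v6 hnb.
pose I i st' := [/\ same [:: 4; 5; 6] [::] [::] st st',
  nmem st' 5 = foldl (fun b i => if negcand lam u i then i else b) d (iota 0 i) &
  nmem st' 6 = foldl (fun b i => if poscand lam u i then i else b) d (iota 0 i)].
have [|||||st' t' [s e5 e6]] := @T_for R d m p G U eps search T0 S S64 I 4 NDim ScanBody st d
   (slcost ScanBody) nb isT.
- by move=> i st' x [s e5 e6]; split => //; exact: same_setn_in.
- by [].
- by split => //; exact: same_refl.
- move=> i st' id [s e5 e6] v4.
  exists (ev ScanBody st'); first exact: T_sl.
  have l1 : rmem st' (raddr d 8 0 i) = lam i.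
    by have := frame_regn d0 (same_frame s) (isT : 8 \notin [::]) d0 id; rewrite hl // => -[].
  have f1 : rmem st' (raddr d 10 1 i) = if i \in u then 1%R else 0%R.
    have := frame_regn d0 (same_frame s) (isT : 10 \notin [::]) d1 id; rewrite hf //.
    by case: ifP => _ [].
  have p1 : rmem st' 4 = psum lam u by rewrite (same_sc s).
  have lE st2 : rmem st2 = rmem st' -> nmem st2 4 = i -> rev st2 (lamE (NV 4)) = lam i.
    by move=> r2 n2; rewrite -l1 -r2 -n2.
  have fE st2 : rmem st2 = rmem st' -> nmem st2 4 = i ->
    (rev st2 (flagE (NV 4)) <= 0)%R = (i \notin u).
    move=> r2 n2; have -> : rev st2 (flagE (NV 4)) = rmem st' (raddr d 10 1 i) by rewrite -r2 -n2.
    by rewrite f1; case: ifP => // _; rewrite ?lexx ?ler10.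
  have nE st2 : rmem st2 = rmem st' -> nmem st2 4 = i -> bev st2 NegTest = negcand lam u i.
    move=> r2 n2; rewrite [LHS]/= -/(rev st2 (flagE (NV 4))) -/(rev st2 (lamE (NV 4))) fE //.
    by have := lE st2 r2 n2; rewrite /= => ->; rewrite /negcand r2 p1 ltNge.
  have pE st2 : rmem st2 = rmem st' -> nmem st2 4 = i -> bev st2 PosTest = poscand lam u i.
    by move=> r2 n2; rewrite [LHS]/= -/(rev st2 (flagE (NV 4))) fE //; have := lE st2 r2 n2; rewrite /= => ->.
  have IE (P : pred nat) : foldl (fun b i => if P i then i else b) d (iota 0 i.+1) =
     if P i then i else foldl (fun b i => if P i then i else b) d (iota 0 i).
     by rewrite -addn1 iotaD foldl_cat.
  have -> : ev ScanBody st' = let st2 := (if bev st' NegTest then setn st' 5 (nmem st' 4) else st') in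
    if bev st2 PosTest then setn st2 6 (nmem st2 4) else st2 by [].
  rewrite nE // v4; cbv zeta; set st2 := if negcand lam u i then _ else _.
  have [r2 n2 [m25 m26] s2] : [/\ rmem st2 = rmem st', nmem st2 4 = i,
     nmem st2 5 = (if negcand lam u i then i else nmem st' 5) /\ nmem st2 6 = nmem st' 6 &
     same [:: 4; 5; 6] [::] [::] st st2].
    rewrite /st2; case: ifP => _; split => //=; rewrite /upd ?v4 //.
    by apply: same_setn_in.
  rewrite pE // n2; split; first by case: ifP.
  split.
  + by case: ifP => _ //; apply: same_setn_in.
  + by rewrite IE -e5 -m25; case: ifP.
  + by rewrite IE -e6 -m26; case: ifP => // _; rewrite /= /upd eqxx.
- by rewrite [nexp_cost _]/=; apply: leq_trans hnb; rewrite leq_add // leq_mul2l; lia.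
by exists st'.
Qed.

Lemma T_copyrow st k l nb : nmem st 3 = k -> nmem st 5 = l -> k < d -> l < d ->
  50 + d * 300 <= nb ->
  exists2 st', T CopyRow st nb st' &
    same [:: 1] [:: 0; 1] [:: 9] st st' /\
    forall i j, i < d -> j < d -> regn d st' 9 i j = if i == k then regn d st 7 l j else regn d st 9 i j.
Proof.
move=> v3 v5 kd ld hnb.
pose I i st' := same [:: 1] [:: 0; 1] [:: 9] st st' /\ forall a j, a < d -> j < d ->
  regn d st' 9 a j = if (a == k) && (j < i) then regn d st 7 l j else regn d st 9 a j.
have [|||||st' t' [s h]] := @T_for R d m p G U eps search T0 S S64 I 1 NDim
  (PutSet (NConst 9) (NV 3) (NV 1) (CE (NConst 7) (NV 5) (NV 1))) st d 250 nb isT.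
- by move=> i st' x [s h]; split => //; exact: same_setn_in.
- by [].
- by split=> [|a j ad jd]; [exact: same_refl|rewrite ltn0 andbF].
- move=> i st' id [s h] v1.
  have w3 : nmem st' 3 = k by rewrite (same_n s).
  have w5 : nmem st' 5 = l by rewrite (same_n s).
  have [||||| |st2 t2 [s2 r2]] := @T_putset (NConst 9) (NV 3) (NV 1) (CE (NConst 7) (NV 5) (NV 1)) st' 250 (regn d st 7 l i).
  + exact: roomk.
  + by rewrite /= w3.
  + by rewrite /= v1.
  + by rewrite ceval_CE /= v1 w5 (same_regn d0 s).
  + by move=> x; rewrite ceval_CE /= v1 w5 regn_setr // (same_regn d0 s).
  + by [].
  exists st2 => //; split; first by rewrite (same_n s2).
  split; first by apply: same_trans s _; apply: same_sub s2; sub.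
  move=> a j ad jd; rewrite r2 //= w3 v1 h // ltnS.
  by case: (a =P k) => [->|_] //=; case: (ltngtP j i) => // ->.
- by rewrite /=; lia.
exists st' => //; split => // i j id jd.
by rewrite h // jd andbT.
Qed.

Lemma T_greedy st nb : reg d st 7 = Q -> (forall l, l < d -> regn d st 8 0 l = (lam l)%:C) ->
  cMx 20 d + 20 + (50 + d * (d * (slcost ScanBody + 350) + slcost Select + 700)) <= nb ->
  exists2 st', T Greedy st nb st' &
    [/\ same [:: 0; 1; 3; 4; 5; 6] [:: 0; 1; 4] [:: 9; 10] st st', reg d st' 9 = permrows Q v
      & forall l : 'I_d, regn d st' 10 0 l = (weight v l)%:C].
Proof.
move=> h7 h8 hnb.
have hn := next_lt.
have [|||st1 t1 [s1 z1]] := @mxset 10 (CR (rn 0)) st (cMx 20 d) (fun _ _ => 0%R).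
- exact: roomk.
- by [].
- exact: cMx_le.
set st2 := setr st1 4 0%R.
have s2 : same [:: 0; 1; 3; 4; 5; 6] [:: 0; 1; 4] [:: 9; 10] st st2.
  by apply: same_setr_in => //; apply: same_sub s1; sub.
pose I k st' := [/\ same [:: 0; 1; 3; 4; 5; 6] [:: 0; 1; 4] [:: 9; 10] st st',
  rmem st' 4 = psum lam (gr k),
  forall l : 'I_d, l < k -> regn d st' 10 0 l = (weight v l)%:C,
  forall l, l < d -> regn d st' 10 1 l = if l \in gr k then 1%R else 0%R &
  forall l j, l < k -> j < d -> regn d st' 9 l j = regn d st 7 (nextidx d lam (gr l)) j].
have [|||||st' t' [s e4 ew ef ep]] := @T_for R d m p G U eps search T0 S S64 I 3 NDim GreedyBody st2 d
   (d * (slcost ScanBody + 350) + slcost Select + 600) (50 + d * (d * (slcost ScanBody + 350) + slcost Select + 700)) isT.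
- by move=> i st' x [s e4 ew ef ep]; split => //; exact: same_setn_in.
- by [].
- split => //.
  + by rewrite /= /upd /= /psum big_nil.
  + by move=> l ld; rewrite regn_setr // -[1]/(val (Ordinal d1)) -[l]/(val (Ordinal ld)) regE z1 mxE.
- move=> k st' kd [s e4 ew ef ep] v3.
  set c0 := Seq (SetN 5 NDim) (SetN 6 NDim); set sa := ev c0 st'.
  have ta : T c0 st' 20 sa by apply: T_sl.
  have [|||||| sb tb [sab b5 b6]] := @T_scan sa (gr k) (50 + d * (slcost ScanBody + 50)).
  + by move=> l ld; rewrite -h8 // -(same_regn d0 s).
  + by move=> l ld; rewrite -ef.
  + by [].
  + by [].
  + by [].
  + by [].
  pose idx := nextidx d lam (gr k); have id := next_lt kd.
  have e4b : rmem sb 4 = psum lam (gr k) by rewrite (same_sc sab).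
  have h8b : regn d sb 8 0 idx = (lam idx)%:C.
    rewrite (same_regn d0 sab) // -h8 // -(same_regn d0 s) //.
  set sc := ev Select sb.
  have tc : T Select sb (slcost Select) sc by apply: T_sl.
  have [c5 ce c4] : [/\ nmem sc 5 = idx, same [:: 5] [:: 4] [::] sb sc & rmem sc 4 = psum lam (gr k.+1)].
    rewrite /sc /Select [ev _ _]/= b5 b6 addn1.
    have rE n : n = idx -> rmem sb (64 + 8 * (2 * (d * d)) + 2 * (0 * d + n)) = lam idx.
      by move=> ->; move: h8b => -[].
    have pE : psum lam (gr k.+1) = (psum lam (gr k) + lam idx)%R by rewrite -psum_rcons.
    have idE : idx = if lastsat d (negcand lam (gr k)) < d
      then lastsat d (negcand lam (gr k)) else lastsat d (poscand lam (gr k)) by [].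
    rewrite pE; clearbody idx; case: ifP idE => hl idE.
      split; first by rewrite /= b5.
        by apply: same_setr_in => //; exact: same_refl.
      by rewrite /= /upd /= e4b rE // b5.
    split; first by rewrite /= /upd eqxx.
      by apply: same_setr_in => //; apply: same_setn_in => //; exact: same_refl.
    by rewrite /= /upd /= e4b rE.
  clearbody sc.
  have c3 : nmem sc 3 = k.
    by rewrite (same_n ce) // (same_n sab).
  have [|||||| sd td [sde dE]] := @T_putset (NConst 10) (NConst 0) (NV 3) (CR (RFun Sqrt (RV 4))) sc 120 ((weight v (Ordinal kd))%:C).
  + exact: roomk.
  + exact: d0.
  + by rewrite /= c3.
  + by rewrite ceval_CR /= c4.
  + by move=> x; rewrite ceval_CR /= /upd /= c4.
  + by [].
  have d3 : nmem sd 3 = k by rewrite (same_n sde).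
  have d5 : nmem sd 5 = idx by rewrite (same_n sde).
  have [|||||| se te [see eE]] := @T_putset (NConst 10) (NConst 1) (NV 5) (CR (rn 1)) sd 120 1%R.
  + exact: roomk.
  + exact: d1.
  + by rewrite /= d5.
  + by rewrite ceval_CR.
  + by move=> x; rewrite ceval_CR.
  + by [].
  have e3 : nmem se 3 = k by rewrite (same_n see).
  have e5 : nmem se 5 = idx by rewrite (same_n see).
  have [|sf tf [sfe fE]] := @T_copyrow se k idx (50 + d * 300) e3 e5 kd id; first by [].
  have sall : same [:: 0; 1; 3; 4; 5; 6] [:: 0; 1; 4] [:: 9; 10] st' sf.
    apply: (same_trans (st2 := sa)); first by do !apply: same_setn_in => //; exact: same_refl.
    same_via sb sab.
    same_via sc ce.
    same_via sd sde.
    same_via se see.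
    by apply: same_sub sfe; sub.
  have sac : same [:: 4; 5; 6] [:: 4] [::] sa sc.
    by apply: (same_trans (st2 := sb)); [apply: same_sub sab|apply: same_sub ce]; sub.
  exists sf.
    apply: T_seq ta _ (_ : _ + (d * (slcost ScanBody + 350) + slcost Select + 560) <= _); last by lia.
    apply: T_seq tb _ (_ : _ + (d * 300 + slcost Select + 400) <= _); last by lia.
    apply: T_seq tc _ (_ : _ + (d * 300 + 400) <= _); last by lia.
    apply: T_seq td _ (_ : _ + (d * 300 + 200) <= _); last by lia.
    by apply: T_seq te tf _; lia.
  split; first by rewrite (same_n sfe).
  split.
  + exact: same_trans s sall.
  + rewrite (same_sc sfe) // (same_sc see) //.
    by rewrite (same_sc sde).
  + move=> l; rewrite ltnS => lk; have ld := ltn_ord l.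
    rewrite (same_regn d0 sfe) // eE // dE //= c3.
    case: (ltngtP l k) lk => // [lk _|lk _]; last by congr ((weight v _)%:C); apply: val_inj.
    by rewrite (same_regn d0 sac) // -ew.
  + move=> l ld; rewrite (same_regn d0 sfe) // eE // dE //.
    have -> : gr k.+1 = rcons (gr k) idx by [].
    rewrite [nev _ (NV 5)]/= d5 mem_rcons inE /=; case: (l =P idx) => //= _.
    by rewrite (same_regn d0 sac) // -ef.
  + move=> l j; rewrite ltnS => lk jd; have ld := leq_ltn_trans lk kd.
    rewrite fE //; case: (ltngtP l k) lk => // [lk _|-> _].
      rewrite (same_regn d0 see) // (same_regn d0 sde) //.
      by rewrite (same_regn d0 sac) // -ep.
    rewrite (same_regn d0 see) // (same_regn d0 sde) //.
    by rewrite (same_regn d0 sac) // -(same_regn d0 s).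
- by rewrite /=; nia.
have t2 : T (SetR 4 (rn 0)) st1 20 st2 by apply: T_sl.
exists st'.
  apply: T_seq t1 _ (_ : _ + (20 + (50 + d * (d * (slcost ScanBody + 350) + slcost Select + 700))) <= _); last by lia.
  by apply: T_seq t2 t' _.
split; [exact: s| |by move=> l; exact: ew].
apply/matrixP => i j; rewrite -regE ep // !mxE -h7 -regE /pidx.
by rewrite insubdK // /in_mem /= next_lt.
Qed.

End GreedyLoop.

Lemma T_trace k st nb : 100 + d * 200 <= nb ->
  exists2 st', T (Trace k) st nb st' &
    same [:: 2] [:: 0; 1; 2; 3] [::] st st' /\ rmem st' 2 +i* rmem st' 3 = (\tr (reg d st k))%R.
Proof.
move=> hnb.
have [|||||st' t' [s e]] := @T_acc R d m p G U eps search T0 S d0 S64 NDim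
  (Cadd (CS 2) (CE (NConst k) (NV 2) (NV 2))) st [:: 2] [:: 0; 1; 2; 3] nb d
  (fun l a => a + regn d st k l l)%R.
- by [].
- by sub.
- by [].
- move=> i st' id s v2; rewrite ceval_Cadd ceval_CE /= v2; congr (_ + _)%R.
  exact: (same_regn d0 s).
- by rewrite /=; lia.
exists st' => //; split => //; rewrite e iteri_sum big_mkord.
by apply: eq_bigr => i _; rewrite mxE.
Qed.

Definition opmx (b : bool) (A : 'M[R[i]]_d) := if b then dag A else A.

Definition opregn st (b : bool) a i l := if b then ((regn d st a l i)^*)%C else regn d st a i l.

Lemma opregnE st b a : \matrix_(i < d, j < d) opregn st b a i j = opmx b (reg d st a).
Proof. by case: b; apply/matrixP => i j; rewrite ?dag_entry !mxE. Qed.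

Lemma ceval_opnd st b a i l : ceval st (opnd b a i l) = opregn st b a (nev st i) (nev st l).
Proof. by case: b; rewrite /opnd /opregn ?ceval_Cconj ceval_CE. Qed.

Lemma opregn_frame N Sc M st st' b a i l : frame N Sc M st st' -> a \notin M -> i < d -> l < d ->
  opregn st' b a i l = opregn st b a i l.
Proof. by move=> f aM hi hl; rewrite /opregn !(frame_regn d0 f). Qed.

Lemma T_mulreg k b1 a1 b2 a2 st nb : k <= 14 -> a1 != k -> a2 != k -> cMul 400 d <= nb ->
  exists2 st', T (MulReg k b1 a1 b2 a2) st nb st' &
    same [:: 0; 1; 2] [:: 0; 1; 2; 3] [:: k] st st' /\
    reg d st' k = opmx b1 (reg d st a1) *m opmx b2 (reg d st a2).
Proof.
move=> hk n1 n2 hnb.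
have [|||||st' t' [s e]] := @mulset k (opnd b1 a1) (opnd b2 a2) st nb 400 (opregn st b1 a1) (opregn st b2 a2).
- exact: roomk.
- move=> i l st' id ld s v0 v2; rewrite ceval_opnd /= v0 v2.
  by apply: opregn_frame (same_frame s) _ _ _; rewrite ?inE.
- move=> i l st' id ld s v0 v2; rewrite ceval_opnd /= v0 v2.
  by apply: opregn_frame (same_frame s) _ _ _; rewrite ?inE.
- by case: b1; case: b2.
- by [].
by exists st' => //; rewrite -!opregnE.
Qed.

Lemma nev_ndpred st i j : nev st i < d -> nev st j < d ->
  nev st (ndpred i j) = (nev st i == (nev st j + d).-1 %% d).
Proof.
move=> hi hj; rewrite [LHS]/= !delta_nat addn1.
case: (nev st j) hj => [|l] hl.
  rewrite add0n modn_small ?prednK // add0n mul1n -(prednK d0) eqSS; by case: eqP.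
rewrite addSn /= modnDr modn_small ?(ltnW hl) // eqSS /= mul0n addn0 //.
Qed.

Lemma detrace_next_lt (H : 'M[R[i]]_d) : dag H = H -> forall k, k < d ->
  nextidx d (eigs (spectral_diag (detrace H))) (greedy d (eigs (spectral_diag (detrace H))) k) < d.
Proof.
move=> hH k kd; set D := detrace H.
have hD := detrace_dag hH; have tD := detrace_trace H d0.
have [_ + _] := greedyP (eigs_herm hD (lexx _)) (nrm_ge0 _) (eigs_sum hD tD) kd.
by rewrite greedyS all_rcons => /andP[].
Qed.

Lemma comm_herm_spec (H : 'M[R[i]]_d) : dag H = H ->
  let X := comm_herm (cX R) H in let Y := comm_herm (cY R) H in
  [/\ True, dag X = X /\ dag Y = Y & True].
Proof.
move=> hH; set D := detrace H.
have hD := detrace_dag hH; have tD := detrace_trace H d0.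
have := comm_gen_spec (spectral_unitary D) (nrm_ge0 D) (eigs_herm hD (lexx _)) (eigs_sum hD tD) d1.
have vreal : spectral_diag D = \row_k (complex.Re (spectral_diag D 0%R k))%:C.
  by apply/rowP => k; rewrite mxE -hermitian_spectral_real.
by move=> /(_ vreal) /= [_ h _ _ _].
Qed.

(** A target is determined by its kind and one Hermitian matrix, so a stack frame can store that
    matrix and recompute the target on return. *)
Definition target st (g : nat) (H : 'M[R[i]]_d) : 'M[R[i]]_d :=
  if g is 0 then reg d st 14 else if g is 1 then balanced (cX R) H else balanced (cY R) H.

Definition cBal n := 100 + n * 200 + cMx 200 n + (2 * n ^ 3 + 200) +
  (cMx 20 n + 20 + (50 + n * (n * (slcost ScanBody + 350) + slcost Select + 700))) + 100 +
  cMx (ccost shiftE) n + 3 * cMul 400 n + cMx (ccost phaseE) n.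

Lemma T_target st nb g : let H := reg d st 5 in nmem st VG = g -> g < 3 -> dag H = H ->
  cBal d + cMx 200 d + 20 <= nb ->
  exists2 st', T Target st nb st' &
    same [:: 0; 1; 2; 3; 4; 5; 6] [:: 0; 1; 2; 3; 4; 6; 7] [:: 0; 6; 7; 8; 9; 10] st st' /\
    reg d st' 0 = target st g H.
Proof.
move=> H vg g3 hH hnb.
pose sm : state R -> state R -> Prop := same [:: 0; 1; 2; 3; 4; 5; 6] [:: 0; 1; 2; 3; 4; 6; 7] [:: 0; 6; 7; 8; 9; 10].
suff [st' t' h] : exists2 st', T (if bev st (NLe (NV VG) (NConst 0)) then
    (MxSet (NConst 0) (CE (NConst 14) (NV 0) (NV 1))) else Balanced) st (cBal d + cMx 200 d) st' &
    sm st st' /\ reg d st' 0 = target st g H.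
  by exists st' => //; apply: (T_if t') => /=; lia.
rewrite /= vg; case: g vg g3 => [|g] vg g3.
  have [|||st' t' [s e]] := @mxset 0 (CE (NConst 14) (NV 0) (NV 1)) st (cMx 200 d) (fun i j => regn d st 14 i j).
  - exact: roomk.
  - by move=> i j st' hi hj s v0 v1 _; rewrite ceval_CE /= v0 v1 (same_regn d0 s).
  - exact: cMx_le.
  exists st'; first by apply: T_le t'; lia.
  by split; [apply: same_sub s; sub|rewrite e].
rewrite ltn0.
have hD := detrace_dag hH; have tD := detrace_trace H d0.
set D := detrace H in hD tD.
set v := spectral_diag D; set Q := spectralmx D.
pose c := if g is 0 then cX R else cY R.
have [|s1 t1 [f1 e1]] := @T_trace 5 st (100 + d * 200); first by [].
have [|||s2 t2 [f2 e2]] := @mxset 6 detraceE s1 (cMx 200 d)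
  (fun i j => regn d st 5 i j - (\tr H / d%:R) * (i == j)%:R)%R.
- exact: roomk.
- move=> i j st' hi hj s v0 v1 _.
  rewrite ceval_Csub ceval_CE ceval_Cmul ceval_CR [nev _ (NConst _)]/= [nev _ (NV _)]/= [nev _ (NV _)]/= v0 v1.
  rewrite [rev _ (RNat _)]/= delta_nat v0 v1 (same_regn d0 s) // (same_regn d0 f1) //.
  congr (_ - _ * _)%R; last exact: rmorph_nat.
  rewrite -e1 -(rmorph_nat (real_complex R)) -fmorphV /ceval /= !(same_sc s) //.
  by apply/eqP; rewrite eq_complex /= !mulr0 subr0 add0r !eqxx.
- exact: cMx_le.
have d2 : reg d s2 6 = D.
  rewrite e2; apply/matrixP => i j; rewrite !mxE; congr (_ - _)%R.
  by rewrite -val_eqE; case: eqP; rewrite ?mulr1 ?mulr0 ?mulr1n ?mulr0n.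
have [|||||s3 t3 [f3 q3 v3]] := @T_diag R d m p G U eps search T0 S d0 S64 (NConst 6) (NConst 7) (NConst 8) s2 (d ^ 3 + 100).
- by rewrite d2; exact: hermitian_normal.
- exact: roomk.
- exact: roomk.
- by [].
- by rewrite /=; lia.
rewrite [nev _ _]/= d2 in q3 v3.
have [|||s4 t4 [f4 q4 w4]] := @T_greedy Q v (detrace_next_lt hH) s3
  (cMx 20 d + 20 + (50 + d * (d * (slcost ScanBody + 350) + slcost Select + 700))).
- by [].
- move=> l ld; have := v3 (Ordinal ld); rewrite [RHS]hermitian_spectral_real //= => ->.
  by rewrite -(eigsE _ (Ordinal ld)).
- by [].
set s5 := ev SetAngle s4.
have t5 : T SetAngle s4 100 s5 by apply: T_sl.
have f5 : same [::] [:: 6; 7] [::] s4 s5 by do !apply: same_setr_in => //; exact: same_refl.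
have vg4 : nmem s4 VG = g.+1.
  by rewrite (same_n f4) // (same_n f3) // (same_n f2) // (same_n f1).
have c5 : rmem s5 6 +i* rmem s5 7 = c.
  rewrite /s5 /= /upd /= vg4 /c; case: (g) g3 => [|[|//]] _.
    by rewrite !subSS subn0 subnn subr0 mul0r div1r.
  rewrite !subSS subnn subn0 mul0r sub0r /cY; apply/eqP; rewrite eq_complex /=.
  by rewrite !(mulr0, mul0r, oppr0, mulN1r, subr0, add0r, subrr, mulNr) !eqxx.
clearbody s5.
have w5 (l : 'I_d) : regn d s5 10 0 l = (weight v l)%:C.
  by rewrite (same_regn d0 f5) // w4.
have [|||s6 t6 [f6 e6]] := @mxset 6 shiftE s5 (cMx (ccost shiftE) d)
  (fun i j => c * (((i == (j + d).-1 %% d)%N%:R : R) * complex.Re (regn d s5 10 0 i))%:C +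
   c^*%C * (((j == (i + d).-1 %% d)%N%:R : R) * complex.Re (regn d s5 10 0 j))%:C)%R.
- exact: roomk.
- move=> i j st' hi hj s v0 v1 _.
  have cE : ceval st' (CS 6) = c by rewrite ceval_CS !(same_sc s).
  have pE a b : nev st' a < d -> nev st' b < d -> rev st' (RNat (ndpred a b)) = (nev st' a == (nev st' b + d).-1 %% d)%N%:R%R.
    by move=> ha hb; rewrite [LHS]/= -nev_ndpred.
  have wE' a l : nev st' a = l -> l < d -> rev st' (wE a) = complex.Re (regn d s5 10 0 l).
    by move=> al ld; rewrite -(same_regn d0 s) // -al.
  rewrite ceval_Cadd !ceval_Cmul ceval_Cconj !ceval_CR cE.
  rewrite ![rev _ (RMul _ _)]/= -!/(nev st' (ndpred _ _)).
  have h1 := pE (NV 0) (NV 1); have h2 := pE (NV 1) (NV 0).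
  have k1 := wE' (NV 0) i v0 hi; have k2 := wE' (NV 1) j v1 hj.
  rewrite /= v0 v1 in h1 h2 k1 k2 *.
  by rewrite h1 // h2 // k1 k2.
- by [].
have p6 : reg d s6 6 = shiftmx v c.
  by rewrite e6; apply/matrixP => i j; rewrite !mxE /shift_entry !w5 -!val_eqE.
have [||||s7 t7 [f7 e7]] := @T_mulreg 7 false 6 false 9 s6 (cMul 400 d) => //.
have [||||s8 t8 [f8 e8]] := @T_mulreg 6 true 9 false 7 s7 (cMul 400 d) => //.
have r9 : reg d s6 9 = permrows Q v.
  by rewrite (same_reg d0 f6) // (same_reg d0 f5) // q4.
have c8 : reg d s8 6 = comm_herm c H.
  have r79 : reg d s7 9 = permrows Q v by rewrite (same_reg d0 f7).
  move: e8; rewrite e7 p6 r9 r79 => e8; exact: e8.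
have hX : dag (comm_herm c H) = comm_herm c H.
  have [_ [hx hy] _] := comm_herm_spec hH.
  by rewrite /c; case: (g).
have [|||||s9 t9 [f9 q9 v9]] := @T_diag R d m p G U eps search T0 S d0 S64 (NConst 6) (NConst 7) (NConst 8) s8 (d ^ 3 + 100).
- by rewrite [nev _ _]/= c8; exact: hermitian_normal.
- exact: roomk.
- exact: roomk.
- by [].
- by rewrite /=; lia.
rewrite [nev _ (NConst 6)]/= c8 in q9 v9.
have [|||s10 t10 [f10 e10]] := @mxset 9 phaseE s9 (cMx (ccost phaseE) d)
  (fun i j => cis (complex.Re (regn d s9 8 0 i)) * regn d s9 7 i j)%R.
- exact: roomk.
- move=> i j st' hi hj s v0 v1 _.
  rewrite ceval_Cmul ceval_CE -!(same_regn d0 s) // [nev _ (NV 0)]/= [nev _ (NV 1)]/= v0 v1.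
  by congr (_ * _)%R; rewrite /ceval /= v0.
- by [].
have [||||s11 t11 [f11 e11]] := @T_mulreg 0 true 7 false 9 s10 (cMul 400 d) => //.
exists s11.
  apply: T_le (_ : _ + (_ + (_ + (_ + (_ + (_ + (_ + (_ + (_ + (_ + _))))))))) <= _) _; last first.
    apply: T_seq t1 _ (leqnn _); apply: T_seq t2 _ (leqnn _); apply: T_seq t3 _ (leqnn _).
    apply: T_seq t4 _ (leqnn _); apply: T_seq t5 _ (leqnn _); apply: T_seq t6 _ (leqnn _).
    apply: T_seq t7 _ (leqnn _); apply: T_seq t8 _ (leqnn _); apply: T_seq t9 _ (leqnn _).
    exact: T_seq t10 t11 (leqnn _).
  by rewrite /cBal; lia.
split.
  same_via s1 f1.
  same_via s2 f2.
  same_via s3 f3.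
  same_via s4 f4.
  same_via s5 f5.
  same_via s6 f6.
  same_via s7 f7.
  same_via s8 f8.
  same_via s9 f9.
  same_via s10 f10.
  by apply: same_sub f11; sub.
have -> : target st g.+1 H = expH (comm_herm c H) by rewrite /target /c; case: (g) g3 => [|[|//]].
rewrite e11 /opmx (same_reg d0 f10) // q9 /expH; congr (_ *m _).
rewrite e10; apply/matrixP => i j; rewrite mul_diag_mx !mxE v9; congr (_ * _)%R.
by rewrite regE q9.
Qed.

End Target.

(** * The generator of the residual *)

Section Code.
Definition AbsT := RFun Sqrt (RAdd (RMul (RV 2) (RV 2)) (RMul (RV 3) (RV 3))).
Definition SetPhase := Seq (SetR 4 (RDiv (RV 2) AbsT)) (SetR 5 (RDiv (RSub (rn 0) (RV 3)) AbsT)).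
Definition unphaseE : cexp := Cmul (CS 4) (CE (NConst 6) (NV 0) (NV 1)).
Definition antihermE : cexp := Cmul (rn 0, RDiv (RSub (rn 0) (rn 1)) (rn 2))
  (Csub (CE (NConst 7) (NV 0) (NV 1)) (Cconj (CE (NConst 7) (NV 1) (NV 0)))).
Definition Residual := Seq (MulReg 6 true 0 false 1) (Seq (Trace 6) (Seq SetPhase
  (Seq (MxSet (NConst 7) unphaseE) (MxSet (NConst 5) antihermE)))).
Definition Copy k l := MxSet (NConst k) (CE (NConst l) (NV 0) (NV 1)).
End Code.

Section Residual.
Variables (R : realType) (d m p : nat).
Variables (G : 'I_m -> 'M[R[i]]_d) (U : 'I_p -> 'M[R[i]]_d) (eps : R).
Variables (search : 'M[R[i]]_d -> seq 'I_m) (T0 S : nat).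
Implicit Types (st : state R) (c : cmd).
Hypothesis d1 : 1 < d.
Let d0 : 0 < d := ltnW d1.
Hypothesis S64 : 64 <= S.
Hypothesis rm : room d S 14.

Local Notation T := (T G U eps search T0 S).
Local Notation nev := (@neval R d m p).
Local Notation rev := (@reval R d m p G U eps).
Local Notation ceval := (ceval G U eps).
Local Notation ev := (ev G U eps).
Local Notation same := (same d).

Lemma T_copy k l st nb : k <= 14 -> k != l -> cMx 200 d <= nb ->
  exists2 st', T (Copy k l) st nb st' &
    same [:: 0; 1] [:: 0; 1] [:: k] st st' /\ reg d st' k = reg d st l.
Proof.
move=> hk kl hnb.
have [|||st' t [s e]] := @mxset R d m p G U eps search T0 S d1 S64 rm k (CE (NConst l) (NV 0) (NV 1)) st nb (regn d st l).
- exact: room_le rm.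
- move=> i j st' hi hj s v0 v1 _; rewrite ceval_CE /= v0 v1 (same_regn d0 s) //.
  by rewrite inE eq_sym.
- by apply: leq_trans hnb; exact: cMx_le.
by exists st'.
Qed.

Lemma T_const k (e : cexp) z st nb : k <= 14 ->
  (forall st', same [:: 0; 1] [:: 0; 1] [:: k] st st' -> ceval st' e = z) ->
  cMx (ccost e) d <= nb ->
  exists2 st', T (MxSet (NConst k) e) st nb st' &
    same [:: 0; 1] [:: 0; 1] [:: k] st st' /\ reg d st' k = const_mx z.
Proof.
move=> hk h hnb.
have [|||st' t [s er]] := @mxset R d m p G U eps search T0 S d1 S64 rm k e st nb (fun _ _ => z).
- exact: room_le rm.
- by move=> i j st' hi hj s _ _ _; exact: h.
- exact: hnb.
by exists st' => //; split => //; rewrite er; apply/matrixP => i j; rewrite !mxE.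
Qed.

Definition cRes n := cMul 400 n + (100 + n * 200) + slcost SetPhase + cMx (ccost unphaseE) n + cMx (ccost antihermE) n.

Lemma T_residual st nb : cRes d <= nb ->
  exists2 st', T Residual st nb st' &
    same [:: 0; 1; 2] [:: 0; 1; 2; 3; 4; 5] [:: 5; 6; 7] st st' /\
    reg d st' 5 = antiherm (unphase (dag (reg d st 0) *m reg d st 1)).
Proof.
move=> hnb.
have [||||s1 t1 [f1 e1]] := @T_mulreg R d m p G U eps search T0 S d1 S64 rm 6 true 0 false 1 st (cMul 400 d) => //.
set M := dag _ *m _.
have {}e1 : reg d s1 6 = M by exact: e1.
clearbody M.
have [|s2 t2 [f2 e2]] := @T_trace R d m p G U eps search T0 S d1 S64 rm 6 s1 (100 + d * 200) => //.
rewrite e1 in e2.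
set s3 := ev SetPhase s2.
have t3 : T SetPhase s2 (slcost SetPhase) s3 by apply: T_sl.
have f3 : same [::] [:: 4; 5] [::] s2 s3 by do !apply: same_setr_in => //; exact: same_refl.
have e3 : rmem s3 4 +i* rmem s3 5 = ((\tr M)^*%C / (normc (\tr M))%:C)%R.
  rewrite -e2 /s3 /= /upd /= sub0r -!expr2 -fmorphV.
  by apply/eqP; rewrite eq_complex /= !mulr0 subr0 add0r !eqxx.
clearbody s3.
have [|||s4 t4 [f4 e4]] := @mxset R d m p G U eps search T0 S d1 S64 rm 7 unphaseE s3 (cMx (ccost unphaseE) d)
  (fun i j => ((\tr M)^*%C / (normc (\tr M))%:C) * regn d s3 6 i j)%R.
- exact: room_le rm.
- move=> i j st' hi hj s v0 v1 _; rewrite ceval_Cmul ceval_CE ceval_CS /= v0 v1.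
  by rewrite (same_regn d0 s) // !(same_sc s) // e3.
- by [].
have {}e4 : reg d s4 7 = unphase M.
  rewrite e4 /unphase; apply/matrixP => i j; rewrite !mxE regE.
  by rewrite (same_reg d0 f3) // (same_reg d0 f2) // e1.
have [|||s5 t5 [f5 e5]] := @mxset R d m p G U eps search T0 S d1 S64 rm 5 antihermE s4 (cMx (ccost antihermE) d)
  (fun i j => (2%:R * 'i%C)^-1 * (regn d s4 7 i j - (regn d s4 7 j i)^*%C))%R.
- exact: room_le rm.
- move=> i j st' hi hj s v0 v1 _; rewrite ceval_Cmul ceval_Csub ceval_Cconj !ceval_CE.
  rewrite [nev _ (NV 0)]/= [nev _ (NV 1)]/= v0 v1 !(same_regn d0 s) //; congr (_ * _)%R.
  have nz : (2%:R * 'i%C)%R != 0%R :> R[i].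
    by rewrite mulf_neq0 ?pnatr_eq0 // eq_complex /= oner_eq0 andbF.
  apply: (mulfI nz); rewrite divff // -(rmorph_nat (real_complex R)) /ceval.
  apply/eqP; rewrite eq_complex /= !(mulr0, mul0r, mulr1, subr0, sub0r, add0r, addr0).
  have -> : (2 * (- 1 / 2) = - 1 :> R)%R by field.
  by rewrite opprK oppr0 mul0r !eqxx.
- by [].
exists s5.
  apply: T_le (_ : _ + (_ + (_ + (_ + _))) <= _) _; last first.
    apply: T_seq t1 _ (leqnn _); apply: T_seq t2 _ (leqnn _); apply: T_seq t3 _ (leqnn _).
    exact: T_seq t4 t5 (leqnn _).
  by move: hnb; rewrite /cRes; lia.
split.
  same_via s1 f1.
  same_via s2 f2.
  same_via s3 f3.
  same_via s4 f4.
  by apply: same_sub f5; sub.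
rewrite e5; apply/matrixP => i j; rewrite [LHS]mxE !regE e4.
by rewrite /antiherm [RHS]mxZE mxDE mxNE dag_entry.
Qed.
End Residual.

(** * The recursion as a machine with an explicit stack *)

Section Words.
Variables (R : realType) (d m : nat) (G : 'I_m -> 'M[R[i]]_d).

Definition wd (s : seq line) k : seq 'I_m := nth [::] (Defs.expand G s) k.

Lemma expand_rcons s l :
  Defs.expand G (rcons s l) = rcons (Defs.expand G s) (flatten (map (expand_ref G (Defs.expand G s)) l)).
Proof. by rewrite /Defs.expand -cats1 foldl_cat. Qed.

Lemma size_expand s : size (Defs.expand G s) = size s.
Proof. by elim/last_ind: s => // s l IH; rewrite expand_rcons !size_rcons IH. Qed.

Lemma wd_rcons s l : wd (rcons s l) (size s) = flatten (map (expand_ref G (Defs.expand G s)) l).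
Proof. by rewrite /wd expand_rcons nth_rcons size_expand ltnn eqxx. Qed.

Lemma wd_cat s t k : k < size s -> wd (s ++ t) k = wd s k.
Proof.
move=> ks; elim/last_ind: t => [|t l IH]; first by rewrite cats0.
rewrite -rcons_cat /wd expand_rcons nth_rcons size_expand size_cat ltn_addr //.
Qed.

Lemma word_eval_cat w1 w2 : word_eval G (w1 ++ w2) = word_eval G w1 *m word_eval G w2.
Proof. by elim: w1 => [|j w IH] /=; rewrite ?mul1mx // IH mulmxA. Qed.

Lemma size_inv_word w : size (inv_word G w) = size w.
Proof. by rewrite size_rev size_map. Qed.

Hypothesis hG : instruction_set G.

Lemma gate_unitary j : unitary (G j).
Proof. by have [/(_ j) [u _] _] := hG; apply/unitarymxE. Qed.

Lemma word_unitary w : unitary (word_eval G w).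
Proof.
elim: w => [|j w IH]; first exact: unitary1.
apply: unitaryM IH; exact: gate_unitary.
Qed.

Lemma word_eval_inv w : word_eval G (inv_word G w) = dag (word_eval G w).
Proof.
have inv j : G (inv_gate G j) = dag (G j).
  have [_ /(_ j) [k hk]] := hG; rewrite /inv_gate; case: pickP => [l /eqP -> /=|/(_ k)]; first exact: dagE.
  by rewrite hk eqxx.
elim: w => [|j w IH]; first by rewrite dag1.
rewrite /inv_word [map _ _]/= rev_cons -cats1 word_eval_cat IH.
by rewrite [RHS]dagM [word_eval _ [:: _]]/= mulmx1 inv.
Qed.

Lemma word_eval_comm w0 w1 w2 :
  word_eval G (w0 ++ w1 ++ w2 ++ inv_word G w1 ++ inv_word G w2) =
  word_eval G w0 *m gcomm (word_eval G w1) (word_eval G w2).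
Proof.
rewrite !word_eval_cat !word_eval_inv.
by move: (word_eval G w0) (word_eval G w1) (word_eval G w2) => a b c; rewrite /gcomm -!mulmxA.
Qed.
End Words.

Section Code.
Variables (PUSH POP LEAF : cmd).
(** Counters of the machine: [VM] is 0 when calling and 1 when returning, [VS] is the level, [VT]
    the top level, [VSIG] the stage stored in the popped frame. [NLV] counts the lines, [LLV] is the
    last line, [LAM] and [VL0] count the lines emitted by one call and by one leaf. *)
Definition VM := 10.
Definition VS := 11.
Definition VT := 12.
Definition VSIG := 14.
Definition NLV := 15.
Definition LLV := 16.
Definition LAM := 17.
Definition VL0 := 18.
(** Stage and kind are stored as the real and imaginary part of a constant matrix; a frame is then
    three matrices, all treated alike by the stacks. *)
Definition FrameF (sg g : nexp) := MxSet (NConst 4) (RNat sg, RNat g).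
Definition CallPush := Seq (Copy 2 5) (Seq (Copy 3 5) (Seq (FrameF (NConst 0) (NV VG))
  (Seq PUSH (SetN VS (NSub (NV VS) (NConst 1)))))).
Definition LeafCall := Seq Target (Seq (SetN 19 (NV NLV)) (Seq LEAF
  (Seq (SetN VL0 (NSub (NV NLV) (NV 19))) (SetN VM (NConst 1))))).
Definition half1 : rexp := RDiv (rn 1) (rn 2).
Definition half3 : rexp := RDiv (rn 3) (rn 2).
(** A real cell cannot be used as a counter directly, so the small integer is recovered by
    comparison with 1/2 and 3/2. *)
Definition DecodeN v (e : rexp) := If (RLe e half1) (SetN v (NConst 0))
  (If (RLe e half3) (SetN v (NConst 1)) (SetN v (NConst 2))).
Definition Decode := Seq (DecodeN VSIG (CE (NConst 4) (NConst 0) (NConst 0)).1)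
  (Seq (DecodeN VG (CE (NConst 4) (NConst 0) (NConst 0)).2) (SetN VS (NAdd (NV VS) (NConst 1)))).
Definition Down g := Seq (SetN VG (NConst g)) (Seq (SetN VS (NSub (NV VS) (NConst 1))) (SetN VM (NConst 0))).
(** The generator is pushed, popped and pushed again so that the first factor is already computed
    from the rounded generator, the same one that the second factor will find on the stack. *)
Definition Ret0 := Seq (Copy 5 2) (Seq Target (Seq Residual (Seq (Copy 2 5) (Seq (Copy 3 1)
  (Seq (FrameF (NConst 1) (NV VG)) (Seq PUSH (Seq POP (Seq (Copy 5 2) (Seq PUSH (Down 1)))))))))).
Definition Ret1 := Seq (Copy 5 2) (Seq (Copy 2 1) (Seq (FrameF (NConst 2) (NConst 0))
  (Seq PUSH (Down 2)))).
(** A call at a given level always emits the same number of consecutive lines, the last of which is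
    its result. The three partial results thus lie 0, [LAM] and 2 [LAM] lines behind the current
    end, and no line number has to be kept on the stack of reals. *)
Definition LamLoop := Seq (SetN LAM (NV VL0)) (For 19 (NSub (NV VS) (NConst 1))
  (SetN LAM (NAdd (NMul (NConst 3) (NV LAM)) (NConst 1)))).
Definition CommLine : seq (ref nexp) :=
  [:: LineRef false (NSub (NV LLV) (NMul (NConst 2) (NV LAM)));
      LineRef false (NSub (NV LLV) (NV LAM)); LineRef false (NV LLV);
      LineRef true (NSub (NV LLV) (NV LAM)); LineRef true (NV LLV)].
Definition Ret2 := Seq (MulReg 6 false 2 false 1) (Seq (MulReg 7 true 2 true 1)
  (Seq (MulReg 8 false 6 false 7) (Seq (MulReg 6 false 3 false 8) (Seq (Copy 1 6)
  (Seq LamLoop (Seq (Emit (NConst LLV) CommLine) (SetN NLV (NAdd (NV LLV) (NConst 1))))))))).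
Definition Ret := Seq POP (Seq Decode (If (NLe (NV VSIG) (NConst 0)) Ret0
  (If (NLe (NV VSIG) (NConst 1)) Ret1 Ret2))).
Definition Body := If (NLe (NV VM) (NConst 0))
  (If (NLe (NV VS) (NConst 0)) LeafCall CallPush) Ret.
Definition Guard := BNot (BAnd (NLe (NConst 1) (NV VM)) (NLe (NV VT) (NV VS))).
Definition SK := While Guard Body.
End Code.

Definition LN := [:: 0; 1; 2; 3; 4; 5; 6; 7; 8; 9; 15; 16; 20; 21; 22; 23; 24; 25; 26; 27; 28; 29].
Definition PN := [:: 0; 1; 2; 3; 4; 5; 6; 7; 8; 9; 40].
Definition PS := iota 0 10.
(** [VT] (12) and all counters from 41 on are absent, so the bound in the guard, the bookkeeping of
    the table and the outer loop counters survive a run. *)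
Definition MN := [:: 40; 10; 11] ++ iota 13 27 ++ iota 0 10.
Definition MS := iota 0 40.

Section Sqrt.
Variable R : realType.
Lemma sqrt_le (x c : R) : (0 <= c -> x <= c ^+ 2 -> Num.sqrt x <= c)%R.
Proof. by move=> h hx; rewrite -[leRHS](ger0_norm h) -sqrtr_sqr; exact: ler_wsqrtr. Qed.

Lemma c512 : (0 <= 1 / 512 :> R)%R.
Proof. by apply: divr_ge0; [exact: ler01|exact: ler0n]. Qed.

Lemma rho_small (z r e : R) : (z <= r -> r <= e -> e <= 1 / 512 -> r + z <= 1 / 20)%R.
Proof. lra. Qed.

Lemma rho_double (z r : R) : (z <= r -> 6 * (r + z) <= 12 * r)%R.
Proof. lra. Qed.
End Sqrt.

Section Costs.
Variables a a' b p r m c v : nat.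
Hypothesis aa : a <= a'.
Let B := 10 * a' + 4 * p + 2 * (b + a + 20) + 4 * m + r + c + 1000.
Lemma cost_call : (bexp_cost (NLe (NV VM) (NConst 0)) + (10 + (a + (a + (a' + (p + 10)))))).+1 <= B.
Proof. by rewrite /B /=; lia. Qed.
Lemma cost_ret0 : p + c + (a + (b + a + 20 + (r + (a + (a + (a' + (p + (p + (a + (p + 40)))))))))) + 40 <= B.
Proof. by rewrite /B; lia. Qed.
Lemma cost_ret1 : p + c + (a + (a + (a' + (p + 40)))) + 40 <= B.
Proof. by rewrite /B; lia. Qed.
Lemma cost_ret2 : p + c + (m + (m + (m + (m + (a + (50 + v * 60 + (100 + 10))))))) + 40 <= B + v * 60.
Proof. by rewrite /B; lia. Qed.
End Costs.

(** * Verification of the stack machine *)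

Section Machine.
Variables (R : realType) (d m p : nat).
Variables (G : 'I_m -> 'M[R[i]]_d) (U : 'I_p -> 'M[R[i]]_d) (eps : R).
Variables (search : 'M[R[i]]_d -> seq 'I_m) (T0 S : nat).
Implicit Types (st : state R) (c : cmd).
Hypothesis d1 : 1 < d.
Let d0 : 0 < d := ltnW d1.
Hypothesis S64 : 64 <= S.
Hypothesis rm : room d S 14.
Hypothesis hG : instruction_set G.

Local Notation T := (T G U eps search T0 S).
Local Notation nev := (@neval R d m p).
Local Notation rev := (@reval R d m p G U eps).
Local Notation bev := (@beval R d m p G U eps).
Local Notation ceval := (ceval G U eps).
Local Notation ev := (ev G U eps).
Local Notation same := (same d).
Local Notation frame := (frame d).
Local Notation M := 'M[R[i]]_d.

(** The machine is verified once for both phases: the preprocessing takes q to be the identity and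
    zeta = 0 with a stack of plain registers, the main phase rounds and packs. *)
Variables (PUSH POP LEAF : cmd) (PM : seq nat).
Hypothesis PM14 : forall k, k \in PM -> 10 < k /\ k != 14.
Definition MM := iota 0 11 ++ PM.

(* [stk st L] says that the stack holds the frames L; pushing rounds by q. *)
Variables (stk : state R -> seq (M * M * M) -> Prop) (q : M -> M) (cap cP : nat) (zeta : R).
Hypothesis stk_frame : forall st st' L,
  frame ([:: 10; 11] ++ iota 13 27 ++ iota 0 10) MS (iota 0 11) st st' -> stk st L -> stk st' L.
Hypothesis push_spec : forall st L (s g : nat), stk st L -> size L < cap ->
  (nrm (reg d st 2) <= 2)%R -> (nrm (reg d st 3) <= 2)%R -> s < 3 -> g < 3 ->
  reg d st 4 = const_mx (s%:R +i* g%:R) ->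
  exists2 st', T PUSH st cP st' & same PN PS PM st st' /\
    stk st' ((q (reg d st 2), q (reg d st 3), reg d st 4) :: L).
Hypothesis pop_spec : forall st f L, stk st (f :: L) ->
  exists2 st', T POP st cP st' & same PN PS ([:: 2; 3; 4] ++ PM) st st' /\
    [/\ stk st' L, reg d st' 2 = f.1.1, reg d st' 3 = f.1.2 & reg d st' 4 = f.2].
Hypothesis q_dag : forall A, dag A = A -> dag (q A) = q A.
Hypothesis q_idem : forall A, q (q A) = q A.
Hypothesis q_near : forall A, (nrm (q A - A) <= zeta)%R.

Variables (e : nat -> R) (Tt lam0 l0 cL : nat).
Hypothesis eS : forall s, e s.+1 = (320 * (e s * Num.sqrt (e s)))%R.
Hypothesis e0 : (0 <= e 0 <= (1 / 512) ^+ 2)%R.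
Hypothesis zeta0 : (0 <= zeta)%R.
(** The numerical error grows at most twelvefold per level and must stay below $e_s^2$, which is
    what [sk_level] tolerates. *)
Hypothesis zeta_e : forall s, s <= Tt -> (12 ^+ s * zeta <= e s ^+ 2)%R.
Hypothesis capT : Tt <= cap.
Hypothesis lam0_gt0 : 0 < lam0.

Variable inv : state R -> Prop.
Hypothesis inv_step : forall st st' Ls, inv st -> frame MN MS MM st st' ->
  slp st' = slp st ++ Ls -> inv st'.

Definition lines_ok st := nmem st NLV = size (slp st).
Definition lastw st := wd G (slp st) (size (slp st)).-1.

(** Two distances are kept apart: rho compares the numerical value in register 1 with the word,
    without a phase, and err compares the target with the word up to a phase. *)
Definition sk_result st st' rho err lam len (A : M) : Prop :=
  [/\ lines_ok st' /\ nmem st' LLV = (size (slp st')).-1, ans st' = ans st,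
    exists2 Ls, slp st' = slp st ++ Ls & size Ls = lam,
    size (lastw st') <= len &
    let B := word_eval G (lastw st') in (nrm (reg d st' 1 - B) <= rho)%R /\ pclose err A B].

(** True if the leaf asks for determinant one, as the net search does. The leaf of the main phase
    accepts every unitary, and it has to: the factors at the root need not have determinant one. *)
Variable special : bool.
Hypothesis leaf_spec : forall st, inv st -> lines_ok st -> unitary (reg d st 0) ->
  (special -> \det (reg d st 0) = 1%R) ->
  exists2 st', T LEAF st cL st' & frame LN MS (iota 0 11) st st' /\
    sk_result st st' zeta (e 0) lam0 l0 (reg d st 0).

Local Notation Body := (Body PUSH POP LEAF).

(** Finite runs of the loop body. Unlike an execution of the loop, such a run need not end with a
    false guard, so the runs of nested calls can be concatenated. *)
Inductive steps : state R -> nat -> state R -> Prop :=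
  | Steps0 st n : steps st n st
  | StepsS st1 n1 st2 n2 st3 n : bev st1 Guard -> T Body st1 n1 st2 -> steps st2 n2 st3 ->
      n1 + n2 + (bexp_cost Guard).+1 <= n -> steps st1 n st3.

Lemma steps_trans st1 n1 st2 n2 st3 n : steps st1 n1 st2 -> steps st2 n2 st3 ->
  n1 + n2 <= n -> steps st1 n st3.
Proof.
move=> h; elim: h n2 st3 n => {st1 n1 st2} [st n1 n2 st3 n h hn|st1 n1 st2 n2 st3 n0 g t _ IH hn n3 st4 n h3 hn'].
  by case: h hn => [st' n' hn|*]; [exact: Steps0|apply: StepsS; eauto; lia].
by apply: (StepsS g t (IH _ _ _ h3 (leqnn _))); lia.
Qed.

Lemma steps_le st n st' n' : n <= n' -> steps st n st' -> steps st n' st'.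
Proof. by move=> h s; apply: steps_trans s (Steps0 st' 0) _; rewrite addn0. Qed.

Lemma steps_one st1 n1 st2 n : bev st1 Guard -> T Body st1 n1 st2 ->
  n1 + (bexp_cost Guard).+1 <= n -> steps st1 n st2.
Proof. by move=> g t hn; apply: (StepsS g t (Steps0 st2 0)); lia. Qed.

Lemma T_SK st n st' n' : steps st n st' -> ~~ bev st' Guard ->
  n + (bexp_cost Guard).+1 <= n' -> T (SK PUSH POP LEAF) st n' st'.
Proof.
move=> h; elim: h n' => {st n st'} [st n n' g hn|st1 n1 st2 n2 st3 n g t _ IH hn n' g' hn'].
  by apply: T_while_end => //; lia.
apply: (T_while_step g t (IH _ g' (leqnn _))); lia.
Qed.

Lemma guardE st : bev st Guard = ~~ ((0 < nmem st VM) && (nmem st VT <= nmem st VS)).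
Proof. by []. Qed.

Local Notation msame st st' := (same MN MS MM st st').

Lemma MMin k : k <= 10 -> k \in MM.
Proof. by move=> h; rewrite mem_cat mem_iota /= add0n ltnS h. Qed.

Lemma sub_MM l : all (fun k => k <= 10) l -> {subset l <= MM}.
Proof. by move=> /allP h k /h; exact: MMin. Qed.

Lemma sub_PMM l : all (fun k => k <= 10) l -> {subset l ++ PM <= MM}.
Proof.
by move=> h k; rewrite mem_cat => /orP[/(sub_MM h)//|kP]; rewrite mem_cat kP orbT.
Qed.

Lemma msame_weak N Sc M st st' : same N Sc M st st' -> all (mem MN) N -> all (mem MS) Sc ->
  all (fun k => k <= 10) M -> msame st st'.
Proof. by move=> s hN hS hM; apply: same_sub s; [exact/allP|exact/allP|exact: sub_MM]. Qed.

Lemma msame_weakP N Sc M st st' : same N Sc (M ++ PM) st st' -> all (mem MN) N -> all (mem MS) Sc ->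
  all (fun k => k <= 10) M -> msame st st'.
Proof. by move=> s hN hS hM; apply: same_sub s; [exact/allP|exact/allP|exact: sub_PMM]. Qed.

Lemma stk_same N Sc M st st' L : same N Sc M st st' ->
  all (mem ([:: 10; 11] ++ iota 13 27 ++ iota 0 10)) N -> all (mem MS) Sc ->
  all (mem (iota 0 11)) M -> stk st L -> stk st' L.
Proof.
move=> s hN hS hM; apply: stk_frame.
by apply: frame_sub (same_frame s); apply/allP.
Qed.

Lemma notin_PM k l : k <= 10 -> k \notin l -> k \notin l ++ PM.
Proof.
move=> h hl; rewrite mem_cat negb_or hl /=; apply/negP => /PM14 [].
by rewrite ltnNge h.
Qed.

Lemma PM_14 l : 14 \notin l -> 14 \notin l ++ PM.
Proof. by move=> hl; rewrite mem_cat negb_or hl /=; apply/negP => /PM14 [_]. Qed.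

Lemma msame_root st st' : msame st st' -> reg d st' 14 = reg d st 14.
Proof. by move=> s; apply: (same_reg d0 s); apply: PM_14. Qed.

Lemma msame_vt st st' : msame st st' -> nmem st' VT = nmem st VT.
Proof. by move=> s; apply: (same_n s). Qed.

Lemma msame_inv st st' : msame st st' -> inv st -> inv st'.
Proof. by move=> s h; apply: (inv_step (Ls := [::]) h (same_frame s)); rewrite cats0 (same_slp s). Qed.

Lemma T_frameF st (sg g : nexp) a b nb :
  (forall st', same [:: 0; 1] [:: 0; 1] [:: 4] st st' -> nev st' sg = a /\ nev st' g = b) ->
  cMx (nexp_cost sg + nexp_cost g + 2) d <= nb ->
  exists2 st', T (FrameF sg g) st nb st' &
    same [:: 0; 1] [:: 0; 1] [:: 4] st st' /\ reg d st' 4 = const_mx (a%:R +i* b%:R).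
Proof.
move=> h hnb; apply: (@T_const R d m p G U eps search T0 S d1 S64 rm 4 (RNat sg, RNat g)) => //.
  by move=> st' s; have [h1 h2] := h st' s; rewrite /ceval /= h1 h2.
by apply: leq_trans hnb; apply: cMx_le; rewrite /ccost /=; lia.
Qed.

Lemma le_half1 (k : nat) : (k%:R <= 1%:R / 2%:R :> R)%R = (k <= 0).
Proof. by rewrite ler_pdivlMr // -natrM ler_nat; lia. Qed.

Lemma le_half3 (k : nat) : (k%:R <= 3%:R / 2%:R :> R)%R = (k <= 1).
Proof. by rewrite ler_pdivlMr // -natrM ler_nat; lia. Qed.

Definition cDec := slcost Decode.

Lemma T_decode st (s g v : nat) : reg d st 4 = const_mx (s%:R +i* g%:R) -> s < 3 -> g < 3 ->
  nmem st VS = v ->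
  exists2 st', T Decode st cDec st' & same [:: VSIG; VG; VS] [::] [::] st st' /\
    [/\ nmem st' VSIG = s, nmem st' VG = g & nmem st' VS = v.+1].
Proof.
move=> r4 s3 g3 vs; exists (ev Decode st); first exact: T_sl.
have e4 : regn d st 4 0 0 = (s%:R +i* g%:R)%R.
  by rewrite -[0]/(val (Ordinal d0)) regE r4 mxE.
pose e1 := (CE (NConst 4) (NConst 0) (NConst 0)).1.
pose e2 := (CE (NConst 4) (NConst 0) (NConst 0)).2.
have rE st' : rmem st' = rmem st -> rev st' e1 = s%:R%R /\ rev st' e2 = g%:R%R.
  move=> r; have := ceval_CE G U eps st' (NConst 4) (NConst 0) (NConst 0).
  rewrite [nev _ _]/= [nev _ _]/= /regn /cell r -/(cell st _) -/(regn d st 4 0 0) e4.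
  by move=> h; split; [exact: (congr1 (@complex.Re R) h)|exact: (congr1 (@complex.Im R) h)].
have dE st' vv (ee : rexp) (x : nat) : rev st' ee = x%:R%R -> x < 3 -> ev (DecodeN vv ee) st' = setn st' vv x.
  move=> er x3; rewrite /DecodeN [LHS]/= er le_half1 le_half3.
  by case: x x3 {er} => [|[|[|]]].
have -> : ev Decode st = ev (SetN VS (NAdd (NV VS) (NConst 1))) (ev (DecodeN VG e2) (ev (DecodeN VSIG e1) st)) by [].
rewrite (dE st VSIG e1 s) ?(rE st _).1 //.
rewrite (dE _ VG e2 g) ?(rE (setn st VSIG s) _).2 //.
split; first by do !apply: same_setn_in => //; exact: same_refl.
by rewrite /= /upd /= vs addn1.
Qed.

Definition cB0 n := 10 * cMx 300 n + 4 * cP + 2 * (cBal n + cMx 200 n + 20) + 4 * cMul 400 n + cRes n + cDec + 1000.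

Lemma T_callpush st s g H L : nmem st VM = 0 -> nmem st VS = s.+1 -> nmem st VG = g -> g < 3 ->
  reg d st 5 = H -> (nrm H <= 2)%R -> stk st L -> size L < cap ->
  exists2 st', T Body st (cB0 d) st' & msame st st' /\
   [/\ [/\ nmem st' VM = 0, nmem st' VS = s, nmem st' VG = g & nmem st' VL0 = nmem st VL0],
     reg d st' 5 = H, stk st' ((q H, q H, const_mx (0%:R +i* g%:R)) :: L) & nmem st' NLV = nmem st NLV].
Proof.
move=> vm vs vg g3 hH nH hs hL.
have [||| s1 t1 [f1 e1]] := @T_copy R d m p G U eps search T0 S d1 S64 rm 2 5 st (cMx 200 d) => //.
have [||| s2 t2 [f2 e2]] := @T_copy R d m p G U eps search T0 S d1 S64 rm 3 5 s1 (cMx 200 d) => //.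
have g2 : nmem s2 VG = g by rewrite (same_n f2) // (same_n f1).
have [|| s3 t3 [f3 e3]] := @T_frameF s2 (NConst 0) (NV VG) 0 g (cMx 300 d).
- by move=> st' s'; split=> //=; rewrite (same_n s').
- exact: cMx_le.
have r2 : reg d s3 2 = H.
  by rewrite (same_reg d0 f3) // (same_reg d0 f2) // e1.
have r3 : reg d s3 3 = H.
  by rewrite (same_reg d0 f3) // e2 (same_reg d0 f1).
have hs3 : stk s3 L.
  by apply: (stk_same f3) => //; apply: (stk_same f2) => //; apply: (stk_same f1).
have ps := @push_spec s3 L 0 g hs3 hL; rewrite r2 r3 e3 in ps.
have [s4 t4 [f4 k4]] := ps nH nH isT g3 erefl.
have vs4 : nmem s4 VS = s.+1.
  by rewrite (same_n f4) // (same_n f3) // (same_n f2) // (same_n f1).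
set s5 := setn s4 VS s.
have t5 : T (SetN VS (NSub (NV VS) (NConst 1))) s4 10 s5.
  have := @T_setn R d m p G U eps search T0 S S64 VS (NSub (NV VS) (NConst 1)) s4 10 isT isT.
  by rewrite /= vs4 subn1.
have f5 : same [:: VS] [::] [::] s4 s5 by apply: same_setn_in => //; exact: same_refl.
have nE k : k \notin PN -> k \notin [:: VS; 0; 1] -> nmem s5 k = nmem st k.
  move=> kP; rewrite !inE !negb_or => /and3P[k1 k2 k3].
  rewrite (same_n f5) ?inE // (same_n f4) //.
  by rewrite (same_n f3) ?(same_n f2) ?(same_n f1) // !inE negb_or k2.
exists s5.
  apply: (@T_if _ _ _ _ _ _ _ _ _ _ _ _ _ _ (10 + (cMx 200 d + (cMx 200 d + (cMx 300 d + (cP + 10)))))).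
    have -> : bev st (NLe (NV VM) (NConst 0)) by rewrite /= vm.
    apply: (@T_if _ _ _ _ _ _ _ _ _ _ _ _ _ _ (cMx 200 d + (cMx 200 d + (cMx 300 d + (cP + 10))))); last by rewrite /=; lia.
    have -> : bev st (NLe (NV VS) (NConst 0)) = false by rewrite /= vs.
    apply: T_seq t1 _ (leqnn _); apply: T_seq t2 _ (leqnn _).
    by apply: T_seq t3 _ (leqnn _); apply: T_seq t4 t5 (leqnn _).
  by apply: cost_call; exact: cMx_le.
split.
  apply: same_trans (msame_weak f1 _ _ _) _ => //; apply: same_trans (msame_weak f2 _ _ _) _ => //.
  apply: same_trans (msame_weak f3 _ _ _) _ => //.
  apply: same_trans (@msame_weakP _ _ [::] _ _ f4 _ _ _) _ => //; exact: (msame_weak f5).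
split.
- by split; [rewrite nE|rewrite /s5 /= /upd /=|rewrite nE|rewrite nE].
- rewrite (same_reg d0 f5) // (same_reg d0 f4) ?(notin_PM (l := [::])) //.
  rewrite (same_reg d0 f3) // (same_reg d0 f2) //.
  by rewrite (same_reg d0 f1).
- exact: (stk_same f5).
- by rewrite nE.
Qed.

Lemma T_down st v n : nmem st VS = v.+1 -> slcost (Down n) <= 40 ->
  exists2 st', T (Down n) st 40 st' & same [:: VG; VS; VM] [::] [::] st st' /\
    [/\ nmem st' VG = n, nmem st' VS = v & nmem st' VM = 0].
Proof.
move=> vs hc; exists (ev (Down n) st); first exact: T_sl.
split; first by do !apply: same_setn_in => //; exact: same_refl.
by rewrite /= /upd /= vs subn1.
Qed.

Lemma T_retpre st P Q F L (s g v : nat) : nmem st VM = 1 -> nmem st VS = v ->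
  F = const_mx (s%:R +i* g%:R) -> s < 3 -> g < 3 -> stk st ((P, Q, F) :: L) ->
  exists2 st1, T (Seq POP Decode) st (cP + cDec) st1 &
    same [:: 0; 1; 2; 3; 4; 5; 6; 7; 8; 9; 40; 14; 13; 11] PS ([:: 2; 3; 4] ++ PM) st st1 /\
    [/\ nmem st1 VSIG = s, nmem st1 VG = g & nmem st1 VS = v.+1] /\
    [/\ reg d st1 2 = P, reg d st1 3 = Q & stk st1 L].
Proof.
move=> vm vs hF s3 g3 hk.
have [s1 t1 [f1 [k1 r2 r3 r4]]] := pop_spec hk.
have v1 : nmem s1 VS = v by rewrite (same_n f1).
have r4' : reg d s1 4 = const_mx (s%:R +i* g%:R) by rewrite r4.
have [s2 t2 [f2 n2]] := T_decode r4' s3 g3 v1.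
exists s2; first exact: T_seq t1 t2 (leqnn _).
split; last first.
  split=> //; rewrite !(same_reg d0 f2) //; split=> //.
  exact: (stk_same f2).
apply: (same_trans (st2 := s1)).
  by apply: same_sub f1 => //; sub.
apply: same_sub f2 => //; first by sub.
Qed.

Lemma T_body_ret st st1 st2 n n1 : nmem st VM = 1 -> T (Seq POP Decode) st n1 st1 ->
  T (if nmem st1 VSIG is 0 then Ret0 PUSH POP else if nmem st1 VSIG is 1 then Ret1 PUSH else Ret2) st1 n st2 ->
  T Body st (n1 + n + 40) st2.
Proof.
move=> vm [t ht e1] t2.
apply: (@T_if _ _ _ _ _ _ _ _ _ _ _ _ _ _ (n1 + (n + 20))); last by rewrite /=; lia.
rewrite /= vm /=; inversion e1 as [| | |c1 c2 ta tb sa sb sc ea eb E1 E2 E3| | | | | | |]; subst.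
apply: (@T_seq _ _ _ _ _ _ _ _ _ _ _ _ _ sb _ ta (tb + (n + 20))); [by exists ta|..|by lia].
apply: (@T_seq _ _ _ _ _ _ _ _ _ _ _ _ _ st1 _ tb (n + 20)); [by exists tb|..|by lia].
apply: (@T_if _ _ _ _ _ _ _ _ _ _ _ _ _ _ (n + 10)); last by rewrite /=; lia.
rewrite /=; move: t2; case E: (nmem st1 VSIG) => [|[|k]] t2.
- by apply: T_le t2; lia.
- by apply: (@T_if _ _ _ _ _ _ _ _ _ _ _ _ _ _ n) => /=; [rewrite E|lia].
- by apply: (@T_if _ _ _ _ _ _ _ _ _ _ _ _ _ _ n) => /=; [rewrite E|lia].
Qed.

Lemma target_eq st st' g (P : M) : reg d st' 14 = reg d st 14 -> target st' g P = target st g P.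
Proof. by rewrite /target => ->. Qed.

Notation sameR := (same [:: 0; 1; 2; 3; 4; 5; 6; 7; 8; 9; 40; 14; 13; 11; 10; 19; 17] (iota 0 10) (iota 0 11 ++ PM)).

Lemma PMsub l : all (fun k => k <= 10) l -> {subset l ++ PM <= iota 0 11 ++ PM}.
Proof. exact: sub_PMM. Qed.

Lemma T_ret0 st P Q L (g v : nat) H : nmem st VM = 1 -> nmem st VS = v ->
  g < 3 -> stk st ((P, Q, const_mx (0%:R +i* g%:R)) :: L) -> size L < cap ->
  dag P = P -> (nrm (reg d st 1) <= 2)%R ->
  H = antiherm (unphase (dag (target st g P) *m reg d st 1)) -> (nrm H <= 2)%R -> (nrm (q H) <= 2)%R -> (nrm (q (reg d st 1)) <= 2)%R ->
  exists2 st', T Body st (cB0 d) st' & sameR st st' /\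
    [/\ [/\ nmem st' VM = 0, nmem st' VS = v & nmem st' VG = 1], reg d st' 5 = q H
     & stk st' ((q H, q (reg d st 1), const_mx (1%:R +i* g%:R)) :: L)].
Proof.
move=> vm vs g3 hk hL hP nM hH nH nqH nqM; set M0 := reg d st 1 in nM hH nqM *.
have [s1 t1 [f1 [[n1 n2 n3] [r2 r3 k1]]]] := T_retpre vm vs erefl (isT : 0 < 3) g3 hk.
have m1 : reg d s1 1 = M0 by rewrite (same_reg d0 f1) // notin_PM.
have ro1 : reg d s1 14 = reg d st 14 by rewrite (same_reg d0 f1) // PM_14.
have [||| s2 t2 [f2 e2]] := @T_copy R d m p G U eps search T0 S d1 S64 rm 5 2 s1 (cMx 200 d) => //.
rewrite r2 in e2.
have g2 : nmem s2 VG = g by rewrite (same_n f2).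
have hd2 : dag (reg d s2 5) = reg d s2 5 by rewrite e2.
have [|s3 t3 [f3 e3]] := @T_target R d m p G U eps search T0 S d1 S64 rm s2 (cBal d + cMx 200 d + 20) g g2 g3 hd2; first by [].
have {}e3 : reg d s3 0 = target st g P.
  by rewrite e3 e2; apply: target_eq; rewrite (same_reg d0 f2).
have m3 : reg d s3 1 = M0.
  by rewrite (same_reg d0 f3) // (same_reg d0 f2).
have [|s4 t4 [f4 e4]] := @T_residual R d m p G U eps search T0 S d1 S64 rm s3 (cRes d); first by [].
rewrite e3 m3 -hH in e4.
have [||| s5 t5 [f5 e5]] := @T_copy R d m p G U eps search T0 S d1 S64 rm 2 5 s4 (cMx 200 d) => //.
rewrite e4 in e5.
have [||| s6 t6 [f6 e6]] := @T_copy R d m p G U eps search T0 S d1 S64 rm 3 1 s5 (cMx 200 d) => //.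
have {}e6 : reg d s6 3 = M0.
  by rewrite e6 (same_reg d0 f5) // (same_reg d0 f4).
have g6 : nmem s6 VG = g.
  by rewrite (same_n f6) // (same_n f5) // (same_n f4) // (same_n f3).
have [|| s7 t7 [f7 e7]] := @T_frameF s6 (NConst 1) (NV VG) 1 g (cMx 300 d).
- by move=> st' s'; split=> //=; rewrite (same_n s').
- exact: cMx_le.
have r72 : reg d s7 2 = H.
  by rewrite (same_reg d0 f7) // (same_reg d0 f6) // e5.
have r73 : reg d s7 3 = M0 by rewrite (same_reg d0 f7).
have k7 : stk s7 L.
  apply: (stk_same f7) => //; apply: (stk_same f6) => //; apply: (stk_same f5) => //.
  by apply: (stk_same f4) => //; apply: (stk_same f3) => //; apply: (stk_same f2).
have ps := @push_spec s7 L 1 g k7 hL; rewrite r72 r73 e7 in ps.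
have [s8 t8 [f8 k8]] := ps nH nM isT g3 erefl.
have [s9 t9 [f9 [k9 r92 r93 r94]]] := pop_spec k8.
have [||| s10 t10 [f10 e10]] := @T_copy R d m p G U eps search T0 S d1 S64 rm 5 2 s9 (cMx 200 d) => //.
rewrite r92 in e10.
have k10 : stk s10 L by apply: (stk_same f10).
have ps2 := @push_spec s10 L 1 g k10 hL; rewrite !(same_reg d0 f10) // r92 r93 r94 in ps2.
have [s11 t11 [f11 k11]] := ps2 nqH nqM isT g3 erefl.
rewrite !q_idem in k11.
have vs11 : nmem s11 VS = v.+1.
  rewrite (same_n f11) // (same_n f10) // (same_n f9) //.
  rewrite (same_n f8) // (same_n f7) // (same_n f6) //.
  rewrite (same_n f5) // (same_n f4) // (same_n f3) //.
  by rewrite (same_n f2).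
have [|s12 t12 [f12 [n12 v12 m12]]] := @T_down s11 v 1 vs11; first by [].
have r12 : reg d s12 5 = q H.
  by rewrite (same_reg d0 f12) // (same_reg d0 f11) // (notin_PM (l := [::])).
exists s12.
  apply: (T_le (_ : cP + cDec + (cMx 200 d + (cBal d + cMx 200 d + 20 + (cRes d + (cMx 200 d + (cMx 200 d + (cMx 300 d + (cP + (cP + (cMx 200 d + (cP + 40)))))))))) + 40 <= _)).
    by apply: cost_ret0; exact: cMx_le.
  apply: (T_body_ret vm t1); rewrite n1.
  apply: T_seq t2 _ (leqnn _); apply: T_seq t3 _ (leqnn _); apply: T_seq t4 _ (leqnn _).
  apply: T_seq t5 _ (leqnn _); apply: T_seq t6 _ (leqnn _); apply: T_seq t7 _ (leqnn _).
  apply: T_seq t8 _ (leqnn _); apply: T_seq t9 _ (leqnn _); apply: T_seq t10 _ (leqnn _).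
  exact: T_seq t11 t12 (leqnn _).
split.
  apply: (same_trans (st2 := s1)); first by apply: same_sub f1; [sub|sub|exact: PMsub].
  apply: (same_trans (st2 := s2)); first by apply: same_sub f2; [sub|sub|exact: (@sub_MM [:: 5])].
  apply: (same_trans (st2 := s3)); first by apply: same_sub f3; [sub|sub|exact: sub_MM].
  apply: (same_trans (st2 := s4)); first by apply: same_sub f4; [sub|sub|exact: sub_MM].
  apply: (same_trans (st2 := s5)); first by apply: same_sub f5; [sub|sub|exact: (@sub_MM [:: 2])].
  apply: (same_trans (st2 := s6)); first by apply: same_sub f6; [sub|sub|exact: (@sub_MM [:: 3])].
  apply: (same_trans (st2 := s7)); first by apply: same_sub f7; [sub|sub|exact: (@sub_MM [:: 4])].
  apply: (same_trans (st2 := s8)); first by apply: same_sub f8; [sub|sub|exact: (@sub_PMM [::])].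
  apply: (same_trans (st2 := s9)); first by apply: same_sub f9; [sub|sub|exact: PMsub].
  apply: (same_trans (st2 := s10)); first by apply: same_sub f10; [sub|sub|exact: (@sub_MM [:: 5])].
  apply: (same_trans (st2 := s11)); first by apply: same_sub f11; [sub|sub|exact: (@sub_PMM [::])].
  by apply: same_sub f12; [sub| |].
by split => //; exact: (stk_same f12).
Qed.

Lemma T_ret1 st P Q L (g v : nat) : nmem st VM = 1 -> nmem st VS = v ->
  g < 3 -> stk st ((P, Q, const_mx (1%:R +i* g%:R)) :: L) -> size L < cap ->
  (nrm (reg d st 1) <= 2)%R -> (nrm Q <= 2)%R ->
  exists2 st', T Body st (cB0 d) st' & sameR st st' /\
    [/\ [/\ nmem st' VM = 0, nmem st' VS = v & nmem st' VG = 2], reg d st' 5 = P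
     & stk st' ((q (reg d st 1), q Q, const_mx (2%:R +i* 0%:R)) :: L)].
Proof.
move=> vm vs g3 hk hL nM nQ; set M0 := reg d st 1 in nM *.
have [s1 t1 [f1 [[n1 n2 n3] [r2 r3 k1]]]] := T_retpre vm vs erefl (isT : 1 < 3) g3 hk.
have m1 : reg d s1 1 = M0 by rewrite (same_reg d0 f1) // notin_PM.
have [||| s2 t2 [f2 e2]] := @T_copy R d m p G U eps search T0 S d1 S64 rm 5 2 s1 (cMx 200 d) => //.
rewrite r2 in e2.
have [||| s3 t3 [f3 e3]] := @T_copy R d m p G U eps search T0 S d1 S64 rm 2 1 s2 (cMx 200 d) => //.
have {}e3 : reg d s3 2 = M0 by rewrite e3 (same_reg d0 f2).
have [|| s4 t4 [f4 e4]] := @T_frameF s3 (NConst 2) (NConst 0) 2 0 (cMx 300 d).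
- by [].
- exact: cMx_le.
have r42 : reg d s4 2 = M0 by rewrite (same_reg d0 f4).
have r43 : reg d s4 3 = Q.
  by rewrite (same_reg d0 f4) // (same_reg d0 f3) // (same_reg d0 f2).
have k4 : stk s4 L.
  by apply: (stk_same f4) => //; apply: (stk_same f3) => //; apply: (stk_same f2).
have ps := @push_spec s4 L 2 0 k4 hL; rewrite r42 r43 e4 in ps.
have [s5 t5 [f5 k5]] := ps nM nQ isT isT erefl.
have vs5 : nmem s5 VS = v.+1.
  rewrite (same_n f5) // (same_n f4) // (same_n f3) //.
  by rewrite (same_n f2).
have [|s6 t6 [f6 [n6 v6 m6]]] := @T_down s5 v 2 vs5; first by [].
exists s6.
  apply: (T_le (_ : cP + cDec + (cMx 200 d + (cMx 200 d + (cMx 300 d + (cP + 40)))) + 40 <= _)).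
    by apply: cost_ret1; exact: cMx_le.
  apply: (T_body_ret vm t1); rewrite n1.
  apply: T_seq t2 _ (leqnn _); apply: T_seq t3 _ (leqnn _); apply: T_seq t4 _ (leqnn _).
  exact: T_seq t5 t6 (leqnn _).
split.
  apply: (same_trans (st2 := s1)); first by apply: same_sub f1; [sub|sub|exact: PMsub].
  apply: (same_trans (st2 := s2)); first by apply: same_sub f2; [sub|sub|exact: (@sub_MM [:: 5])].
  apply: (same_trans (st2 := s3)); first by apply: same_sub f3; [sub|sub|exact: (@sub_MM [:: 2])].
  apply: (same_trans (st2 := s4)); first by apply: same_sub f4; [sub|sub|exact: (@sub_MM [:: 4])].
  apply: (same_trans (st2 := s5)); first by apply: same_sub f5; [sub|sub|exact: (@sub_PMM [::])].
  by apply: same_sub f6; [sub| |].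
split => //; last exact: (stk_same f6).
rewrite (same_reg d0 f6) // (same_reg d0 f5) ?(notin_PM (l := [::])) //.
by rewrite (same_reg d0 f4) // (same_reg d0 f3).
Qed.

Fixpoint lam s := if s is s'.+1 then 3 * lam s' + 1 else lam0.

Lemma T_lamloop st s : nmem st VS = s.+1 -> nmem st VL0 = lam0 ->
  exists2 st', T LamLoop st (50 + s * 60) st' & same [:: 19; LAM] [::] [::] st st' /\ nmem st' LAM = lam s.
Proof.
move=> vs vl; set s1 := setn st LAM lam0.
have t1 : T (SetN LAM (NV VL0)) st 4 s1.
  have := @T_setn R d m p G U eps search T0 S S64 LAM (NV VL0) st 4 isT isT.
  by rewrite /= vl.
pose I i st' := same [:: 19; LAM] [::] [::] st st' /\ nmem st' LAM = lam i.
have [|||||st' t' [f' e']] := @T_for R d m p G U eps search T0 S S64 I 19 (NSub (NV VS) (NConst 1))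
  (SetN LAM (NAdd (NMul (NConst 3) (NV LAM)) (NConst 1))) s1 s 20 (46 + s * 60) isT.
- by move=> i st' x [s' h]; split => //; exact: same_setn_in.
- by move=> i st' [s' _] /=; rewrite (same_n s') //= vs subn1.
- by split => //; apply: same_setn_in => //; exact: same_refl.
- move=> i st' il [s' h] v19; exists (setn st' LAM (lam i.+1)).
    have := @T_setn R d m p G U eps search T0 S S64 LAM (NAdd (NMul (NConst 3) (NV LAM)) (NConst 1)) st' 20 isT isT.
    by rewrite /= h.
  by split => //; split => //; exact: same_setn_in.
- by rewrite /=; lia.
by exists st' => //; apply: T_seq t1 t' _; lia.
Qed.

Lemma T_ret2 st P Q L (g v : nat) : nmem st VM = 1 -> nmem st VS = v ->
  g < 3 -> stk st ((P, Q, const_mx (2%:R +i* g%:R)) :: L) -> nmem st VL0 = lam0 ->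
  nmem st LLV = (size (slp st)).-1 -> 3 * lam v <= size (slp st) ->
  let C := reg d st 1 in
  exists2 st', T Body st (cB0 d + v * 60) st' &
    frame MN MS MM st st' /\
    [/\ [/\ nmem st' VM = 1, nmem st' VS = v.+1, nmem st' VL0 = lam0 & ans st' = ans st],
      lines_ok st' /\ nmem st' LLV = (size (slp st')).-1,
      reg d st' 1 = Q *m ((P *m C) *m (dag P *m dag C)), stk st' L &
      slp st' = rcons (slp st) [:: LineRef false ((size (slp st)).-1 - 2 * lam v);
        LineRef false ((size (slp st)).-1 - lam v); LineRef false (size (slp st)).-1;
        LineRef true ((size (slp st)).-1 - lam v); LineRef true (size (slp st)).-1]].
Proof.
move=> vm vs g3 hk hl0 hll hsz C.
have [s1 t1 [f1 [[n1 n2 n3] [r2 r3 k1]]]] := T_retpre vm vs erefl (isT : 2 < 3) g3 hk.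
have m1 : reg d s1 1 = C by rewrite (same_reg d0 f1) // notin_PM.
have [|||| s2 t2 [f2 e2]] := @T_mulreg R d m p G U eps search T0 S d1 S64 rm 6 false 2 false 1 s1 (cMul 400 d) => //.
have {}e2 : reg d s2 6 = P *m C by rewrite e2 r2 m1.
have [|||| s3 t3 [f3 e3]] := @T_mulreg R d m p G U eps search T0 S d1 S64 rm 7 true 2 true 1 s2 (cMul 400 d) => //.
have {}e3 : reg d s3 7 = dag P *m dag C.
  by rewrite e3 !(same_reg d0 f2) // r2 m1.
have [|||| s4 t4 [f4 e4]] := @T_mulreg R d m p G U eps search T0 S d1 S64 rm 8 false 6 false 7 s3 (cMul 400 d) => //.
have {}e4 : reg d s4 8 = (P *m C) *m (dag P *m dag C).
  by move: e4; rewrite e3 (same_reg d0 f3) // e2 => e4; exact: e4.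
have [|||| s5 t5 [f5 e5]] := @T_mulreg R d m p G U eps search T0 S d1 S64 rm 6 false 3 false 8 s4 (cMul 400 d) => //.
have {}e5 : reg d s5 6 = Q *m ((P *m C) *m (dag P *m dag C)).
  rewrite e5 e4 (same_reg d0 f4) // (same_reg d0 f3) //.
  by rewrite (same_reg d0 f2) // r3.
have [||| s6 t6 [f6 e6]] := @T_copy R d m p G U eps search T0 S d1 S64 rm 1 6 s5 (cMx 200 d) => //.
rewrite e5 in e6.
have nE k : k \notin [:: 0; 1; 2] -> nmem s6 k = nmem s1 k.
  rewrite !inE !negb_or => /and3P[k1' k2' k3'].
  rewrite (same_n f6) ?(same_n f5) ?(same_n f4) ?(same_n f3) ?(same_n f2) //;
  by rewrite !inE !negb_or ?k1' ?k2' ?k3'.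
have vs6 : nmem s6 VS = v.+1 by rewrite nE.
have l06 : nmem s6 VL0 = lam0 by rewrite nE // (same_n f1).
have [s7 t7 [f7 e7]] := T_lamloop vs6 l06.
have sl7 : slp s7 = slp st.
  by rewrite (same_slp f7) (same_slp f6) (same_slp f5) (same_slp f4) (same_slp f3) (same_slp f2) (same_slp f1).
have ll7 : nmem s7 LLV = (size (slp st)).-1.
  by rewrite (same_n f7) // nE // (same_n f1).
have sz : 0 < size (slp st) by apply: leq_trans hsz; rewrite muln_gt0 /=; elim: (v) => //= n; rewrite addn1.
set l' := map (ref_map (nev s7)) CommLine.
have l'E : l' = [:: LineRef false ((size (slp st)).-1 - 2 * lam v);
        LineRef false ((size (slp st)).-1 - lam v); LineRef false (size (slp st)).-1;
        LineRef true ((size (slp st)).-1 - lam v); LineRef true (size (slp st)).-1].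
  by rewrite /l' /= ll7 e7.
have t8 : T (Emit (NConst LLV) CommLine) s7 100 (add_line s7 LLV l').
  have := @T_emit R d m p G U eps search T0 S d0 S64 LLV CommLine s7 100 isT.
  rewrite -/l'; apply; last by rewrite !big_cons big_nil.
  rewrite l'E sl7 /=; move: (lam v) (size (slp st)) sz; clear; lia.
set s8 := add_line s7 LLV l' in t8.
set s9 := setn s8 NLV (size (slp st)).+1.
have t9 : T (SetN NLV (NAdd (NV LLV) (NConst 1))) s8 10 s9.
  have := @T_setn R d m p G U eps search T0 S S64 NLV (NAdd (NV LLV) (NConst 1)) s8 10 isT isT.
  by rewrite /= /upd /= sl7 addn1.
have f89 : frame [:: LLV; NLV] [::] [::] s7 s9.
  by split=> // k; rewrite !inE negb_or => /andP[h1 h2]; rewrite /= /upd (negPf h1) (negPf h2).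
exists s9.
  apply: (T_le (_ : cP + cDec + (cMul 400 d + (cMul 400 d + (cMul 400 d + (cMul 400 d + (cMx 200 d + (50 + v * 60 + (100 + 10))))))) + 40 <= _)).
    by apply: cost_ret2; exact: cMx_le.
  apply: (T_body_ret vm t1); rewrite n1.
  apply: T_seq t2 _ (leqnn _); apply: T_seq t3 _ (leqnn _); apply: T_seq t4 _ (leqnn _).
  apply: T_seq t5 _ (leqnn _); apply: T_seq t6 _ (leqnn _); apply: T_seq t7 _ (leqnn _).
  exact: T_seq t8 t9 (leqnn _).
have fall : frame MN MS MM st s9.
  apply: (frame_trans (st2 := s1)); first by apply: frame_sub (same_frame f1); [sub|sub|exact: sub_PMM].
  apply: (frame_trans (st2 := s2)); first by apply: frame_sub (same_frame f2); [sub|sub|exact: sub_MM].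
  apply: (frame_trans (st2 := s3)); first by apply: frame_sub (same_frame f3); [sub|sub|exact: sub_MM].
  apply: (frame_trans (st2 := s4)); first by apply: frame_sub (same_frame f4); [sub|sub|exact: sub_MM].
  apply: (frame_trans (st2 := s5)); first by apply: frame_sub (same_frame f5); [sub|sub|exact: sub_MM].
  apply: (frame_trans (st2 := s6)); first by apply: frame_sub (same_frame f6); [sub|sub|exact: sub_MM].
  apply: (frame_trans (st2 := s7)); first by apply: frame_sub (same_frame f7); [sub| |].
  by apply: frame_sub f89; [sub| |].
split => //; split.
- split.
  + rewrite (frame_n f89) // (same_n f7) // nE //.
    by rewrite (same_n f1).
  + by rewrite (frame_n f89) // (same_n f7) // nE.
  + by rewrite (frame_n f89) // (same_n f7).
  + by rewrite /= (same_ans f7) (same_ans f6) (same_ans f5) (same_ans f4) (same_ans f3) (same_ans f2) (same_ans f1).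
- by rewrite /lines_ok /= /upd /= size_rcons sl7.
- by rewrite (frame_reg d0 f89) // (same_reg d0 f7).
- apply: stk_frame (frame_sub _ _ _ f89) _ => //; first by sub.
  apply: (stk_same f7) => //; apply: (stk_same f6) => //; apply: (stk_same f5) => //.
  by apply: (stk_same f4) => //; apply: (stk_same f3) => //; apply: (stk_same f2).
- by rewrite /= sl7 l'E.
Qed.

Definition cLeaf n := cBal n + cMx 200 n + 100 + cL.

Lemma T_leafcall st g H : nmem st VM = 0 -> nmem st VS = 0 -> nmem st VG = g -> g < 3 ->
  reg d st 5 = H -> dag H = H -> inv st -> lines_ok st -> unitary (target st g H) -> (special -> \det (target st g H) = 1%R) ->
  exists2 st', T Body st (cLeaf d) st' & frame (19 :: MN) MS (iota 0 11) st st' /\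
    [/\ nmem st' VM = 1, nmem st' VS = 0, nmem st' VL0 = lam0, forall L, stk st L -> stk st' L
      & sk_result st st' zeta (e 0) lam0 l0 (target st g H)].
Proof.
move=> vm vs vg g3 hH dH hi hl uA dA.
have dH' : dag (reg d st 5) = reg d st 5 by rewrite hH.
have [|s1 t1 [f1 e1]] := @T_target R d m p G U eps search T0 S d1 S64 rm st (cBal d + cMx 200 d + 20) g vg g3 dH'; first by [].
rewrite hH in e1.
set s2 := setn s1 19 (size (slp st)).
have nl1 : nmem s1 NLV = size (slp st) by rewrite (same_n f1).
have t2 : T (SetN 19 (NV NLV)) s1 10 s2.
  by have := @T_setn R d m p G U eps search T0 S S64 19 (NV NLV) s1 10 isT isT; rewrite /= nl1.
have f2 : same [:: 19] [::] [::] s1 s2 by apply: same_setn_in => //; exact: same_refl.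
have r2 : reg d s2 0 = target st g H by rewrite (same_reg d0 f2).
have m2 : msame st s2.
  by apply: (same_trans (st2 := s1)); [apply: (msame_weak f1)|apply: (msame_weak f2)].
have [|||| s3 t3 [f3 [[lo3 ll3] an3 [Ls sl3 sL] sw3 hw3]]] := leaf_spec (st := s2).
- exact: msame_inv m2 hi.
- by rewrite /lines_ok (same_slp m2) (same_n f2).
- by rewrite r2.
- by rewrite r2.
rewrite r2 in hw3; rewrite (same_slp m2) in sl3; rewrite (same_ans m2) in an3.
have n19 : nmem s3 19 = size (slp st) by rewrite (frame_n f3).
set s4 := setn (setn s3 VL0 lam0) VM 1.
have t4 : T (Seq (SetN VL0 (NSub (NV NLV) (NV 19))) (SetN VM (NConst 1))) s3 20 s4.
  suff -> : s4 = ev (Seq (SetN VL0 (NSub (NV NLV) (NV 19))) (SetN VM (NConst 1))) s3 by apply: T_sl.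
  by rewrite /s4 /= lo3 sl3 n19 size_cat addKn sL.
have f4 : same [:: VL0; VM] [::] [::] s3 s4 by do !apply: same_setn_in => //; exact: same_refl.
have f24 : frame ([:: VL0; VM] ++ LN) MS (iota 0 11) s2 s4.
  by apply: (frame_trans (st2 := s3)); [apply: frame_sub f3|apply: frame_sub (same_frame f4)]; sub.
exists s4.
  apply: (@T_if _ _ _ _ _ _ _ _ _ _ _ _ _ _ (cBal d + cMx 200 d + 20 + (10 + (cL + 20)) + 10)); last by rewrite /cLeaf /=; lia.
  have -> : bev st (NLe (NV VM) (NConst 0)) by rewrite /= vm.
  apply: (@T_if _ _ _ _ _ _ _ _ _ _ _ _ _ _ (cBal d + cMx 200 d + 20 + (10 + (cL + 20)))); last by rewrite /=; lia.
  have -> : bev st (NLe (NV VS) (NConst 0)) by rewrite /= vs.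
  apply: T_seq t1 _ (leqnn _); apply: T_seq t2 _ (leqnn _); exact: T_seq t3 t4 (leqnn _).
have fr : frame (19 :: MN) MS (iota 0 11) st s4.
  apply: (frame_trans (st2 := s1)); first by apply: frame_sub (same_frame f1); sub.
  apply: (frame_trans (st2 := s2)); first by apply: frame_sub (same_frame f2); sub.
  by apply: frame_sub f24; sub.
split => //; split => //.
- rewrite (frame_n f24) // (same_n f2) // (same_n f1) //.
- move=> L hL; apply: stk_frame hL.
  apply: (frame_trans (st2 := s1)); first by apply: frame_sub (same_frame f1); sub.
  apply: (frame_trans (st2 := s2)); first by apply: frame_sub (same_frame f2); sub.
  by apply: frame_sub f24; sub.
- by split => //; exists Ls.
Qed.

Definition rho s : R := (12 ^+ s * zeta)%R.
Definition cG := (bexp_cost Guard).+1.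
Fixpoint tau s := if s is s'.+1 then 3 * tau s' + 4 * (cB0 d + s' * 60 + cG) else cLeaf d + cG.

Lemma e_bounds s : (0 <= e s <= (1 / 512) ^+ 2)%R.
Proof.
elim: s => [|s /andP[h0 h1]]; first exact: e0.
have r0 : (0 <= Num.sqrt (e s))%R by exact: sqrtr_ge0.
have r1 : (Num.sqrt (e s) <= 1 / 512)%R.
  by apply: sqrt_le h1; exact: (c512 R).
rewrite eS; apply/andP; split; first exact: mulr_ge0 (ler0n _ _) (mulr_ge0 h0 r0).
apply: le_trans h1; have : (e s * Num.sqrt (e s) <= e s * (1 / 512))%R by rewrite ler_wpM2l.
lra.
Qed.

Lemma rho_ge s : (zeta <= rho s)%R.
Proof. by rewrite /rho ler_peMl // exprn_ege1 // ler1n. Qed.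

Lemma normc_phase (z : R[i]) : (normc (z^*%C / (normc z)%:C) <= 1)%R.
Proof.
have [->|z0] := eqVneq (normc z) 0%R; last by rewrite normc_unit_div.
by rewrite rmorph0 invr0 mulr0 normc0.
Qed.

(** Keeps the generator within norm 2, the range in which the stack accepts a matrix. *)
Lemma nrm_residual (A X : M) x : unitary A -> (nrm X <= x)%R -> (nrm (antiherm (unphase (dag A *m X))) <= x)%R.
Proof.
move=> uA hX; apply: nrm_antiherm; apply: le_trans (nrmZ_le _ _) _.
apply: le_trans (ler_wpM2r (nrm_ge0 _) (normc_phase _)) _; rewrite mul1r nrm_mulU //.
by uni.
Qed.

Lemma lastw_cat st st' Ls : slp st' = slp st ++ Ls -> 0 < size (slp st) ->
  wd G (slp st') (size (slp st)).-1 = lastw st.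
Proof. by move=> -> h; rewrite /lastw wd_cat // prednK. Qed.

Lemma lam_gt0 s : 0 < lam s.
Proof. by case: s => //= s; rewrite addn1. Qed.

(** Induction on the level. Nested calls overwrite the low registers, so whatever is needed
    afterwards (the Hermitian matrix, the kind, the first two results) travels through the stack.
    [sk_level] gives the error of the word and [product_error] that of its numerical value. *)
Lemma call_spec s : s <= Tt -> forall st L g H, nmem st VM = 0 -> nmem st VS = s -> nmem st VT = Tt ->
  nmem st VG = g -> g < 3 -> reg d st 5 = H -> dag H = H -> (nrm H <= 2)%R -> q H = H ->
  inv st -> lines_ok st -> unitary (target st g H) -> (special -> \det (target st g H) = 1%R) ->
  stk st L -> size L + s <= cap ->
  exists2 st', steps st (tau s) st' & frame MN MS MM st st' /\
    [/\ nmem st' VM = 1, nmem st' VS = s, nmem st' VL0 = lam0, stk st' L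
      & sk_result st st' (rho s) (e s) (lam s) (5 ^ s * l0) (target st g H)].
Proof.
elim: s => [|s IH] sT st L g H vm vs vt vg g3 hH dH nH qH hi hl uA dA hk hL.
  have [st' t' [f' [vm' vs' vl' k' res]]] := T_leafcall vm vs vg g3 hH dH hi hl uA dA.
  exists st'; first by apply: steps_one t' (leqnn _); rewrite guardE vm.
  split; first by apply: frame_sub f'; [sub|sub|exact: sub_MM].
  split => //; first exact: k'.
  by rewrite /rho expr0 mul1r mul1n.
set A := target st g H in uA dA *.
have sT' : s <= Tt := ltnW sT.
have sN : (Tt <= s) = false by rewrite leqNgt sT.
have Lc : size L < cap by apply: leq_trans hL; rewrite addnS ltnS leq_addr.
have [st1 t1 [f1 [[vm1 vs1 vg1 _] h1 k1 nl1]]] := T_callpush vm vs vg g3 hH nH hk Lc.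
(* The frame contains the rounded matrix, which is H itself; the target recomputed after the return
   is therefore the one of this call. *)
rewrite qH in k1.
have A1 : target st1 g H = A by apply: target_eq; exact: msame_root f1.
have vt1 : nmem st1 VT = Tt by rewrite (msame_vt f1).
have [||||st2 p2 [f2 [vm2 vs2 vl2 k2 [[lo2 ll2] an2 [Ls2 sl2 zl2] sw2]]]] :=
  IH sT' st1 _ g H vm1 vs1 vt1 vg1 g3 h1 dH nH qH (msame_inv f1 hi) _ _ _ k1 _.
- by rewrite /lines_ok nl1 (same_slp f1).
- by rewrite A1.
- by rewrite A1.
- by rewrite /= addSnnS.
cbv zeta; rewrite A1; set B0 := word_eval G (lastw st2); set M0 := reg d st2 1.
move=> [hM0 p0].
have /andP[es0 es1] := e_bounds s.
set r := Num.sqrt (e s); have r0 : (0 <= r)%R by exact: sqrtr_ge0.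
have er : e s = (r ^+ 2)%R by rewrite sqr_sqrtr.
have r1 : (r <= 1 / 512)%R.
  by apply: sqrt_le es1; exact: (c512 R).
have hrho : (rho s <= e s ^+ 2)%R by exact: zeta_e.
have hz := rho_ge s.
have hzeta : (zeta <= e s ^+ 2)%R by exact: le_trans hrho.
have e2s : (e s ^+ 2 <= 1 / 512)%R.
  have h512 : ((1 / 512) ^+ 2 <= 1 / 512 :> R)%R by rewrite expr2; lra.
  have : (e s <= 1 / 512)%R by exact: le_trans h512.
  by rewrite expr2; nra.
have uB0 : unitary B0 by exact: word_unitary.
have nearU (X B : M) : unitary B -> (nrm (X - B) <= rho s)%R -> (nrm X <= 1 + 1 / 512)%R.
  move=> uB hX; have -> : X = (X - B + B)%R by rewrite subrK.
  by have := nrmD_le hX (nrm_unitary uB); lra.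
have nM0 := nearU _ _ uB0 hM0.
set K := antiherm (unphase (dag A *m M0)).
have nK : (nrm K <= 1 + 1 / 512)%R by exact: nrm_residual.
have nq (X : M) : (nrm X <= 1 + 1 / 512)%R -> (nrm (q X) <= 2)%R.
  move=> hX; have -> : q X = (q X - X + X)%R by rewrite subrK.
  by have := nrmD_le (q_near X) hX; lra.
have le2 (X : M) : (nrm X <= 1 + 1 / 512)%R -> (nrm X <= 2)%R by lra.
have dK : dag (q K) = q K by apply: q_dag; exact: antiherm_dag.
have [[uV dV] [uW dW] lvl] := sk_level d1 r0 er r1 hrho hzeta uA uB0 p0 hM0 dK (q_near K).
have g2 : bev st2 Guard by rewrite guardE vs2 (frame_n (k := VT) f2 isT) vt1 sN andbF.
have A2 : target st2 g H = A.
  by rewrite -A1; apply: target_eq; apply: (frame_reg d0 f2); apply: PM_14.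
have KE : K = antiherm (unphase (dag (target st2 g H) *m reg d st2 1)) by rewrite A2.
have [st3 t3 [f3 [[vm3 vs3 vg3] h3 k3]]] := T_ret0 vm2 vs2 g3 k2 Lc dH (le2 _ nM0) KE (le2 _ nK) (nq _ nK) (nq _ nM0).
have m3 : msame st2 st3 by apply: same_sub f3; sub.
have vt3 : nmem st3 VT = Tt by rewrite (msame_vt m3) (frame_n (k := VT) f2 isT).
have nl3 : lines_ok st3 by rewrite /lines_ok (same_slp f3) (frame_n (k := NLV) (same_frame f3) isT).
have inv2 : inv st2 by apply: (inv_step (msame_inv f1 hi) f2 sl2).
have Lc1 : size L < cap by [].
have [|st4 p4 [f4 [vm4 vs4 vl4 k4 [[lo4 ll4] an4 [Ls4 sl4 zl4] sw4]]]] :=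
  IH sT' st3 _ 1 (q K) vm3 vs3 vt3 vg3 isT h3 dK (nq _ nK) (q_idem K) (msame_inv m3 inv2) nl3 uV (fun _ => dV) k3 _.
- by rewrite /= addSnnS.
cbv zeta; set B1 := word_eval G (lastw st4); set M1 := reg d st4 1.
move=> [hM1 p1].
have uB1 : unitary B1 by exact: word_unitary.
have nM1 := nearU _ _ uB1 hM1.
have g4 : bev st4 Guard by rewrite guardE vs4 (frame_n (k := VT) f4 isT) vt3 sN andbF.
have [st5 t5 [f5 [[vm5 vs5 vg5] h5 k5]]] := T_ret1 vm4 vs4 g3 k4 Lc (le2 _ nM1) (nq _ nM0).
rewrite q_idem in k5.
have m5 : msame st4 st5 by apply: same_sub f5; sub.
have vt5 : nmem st5 VT = Tt by rewrite (msame_vt m5) (frame_n (k := VT) f4 isT).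
have nl5 : lines_ok st5 by rewrite /lines_ok (same_slp f5) (frame_n (k := NLV) (same_frame f5) isT).
have inv4 : inv st4 by apply: (inv_step (msame_inv m3 inv2) f4 sl4).
have [|st6 p6 [f6 [vm6 vs6 vl6 k6 [[lo6 ll6] an6 [Ls6 sl6 zl6] sw6]]]] :=
  IH sT' st5 _ 2 (q K) vm5 vs5 vt5 vg5 isT h5 dK (nq _ nK) (q_idem K) (msame_inv m5 inv4) nl5 uW (fun _ => dW) k5 _.
- by rewrite /= addSnnS.
cbv zeta; set B2 := word_eval G (lastw st6); set M2 := reg d st6 1.
move=> [hM2 p2'].
have uB2 : unitary B2 by exact: word_unitary.
have g6 : bev st6 Guard by rewrite guardE vs6 (frame_n (k := VT) f6 isT) vt5 sN andbF.
rewrite (same_slp f5) in sl6; rewrite (same_slp f3) in sl4; rewrite (same_slp f1) in sl2.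
have z2 : size (slp st2) = size (slp st) + lam s by rewrite sl2 size_cat zl2.
have z4 : size (slp st4) = size (slp st) + 2 * lam s by rewrite sl4 size_cat zl4 z2; clear; lia.
have z6 : size (slp st6) = size (slp st) + 3 * lam s by rewrite sl6 size_cat zl6 z4; clear; lia.
have lp := lam_gt0 s.
have [|st7 t7 [f7 [[vm7 vs7 vl7 an7] [lo7 ll7] h7 k7 sl7]]] := T_ret2 vm6 vs6 (isT : 0 < 3) k6 vl6 ll6.
  by rewrite z6 leq_addl.
exists st7.
  apply: steps_le (_ : _ + (_ + (_ + (_ + (_ + (_ + _))))) <= _) _; last first.
    apply: steps_trans (steps_one (_ : bev st Guard) t1 (leqnn _)) _ (leqnn _); first by rewrite guardE vm.
    apply: steps_trans p2 _ (leqnn _); apply: steps_trans (steps_one g2 t3 (leqnn _)) _ (leqnn _).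
    apply: steps_trans p4 _ (leqnn _); apply: steps_trans (steps_one g4 t5 (leqnn _)) _ (leqnn _).
    apply: steps_trans p6 (steps_one g6 t7 (leqnn _)) (leqnn _).
  rewrite [tau s.+1]/= /cG; clear; lia.
have fall : frame MN MS MM st st7.
  apply: (frame_trans (st2 := st1)); first exact: same_frame f1.
  apply: (frame_trans f2); apply: (frame_trans (same_frame m3)).
  apply: (frame_trans f4); apply: (frame_trans (same_frame m5)).
  exact: (frame_trans f6 f7).
have w0 : wd G (slp st6) ((size (slp st6)).-1 - 2 * lam s) = lastw st2.
  have -> : (size (slp st6)).-1 - 2 * lam s = (size (slp st2)).-1 by rewrite z6 z2; move: lp; clear; lia.
  by apply: (lastw_cat (Ls := Ls4 ++ Ls6)); [rewrite sl6 sl4 catA|rewrite z2; move: lp; clear; lia].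
have w1 : wd G (slp st6) ((size (slp st6)).-1 - lam s) = lastw st4.
  have -> : (size (slp st6)).-1 - lam s = (size (slp st4)).-1 by rewrite z6 z4; move: lp; clear; lia.
  by apply: (lastw_cat (Ls := Ls6)); [rewrite sl6|rewrite z4; move: lp; clear; lia].
have lw7 : lastw st7 = lastw st2 ++ lastw st4 ++ lastw st6 ++ inv_word G (lastw st4) ++ inv_word G (lastw st6).
  rewrite /lastw sl7 size_rcons [_.-1]/= wd_rcons /= -!/(wd G (slp st6) _) w0 w1 cats0 //.
split; first exact: fall.
split; [exact: vm7|exact: vs7|exact: vl7|exact: k7|split; first exact: conj lo7 ll7].
- by rewrite an7 an6 (same_ans f5) an4 (same_ans f3) an2 (same_ans f1).
- exists (Ls2 ++ Ls4 ++ Ls6 ++ [:: last [::] (slp st7)]).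
    rewrite sl7 sl6 sl4 sl2 -cats1 last_cat /= -!catA //.
  by rewrite !size_cat /= zl2 zl4 zl6; clear; lia.
- by rewrite lw7 !size_cat !size_inv_word expnS; move: sw2 sw4 sw6; clear; lia.
have BE : word_eval G (lastw st7) = B0 *m gcomm B1 B2.
  by rewrite lw7; exact: word_eval_comm.
cbv zeta; rewrite BE h7; split; last by rewrite eS; exact: lvl.
(* The first two results have been on the stack and pay one more zeta; idempotence of q prevents the
   first from paying twice. The third is still in register 1. *)
have qn (X B : M) : (nrm (X - B) <= rho s -> nrm (q X - B) <= rho s + zeta)%R.
  by move=> hX; apply: le_trans (nrm_tri X _ _) _; rewrite addrC; apply: lerD hX (q_near X).
have hr2 : (nrm (M2 - B2) <= rho s + zeta)%R by apply: le_trans hM2 _; rewrite lerDl; exact: zeta0.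
have r20 : (rho s + zeta <= 1 / 20)%R := rho_small hz hrho e2s.
apply: le_trans (product_error r20 uB0 uB1 uB2 (qn _ _ hM0) (qn _ _ hM1) hr2) _.
have -> : rho s.+1 = (12 * rho s)%R by rewrite /rho exprS mulrA.
exact: rho_double.
Qed.

End Machine.

Local Open Scope ring_scope.
Local Open Scope sesquilinear_scope.
Local Open Scope complex_scope.

(** * Rounding by tangents and extraction of digits *)

Section Rounding.
Variable R : realType.
Implicit Types (x y : R).

(* Nearest integer; at half-integers the tangent is a junk value 0 and rnd is the identity. *)
Definition rnd x : R := x - atan (sin (pi * x) / cos (pi * x)) / pi.

Lemma cos_pi_nat (n : nat) : cos (pi *+ n) = (-1) ^+ n :> R /\ sin (pi *+ n) = 0 :> R.
Proof.
elim: n => [|n [IH1 IH2]]; first by rewrite mulr0n cos0 sin0 expr0.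
rewrite (mulrS pi n) (cosD pi) (sinD pi) IH1 IH2 cospi sinpi exprS; split; ring.
Qed.

Lemma tan_shift (z : int) x :
  sin (pi * (x + z%:~R)) / cos (pi * (x + z%:~R)) = sin (pi * x) / cos (pi * x).
Proof.
have hn (n : nat) y : sin (pi * (y + n%:R)) / cos (pi * (y + n%:R)) = sin (pi * y) / cos (pi * y).
  have [c s] := cos_pi_nat n; rewrite mulrDr mulr_natr cosD sinD c s !mulr0 addr0 subr0.
  have : ((-1) ^+ n : R) != 0 by rewrite signr_eq0.
  by move=> h; rewrite invfM mulrACA divff // mulr1.
case: z => n; first exact: hn.
by rewrite NegzE mulrNz -(hn n.+1 (x + - n.+1%:R)) subrK.
Qed.

Lemma rnd_shift (z : int) x : rnd (x + z%:~R) = rnd x + z%:~R.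
Proof. by rewrite /rnd tan_shift addrAC. Qed.

Lemma rnd_small x : `|x| < 1 / 2 -> rnd x = 0.
Proof.
move=> h; rewrite /rnd -/(tan (pi * x)) tanK; last first.
  rewrite in_itv /=; move: h; rewrite ltr_norml => /andP[h1 h2]; have p := pi_gt0 R.
  by apply/andP; split; nra.
by rewrite mulrC mulKf ?subrr // gt_eqF // pi_gt0.
Qed.

Lemma rndE (z : int) x : `|x - z%:~R| < 1 / 2 -> rnd x = z%:~R.
Proof. by move=> h; rewrite -{1}[x](subrK z%:~R) rnd_shift rnd_small // add0r. Qed.

Lemma rnd_int (z : int) : rnd z%:~R = z%:~R.
Proof. by apply: rndE; rewrite subrr normr0 divr_gt0. Qed.

Lemma rnd0 : rnd 0 = 0. Proof. exact: (rnd_int 0). Qed.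

Lemma rnd_half : rnd (1 / 2) = 1 / 2.
Proof. by rewrite /rnd mulrA mulr1 cos_pihalf invr0 mulr0 atan0 mul0r subr0. Qed.

(** The floor of x + 1/2 is the nearest integer, except when x + 1/2 is itself an integer; there the
    cosine vanishes and x is returned unchanged. *)
Lemma rnd_cases x : (exists z : int, rnd x = z%:~R /\ `|x - z%:~R| < 1 / 2) \/
  (exists z : int, rnd x = z%:~R + 1 / 2 /\ x = z%:~R + 1 / 2).
Proof.
pose z := Num.floor (x + 1 / 2).
have /andP[h1 h2] : z%:~R <= x + 1 / 2 < (z + 1)%:~R by rewrite floor_le_tmp floorD1_gt.
rewrite intrD in h2.
have [e|ne] := eqVneq (x + 1 / 2) z%:~R.
  right; exists (z - 1); rewrite intrB -e; split; last by lra.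
  have -> : x = 1 / 2 + (z - 1)%:~R by rewrite intrB -e; lra.
  by rewrite rnd_shift rnd_half intrB -e; lra.
left; exists z; have : `|x - z%:~R| < 1 / 2; last by move=> h; split => //; exact: rndE.
have : z%:~R < x + 1 / 2 by rewrite lt_neqAle eq_sym ne.
by rewrite ltr_norml => h3; apply/andP; split; lra.
Qed.

Lemma rnd_near x : `|rnd x - x| <= 1 / 2.
Proof.
have [[z [-> h]]|[z [-> ->]]] := rnd_cases x; first by rewrite distrC ltW.
by rewrite subrr normr0 divr_ge0.
Qed.

(** Half-integers are fixed by [rnd], so only the double is always an integer. This is why digits
    are stored as [2 * rnd] and the factor 2 B appears in the packed formats. *)
Lemma rnd2_int x : exists z : int, 2 * rnd x = z%:~R.
Proof.
have [[z [-> _]]|[z [-> _]]] := rnd_cases x.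
  by exists (2 * z); rewrite intrM.
by exists (2 * z + 1); rewrite intrD intrM; lra.
Qed.

(** Oddness makes entrywise rounding commute with complex conjugation, so a rounded Hermitian matrix
    is Hermitian. *)
Lemma rndN x : rnd (- x) = - rnd x.
Proof. by rewrite /rnd mulrN sinN cosN mulNr atanN mulNr opprD. Qed.

Lemma rnd_idem x : rnd (rnd x) = rnd x.
Proof.
have [[z [-> _]]|[z [-> _]]] := rnd_cases x; first exact: rnd_int.
by rewrite addrC rnd_shift rnd_half.
Qed.

Section Packing.
Variables (X : R) (d : nat) (z : 'I_d -> 'I_d -> int) (B : R).
Hypothesis X0 : 0 < X.
Variable Xz : int.
Hypothesis XE : X = Xz%:~R.
Hypothesis zB : forall s t, `|(z s t)%:~R : R| <= B.
Hypothesis big : 2 * (d%:R ^+ 2 * B) < X.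
Hypothesis X1 : 1 <= X.

(** The digit at $X^{d-1}$ of a number with signed digits in base X: the first rounding drops the
    lower digits, the second finds the higher ones, which are subtracted. *)
Definition extract (N : R) : R :=
  rnd (N / X ^+ d.-1) - X * rnd (rnd (N / X ^+ d.-1) / X).

Lemma sum_bound (P : 'I_d -> 'I_d -> bool) (c : 'I_d -> 'I_d -> R) : (forall s t, `|c s t| <= 1) ->
  `|\sum_s \sum_(t | P s t) (z s t)%:~R * c s t| <= d%:R ^+ 2 * B.
Proof.
move=> hc.
have B0 (s : 'I_d) : 0 <= B by apply: le_trans (zB s s); exact: normr_ge0.
apply: le_trans (ler_norm_sum _ _ _) _.
have -> : d%:R ^+ 2 * B = \sum_(s < d) (d%:R * B) by rewrite sumr_const card_ord -[RHS]mulr_natl mulrA expr2.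
apply: ler_sum => s _; apply: le_trans (ler_norm_sum _ _ _) _.
have -> : d%:R * B = \sum_(t < d) B by rewrite sumr_const card_ord -[RHS]mulr_natl.
rewrite big_mkcond /=; apply: ler_sum => t _; case: ifP => _; last exact: B0 s.
rewrite normrM; apply: le_trans (_ : B * 1 <= B); last by rewrite mulr1.
by apply: ler_pM.
Qed.

(** After division by $X^{d-1}$ the terms with s < t add up to less than 1/2, those with s > t to a
    multiple of X, and the diagonal to less than X/2. The assumption $2d^2B<X$ gives both strict
    bounds. *)
Lemma extractP : (0 < d)%N ->
  extract (\sum_s \sum_t (z s t)%:~R * X ^+ (d.-1 + s - t)) = \sum_s (z s s)%:~R.
Proof.
move=> d0; have Xn0 : X != 0 by rewrite gt_eqF.
have Xe k : X ^+ k != 0 by rewrite expf_neq0.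
pose Lo := \sum_(s < d) \sum_(t < d | (s < t)%N) (z s t)%:~R * (X ^+ (t - s))^-1.
pose D : int := \sum_s z s s.
pose Hi : int := \sum_(s < d) \sum_(t < d | (t < s)%N) z s t * Xz ^+ (s - t).-1.
have hLo : `|Lo| < 1 / 2.
  have -> : Lo = X^-1 * \sum_(s < d) \sum_(t < d | (s < t)%N) (z s t)%:~R * (X ^+ (t - s).-1)^-1.
    rewrite mulr_sumr; apply: eq_bigr => s _; rewrite mulr_sumr; apply: eq_bigr => t st.
    rewrite mulrCA -invfM -exprS prednK // subn_gt0 //.
  rewrite normrM ger0_norm ?invr_ge0 ?ltW // mulrC ltr_pdivrMr //.
  apply: (@le_lt_trans _ _ (d%:R ^+ 2 * B)); last by move: big; lra.
  apply: sum_bound => s t.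
  rewrite ger0_norm; last by rewrite invr_ge0 exprn_ge0 // ltW.
  by rewrite invr_le1 ?exprn_ege1 ?exprn_gt0 // unitfE expf_neq0.
have hD : `|D%:~R / X| < 1 / 2.
  rewrite normrM [`|X^-1|]ger0_norm ?invr_ge0 ?ltW // ltr_pdivrMr //.
  have -> : (D%:~R : R) = \sum_s \sum_(t | t == s) (z s t)%:~R * 1.
    rewrite rmorph_sum /=; apply: eq_bigr => s _; by rewrite big_pred1_eq mulr1.
  apply: (@le_lt_trans _ _ (d%:R ^+ 2 * B)); last by move: big; lra.
  by apply: sum_bound => s t; rewrite normr1.
have NE : (\sum_s \sum_t (z s t)%:~R * X ^+ (d.-1 + s - t)) / X ^+ d.-1 = Lo + (D + Xz * Hi)%:~R.
  rewrite intrD intrM -XE /Lo /D /Hi !rmorph_sum /= mulr_sumr mulr_suml -!big_split /=.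
  apply: eq_bigr => s _; rewrite rmorph_sum /= mulr_sumr mulr_suml.
  rewrite (bigD1 s) //= (bigID (fun t : 'I_d => (s < t)%N)) /=.
  rewrite addnK mulfK // addrCA; congr (_ + (_ + _)).
  - apply: eq_big => [t|t /andP[_ st]].
      by case: (ltngtP s t) => [h|h|/val_inj ->]; rewrite ?andbF ?andbT ?eqxx // -val_eqE /= ?gtn_eqF.
    rewrite -mulrA; congr (_ * _); apply: (mulIf (Xe d.-1)); rewrite mulfVK //.
    apply: (mulfI (Xe (t - s)%N)); rewrite mulrA divff // mul1r -exprD; congr (_ ^+ _).
    have := ltn_ord t; lia.
  - apply: eq_big => [t|t /andP[ne st]].
      case: (ltngtP s t) => [h|h|/val_inj ->]; rewrite ?andbF ?andbT ?eqxx // -val_eqE /= ?ltn_eqF //.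
    have ts : (t < s)%N by move: st ne; rewrite -leqNgt leq_eqVlt -val_eqE => /orP[->|].
    rewrite intrM rmorphXn /= -XE mulrCA -mulrA; congr (_ * _); rewrite -exprS prednK ?subn_gt0 //.
    apply: (mulIf (Xe d.-1)); rewrite mulfVK // -exprD; congr (_ ^+ _).
    have := ltn_ord t; lia.
rewrite /extract NE (rndE (z := D + Xz * Hi)) ?addrK //.
have -> : rnd ((D + Xz * Hi)%:~R / X) = Hi%:~R.
  by apply: rndE; rewrite intrD intrM -XE mulrDl [X * _]mulrC mulfK // addrK.
by rewrite intrD intrM -XE addrK /D rmorph_sum.
Qed.
End Packing.

End Rounding.

(** * Stacks of matrices packed into real registers *)

Local Open Scope nat_scope.

Section Code.
(* Real scalars 40, 41, 42: pi, the rounding scale B and the base of the packed stacks. *)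
Definition rndX e : rexp := RSub e (RDiv (RFun Atan (RDiv (RFun Sin (RMul (RV 40) e))
  (RFun Cos (RMul (RV 40) e)))) (RV 40)).
Definition Cscale s (e : cexp) : cexp := (RMul s e.1, RMul s e.2).
Definition Cdiv (e : cexp) s : cexp := (RDiv e.1 s, RDiv e.2 s).
Definition Crnd (e : cexp) : cexp := (rndX e.1, rndX e.2).
Definition CE01 k : cexp := CE (NConst k) (NV 0) (NV 1).
Definition Crnd2 (e : cexp) : cexp := Cscale (rn 2) (Crnd (Cscale (RV 41) e)).
Definition PushReg k l := MxSet (NConst k) (Cadd (Cscale (RV 42) (CE01 k)) (Crnd2 (CE01 l))).
Definition PopReg k l := Seq
  (MxSet (NConst l) (Cdiv (Csub (CE01 k) (Cscale (RV 42) (Crnd (Cdiv (CE01 k) (RV 42))))) (RMul (rn 2) (RV 41))))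
  (MxSet (NConst k) (Crnd (Cdiv (CE01 k) (RV 42)))).
Definition PackPush := Seq (PushReg 11 2) (Seq (PushReg 12 3) (PushReg 13 4)).
Definition PackPop := Seq (PopReg 11 2) (Seq (PopReg 12 3) (PopReg 13 4)).

(* Counters 40, 41: depth and first register of the exact stack. *)
Definition slot j : nexp := NAdd (NV 41) (NAdd (NMul (NConst 3) (NV 40)) (NConst j)).
Definition ExactPush := Seq (MxSet (slot 0) (CE01 2)) (Seq (MxSet (slot 1) (CE01 3))
  (Seq (MxSet (slot 2) (CE01 4)) (SetN 40 (NAdd (NV 40) (NConst 1))))).
Definition LoadSlot k j := MxSet (NConst k) (CE (slot j) (NV 0) (NV 1)).
Definition ExactPop := Seq (SetN 40 (NSub (NV 40) (NConst 1)))
  (Seq (LoadSlot 2 0) (Seq (LoadSlot 3 1) (LoadSlot 4 2))).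
End Code.

(** * Rounded matrices as digits of packed numbers *)

Section Round.
Variables (R : realType) (n : nat) (B : R).
Implicit Types (A : 'M[R[i]]_n) (x : R) (z : R[i]).

Definition crnd z : R[i] := rnd (complex.Re z) +i* rnd (complex.Im z).
Definition qc z : R[i] := (rnd (B * complex.Re z) / B) +i* (rnd (B * complex.Im z) / B).
Definition qmx A : 'M[R[i]]_n := \matrix_(i, j) qc (A i j).
Lemma rnd_intz x y : y \is a Num.int -> (`|x - y| < 1 / 2)%R -> rnd x = y.
Proof. by move=> /intrP [z ->]; exact: rndE. Qed.

Lemma rnd2_intz x : (2 * rnd x)%R \is a Num.int.
Proof. by have [z ->] := rnd2_int x; exact: intr_int. Qed.

Hypothesis B1 : (1 <= B)%R.
Hypothesis Bz : B \is a Num.int.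

Let B0 : (0 < B)%R. Proof. exact: lt_le_trans B1. Qed.

Lemma qmx_dag A : dag A = A -> dag (qmx A) = qmx A.
Proof.
move=> hA; apply/matrixP => i j; rewrite dag_entry !mxE -{1}hA dag_entry /qc.
case: (A i j) => a b; apply/eqP; rewrite eq_complex /= mulrN rndN mulNr opprK !eqxx.
by [].
Qed.

Lemma qc_idem z : qc (qc z) = qc z.
Proof. by rewrite /qc /= ![(B * (_ / B))%R]mulrC !mulfVK ?gt_eqF // !rnd_idem. Qed.

Lemma qmx_idem A : qmx (qmx A) = qmx A.
Proof. by apply/matrixP => i j; rewrite !mxE qc_idem. Qed.

Lemma rnd_scaled x : (`|rnd (B * x) / B - x| <= 1 / (2 * B))%R.
Proof.
have -> : (rnd (B * x) / B - x = (rnd (B * x) - B * x) / B)%R.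
  by field; rewrite gt_eqF.
rewrite normrM normfV (ger0_norm (ltW B0)) invfM mul1r -div1r.
by rewrite ler_pM2r ?divr_gt0 //; have := rnd_near (B * x); rewrite div1r.
Qed.

Lemma qc_near z : (normc (qc z - z) <= 1 / B)%R.
Proof.
apply: le_trans (normc_le_norms _) _; case: z => a b /=.
have := rnd_scaled a; have := rnd_scaled b.
have -> : (1 / B = 1 / (2 * B) + 1 / (2 * B))%R by field; rewrite gt_eqF.
by move=> h1 h2; apply: lerD.
Qed.

Lemma qmx_near A : (nrm (qmx A - A) <= n%:R ^+ 2 / B)%R.
Proof.
rewrite -[B^-1%R]mul1r; apply: nrm_entries => i j.
by rewrite mxDE mxNE mxE; exact: qc_near.
Qed.

Definition zval (beta : R) (L : seq 'M[R[i]]_n) i j : R[i] :=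
  foldr (fun A z => (beta%:C * z + (2 * B)%:C * A i j)%R) 0%R L.

(** Digits are signed and smaller than half the base, so that rounding to the nearest integer
    separates the top digit from the rest. *)
Definition packable beta A := forall i j (b : bool),
  let x := (2 * B * (if b then complex.Im (A i j) else complex.Re (A i j)))%R in
  x \is a Num.int /\ (`|x| < beta / 2)%R.

(** Entries of modulus at most 2 give digits of modulus at most $2(2B+\tfrac12)=4B+1$, and half the
    base is at least $4B+2$. *)
Lemma packable_q beta A : (nrm A <= 2)%R -> (8 * B + 4 <= beta)%R -> packable beta (qmx A).
Proof.
move=> nA hb i j b; have hc := le_trans (entry_le_nrm A i j) nA.
have [hr hi] : (`|complex.Re (A i j)| <= 2 /\ `|complex.Im (A i j)| <= 2)%R.
  have : (normc (A i j) ^+ 2 <= 2 ^+ 2)%R by rewrite ler_pXn2r ?nnegrE ?normc_ge0.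
  rewrite normc_sqr => h; split; rewrite -(@ler_pXn2r _ 2) ?nnegrE // -normrX ger0_norm ?sqr_ge0 //;
    apply: le_trans h; rewrite ?lerDl ?lerDr sqr_ge0 //.
have key x : (`|x| <= 2)%R -> (2 * B * (rnd (B * x) / B))%R \is a Num.int /\
    (`|2 * B * (rnd (B * x) / B)| < beta / 2)%R.
  move=> hx; have -> : (2 * B * (rnd (B * x) / B) = 2 * rnd (B * x))%R.
    by field; rewrite gt_eqF.
  split; first exact: rnd2_intz.
  rewrite normrM (ger0_norm (ler0n _ _)).
  have := rnd_near (B * x); have := ler_normD (rnd (B * x) - B * x)%R (B * x)%R.
  rewrite subrK [(`|B * x|)%R]normrM (gtr0_norm B0).
  have : (B * `|x| <= B * 2)%R by rewrite ler_wpM2l // ltW.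
  lra.
by rewrite mxE /=; case: (b); apply: key.
Qed.

(** Stage and kind are small integers and B is an integer, so these frames pass through the rounding
    unchanged. *)
Lemma packable_const beta (s g : nat) : s < 3 -> g < 3 -> (8 * B + 4 <= beta)%R ->
  packable beta (const_mx (s%:R +i* g%:R)) /\ qmx (const_mx (s%:R +i* g%:R)) = const_mx (s%:R +i* g%:R) :> 'M[R[i]]_n.
Proof.
move=> s3 g3 hb.
have Bn (k : nat) : (B * k%:R)%R \is a Num.int by rewrite rpredM // natr_int.
split; last first.
  apply/matrixP => i j; rewrite !mxE /qc /=.
  have rk (k : nat) : (rnd (B * k%:R) / B = k%:R)%R.
    rewrite (@rnd_intz _ (B * k%:R)%R) ?Bn // ?subrr ?normr0 ?divr_gt0 //.
    by rewrite mulrC mulKf // gt_eqF.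
  by rewrite !rk.
move=> i j b; rewrite mxE.
have key (k : nat) : k < 3 -> (2 * B * k%:R)%R \is a Num.int /\ (`|2 * B * k%:R| < beta / 2 :> R)%R.
  move=> k3; split; first by rewrite -mulrA rpredM // natr_int.
  have k2 : (k%:R <= 2 :> R)%R by rewrite ler_nat.
  rewrite ger0_norm; last by rewrite !mulr_ge0 // ltW.
  have : (2 * B * k%:R <= 2 * B * 2)%R by rewrite ler_wpM2l // mulr_ge0 // ltW.
  lra.
by case: b; apply: key.
Qed.

Lemma zval_int beta L i j : beta \is a Num.int -> (forall A, List.In A L -> packable beta A) ->
  complex.Re (zval beta L i j) \is a Num.int /\ complex.Im (zval beta L i j) \is a Num.int.
Proof.
move=> hb; elim: L => [|A L IH] h; first by rewrite /= !rpred0.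
have [|i1 i2] := IH; first by move=> A' hA'; apply: h; right.
have hA := h A (or_introl erefl).
have [r1 _] := hA i j false; have [r2 _] := hA i j true.
rewrite [zval _ _ _ _]/= -/(zval beta L i j).
case: (zval beta L i j) i1 i2 => a b /= i1 i2; case: (A i j) r1 r2 => a' b' /= r1 r2.
by rewrite !mul0r !subr0 !addr0; split; rewrite rpredD // rpredM.
Qed.

(** Division by the base leaves the integer below the top plus a fraction of modulus less than
    1/2. *)
Lemma zval_pop beta A L i j : (0 < beta)%R -> beta \is a Num.int ->
  (forall A', List.In A' (A :: L) -> packable beta A') ->
  crnd ((beta^-1)%:C * zval beta (A :: L) i j)%R = zval beta L i j.
Proof.
move=> b0 bz h.
have [|i1 i2] := @zval_int beta L i j bz; first by move=> A' hA'; apply: h; right.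
have hA := h A (or_introl erefl).
have [_ r1] := hA i j false; have [_ r2] := hA i j true.
rewrite [zval _ (_ :: _) _ _]/= -/(zval beta L i j).
case: (zval beta L i j) i1 i2 => a b /= i1 i2; case: (A i j) r1 r2 => a' b' /= r1 r2.
have key x y : y \is a Num.int -> (`|x| < beta / 2)%R -> rnd (beta^-1 * (beta * y + x))%R = y.
  move=> yz hx; apply: rnd_intz => //.
  rewrite mulrDr mulKf ?gt_eqF // addrAC subrr add0r normrM gtr0_norm ?invr_gt0 //.
  by rewrite mulrC ltr_pdivrMr //; lra.
by rewrite /crnd /= !(mul0r, subr0, addr0); congr (_ +i* _); apply: key.
Qed.
End Round.

Lemma subset_refl' (T : eqType) (s : seq T) : {subset s <= s}. Proof. by []. Qed.

(** * The packed stack and the exact stack *)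

Section Stacks.
Variables (R : realType) (d m p : nat).
Variables (G : 'I_m -> 'M[R[i]]_d) (U : 'I_p -> 'M[R[i]]_d) (eps : R).
Variables (search : 'M[R[i]]_d -> seq 'I_m) (T0 S : nat).
Implicit Types (st : state R) (c : cmd).
Hypothesis d1 : 1 < d.
Let d0 : 0 < d := ltnW d1.
Hypothesis S64 : 64 <= S.
Hypothesis rm : room d S 14.
Local Notation T := (T G U eps search T0 S).
Local Notation nev := (@neval R d m p).
Local Notation rev := (@reval R d m p G U eps).
Local Notation ceval := (ceval G U eps).
Local Notation same := (same d).
Local Notation frame := (frame d).
Local Notation M := 'M[R[i]]_d.

Lemma rev_rndX st e : rmem st 40 = pi -> rev st (rndX e) = rnd (rev st e).
Proof. by rewrite /= => ->. Qed.

Lemma ceval_Crnd st e : rmem st 40 = pi -> ceval st (Crnd e) = crnd (ceval st e).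
Proof. by move=> h; rewrite /ceval /crnd /Crnd !rev_rndX. Qed.

Lemma ceval_Cscale st s e : ceval st (Cscale s e) = ((rev st s)%:C * ceval st e)%R.
Proof. by apply/eqP; rewrite eq_complex /= !mul0r subr0 addr0 !eqxx. Qed.

Lemma ceval_Cdiv st s e : ceval st (Cdiv e s) = (((rev st s)^-1)%:C * ceval st e)%R.
Proof. by apply/eqP; rewrite eq_complex /= !mul0r subr0 addr0 ![(_ / _)%R]mulrC !eqxx. Qed.

Lemma ceval_CE01 st k i j : nmem st 0 = i -> nmem st 1 = j -> ceval st (CE01 k) = regn d st k i j.
Proof. by move=> h0 h1; rewrite ceval_CE /= h0 h1. Qed.

Section Packed.
Variables (B beta : R).
Hypothesis B1 : (1 <= B)%R.
Hypothesis Bz : B \is a Num.int.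
Hypothesis bz : beta \is a Num.int.
Hypothesis bB : (8 * B + 4 <= beta)%R.

Let B0 : (0 < B)%R. Proof. exact: lt_le_trans B1. Qed.
Let b0 : (0 < beta)%R. Proof. by move: bB B0; lra. Qed.

Definition consts_ok st := [/\ rmem st 40 = pi, rmem st 41 = B & rmem st 42 = beta].

Lemma consts_same N M' st st' : same N (iota 0 40) M' st st' -> consts_ok st -> consts_ok st'.
Proof. by move=> s [h1 h2 h3]; split; rewrite (same_sc s). Qed.

Definition zreg st k (L : seq M) :=
  (forall A, List.In A L -> packable B beta A) /\ reg d st k = \matrix_(i, j) zval B beta L i j.

Definition cPush n := cMx (ccost (Cadd (Cscale (RV 42) (CE01 11)) (Crnd2 (CE01 2)))) n.
Definition cPopA n := cMx (ccost (Cdiv (Csub (CE01 11) (Cscale (RV 42) (Crnd (Cdiv (CE01 11) (RV 42))))) (RMul (rn 2) (RV 41)))) n.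

Lemma T_pushreg k l st L : consts_ok st -> zreg st k L -> k <= 14 -> k != l ->
  packable B beta (qmx B (reg d st l)) ->
  exists2 st', T (PushReg k l) st (cPush d) st' & same [:: 0; 1] [:: 0; 1] [:: k] st st' /\
    zreg st' k (qmx B (reg d st l) :: L).
Proof.
move=> [c1 c2 c3] [gL hz] hk kl hA.
have [|||st' t [s e]] := @mxset R d m p G U eps search T0 S d1 S64 rm k
   (Cadd (Cscale (RV 42) (CE01 k)) (Crnd2 (CE01 l))) st (cPush d)
   (fun i j => beta%:C * regn d st k i j + 2%:C * crnd (B%:C * regn d st l i j))%R.
- exact: room_le rm.
- move=> i j st' hi hj s v0 v1 hr.
  rewrite ceval_Cadd !ceval_Cscale ceval_Crnd; last by rewrite (same_sc s).
  rewrite ceval_Cscale !(ceval_CE01 _ v0 v1) hr (same_regn d0 s) ?inE 1?eq_sym //.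
  by rewrite /= !(same_sc s) // c2 c3.
- exact: leqnn.
exists st' => //; split => //; split; first by move=> A [<-|/gL].
rewrite e; apply/matrixP => i j; rewrite !mxE [zval _ _ _ _ _]/= -/(zval B beta L i j) !regE hz !mxE.
congr (_ + _)%R; case: (reg d st l i j) => a b; apply/eqP.
have nB : B != 0%R by rewrite gt_eqF.
rewrite eq_complex /= !(mul0r, subr0, addr0).
by rewrite -!mulrA ![(B * (_ / B))%R]mulrC !mulfVK // !eqxx.
Qed.

Lemma T_popreg k l st A L : consts_ok st -> zreg st k (A :: L) -> k <= 14 -> l <= 14 -> k != l ->
  exists2 st', T (PopReg k l) st (2 * cPopA d) st' & same [:: 0; 1] [:: 0; 1] [:: k; l] st st' /\
    zreg st' k L /\ reg d st' l = A.
Proof.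
move=> [c1 c2 c3] [gL hz] hk hl kl.
have nB : B != 0%R by rewrite gt_eqF.
have pE i j : crnd ((beta^-1)%:C * zval B beta (A :: L) i j)%R = zval B beta L i j by exact: zval_pop.
have [|||s1 t1 [f1 e1]] := @mxset R d m p G U eps search T0 S d1 S64 rm l
   (Cdiv (Csub (CE01 k) (Cscale (RV 42) (Crnd (Cdiv (CE01 k) (RV 42))))) (RMul (rn 2) (RV 41))) st (cPopA d)
   (fun i j => ((2 * B)^-1)%:C * (regn d st k i j - beta%:C * crnd ((beta^-1)%:C * regn d st k i j)))%R.
- exact: room_le rm.
- move=> i j st' hi hj s v0 v1 hr.
  rewrite ceval_Cdiv ceval_Csub ceval_Cscale ceval_Crnd; last by rewrite (same_sc s).
  rewrite ceval_Cdiv !(ceval_CE01 _ v0 v1) (same_regn d0 s) ?inE //.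
  by rewrite /= !(same_sc s) // c2 c3.
- exact: leqnn.
have hz1 : reg d s1 k = \matrix_(i, j) zval B beta (A :: L) i j.
  by rewrite (same_reg d0 f1) // inE.
have [|||s2 t2 [f2 e2]] := @mxset R d m p G U eps search T0 S d1 S64 rm k
   (Crnd (Cdiv (CE01 k) (RV 42))) s1 (cPopA d)
   (fun i j => crnd ((beta^-1)%:C * regn d s1 k i j))%R.
- exact: room_le rm.
- move=> i j st' hi hj s v0 v1 hr.
  rewrite ceval_Crnd; last by rewrite !(same_sc s) // (same_sc f1).
  rewrite ceval_Cdiv !(ceval_CE01 _ v0 v1) hr.
  by rewrite /= !(same_sc s) // (same_sc f1) // c3.
- exact: cMx_le.
exists s2; first by apply: T_seq t1 t2 _; rewrite mul2n addnn.
split.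
  by apply: (same_trans (st2 := s1)); [apply: same_sub f1|apply: same_sub f2] => // x; rewrite !inE => ->; rewrite ?orbT.
split; first split.
- by move=> A' hA'; apply: gL; right.
- by rewrite e2; apply/matrixP => i j; rewrite !mxE regE hz1 mxE pE.
rewrite (same_reg d0 f2) ?inE 1?eq_sym // e1; apply/matrixP => i j.
rewrite !mxE regE hz mxE pE [zval _ _ (_ :: _) _ _]/= -/(zval B beta L i j) addrC addKr mulrA -rmorphM /=.
by rewrite mulVf ?rmorph1 ?mul1r // mulf_neq0 // pnatr_eq0.
Qed.

Definition pstk st (L : seq (M * M * M)) := consts_ok st /\
  [/\ zreg st 11 (map (fun f => f.1.1) L), zreg st 12 (map (fun f => f.1.2) L)
    & zreg st 13 (map (fun f => f.2) L)].

Lemma zreg_frame N Sc M' st st' k L : frame N Sc M' st st' -> k \notin M' -> zreg st k L -> zreg st' k L.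
Proof. by move=> f kM [h e]; split => //; rewrite (frame_reg d0 f). Qed.

Lemma pstk_frame st st' L :
  frame ([:: 10; 11] ++ iota 13 27 ++ iota 0 10) MS (iota 0 11) st st' -> pstk st L -> pstk st' L.
Proof.
move=> f [[c1 c2 c3] [z1 z2 z3]]; split; first by split; rewrite (frame_sc f).
by split; apply: zreg_frame f _ _.
Qed.

Definition cPack n := 3 * cPush n + 6 * cPopA n.

Lemma pack_push st L (s g : nat) : pstk st L ->
  (nrm (reg d st 2) <= 2)%R -> (nrm (reg d st 3) <= 2)%R -> s < 3 -> g < 3 ->
  reg d st 4 = const_mx (s%:R +i* g%:R) ->
  exists2 st', T PackPush st (cPack d) st' & same PN PS [:: 11; 12; 13] st st' /\
    pstk st' ((qmx B (reg d st 2), qmx B (reg d st 3), reg d st 4) :: L).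
Proof.
move=> [hc [z1 z2 z3]] n2 n3 s3 g3 r4.
have [p4 q4] := packable_const d B1 Bz s3 g3 bB; rewrite -r4 in p4 q4.
have [s1 t1 [f1 y1]] := T_pushreg hc z1 (isT : 11 <= 14) (isT : 11 != 2) (packable_q B1 n2 bB).
have e13 : reg d s1 3 = reg d st 3 by rewrite (same_reg d0 f1).
have e14 : reg d s1 4 = reg d st 4 by rewrite (same_reg d0 f1).
have c1 : consts_ok s1 by apply: consts_same hc; apply: same_sub f1; [exact: subset_refl'|sub|exact: subset_refl'].
have z2' : zreg s1 12 (map (fun f => f.1.2) L) by apply: zreg_frame (same_frame f1) _ _.
have z3' : zreg s1 13 (map (fun f => f.2) L) by apply: zreg_frame (same_frame f1) _ _.
rewrite -e13 in n3 *.
have [s2 t2 [f2 y2]] := T_pushreg c1 z2' (isT : 12 <= 14) (isT : 12 != 3) (packable_q B1 n3 bB).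
have c2 : consts_ok s2 by apply: consts_same c1; apply: same_sub f2; [exact: subset_refl'|sub|exact: subset_refl'].
have z3'' : zreg s2 13 (map (fun f => f.2) L) by apply: zreg_frame (same_frame f2) _ _.
have e24 : reg d s2 4 = reg d st 4 by rewrite (same_reg d0 f2).
have p4' : packable B beta (qmx B (reg d s2 4)) by rewrite e24 q4.
have [s3' t3 [f3 y3]] := T_pushreg c2 z3'' (isT : 13 <= 14) (isT : 13 != 4) p4'.
rewrite e24 q4 in y3.
have c3 : consts_ok s3' by apply: consts_same c2; apply: same_sub f3; [exact: subset_refl'|sub|exact: subset_refl'].
exists s3'.
  by apply: T_seq t1 (T_seq t2 t3 (leqnn _)) _; rewrite /cPack; clear; lia.
split.
  same_via s1 f1.
  by apply: (same_trans (st2 := s2)); [apply: same_sub f2|apply: same_sub f3]; sub.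
split=> //; split => //.
  apply: zreg_frame (same_frame f3) _ _ => //; apply: zreg_frame (same_frame f2) _ _ => //.
exact: zreg_frame (same_frame f3) _ _.
Qed.

Lemma pack_pop st f L : pstk st (f :: L) ->
  exists2 st', T PackPop st (cPack d) st' & same PN PS ([:: 2; 3; 4] ++ [:: 11; 12; 13]) st st' /\
    [/\ pstk st' L, reg d st' 2 = f.1.1, reg d st' 3 = f.1.2 & reg d st' 4 = f.2].
Proof.
move=> [hc [z1 z2 z3]].
have [s1 t1 [f1 [y1 r1]]] := T_popreg hc z1 (isT : 11 <= 14) (isT : 2 <= 14) (isT : 11 != 2).
have c1 : consts_ok s1 by apply: consts_same hc; apply: same_sub f1; [exact: subset_refl'|sub|exact: subset_refl'].
have z2' : zreg s1 12 (map (fun f => f.1.2) (f :: L)) by apply: zreg_frame (same_frame f1) _ _.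
have z3' : zreg s1 13 (map (fun f => f.2) (f :: L)) by apply: zreg_frame (same_frame f1) _ _.
have [s2 t2 [f2 [y2 r2]]] := T_popreg c1 z2' (isT : 12 <= 14) (isT : 3 <= 14) (isT : 12 != 3).
have c2 : consts_ok s2 by apply: consts_same c1; apply: same_sub f2; [exact: subset_refl'|sub|exact: subset_refl'].
have z3'' : zreg s2 13 (map (fun f => f.2) (f :: L)) by apply: zreg_frame (same_frame f2) _ _.
have [s3 t3 [f3 [y3 r3]]] := T_popreg c2 z3'' (isT : 13 <= 14) (isT : 4 <= 14) (isT : 13 != 4).
have c3 : consts_ok s3 by apply: consts_same c2; apply: same_sub f3; [exact: subset_refl'|sub|exact: subset_refl'].
exists s3.
  by apply: T_seq t1 (T_seq t2 t3 (leqnn _)) _; rewrite /cPack; clear; lia.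
split.
  same_via s1 f1.
  by apply: (same_trans (st2 := s2)); [apply: same_sub f2|apply: same_sub f3]; sub.
split => //.
- split=> //; split => //.
    apply: zreg_frame (same_frame f3) _ _ => //; apply: zreg_frame (same_frame f2) _ _ => //.
  exact: zreg_frame (same_frame f3) _ _.
- by rewrite (same_reg d0 f3) // (same_reg d0 f2).
- by rewrite (same_reg d0 f3).
Qed.
End Packed.

Section Exact.
Variables (base cap : nat).
Hypothesis base14 : 14 < base.
Hypothesis rcap : room d S (base + 3 * cap).

(** The list starts at the top of the stack while registers are numbered from the bottom, hence the
    reversal: a frame keeps its registers as others come and go. *)
Definition xstk st (L : seq (M * M * M)) := [/\ nmem st 40 = size L, nmem st 41 = base, size L <= cap &
  forall k, k < size L -> [/\ reg d st (base + (3 * k)) = (nth (0, 0, 0)%R (seq.rev L) k).1.1,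
    reg d st (base + (3 * k + 1)) = (nth (0, 0, 0)%R (seq.rev L) k).1.2 &
    reg d st (base + (3 * k + 2)) = (nth (0, 0, 0)%R (seq.rev L) k).2]].

Definition XM := iota base (3 * cap).

Lemma xstk_frame st st' L :
  frame ([:: 10; 11] ++ iota 13 27 ++ iota 0 10) MS (iota 0 11) st st' -> xstk st L -> xstk st' L.
Proof.
move=> f [h1 h2 hs h3]; split; rewrite ?(frame_n f) // => k hk.
have [e1 e2 e3] := h3 k hk.
have nk x : base <= x -> x \notin iota 0 11 by move=> hx; rewrite mem_iota /= add0n -leqNgt; lia.
by split; rewrite (frame_reg d0 f) //; apply: nk; lia.
Qed.

Definition cExact n := 3 * cMx 300 n + 40.

Lemma T_slotset j l st v : l <= 14 -> j < 3 -> nmem st 41 = base -> nmem st 40 = v -> v < cap ->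
  exists2 st', T (MxSet (slot j) (CE01 l)) st (cMx 300 d) st' &
    same [:: 0; 1] [:: 0; 1] [:: base + (3 * v + j)] st st' /\ reg d st' (base + (3 * v + j)) = reg d st l.
Proof.
move=> hl hj h41 h40 hv.
have sE st' : nmem st' 41 = base -> nmem st' 40 = v -> nev st' (slot j) = base + (3 * v + j).
  by move=> e1 e2; rewrite /= e1 e2.
have e0 := sE st h41 h40.
have [||||||||st' t [s e]] := @T_mxset R d m p G U eps search T0 S d0 S64 (slot j) (CE01 l) st [::] [:: 0; 1] (cMx 300 d) (regn d st l); rewrite ?e0 //.
- by apply: room_le rcap; lia.
- by move=> st' s; apply: sE; rewrite (same_n s).
- move=> i j' st' hi hj' s v0 v1 _; rewrite (ceval_CE01 _ v0 v1).
  by rewrite (same_regn d0 s) // inE; lia.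
- by rewrite /cMx leq_add2l leq_mul2l leq_add2l leq_mul2l /=; lia.
by exists st' => //; rewrite e0 in s e; split => //; rewrite e.
Qed.

Lemma exact_push st L (s g : nat) : xstk st L -> size L < cap ->
  exists2 st', T ExactPush st (cExact d) st' & same PN PS XM st st' /\
    xstk st' ((reg d st 2, reg d st 3, reg d st 4) :: L).
Proof.
move=> [h1 h2 hs h3] hL.
have [s1 t1 [f1 e1]] := T_slotset (isT : 2 <= 14) (isT : 0 < 3) h2 h1 hL.
have n1 k : k \notin [:: 0; 1] -> nmem s1 k = nmem st k by move=> hk; rewrite (same_n f1).
have h12 : nmem s1 41 = base by rewrite n1.
have h11 : nmem s1 40 = size L by rewrite n1.
have [s2 t2 [f2 e2]] := T_slotset (isT : 3 <= 14) (isT : 1 < 3) h12 h11 hL.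
have n2 k : k \notin [:: 0; 1] -> nmem s2 k = nmem s1 k by move=> hk; rewrite (same_n f2).
have h22 : nmem s2 41 = base by rewrite n2.
have h21 : nmem s2 40 = size L by rewrite n2.
have [s3 t3 [f3 e3]] := T_slotset (isT : 4 <= 14) (isT : 2 < 3) h22 h21 hL.
have n3 k : k \notin [:: 0; 1] -> nmem s3 k = nmem s2 k by move=> hk; rewrite (same_n f3).
set s4 := setn s3 40 (size L).+1.
have t4 : T (SetN 40 (NAdd (NV 40) (NConst 1))) s3 10 s4.
  have := @T_setn R d m p G U eps search T0 S S64 40 (NAdd (NV 40) (NConst 1)) s3 10 isT isT.
  by rewrite /= n3 // h21 addn1.
have f4 : same [:: 40] [::] [::] s3 s4 by apply: same_setn_in => //; exact: same_refl.
have r1 x : x != base + (3 * size L + 0) -> reg d s1 x = reg d st x.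
  by move=> hx; rewrite (same_reg d0 f1) // inE.
have r2 x : x != base + (3 * size L + 1) -> reg d s2 x = reg d s1 x.
  by move=> hx; rewrite (same_reg d0 f2) // inE.
have r3 x : x != base + (3 * size L + 2) -> reg d s4 x = reg d s2 x.
  by move=> hx; rewrite (same_reg d0 f4) // (same_reg d0 f3) // inE.
exists s4.
  by apply: T_seq t1 (T_seq t2 (T_seq t3 t4 (leqnn _)) (leqnn _)) _; rewrite /cExact; lia.
have XMin j : j < 3 -> {subset [:: base + (3 * size L + j)] <= XM}.
  by move=> hj x; rewrite inE => /eqP ->; rewrite mem_iota; lia.
split.
  apply: (same_trans (st2 := s1)); first by apply: same_sub f1; [sub|sub|exact: XMin].
  apply: (same_trans (st2 := s2)); first by apply: same_sub f2; [sub|sub|exact: XMin].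
  apply: (same_trans (st2 := s3)); first by apply: same_sub f3; [sub|sub|exact: XMin].
  by apply: same_sub f4; [sub| |].
split => //; first by rewrite /= /upd /= n3.
move=> k; rewrite [size _]/= ltnS rev_cons nth_rcons size_rev => hk.
case: (ltngtP k (size L)) hk => // [hk _|-> _].
  have [a1 a2 a3] := h3 k hk.
  by split; rewrite r3 ?r2 ?r1 //; apply/eqP; lia.
rewrite -[3 * size L]addn0; split.
- by rewrite addn0 -[3 * _]addn0 r3 ?r2 ?e1 //; apply/eqP; lia.
- rewrite addn0 r3 ?e2 ?r1 //; apply/eqP; lia.
- rewrite addn0 (same_reg d0 f4) // e3 r2 ?r1 //; apply/eqP; lia.
Qed.

Lemma T_loadslot k j st v : k <= 14 -> j < 3 -> nmem st 41 = base -> nmem st 40 = v ->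
  exists2 st', T (LoadSlot k j) st (cMx 300 d) st' &
    same [:: 0; 1] [:: 0; 1] [:: k] st st' /\ reg d st' k = reg d st (base + (3 * v + j)).
Proof.
move=> hk hj h41 h40.
have [|||st' t [s e]] := @mxset R d m p G U eps search T0 S d1 S64 rm k
   (CE (slot j) (NV 0) (NV 1)) st (cMx 300 d) (regn d st (base + (3 * v + j))).
- exact: room_le rm.
- move=> i j' st' hi hj' s v0 v1 _; rewrite ceval_CE /= v0 v1 !(same_n s) // h41 h40.
  rewrite (same_regn d0 s) // inE; apply/eqP; lia.
- exact: cMx_le.
by exists st' => //; split => //; rewrite e.
Qed.

Lemma exact_pop st f L : xstk st (f :: L) ->
  exists2 st', T ExactPop st (cExact d) st' & same PN PS ([:: 2; 3; 4] ++ XM) st st' /\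
    [/\ xstk st' L, reg d st' 2 = f.1.1, reg d st' 3 = f.1.2 & reg d st' 4 = f.2].
Proof.
move=> [h1 h2 hs h3].
set s0 := setn st 40 (size L).
have t0 : T (SetN 40 (NSub (NV 40) (NConst 1))) st 10 s0.
  have := @T_setn R d m p G U eps search T0 S S64 40 (NSub (NV 40) (NConst 1)) st 10 isT isT.
  by rewrite /= h1 subn1.
have f0 : same [:: 40] [::] [::] st s0 by apply: same_setn_in => //; exact: same_refl.
have h01 : nmem s0 40 = size L by rewrite /= /upd eqxx.
have h02 : nmem s0 41 = base by [].
have [s1 t1 [f1 e1]] := T_loadslot (isT : 2 <= 14) (isT : 0 < 3) h02 h01.
have h11 : nmem s1 40 = size L by rewrite (same_n f1).
have h12 : nmem s1 41 = base by rewrite (same_n f1).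
have [s2 t2 [f2 e2]] := T_loadslot (isT : 3 <= 14) (isT : 1 < 3) h12 h11.
have h21 : nmem s2 40 = size L by rewrite (same_n f2).
have h22 : nmem s2 41 = base by rewrite (same_n f2).
have [s3 t3 [f3 e3]] := T_loadslot (isT : 4 <= 14) (isT : 2 < 3) h22 h21.
have [a1 a2 a3] := h3 (size L) (ltnSn _).
rewrite rev_cons nth_rcons size_rev ltnn eqxx in a1 a2 a3.
have sr k : 14 < k -> [/\ reg d s3 k = reg d st k, reg d s2 k = reg d st k & reg d s1 k = reg d st k].
  move=> hk; have q1 : reg d s1 k = reg d st k.
    by rewrite (same_reg d0 f1) ?(same_reg d0 f0) // inE; apply/eqP; lia.
  have q2 : reg d s2 k = reg d st k.
    by rewrite (same_reg d0 f2) ?q1 // inE; apply/eqP; lia.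
  split => //; rewrite (same_reg d0 f3) ?q2 // inE; apply/eqP; lia.
exists s3.
  by apply: T_seq t0 (T_seq t1 (T_seq t2 t3 (leqnn _)) (leqnn _)) _; rewrite /cExact; lia.
split.
  have sX l : all (fun k => k \in [:: 2; 3; 4]) l -> {subset l <= [:: 2; 3; 4] ++ XM}.
    by move=> /allP h x /h; rewrite mem_cat => ->.
  apply: (same_trans (st2 := s0)); first by apply: same_sub f0; [sub| |].
  apply: (same_trans (st2 := s1)); first by apply: same_sub f1; [sub|sub|exact: (sX [:: 2])].
  by apply: (same_trans (st2 := s2)); [apply: same_sub f2|apply: same_sub f3];
    [sub|sub|exact: (sX [:: 3])|sub|sub|exact: (sX [:: 4])].
split.
- split; rewrite ?(same_n f3) //; first exact: ltnW.
  move=> k hk; have [b1 b2 b3] := h3 k (ltnW hk).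
  rewrite rev_cons nth_rcons size_rev hk in b1 b2 b3.
  have sr3 x : 14 < x -> reg d s3 x = reg d st x by move=> hx; have [] := sr x hx.
  by split; rewrite sr3 //; lia.
- rewrite (same_reg d0 f3) // (same_reg d0 f2) // e1 addn0.
  by rewrite (same_reg d0 f0).
- rewrite (same_reg d0 f3) // e2.
  by have [_ _ ->] := sr (base + (3 * size L + 1)) ltac:(lia).
- by rewrite e3; have [_ -> _] := sr (base + (3 * size L + 2)) ltac:(lia).
Qed.
End Exact.
End Stacks.

(** * Plane rotations *)

Local Open Scope ring_scope.
Local Open Scope sesquilinear_scope.
Local Open Scope complex_scope.

(** * Arguments of complex numbers from the arctangent *)

Section Argument.
Variable R : realType.
Implicit Types (x y : R) (z : R[i]).

(** For a point of the unit circle, $\tan(\theta/2)=y/(1+x)$; the branch covers the point -1, where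
    this quotient is undefined. *)
Definition ang x y : R := if x <= -1 then pi else 2 * atan (y / (1 + x)).
Definition arg z : R := ang (complex.Re z / normc z) (complex.Im z / normc z).

Lemma angP x y : x ^+ 2 + y ^+ 2 = 1 -> cis (ang x y) = x +i* y.
Proof.
move=> h; rewrite /ang; case: lerP => hx.
  have x1 : x = -1 by nra.
  have y0 : y = 0 by apply/eqP; rewrite -sqrf_eq0; apply/eqP; move: h; rewrite x1; lra.
  by rewrite /cis cospi sinpi x1 y0.
have x0 : 0 < 1 + x by lra.
set u := y / (1 + x); set c := cos (atan u).
have c0 : 0 < c by apply: cos_gt0_pihalf; rewrite atan_gtNpi2 atan_ltpi2.
have sE : sin (atan u) = u * c by rewrite -[u in u * c]atanK /tan mulfVK // gt_eqF.
have cs : c ^+ 2 * (1 + u ^+ 2) = 1.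
  by have h2 := cos2Dsin2 (atan u); rewrite sE -/c in h2; rewrite -[RHS]h2; ring.
have uE : u * (1 + x) = y by rewrite /u mulfVK // gt_eqF.
have u2 : (1 + u ^+ 2) * (1 + x) = 2.
  have x1 : 1 + x != 0 by rewrite gt_eqF.
  apply: (mulIf x1); rewrite mulrDl mul1r.
  have -> : (1 + x + u ^+ 2 * (1 + x)) * (1 + x) = (1 + x) ^+ 2 + (u * (1 + x)) ^+ 2 by ring.
  by rewrite uE; move: h; lra.
have c2 : 2 * c ^+ 2 = 1 + x.
  have : c ^+ 2 * ((1 + u ^+ 2) * (1 + x)) = 1 * (1 + x) by rewrite mulrA cs.
  by rewrite u2 mul1r mulrC.
rewrite /cis mulrDl !mul1r cosD sinD sE -/c; congr (_ +i* _).
  have -> : c * c - u * c * (u * c) = 2 * c ^+ 2 - c ^+ 2 * (1 + u ^+ 2) by ring.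
  by rewrite cs c2; lra.
have -> : u * c * c + c * (u * c) = u * (2 * c ^+ 2) by ring.
by rewrite c2.
Qed.

Lemma ang_bound x y : `|ang x y| <= pi.
Proof.
rewrite /ang; case: ifP => _; first by rewrite ger0_norm ?pi_ge0.
have := atan_gtNpi2 (y / (1 + x)); have := atan_ltpi2 (y / (1 + x)).
rewrite ler_norml => h1 h2; apply/andP; split; lra.
Qed.

Lemma argP z : z = (normc z)%:C * cis (arg z).
Proof.
have [z0|z0] := eqVneq (normc z) 0; first by rewrite z0 mul0r; exact: eq0_normc.
rewrite /arg angP; last by rewrite !expr_div_n -mulrDl -normc_sqr divff // expf_neq0.
case: z z0 => a b z0; apply/eqP; rewrite eq_complex /= !mul0r subr0 addr0.
by rewrite ![_ * (_ / _)]mulrC !mulfVK // !eqxx.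
Qed.

Lemma arg_bound z : `|arg z| <= pi. Proof. exact: ang_bound. Qed.

End Argument.

Section RotAlgebra.
Variables (K : comNzRingType) (n : nat).
Implicit Types (P N A : 'M[K]_n) (x y : K).

(** P is a projection and N a complex structure on its range, so this is multiplication of the
    complex numbers $1+x+iy$ and $1+x'+iy'$. *)
Lemma rot_algebra P N x y x' y' : P *m P = P -> P *m N = N -> N *m P = N -> N *m N = - P ->
  (1%:M + x *: P + y *: N) *m (1%:M + x' *: P + y' *: N) =
  1%:M + ((1 + x) * (1 + x') - 1 - y * y') *: P + (y * (1 + x') + (1 + x) * y') *: N.
Proof.
move=> PP PN NP NN.
rewrite !mulmxDl !mulmxDr -!scalemxAl -!scalemxAr !mul1mx !mulmx1 PP PN NP NN !scalerA.
by apply/matrixP => i j; rewrite !mxE; ring.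
Qed.

Lemma rot_algebra_tr (a b : 'I_n) x y :
  (1%:M + x *: (delta_mx a a + delta_mx b b) + y *: (delta_mx a b - delta_mx b a))^T =
  1%:M + x *: (delta_mx a a + delta_mx b b) + (- y) *: (delta_mx a b - delta_mx b a) :> 'M[K]_n.
Proof.
apply/matrixP => k l; rewrite !mxE (eq_sym l k) ![(l == _) && _]andbC; ring.
Qed.
End RotAlgebra.

Section RotScalars.
Variable R : realType.
Implicit Types x y u v : R.

Lemma rot_c1 x y u v : (1 + (x - 1)%:C) * (1 + (y - 1)%:C) - 1 - u%:C * v%:C = (x * y - u * v - 1)%:C.
Proof. by rewrite !(rmorphB (real_complex R)) !(rmorphM (real_complex R)) rmorph1 /=; ring. Qed.

Lemma rot_c2 x y u v : u%:C * (1 + (y - 1)%:C) + (1 + (x - 1)%:C) * v%:C = (u * y + x * v)%:C.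
Proof. by rewrite !(rmorphB (real_complex R)) (rmorphD (real_complex R)) !(rmorphM (real_complex R)) rmorph1 /=; ring. Qed.

Lemma rot_c3 x (a b : nat) : (1 + x * (a%:R + b%:R))%:C = 1 + x%:C * (a%:R + b%:R).
Proof. by rewrite rmorphD rmorphM rmorphD !rmorph_nat rmorph1. Qed.
End RotScalars.

(** * Two families of rotations in a coordinate plane *)

Section Rotation.
Variables (R : realType) (n : nat) (j j' : 'I_n).
Hypothesis jj' : j != j'.
Implicit Types (ty : bool) (t : R) (A : 'M[R[i]]_n).

Local Notation E := (@delta_mx R[i] n n).
Definition rotP : 'M[R[i]]_n := E j j + E j' j'.
Definition rotN ty : 'M[R[i]]_n := if ty then E j j' - E j' j else 'i%C *: (E j j - E j' j').
(** This is $e^{tN}$, since N squares to -P. The flag true gives a real plane rotation, false gives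
    the phases $e^{it}$ and $e^{-it}$ on the two coordinates. *)
Definition givens ty t : 'M[R[i]]_n := 1%:M + (cos t - 1)%:C *: rotP + (sin t)%:C *: rotN ty.

Let dE := (@mul_delta_mx_cond R[i] n n n).

Lemma rotPP : rotP *m rotP = rotP.
Proof. by rewrite /rotP mulmxDl !mulmxDr !dE !eqxx (negPf jj') eq_sym (negPf jj') !mulr0n !mulr1n addr0 add0r. Qed.

Let j'j : (j' == j) = false. Proof. by rewrite eq_sym (negPf jj'). Qed.
Let simp := (mulmxBl, mulmxBr, mulmxDl, mulmxDr, dE, eqxx, negPf jj', j'j, mulr0n, mulr1n, subr0, sub0r, addr0, add0r).

Lemma rotPN ty : rotP *m rotN ty = rotN ty.
Proof.
case: ty; rewrite /rotP /rotN -?scalemxAr; last congr (_ *: _).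
  by rewrite !simp.
by rewrite !simp.
Qed.

Lemma rotNP ty : rotN ty *m rotP = rotN ty.
Proof.
case: ty; rewrite /rotP /rotN -?scalemxAl; last congr (_ *: _).
  by rewrite !simp addrC.
by rewrite !simp.
Qed.

Lemma rotNN ty : rotN ty *m rotN ty = - rotP.
Proof.
case: ty; rewrite /rotP /rotN.
  by rewrite !simp opprD.
rewrite -scalemxAl -scalemxAr scalerA.
have -> : 'i%C * 'i%C = -1 :> R[i] by rewrite -expr2 sqr_i.
by rewrite !simp opprK scaleN1r.
Qed.

Lemma givens_add ty a b : givens ty a *m givens ty b = givens ty (a + b).
Proof.
rewrite /givens (rot_algebra _ _ _ _ rotPP (rotPN ty) (rotNP ty) (rotNN ty)).
by rewrite rot_c1 rot_c2 cosD sinD.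
Qed.

Lemma givens0 ty : givens ty 0 = 1%:M.
Proof. by rewrite /givens cos0 sin0 subrr !scale0r !addr0. Qed.

Lemma rot_2pi ty t : givens ty (t + 2 * pi) = givens ty t.
Proof.
by have := cis_2pi t; rewrite /cis /givens => -[-> ->].
Qed.

Lemma dag_delta a b : dag (E a b) = E b a.
Proof. by apply/matrixP => k l; rewrite dag_entry !mxE rmorph_nat andbC. Qed.

Lemma rot_dag ty t : dag (givens ty t) = givens ty (- t).
Proof.
rewrite /givens !dagD !dagZ dag1 cosN sinN.
have -> : dag rotP = rotP by rewrite /rotP dagD !dag_delta.
have -> : dag (rotN ty) = - rotN ty.
  case: ty; rewrite /rotN; first by rewrite dagB !dag_delta opprB.
  rewrite dagZ dagB !dag_delta -scaleNr; congr (_ *: _).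
  by apply/eqP; rewrite eq_complex /= oppr0 !eqxx.
by rewrite !conjCc !conjc_real scalerN -scaleNr -(rmorphN (real_complex R)).
Qed.

Lemma rot_unitary ty t : unitary (givens ty t).
Proof. by apply: unitaryI; rewrite rot_dag givens_add subrr givens0. Qed.

Definition rot_apply ty t A : 'M[R[i]]_n := \matrix_(k, l)
  (A k l * (1 + (cos t - 1) * ((k == j)%:R + (k == j')%:R))%:C +
   (sin t)%:C * (if ty then (k == j)%:R * A j' l - (k == j')%:R * A j l
                 else 'i%C * ((k == j)%:R * A j l - (k == j')%:R * A j' l))).

Lemma delta_mulE a b A k l : (E a b *m A) k l = (k == a)%:R * A b l.
Proof.
rewrite mxE (bigD1 b) //= big1 => [|i /negPf h]; last by rewrite mxE h andbF mul0r.
by rewrite mxE eqxx andbT addr0.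
Qed.

Lemma rot_mulE ty t A : givens ty t *m A = rot_apply ty t A.
Proof.
apply/matrixP => k l; rewrite /givens mulmxDl mulmxDl mul1mx -!scalemxAl !mxDE !mxZE.
rewrite /rotP mulmxDl mxDE !delta_mulE [RHS]mxE; congr (_ + _ * _); last first.
  rewrite /rotN; case: ty; first by rewrite mulmxBl mxDE mxNE !delta_mulE.
  by rewrite -scalemxAl mxZE mulmxBl mxDE mxNE !delta_mulE.
have h a : (k == a)%:R * A a l = (k == a)%:R * A k l by case: eqP => [->|_]; rewrite ?mul0r.
by rewrite !h -mulrDl rot_c3 mulrDr mulr1 mulrA [in RHS]mulrC.
Qed.

(** Meant for the tail after the fortieth digit, where a crude entrywise estimate is enough. *)
Lemma rot_sub1 ty t : nrm (givens ty t - 1%:M) <= n%:R ^+ 2 * (2 * `|t|).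
Proof.
apply: nrm_entries => k l.
have -> : givens ty t - 1%:M = (cos t - 1)%:C *: rotP + (sin t)%:C *: rotN ty.
  by rewrite /givens -(addrA 1%:M) addrAC subrr add0r.
have hc := normc_cis_sub1 t.
have [c1 s1] : `|cos t - 1| <= `|t| /\ `|sin t| <= `|t|.
  split; last exact: normr_sin_le.
  apply: le_trans hc; rewrite /= subr0 -sqrtr_sqr ler_wsqrtr // lerDl sqr_ge0 //.
rewrite mxDE !mxZE mulrDl mul1r; apply: le_trans (normcD _ _) _; rewrite !normcM !normc_real.
have b1 (a : bool) : normc (a%:R : R[i]) <= 1 by case: a; rewrite ?normc1 ?normc0.
have pk : normc (rotP k l) <= 1.
  rewrite /rotP mxDE !mxE; case: (k =P j) => [->|_]; last by rewrite add0r.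
  by rewrite (negPf jj') addr0.
have nk : normc (rotN ty k l) <= 1.
  rewrite /rotN; case: ty.
    rewrite mxDE mxNE !mxE; case: (k =P j) => [->|_]; last by rewrite add0r normcNe.
    by rewrite (negPf jj') subr0.
  rewrite mxZE normcM normc_i mul1r mxDE mxNE !mxE; case: (k =P j) => [->|_]; last by rewrite add0r normcNe.
  by rewrite (negPf jj') subr0.
by apply: lerD; rewrite -[leRHS]mulr1; apply: ler_pM; rewrite ?normr_ge0 ?normc_ge0.
Qed.

Lemma rot_det ty t : \det (givens ty t) = 1.
Proof.
case: ty; last first.
  pose v : 'rV[R[i]]_n := \row_k (if k == j then cis t else if k == j' then cis (- t) else 1).
  have -> : givens false t = diag_mx v.
    rewrite -[givens _ _]mulmx1 rot_mulE; apply/matrixP => k l; rewrite !mxE.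
    case: (k =P l) => [<-|kl]; rewrite ?mulr1n ?mulr0n; last first.
      case: (k =P j) kl => [-> /eqP/negPf jl|_ /eqP /negPf kl].
        by rewrite (negPf jj') jl !mulr0n !(mul0r, mulr0, subrr, addr0, mulr0).
      case: (k =P j') kl => [->|_] kl; rewrite ?kl ?mulr0n !(mul0r, mulr0, subrr, addr0, mulr0) //.
    case: (k =P j) => [->|_].
      rewrite (negPf jj') eqxx !(mul0r, mul1r, mulr1, subr0, addr0) [1 + _]addrC subrK.
      by apply/eqP; rewrite eq_complex /= !(mul0r, mulr0, mulr1, subr0, addr0, add0r) !eqxx.
    case: (k =P j') => [->|_].
      rewrite eqxx !(mul0r, mul1r, mulr1, sub0r, add0r) [1 + _]addrC subrK /cis cosN sinN.
      by apply/eqP; rewrite eq_complex /= !(mul0r, mulr0, mulr1, mulrN, subr0, addr0, add0r, oppr0) !eqxx.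
    by rewrite !(mul0r, mulr0, subr0, addr0, mulr1).
  rewrite det_diag (bigD1 j) //= (bigD1 j') /=; last by rewrite eq_sym.
  rewrite big1 => [|k /andP[/negPf h1 /negPf h2]]; last by rewrite mxE h1 h2.
  by rewrite !mxE eqxx j'j eqxx mulr1 cisN.
have tr s : (givens true s)^T = givens true (- s).
  by rewrite /givens /rotP /rotN rot_algebra_tr cosN sinN (rmorphN (real_complex R)).
(* Transposition inverts a real rotation, so its determinant has square one. Writing the rotation as
   the square of the one by half the angle excludes -1 without a continuity argument. *)
have sq s : \det (givens true s) * \det (givens true s) = 1.
  by rewrite -{2}det_tr tr -det_mulmx givens_add subrr givens0 det1.
have -> : t = t / 2 + t / 2 by field.
by rewrite -givens_add det_mulmx sq.
Qed.

Lemma rotZ_j t A l : (givens false t *m A) j l = cis t * A j l.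
Proof.
rewrite rot_mulE mxE eqxx (negPf jj') !(mul0r, mul1r, mulr1, subr0, addr0) [1 + _]addrC subrK.
rewrite mulrC mulrA -mulrDl; congr (_ * _).
by apply/eqP; rewrite eq_complex /= !(mul0r, mulr0, mulr1, subr0, addr0, add0r) !eqxx.
Qed.

Lemma rotZ_j' t A l : (givens false t *m A) j' l = cis (- t) * A j' l.
Proof.
rewrite rot_mulE mxE eqxx j'j !(mul0r, mul1r, mulr1, sub0r, add0r) [1 + _]addrC subrK.
rewrite [A j' l * _]mulrC mulrA mulrN -mulNr -mulrDl; congr (_ * _); rewrite /cis cosN sinN.
by apply/eqP; rewrite eq_complex /= !(mul0r, mulr0, mulr1, subr0, addr0, add0r, oppr0) !eqxx.
Qed.

Lemma rotY_j t A l : (givens true t *m A) j l = (cos t)%:C * A j l + (sin t)%:C * A j' l.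
Proof.
rewrite rot_mulE mxE eqxx (negPf jj') !(mul0r, mul1r, mulr1, subr0, addr0) [1 + _]addrC subrK.
by rewrite mulrC.
Qed.

Lemma rotY_j' t A l : (givens true t *m A) j' l = (cos t)%:C * A j' l - (sin t)%:C * A j l.
Proof.
rewrite rot_mulE mxE eqxx j'j !(mul0r, mul1r, mulr1, sub0r, add0r) [1 + _]addrC subrK.
by rewrite mulrC mulrN.
Qed.

Lemma rot_other ty t A k l : k != j -> k != j' -> (givens ty t *m A) k l = A k l.
Proof.
move=> /negPf h1 /negPf h2; rewrite rot_mulE mxE h1 h2.
by case: ty; rewrite !(mul0r, subr0, addr0, mulr0, mulr1).
Qed.

Lemma rot_zeros ty t A l : A j l = 0 -> A j' l = 0 ->
  (givens ty t *m A) j l = 0 /\ (givens ty t *m A) j' l = 0.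
Proof.
move=> h1 h2; case: ty; first by rewrite rotY_j rotY_j' h1 h2 !mulr0 subr0 addr0.
by rewrite rotZ_j rotZ_j' h1 h2 !mulr0.
Qed.

(** The phase rotation gives both entries the common argument $(\arg a+\arg b)/2$; a real rotation
    by the angle of the point $(|a|,|b|)$ then annihilates the second. *)
Lemma givens_zero A c : let A1 := givens false ((arg (A j' c) - arg (A j c)) / 2) *m A in
  (givens true (arg (normc (A1 j c) +i* normc (A1 j' c))) *m A1) j' c = 0.
Proof.
set a := A j c; set b := A j' c; set t := (arg b - arg a) / 2; move=> A1.
set mu := (arg a + arg b) / 2.
have e1 : A1 j c = cis mu * (normc a)%:C.
  rewrite /A1 rotZ_j -/a [in LHS](argP a) mulrCA -cisD mulrC; congr (cis _ * _); rewrite /t /mu; lra.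
have e2 : A1 j' c = cis mu * (normc b)%:C.
  rewrite /A1 rotZ_j' -/b [in LHS](argP b) mulrCA -cisD mulrC; congr (cis _ * _); rewrite /t /mu; lra.
have nr x : 0 <= x -> normc (cis mu * x%:C) = x.
  by move=> hx; rewrite normcM normc_cis mul1r normc_real ger0_norm.
rewrite rotY_j' e1 e2 !nr ?normc_ge0 //; set z := normc a +i* normc b.
have := argP z; set r := normc z => /eqP; rewrite eq_complex /= !(mul0r, subr0, addr0) => /andP[/eqP -> /eqP ->].
rewrite !(rmorphM (real_complex R)) /=; ring.
Qed.
End Rotation.

Section Triangular.
Variables (R : realType) (n : nat).
Implicit Types (A : 'M[R[i]]_n).

(** Induction on the rows: once the earlier rows are diagonal, column i has only its diagonal entry
    left, of modulus one, and orthogonality to the other columns clears the rest of row i. *)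
Lemma unitary_triangular A : unitary A -> (forall i j : 'I_n, (j < i)%N -> A i j = 0) ->
  (forall i j : 'I_n, i != j -> A i j = 0) /\ (forall i, normc (A i i) = 1).
Proof.
move=> uA tri; have h := unitary_dagl uA.
have entry (i j : 'I_n) : \sum_k (A k i)^* * A k j = (i == j)%:R.
  have := congr1 (fun Q : matrix R[i] n n => Q i j) h; rewrite !mxE => <-.
  by apply: eq_bigr => k _; rewrite dag_entry.
suff H : forall m, (m <= n)%N -> forall i : 'I_n, (i < m)%N ->
    (forall j : 'I_n, i != j -> A i j = 0) /\ normc (A i i) = 1.
  by split=> i; [move=> j; exact: (H n (leqnn n) i (ltn_ord i)).1|exact: (H n (leqnn n) i (ltn_ord i)).2].
elim=> [|m IH] mn i //; rewrite ltnS leq_eqVlt => /orP[/eqP im|]; last exact: IH (ltnW mn) i.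
have col k : k != i -> A k i = 0.
  rewrite -val_eqE /= neq_ltn => /orP[ki|/tri //].
  by apply: (IH (ltnW mn) k _).1; rewrite -?im // -val_eqE neq_ltn ki.
have ii j : (A i i)^* * A i j = (i == j)%:R.
  rewrite -entry (bigD1 i) //= big1 ?addr0 // => k ki.
  by rewrite col // rmorph0 mul0r.
have n1 : normc (A i i) = 1.
  have := ii i; rewrite eqxx mulrC mul_conjc => /(congr1 (@complex.Re R)) /= h2.
  by apply/eqP; rewrite -(@eqrXn2 _ 2) ?normc_ge0 // h2 expr1n.
split => // j /negPf ij; have := ii j; rewrite ij => /eqP; rewrite mulf_eq0 => /orP[|/eqP //].
by move=> /eqP h0; have := normc_conj (A i i); rewrite -conjCc h0 normc0 n1 => /eqP; rewrite eq_sym oner_eq0.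
Qed.
End Triangular.

Section Frac.
Variable R : realType.
Implicit Types x t : R.

(* The rotation by [t] is the one by [2 * pi * turn t]. *)
Definition turn t : R := let x := t / (2 * pi) in if 0 <= x then x else x + 1.

Lemma turn_itv t : `|t| <= pi -> 0 <= turn t < 1.
Proof.
have key (y : R) : `|y| <= 1 / 2 -> 0 <= (if 0 <= y then y else y + 1) < 1.
  by rewrite ler_norml => /andP[h1 h2]; case: (lerP 0 y) => h; apply/andP; split; lra.
move=> ht; rewrite /turn; cbv zeta; have p := @pi_gt0 R.
have hx : `|t / (2 * pi)| <= 1 / 2.
  rewrite normrM normfV (ger0_norm (_ : 0 <= 2 * pi)); last by rewrite mulr_ge0 // ltW.
  by rewrite ler_pdivrMr ?mulr_gt0 //; lra.
exact: key.
Qed.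

Lemma rot_turn n (j j' : 'I_n) ty t : givens j j' ty (2 * pi * turn t) = givens j j' ty t.
Proof.
have p0 : 2 * pi != 0 :> R by rewrite mulf_neq0 ?pnatr_eq0 // gt_eqF ?pi_gt0.
have e : 2 * pi * (t / (2 * pi)) = t by rewrite mulrC mulfVK.
rewrite /turn; cbv zeta; case: ifP => _; first by rewrite e.
rewrite mulrDr e mulr1; exact: rot_2pi.
Qed.
End Frac.

Section Pclose.
Variables (R : realType) (n : nat).
Implicit Types (A B C D : 'M[R[i]]_n) (e f : R).

Lemma pclose_mul A B C D e f : unitary A -> unitary D -> pclose e A B -> pclose f C D ->
  pclose (e + f) (A *m C) (B *m D).
Proof.
move=> uA uD [u u1 h1] [w w1 h2]; exists (u * w); first by rewrite normcM u1 w1 mul1r.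
have -> : A *m C - (u * w) *: (B *m D) = A *m (C - w *: D) + (A - u *: B) *m (w *: D).
  by rewrite mulmxBr mulmxBl !(mxZl, mxZr) scalerA addrA subrK.
rewrite addrC; apply: nrmD_le; last by rewrite nrm_mulU.
by rewrite nrm_mulrU //; exact: phase_unitary.
Qed.

Lemma pclose_trans_l A A' B e f : nrm (A - A') <= f -> pclose e A' B -> pclose (f + e) A B.
Proof. by move=> h [u u1 h1]; exists u => //; apply: le_trans (nrm_tri A' _ _) _; exact: lerD. Qed.

Lemma pclose_phase_l z A B e : normc z = 1 -> pclose e A B -> pclose e (z *: A) B.
Proof.
move=> z1 [u u1 h]; exists (z * u); first by rewrite normcM z1 u1 mul1r.
rewrite -scalerA -scalerBr; apply: le_trans (nrmZ_le _ _) _; by rewrite z1 mul1r.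
Qed.

Lemma pclose_refl A : pclose 0 A A.
Proof. by exists 1; rewrite ?normc1 // scale1r subrr nrm0. Qed.
End Pclose.

(** * Matrix products by packing rows and columns *)

Local Open Scope nat_scope.

(** * One matrix entry as a digit of a product *)

Section PackedEntry.
Variables (R : realType) (d : nat) (X b : R).
Hypothesis d0 : 0 < d.
Hypothesis Xz : X \is a Num.int.
Hypothesis X1 : (1 <= X)%R.
Hypothesis big : (2 * (d%:R ^+ 2 * b) < X)%R.

Definition cint (z : R[i]) := complex.Re z \is a Num.int /\ complex.Im z \is a Num.int.

Lemma cintM z w : cint z -> cint w -> cint (z * w)%R.
Proof.
by case: z w => [a1 a2] [b1 b2] [/= h1 h2] [h3 h4]; split; rewrite /= ?rpredB ?rpredD ?rpredM.
Qed.

Lemma extract_int (y : 'I_d -> 'I_d -> R) : (forall s t, y s t \is a Num.int) ->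
  (forall s t, `|y s t| <= b)%R ->
  extract X d (\sum_s \sum_t y s t * X ^+ (d.-1 + s - t))%R = (\sum_s y s s)%R.
Proof.
move=> yz yb; have yE s t : y s t = (Num.floor (y s t))%:~R%R.
  by have := yz s t; rewrite intrEfloor => /eqP ->.
have XE : X = (Num.floor X)%:~R%R by have := Xz; rewrite intrEfloor => /eqP ->.
have X0 : (0 < X)%R by apply: lt_le_trans X1.
have zb s t : (`|(Num.floor (y s t))%:~R : R| <= b)%R by rewrite -yE.
transitivity (extract X d (\sum_s \sum_t (Num.floor (y s t))%:~R * X ^+ (d.-1 + s - t))%R).
  by congr extract; apply: eq_bigr => s _; apply: eq_bigr => t _; rewrite -yE.
rewrite (extractP X0 XE zb big X1 d0).
by apply: eq_bigr => s _; rewrite -yE.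
Qed.

Variables (c t : 'I_d -> R[i]).
Hypothesis cz : forall s, cint (c s).
Hypothesis tz : forall s, cint (t s).
Hypothesis ctb : forall s u, (normc (c s * t u) <= b)%R.

Let pa := (\sum_s c s * (X ^+ s)%:C)%R.
Let pb := (\sum_s t s * (X ^+ (d.-1 - s))%:C)%R.

Lemma packed_mulE : (pa * pb = \sum_s \sum_u (c s * t u) * (X ^+ (d.-1 + s - u))%:C)%R.
Proof.
rewrite /pa /pb mulr_suml; apply: eq_bigr => s _; rewrite mulr_sumr; apply: eq_bigr => u _.
rewrite mulrACA -(rmorphM (real_complex R)) -exprD /=; congr (_ * (_ ^+ _)%:C)%R.
by have := ltn_ord u; lia.
Qed.

Lemma Re_le_normc (z : R[i]) : (`|complex.Re z| <= normc z /\ `|complex.Im z| <= normc z)%R.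
Proof.
split; rewrite -(@ler_pXn2r _ 2) ?nnegrE ?normc_ge0 // normc_sqr -normrX ger0_norm ?sqr_ge0 //;
  by rewrite ?lerDl ?lerDr sqr_ge0.
Qed.

(** The real and imaginary parts of the complex product are each numbers in base X with small
    integer digits, so one multiplication of packed complex numbers yields a whole inner product. *)
Lemma packed_entry : extract X d (complex.Re (pa * pb)%R) = complex.Re (\sum_s c s * t s)%R /\
  extract X d (complex.Im (pa * pb)%R) = complex.Im (\sum_s c s * t s)%R.
Proof.
have mre (z : R[i]) (x : R) : complex.Re (z * x%:C)%R = (complex.Re z * x)%R.
  by case: z => z1 z2 /=; rewrite mulr0 subr0.
have mim (z : R[i]) (x : R) : complex.Im (z * x%:C)%R = (complex.Im z * x)%R.
  by case: z => z1 z2 /=; rewrite mulr0 add0r.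
rewrite packed_mulE !raddf_sum; split.
  rewrite -(extract_int (y := fun s u => complex.Re (c s * t u)%R)).
  - by congr extract; apply: eq_bigr => s _; rewrite raddf_sum; apply: eq_bigr => u _; exact: mre.
  - by move=> s u; have [] := cintM (cz s) (tz u).
  - by move=> s u; apply: le_trans (ctb s u); have [] := Re_le_normc (c s * t u)%R.
rewrite -(extract_int (y := fun s u => complex.Im (c s * t u)%R)).
- by congr extract; apply: eq_bigr => s _; rewrite raddf_sum; apply: eq_bigr => u _; exact: mim.
- by move=> s u; have [] := cintM (cz s) (tz u).
- by move=> s u; apply: le_trans (ctb s u); have [] := Re_le_normc (c s * t u)%R.
Qed.
End PackedEntry.

Lemma iteri_horner (R : realType) N (X : R) (g : nat -> R[i]) :
  iteri N (fun k a => (X%:C * a + g k)%R) 0%R = (\sum_(k < N) g k * (X ^+ (N.-1 - k))%:C)%R.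
Proof.
elim: N => [|N IH]; first by rewrite big_ord0.
rewrite big_ord_recr /= subnn expr0 rmorph1 mulr1 IH mulr_sumr; congr (_ + _)%R.
apply: eq_bigr => k _; rewrite mulrCA -(rmorphM (real_complex R)) -exprS; congr (_ * (_ ^+ _)%:C)%R.
by have := ltn_ord k; lia.
Qed.

Section Code.
(** A row is read backwards and a column forwards by the same Horner scheme. In the product of the
    two packed numbers the digit at $X^{d-1}$ then collects the inner product. *)
Definition RowPackE := Cadd (Cscale (RV 43) (CS 2))
  (Crnd2 (CE (NConst 1) (NV 3) (NSub (NSub NDim (NConst 1)) (NV 2)))).
Definition ColPackE k := Cadd (Cscale (RV 43) (CS 2)) (Crnd2 (CE k (NV 2) (NV 3))).
Definition RowPack := For 3 NDim (Seq (Acc NDim RowPackE) (PutSet (NConst 7) (NV 3) (NConst 0) (CS 2))).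
Definition ColPack k := For 3 NDim (Seq (Acc NDim (ColPackE k)) (PutSet (NConst 7) (NV 3) (NConst 1) (CS 2))).
Definition extX e : rexp := RSub (rndX (RDiv e (RV 44)))
  (RMul (RV 43) (rndX (RDiv (rndX (RDiv e (RV 44))) (RV 43)))).
Definition packN : cexp := Cmul (CE (NConst 7) (NV 0) (NConst 0)) (CE (NConst 7) (NV 1) (NConst 1)).
(** Each factor was scaled by 2 B, hence the division by $4B^2$. *)
Definition UnpackE : cexp := Cdiv (extX packN.1, extX packN.2) (RMul (rn 4) (RMul (RV 41) (RV 41))).
Definition PackMul k := Seq RowPack (Seq (ColPack k) (MxSet (NConst 1) UnpackE)).
Definition tableReg := NAdd (NConst 16) (NV 24).
Definition MultLine : seq (ref nexp) :=
  [:: LineRef false (NV LLV); LineRef false (NSub (NMul (NAdd (NV 24) (NConst 1)) (NV 43)) (NConst 1))].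
Definition EmitLine l := Seq (Emit (NConst LLV) l) (SetN NLV (NAdd (NV LLV) (NConst 1))).
Definition Mult := Seq (PackMul tableReg) (EmitLine MultLine).
End Code.

(** * Matrix products in quadratic time *)

Section PackedProduct.
Variables (R : realType) (d m p : nat).
Variables (G : 'I_m -> 'M[R[i]]_d) (U : 'I_p -> 'M[R[i]]_d) (eps : R).
Variables (search : 'M[R[i]]_d -> seq 'I_m) (T0 S : nat).
Implicit Types (st : state R) (c : cmd).
Hypothesis d1 : 1 < d.
Let d0 : 0 < d := ltnW d1.
Hypothesis S64 : 64 <= S.
Hypothesis rm : room d S 14.
Local Notation T := (T G U eps search T0 S).
Local Notation nev := (@neval R d m p).
Local Notation rev := (@reval R d m p G U eps).
Local Notation ceval := (ceval G U eps).
Local Notation same := (same d).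
Local Notation frame := (frame d).
Local Notation M := 'M[R[i]]_d.
Variables (B X : R).
Hypothesis B1 : (1 <= B)%R.
Hypothesis Bz : B \is a Num.int.
Hypothesis Xz : X \is a Num.int.
Hypothesis Xbig : (2 * (d%:R ^+ 2 * (8 * B + 2) ^+ 2) < X)%R.

Let B0 : (0 < B)%R. Proof. exact: lt_le_trans B1. Qed.
Let nB : B != 0%R. Proof. by rewrite gt_eqF. Qed.

Definition packc st := [/\ rmem st 40 = pi, rmem st 41 = B, rmem st 43 = X & rmem st 44 = (X ^+ d.-1)%R].

Lemma packc_same N M' st st' : same N [:: 0; 1; 2; 3] M' st st' -> packc st -> packc st'.
Proof. by move=> s [h1 h2 h3 h4]; split; rewrite (same_sc s). Qed.

Definition idig (z : R[i]) : R[i] := (2%:C * crnd (B%:C * z))%R.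

Lemma idigE z : idig z = ((2 * B)%:C * qc B z)%R.
Proof.
case: z => a b; apply/eqP; rewrite eq_complex /= !(mul0r, subr0, addr0).
by rewrite -!mulrA ![(B * (_ / B))%R]mulrC !mulfVK // !eqxx.
Qed.

Lemma idig_int z : cint (idig z).
Proof. by case: z => a b; rewrite /cint /idig /= !(mul0r, subr0, addr0); split; exact: rnd2_intz. Qed.

Lemma idig_bound z : (normc z <= 2)%R -> (normc (idig z) <= 8 * B + 2)%R.
Proof.
move=> hz; have -> : idig z = ((2 * B)%:C * (qc B z - z) + (2 * B)%:C * z)%R.
  by rewrite idigE -mulrDr subrK.
apply: le_trans (normcD _ _) _; rewrite !normcM normc_real ger0_norm ?mulr_ge0 ?ltW //.
have h1 := qc_near B1 z.
have : (2 * B * normc (qc B z - z)%R <= 2 * B * (1 / B))%R by rewrite ler_pM2l ?mulr_gt0.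
have -> : (2 * B * (1 / B) = 2)%R by field.
have : (2 * B * normc z <= 2 * B * 2)%R by rewrite ler_pM2l ?mulr_gt0.
move: B1; lra.
Qed.

Lemma ceval_Crnd2 st e : packc st -> ceval st (Crnd2 e) = idig (ceval st e).
Proof. by move=> [h1 h2 _ _]; rewrite /Crnd2 ceval_Cscale ceval_Crnd // ceval_Cscale /= h2. Qed.

Definition cPk e n := 50 + n * (100 + 100 + n * (ccost e + 60) + ccost (CS 2) + 400).

(* Row (column) i of a matrix is packed into the complex entry (i, cc) of register 7. *)
Lemma T_pack e cc (g : nat -> nat -> R[i]) st nb : packc st -> cc < d ->
  (forall i k st', i < d -> k < d -> same [:: 0; 1; 2; 3] [:: 0; 1; 2; 3] [:: 7] st st' ->
     nmem st' 3 = i -> nmem st' 2 = k ->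
     ceval st' e = (X%:C * (rmem st' 2 +i* rmem st' 3) + g i k)%R) ->
  cPk e d <= nb ->
  exists2 st', T (For 3 NDim (Seq (Acc NDim e) (PutSet (NConst 7) (NV 3) (NConst cc) (CS 2)))) st nb st' &
    same [:: 0; 1; 2; 3] [:: 0; 1; 2; 3] [:: 7] st st' /\
    forall i j, i < d -> j < d -> regn d st' 7 i j =
      if j == cc then iteri d (fun k a => X%:C * a + g i k)%R 0%R else regn d st 7 i j.
Proof.
move=> hc hcc He hnb.
pose I i st' := same [:: 0; 1; 2; 3] [:: 0; 1; 2; 3] [:: 7] st st' /\
  forall i' j, i' < d -> j < d -> regn d st' 7 i' j =
    if (i' < i) && (j == cc) then iteri d (fun k a => X%:C * a + g i' k)%R 0%R else regn d st 7 i' j.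
have [|||||st' t' [s' h']] := @T_for R d m p G U eps search T0 S S64 I 3 NDim
   (Seq (Acc NDim e) (PutSet (NConst 7) (NV 3) (NConst cc) (CS 2))) st d
   (100 + 100 + d * (ccost e + 60) + ccost (CS 2) + 300) nb isT.
- by move=> i st' x [s h]; split => //; exact: same_setn_in.
- by [].
- by split; [exact: same_refl|].
- move=> i st' id [s h] v3.
  have [|||||s1 t1 [f1 e1]] := @T_acc R d m p G U eps search T0 S d0 S64 NDim e st' [:: 2] [:: 0; 1; 2; 3]
     (100 + 10 + d * (ccost e + 60)) d (fun k a => X%:C * a + g i k)%R.
  + by [].
  + by sub.
  + by [].
  + move=> k st2 kd s2 v2; apply: He => //.
      by apply: (same_trans (st2 := st')) s _; apply: same_sub s2; sub.
    by rewrite (same_n s2).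
  + by rewrite /ccost [nexp_cost _]/=; clear; nia.
  have [|||||| s2 t2 [f2 e2]] := @T_putset R d m p G U eps search T0 S d1 S64 rm (NConst 7) (NV 3) (NConst cc) (CS 2) s1
    (ccost (CS 2) + 150) (rmem s1 2 +i* rmem s1 3).
  + exact: room_le rm.
  + by rewrite /= (same_n f1) // v3.
  + exact: hcc.
  + by [].
  + by [].
  + by rewrite /ccost /=; clear; lia.
  exists s2; first by apply: T_seq t1 t2 _; clear; lia.
  have v3' : nmem s1 3 = i by rewrite (same_n f1).
  split; first by rewrite (same_n f2).
  split.
    apply: (same_trans (st2 := st')) s _; apply: (same_trans (st2 := s1)).
      by apply: same_sub f1; sub.
    by apply: same_sub f2; sub.
  move=> a j ad jd; rewrite e2 // [nev _ (NV 3)]/= [nev _ (NConst 7)]/= [nev _ (NConst cc)]/= v3' e1.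
  rewrite (same_regn d0 f1) // h // ltnS.
  by case: (j == cc); rewrite ?andbT ?andbF //; case: (ltngtP a i) => // ->.
- by move: hnb; rewrite /cPk [nexp_cost _]/=; clear; nia.
exists st' => //; split => // i j id jd.
by rewrite h' // id.
Qed.

Lemma ord_rev_sum (f : nat -> R[i]) : (\sum_(k < d) f (d.-1 - k)%N * (X ^+ (d.-1 - k))%:C = \sum_(k < d) f k * (X ^+ k)%:C)%R.
Proof.
rewrite (reindex_inj rev_ord_inj) /=; apply: eq_bigr => k _.
by have -> : d.-1 - (d - k.+1) = k by have := ltn_ord k; lia.
Qed.

Definition cPM k n := cPk RowPackE n + cPk (ColPackE k) n + cMx (ccost UnpackE) n.

(** The product of the rounded factors is computed exactly, so rounding the factors is the only
    source of error. *)
Lemma T_packmul k kk st nb : packc st -> (forall st', (forall x, x \notin [:: 0; 1; 2; 3] -> nmem st' x = nmem st x) -> nev st' k = kk) ->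
  kk != 7 -> kk != 1 -> (nrm (reg d st 1) <= 2)%R -> (nrm (reg d st kk) <= 2)%R ->
  cPM k d <= nb ->
  exists2 st', T (PackMul k) st nb st' &
    same [:: 0; 1; 2; 3] [:: 0; 1; 2; 3] [:: 1; 7] st st' /\
    reg d st' 1 = qmx B (reg d st 1) *m qmx B (reg d st kk).
Proof.
move=> hc hk k7 k1 n1 n2 hnb.
pose ga i l := idig (regn d st 1 i (d.-1 - l)).
pose gb j l := idig (regn d st kk l j).
have [||s1 t1 [f1 e1]] := @T_pack RowPackE 0 ga st (cPk RowPackE d) hc d0.
- move=> i l st' id ld s v3 v2; have hc' := packc_same s hc.
  rewrite /RowPackE ceval_Cadd ceval_Crnd2 // ceval_Cscale ceval_CS ceval_CE /= v3 v2.
  have [_ _ -> _] := hc'; congr (_ + idig _)%R.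
  rewrite subn1 (same_regn d0 s) //; have := ltn_predK d0; clear -ld; lia.
- exact: leqnn.
have hc1 := packc_same f1 hc.
have r1k : reg d s1 kk = reg d st kk by rewrite (same_reg d0 f1) // inE.
have [||s2 t2 [f2 e2]] := @T_pack (ColPackE k) 1 gb s1 (cPk (ColPackE k) d) hc1 d1.
- move=> j l st' jd ld s v3 v2; have hc' := packc_same s hc1.
  rewrite /ColPackE ceval_Cadd ceval_Crnd2 // ceval_Cscale ceval_CS ceval_CE [nev _ (NV 2)]/= [nev _ (NV 3)]/= v3 v2.
  rewrite hk; last by move=> x hx; rewrite (same_n s) // (same_n f1).
  have [_ _ h43 _] := hc'; rewrite [rev _ (RV 43)]/= h43; congr (_ + idig _)%R.
  by rewrite (same_regn d0 s) ?inE // (same_regn d0 f1) ?inE.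
- exact: leqnn.
have hc2 := packc_same f2 hc1.
have A0 i : i < d -> regn d s2 7 i 0 = (\sum_(l < d) idig (regn d st 1 i l) * (X ^+ l)%:C)%R.
  by move=> id; rewrite e2 //= e1 //= iteri_horner; exact: (ord_rev_sum (fun l => idig (regn d st 1 i l))).
have A1 j : j < d -> regn d s2 7 j 1 = (\sum_(l < d) idig (regn d st kk l j) * (X ^+ (d.-1 - l))%:C)%R.
  by move=> jd; rewrite e2 // eqxx iteri_horner.
have entry2 (Q : M) (i j : 'I_d) : (nrm Q <= 2)%R -> (normc (Q i j) <= 2)%R.
  by move=> h; apply: le_trans (entry_le_nrm _ _ _) h.
have X1 : (1 <= X)%R.
  apply: ltW; apply: le_lt_trans Xbig; have : (1 <= d%:R ^+ 2 :> R)%R by rewrite exprn_ege1 // ler1n.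
  have : (1 <= (8 * B + 2) ^+ 2)%R by rewrite exprn_ege1 //; move: B1; lra.
  move=> h1 h2; have := ler_pM ler01 ler01 h2 h1; lra.
have key (i j : 'I_d) : let c s := idig (reg d st 1 i s) in let t s := idig (reg d st kk s j) in
    let N := (regn d s2 7 i 0 * regn d s2 7 j 1)%R in
    extract X d (complex.Re N) = complex.Re (\sum_s c s * t s)%R /\
    extract X d (complex.Im N) = complex.Im (\sum_s c s * t s)%R.
  move=> c t N.
  have -> : N = ((\sum_s c s * (X ^+ s)%:C) * (\sum_s t s * (X ^+ (d.-1 - s))%:C))%R.
    by rewrite /N A0 // A1 //; congr (_ * _)%R; apply: eq_bigr => s _; rewrite ?/c ?/t regE.
  apply: (packed_entry d0 Xz X1 Xbig) => [s|s|s u]; [exact: idig_int|exact: idig_int|].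
  rewrite normcM expr2; apply: ler_pM; rewrite ?normc_ge0 //; apply: idig_bound; exact: entry2.
have [|||s3 t3 [f3 e3]] := @mxset R d m p G U eps search T0 S d1 S64 rm 1 UnpackE s2 (cMx (ccost UnpackE) d)
   (fun i j => ((4 * (B * B))^-1)%:C * (extract X d (complex.Re (regn d s2 7 i 0 * regn d s2 7 j 1))
      +i* extract X d (complex.Im (regn d s2 7 i 0 * regn d s2 7 j 1))))%R.
- exact: room_le rm.
- move=> i j st' id jd s v0 v1 _; have hc' := packc_same (same_sub (@subset_refl' _ _) (_ : {subset [:: 0; 1] <= [:: 0; 1; 2; 3]}) (@subset_refl' _ _) s) hc2.
  have {}hc' : packc st' by apply: hc'; sub.
  have [h1 h2 h3 h4] := hc'.
  have nE : ceval st' packN = (regn d s2 7 i 0 * regn d s2 7 j 1)%R.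
    rewrite /packN ceval_Cmul !ceval_CE [nev _ (NV 0)]/= [nev _ (NV 1)]/= v0 v1.
    by rewrite !(same_regn d0 s).
  have xE e : rev st' (extX e) = extract X d (rev st' e).
    by rewrite /extX /= h1 h3 h4.
  rewrite /UnpackE ceval_Cdiv [rev _ (RMul _ _)]/= h2; congr (_ * _)%R.
  by rewrite /ceval !xE -nE.
- exact: leqnn.
exists s3.
  by apply: T_seq t1 (T_seq t2 t3 (leqnn _)) _; move: hnb; rewrite /cPM; clear; lia.
split.
  same_via s1 f1.
  same_via s2 f2.
  by apply: same_sub f3; sub.
rewrite e3; apply/matrixP => i j; rewrite [LHS]mxE [RHS]mxE.
have [-> ->] := key i j.
have -> : (\sum_s idig (reg d st 1 i s) * idig (reg d st kk s j) =
   (4 * (B * B))%:C * \sum_s qmx B (reg d st 1) i s * qmx B (reg d st kk) s j)%R.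
  rewrite mulr_sumr; apply: eq_bigr => s _; rewrite !idigE mulrACA -(rmorphM (real_complex R)) ![qmx _ _ _ _]mxE.
  by congr (_%:C * _)%R; ring.
set z := (\sum_s qmx B _ i s * _)%R; case: z => z1 z2.
have n4 : (4 * (B * B) != 0 :> R)%R by rewrite !mulf_neq0 // pnatr_eq0.
by apply/eqP; rewrite eq_complex /= !(mul0r, subr0, addr0) !mulKf // !eqxx.
Qed.
End PackedProduct.

(** * Approximation from the table of rotations *)

Section Code.
Definition VJ' := NAdd (NV 21) (NConst 1).
Definition dA k r : cexp := Cscale (RNat (ndelta (NV 0) k)) (CE (NConst 0) r (NV 1)).
Definition RotE : cexp :=
  Cadd (Cscale (RAdd (rn 1) (RMul (RSub (RV 21) (rn 1)) (RAdd (RNat (ndelta (NV 0) (NV 21))) (RNat (ndelta (NV 0) VJ'))))) (CE01 0))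
  (Cscale (RV 22) (Cadd (Cscale (RNat (NV 20)) (Csub (dA (NV 21) VJ') (dA VJ' (NV 21))))
     (Cscale (RNat (NSub (NConst 1) (NV 20))) (Cmul (rn 0, rn 1) (Csub (dA (NV 21) (NV 21)) (dA VJ' VJ')))))).
Definition SetTrig := Seq (SetR 21 (RFun Cos (RV 20))) (SetR 22 (RFun Sin (RV 20))).
Definition RotateA := Seq SetTrig (Seq (MxSet (NConst 6) RotE) (Copy 0 6)).
Definition SetTurn := Seq (SetR 23 (RDiv (RSub (rn 0) (RV 20)) (RMul (rn 2) (RV 40))))
  (If (RLe (rn 0) (RV 23)) Skip (SetR 23 (RAdd (RV 23) (rn 1)))).
(** Floor by repeated subtraction. A digit in base d takes fewer than d rounds, little compared with
    the product that follows. *)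
Definition DigitLoop := While (RLe (rn 1) (RV 23))
  (Seq (SetR 23 (RSub (RV 23) (rn 1))) (SetN 23 (NAdd (NV 23) (NConst 1)))).
Definition SetIndex := SetN 24 (NAdd (NMul (NAdd (NMul (NAdd (NMul (NV 20) (NSub NDim (NConst 1))) (NV 21))
   (NConst 40)) (NV 22)) NDim) (NV 23)).
Definition DigitStep := Seq (Seq (SetR 23 (RMul (RV 23) (RNat NDim))) (SetN 23 (NConst 0)))
  (Seq DigitLoop (Seq SetIndex Mult)).
Definition Rotate := Seq RotateA (Seq SetTurn (For 22 (NConst 40) DigitStep)).
Definition ModE (e : cexp) := RFun Sqrt (RAdd (RMul e.1 e.1) (RMul e.2 e.2)).
Definition ArgR := Seq (SetR 13 (ModE (CS 10))) (Seq (SetR 14 (RDiv (RV 10) (RV 13)))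
  (Seq (SetR 15 (RDiv (RV 11) (RV 13)))
  (If (RLe (RV 14) (RSub (rn 0) (rn 1))) (SetR 12 (RV 40))
     (SetR 12 (RMul (rn 2) (RFun Atan (RDiv (RV 15) (RAdd (rn 1) (RV 14))))))))).
Definition ArgTo (e : cexp) k := Seq (SetR 10 e.1) (Seq (SetR 11 e.2) (Seq ArgR (SetR k (RV 12)))).
Definition AE i l := CE (NConst 0) i l.
Definition GivensStep :=
  Seq (ArgTo (AE VJ' (NV 25)) 16) (Seq (ArgTo (AE (NV 21) (NV 25)) 17)
  (Seq (Seq (SetR 20 (RDiv (RSub (RV 16) (RV 17)) (rn 2))) (SetN 20 (NConst 0))) (Seq Rotate
  (Seq (ArgTo (ModE (AE (NV 21) (NV 25)), ModE (AE VJ' (NV 25))) 20) (Seq (SetN 20 (NConst 1)) Rotate))))).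
(** Rows are cleared from the bottom upwards by rotations of adjacent rows, so only rotations of
    adjacent coordinates have to be tabulated. *)
Definition ColStep := For 26 (NSub (NSub NDim (NConst 1)) (NV 25))
  (Seq (SetN 21 (NSub (NSub NDim (NConst 2)) (NV 26))) GivensStep).
Definition DiagSum := Seq (SetR 18 (rn 0)) (For 25 NDim
  (Seq (ArgTo (AE (NV 25) (NV 25)) 17) (SetR 18 (RAdd (RV 18) (RV 17))))).
(** v is the exponential of the mean argument, a d-th root of the determinant of the remaining
    diagonal matrix; rotations of determinant one can therefore turn that matrix into v times the
    identity. *)
Definition SetV := Seq (SetR 19 (RDiv (RV 18) (RNat NDim))) (Seq (SetR 24 (RFun Cos (RV 19))) (SetR 25 (RFun Sin (RV 19)))).
Definition PhaseStep := Seq (ArgTo (Cmul (CS 24) (Cconj (AE (NV 25) (NV 25)))) 20)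
  (Seq (Seq (SetN 21 (NV 25)) (SetN 20 (NConst 0))) Rotate).
(** The word starts as an empty line of its own, so that every later line only has to append one
    table entry to its predecessor. *)
Definition Leaf := Seq (MxSet (NConst 1) (CR (RNat (ndelta (NV 0) (NV 1))))) (Seq (EmitLine [::])
  (Seq (For 25 NDim ColStep) (Seq DiagSum (Seq SetV (For 25 (NSub NDim (NConst 1)) PhaseStep))))).
End Code.

(** Mixed-radix number with the digits: type of the rotation, first coordinate, position of the
    digit in base d, value of that digit. *)
Definition tidx d (ty : bool) j b a := ((ty * (d - 1) + j) * 40 + b) * d + a.

Lemma digit_angle (K : fieldType) (c y0 y a D P : K) : D != 0%R -> P != 0%R ->
  (c * (y0 - y / P) + c * (a / (D * P)) = c * (y0 - (D * y - a) / (D * P)))%R.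
Proof. by move=> h1 h2; field; rewrite h1 h2. Qed.

Lemma frac_lt (K : realFieldType) (c D y : K) : (0 < c)%R -> (0 < D)%R -> (y < 1)%R -> (c * (y / D) < c / D)%R.
Proof. by move=> h1 h2 h3; rewrite mulrA ltr_pM2r ?invr_gt0 // gtr_pMr. Qed.

Lemma half_diff_bound (R : realFieldType) (a b c : R) : (`|b| <= c -> `|a| <= c -> `|(a - b) / 2| <= c)%R.
Proof. by rewrite !ler_norml => /andP[h1 h2] /andP[h3 h4]; apply/andP; split; lra. Qed.

Lemma cis_exp (R : realType) (t : R) n : (cis t ^+ n = cis (n%:R * t))%R.
Proof. by elim: n => [|n IH]; rewrite ?mul0r ?cis0 // exprS IH -cisD -natr1 mulrDl mul1r addrC. Qed.

Lemma det_offdiag0 (K : comNzRingType) n (A : 'M[K]_n) : (forall a b, a != b -> A a b = 0)%R ->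
  (\det A = \prod_a A a a)%R.
Proof. by move=> h; apply: det_trig; apply/is_trig_mxP => a b ab; apply: h; rewrite -val_eqE ltn_eqF. Qed.

Lemma cis_arg (R : realType) (z : R[i]) : normc z = 1%R -> cis (arg z) = z.
Proof. by move=> h; rewrite {2}(argP z) h mul1r. Qed.

Lemma givens_zeroB (R : realType) n (j j' : 'I_n) (A B : 'M[R[i]]_n) c t : j != j' ->
  t = ((arg (A j' c) - arg (A j c)) / 2)%R -> B = givens j j' false t *m A ->
  (givens j j' true (arg (normc (B j c) +i* normc (B j' c))%C) *m B) j' c = 0%R.
Proof. by move=> jn -> ->; exact: givens_zero. Qed.

(** * The depth-zero search of the main phase *)

Section Leaf.
Variables (R : realType) (d m p : nat).
Variables (G : 'I_m -> 'M[R[i]]_d) (U : 'I_p -> 'M[R[i]]_d) (eps : R).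
Variables (search : 'M[R[i]]_d -> seq 'I_m) (T0 S : nat).
Implicit Types (st : state R) (c : cmd).
Hypothesis d1 : 1 < d.
Let d0 : 0 < d := ltnW d1.
Hypothesis S64 : 64 <= S.
Hypothesis rm : room d S 14.
Hypothesis hG : instruction_set G.
Local Notation T := (T G U eps search T0 S).
Local Notation nev := (@neval R d m p).
Local Notation rev := (@reval R d m p G U eps).
Local Notation ceval := (ceval G U eps).
Local Notation ev := (ev G U eps).
Local Notation same := (same d).
Local Notation frame := (frame d).
Local Notation M := 'M[R[i]]_d.
Variables (B X : R).
Hypothesis B1 : (1 <= B)%R.
Hypothesis Bz : B \is a Num.int.
Hypothesis Xz : X \is a Num.int.
Hypothesis Xbig : (2 * (d%:R ^+ 2 * (8 * B + 2) ^+ 2) < X)%R.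
Variables (eta : R) (Lam lt : nat).
Hypothesis eta_turn : (d%:R ^+ 2 * (2 * (2 * pi * (d%:R ^+ 40)^-1)) <= eta)%R.
Hypothesis Lam0 : 0 < Lam.

Let kap : R := (d%:R ^+ 2 / B)%R.
(* Register 16 + e and line (e + 1) Lam - 1 hold the word for table entry e. *)
Definition entry_ok st e (W : M) := [/\ reg d st (16 + e) = W, (e + 1) * Lam <= size (slp st),
  size (wd G (slp st) ((e + 1) * Lam - 1)) <= lt & word_eval G (wd G (slp st) ((e + 1) * Lam - 1)) = W].

Definition table_ok st := forall (ty : bool) (j j' : 'I_d) b a, j' = j.+1 :> nat -> b < 40 -> a < d ->
  exists2 W, entry_ok st (tidx d ty j b a) W &
    pclose eta (givens j j' ty (2 * pi * (a%:R / d%:R ^+ b.+1))) W.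

Definition leaf_inv st := [/\ packc d B X st, nmem st 43 = Lam & table_ok st].

Lemma leaf_inv_step N Sc M' st st' Ls : leaf_inv st -> frame N Sc M' st st' ->
  {subset N <= 43 :: iota 0 43} -> 43 \notin N -> {subset Sc <= iota 0 40} -> {subset M' <= iota 0 16} ->
  slp st' = slp st ++ Ls -> leaf_inv st'.
Proof.
move=> [[c1 c2 c3 c4] hn ht] f _ hN hS hM hs.
have nS k : 40 <= k -> k \notin Sc by move=> hk; apply/negP => /hS; rewrite mem_iota; lia.
split; first by split; rewrite (frame_sc f) // nS.
  by rewrite (frame_n f).
move=> ty j j' b a jj hb ha; have [W [w1 w2 w3 w4] hW] := ht ty j j' b a jj hb ha.
have wE : wd G (slp st') ((tidx d ty j b a + 1) * Lam - 1) = wd G (slp st) ((tidx d ty j b a + 1) * Lam - 1).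
  by rewrite hs wd_cat //; move: w2 Lam0; clear; nia.
exists W => //; split; rewrite ?wE //.
  by rewrite (frame_reg d0 f) //; apply/negP => /hM; rewrite mem_iota; lia.
by rewrite hs size_cat (leq_trans w2) // leq_addr.
Qed.

Lemma T_rotateA st (ty : bool) (j j' : 'I_d) t : nmem st 20 = ty -> nmem st 21 = j -> j' = j.+1 :> nat ->
  rmem st 20 = t ->
  exists2 st', T RotateA st (slcost SetTrig + cMx (ccost RotE) d + cMx 200 d) st' &
    same [:: 0; 1] [:: 0; 1; 21; 22] [:: 0; 6] st st' /\ reg d st' 0 = givens j j' ty t *m reg d st 0.
Proof.
move=> h20 h21 jj ht.
have jn : j != j' by rewrite -val_eqE /= jj neq_ltn ltnSn.
set s1 := ev SetTrig st.
have t1 : T SetTrig st (slcost SetTrig) s1 by apply: T_sl.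
have f1 : same [::] [:: 21; 22] [::] st s1 by do !apply: same_setr_in => //; exact: same_refl.
have [e21 e22] : rmem s1 21 = cos t /\ rmem s1 22 = sin t by rewrite /s1 /= /upd /= ht.
clearbody s1.
have r0 : reg d s1 0 = reg d st 0 by rewrite (same_reg d0 f1).
set A := reg d st 0 in r0 *.
have [|||s2 t2 [f2 e2]] := @mxset R d m p G U eps search T0 S d1 S64 rm 6 RotE s1 (cMx (ccost RotE) d)
  (fun k l => regn d s1 0 k l * (1 + (cos t - 1) * ((k == j)%:R + (k == j')%:R))%:C +
   (sin t)%:C * (if ty then (k == j)%:R * regn d s1 0 j' l - (k == j')%:R * regn d s1 0 j l
                 else 'i%C * ((k == j)%:R * regn d s1 0 j l - (k == j')%:R * regn d s1 0 j' l)))%R.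
- exact: room_le rm.
- move=> k l st' kd ld s v0 v1 _.
  have n20 : nmem st' 20 = ty by rewrite (same_n s) // (same_n f1).
  have n21 : nmem st' 21 = j by rewrite (same_n s) // (same_n f1).
  have rg a b : a < d -> b < d -> regn d st' 0 a b = regn d s1 0 a b.
    by move=> ha hb; rewrite (same_regn d0 s).
  have dE e x : nev st' e = x -> (rev st' (RNat (ndelta (NV 0) e)) = (k == x)%:R)%R.
    by move=> he; rewrite [LHS]/= -/(nev st' e) (delta_nat d1 S64 rm) v0 he.
  have nj : nev st' (NV 21) = j by [].
  have nj' : nev st' VJ' = j' by rewrite /= n21 jj addn1.
  have dAE e r x y : nev st' e = x -> nev st' r = y -> y < d -> ceval st' (dA e r) = ((k == x)%:R * regn d s1 0 y l)%R.
    move=> he hr yd; rewrite /dA ceval_Cscale (dE _ _ he) ceval_CE hr [nev _ (NConst 0)]/= [nev _ (NV 1)]/= v1 rg //.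
    by rewrite rmorph_nat.
  rewrite /RotE ceval_Cadd !ceval_Cscale ceval_Cadd !ceval_Cscale ceval_Cmul !ceval_Csub.
  rewrite (@ceval_CE01 R d m p G U eps st' 0 _ _ v0 v1) rg // !(dAE _ _ _ _ nj nj') // !(dAE _ _ _ _ nj' nj) // !(dAE _ _ _ _ nj nj) // !(dAE _ _ _ _ nj' nj') //.
  have -> : rev st' (RAdd (rn 1) (RMul (RSub (RV 21) (rn 1)) (RAdd (RNat (ndelta (NV 0) (NV 21))) (RNat (ndelta (NV 0) VJ'))))) =
     (1 + (cos t - 1) * ((k == j)%:R + (k == j')%:R))%R.
    rewrite [LHS]/= -/(rev st' (RNat (ndelta (NV 0) (NV 21)))) -/(rev st' (RNat (ndelta (NV 0) VJ'))).
    have := dE _ _ nj; have := dE _ _ nj'; rewrite /= => -> ->.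
    by rewrite (same_sc s) // e21.
  rewrite mulrC; congr (_ + _ * _)%R; first by rewrite /= (same_sc s) // e22.
  rewrite [rev _ (RNat (NV 20))]/= [rev _ (RNat (NSub _ _))]/= n20.
  have -> : ceval st' (rn 0, rn 1) = 'i%C by [].
  by case: (ty); rewrite /= ?rmorph0 ?rmorph1 ?(mul1r, mul0r, addr0, add0r).
- exact: leqnn.
have [|||s3 t3 [f3 e3]] := @T_copy R d m p G U eps search T0 S d1 S64 rm 0 6 s2 (cMx 200 d) => //.
exists s3; first by apply: T_seq t1 (T_seq t2 t3 (leqnn _)) _; clear; lia.
split.
  same_via s1 f1.
  by apply: (same_trans (st2 := s2)); [apply: same_sub f2|apply: same_sub f3]; sub.
rewrite e3 e2 rot_mulE /rot_apply -r0; apply/matrixP => k l; rewrite !mxE.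
by rewrite -!val_eqE.
Qed.

(* Progress of the word under construction: e bounds the projective distance of
   its value to X, after k factors. *)
Definition prog st0 e k Y st := [/\ lines_ok st /\ nmem st LLV = (size (slp st)).-1, ans st = ans st0,
  exists2 Ls, slp st = slp st0 ++ Ls & size Ls = k.+1, size (lastw G st) <= k * lt &
  (nrm (reg d st 1 - word_eval G (lastw G st)) <= 4 * kap * k%:R)%R /\
  pclose e Y (word_eval G (lastw G st))].

Lemma prog_same st0 e k Y N Sc M' st st' : same N Sc M' st st' -> 1 \notin M' ->
  NLV \notin N -> LLV \notin N -> prog st0 e k Y st -> prog st0 e k Y st'.
Proof.
move=> s h1 hn hl [[p1 p2] p3 p4 p5 p6].
by split; rewrite /lines_ok /lastw ?(same_slp s) ?(same_ans s) ?(same_n s) ?(same_reg d0 s).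
Qed.

Lemma T_emitline l st (w : seq 'I_m) nb : lines_ok st -> all (fun r => ref_ok m (size (slp st)) (ref_map (nev st) r)) l ->
  flatten (map (fun r => expand_ref G (Defs.expand G (slp st)) (ref_map (nev st) r)) l) = w ->
  \sum_(r <- l) (nexp_cost (ref_arg r)).+1 + 20 <= nb ->
  exists2 st', T (EmitLine l) st nb st' & frame [:: LLV; NLV] [::] [::] st st' /\
    [/\ lines_ok st', nmem st' LLV = (size (slp st')).-1, ans st' = ans st,
      exists x, slp st' = rcons (slp st) x & lastw G st' = w].
Proof.
move=> lo hl hw hnb.
set l' := map (ref_map (nev st)) l.
have t1 : T (Emit (NConst LLV) l) st (\sum_(r <- l) (nexp_cost (ref_arg r)).+1 + 2) (add_line st LLV l').
  have := @T_emit R d m p G U eps search T0 S d0 S64 LLV l st (\sum_(r <- l) (nexp_cost (ref_arg r)).+1 + 2) isT.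
  by apply => //; rewrite all_map.
set s1 := add_line st LLV l' in t1; set s2 := setn s1 NLV (size (slp st)).+1.
have t2 : T (SetN NLV (NAdd (NV LLV) (NConst 1))) s1 10 s2.
  have := @T_setn R d m p G U eps search T0 S S64 NLV (NAdd (NV LLV) (NConst 1)) s1 10 isT isT.
  by rewrite /= /upd /= addn1.
exists s2; first by apply: T_seq t1 t2 _; move: hnb; clear; lia.
split.
  by split=> // k; rewrite !inE negb_or => /andP[h1 h2]; rewrite /= /upd (negPf h1) (negPf h2).
split.
- by rewrite /lines_ok /= /upd /= size_rcons.
- by rewrite /= /upd /= size_rcons.
- by [].
- by exists l'.
- by rewrite /lastw /= size_rcons /= wd_rcons /l' -map_comp.
Qed.

Definition cMult := cPM tableReg d + 100.

(** Rounding the two factors costs [kap] each, besides a second-order term. A budget of 4 [kap] per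
    factor covers this as long as the accumulated error stays below one. *)
Lemma T_mult st0 e k Y st (ty : bool) (j j' : 'I_d) b a : leaf_inv st -> prog st0 e k Y st -> unitary Y ->
  j' = j.+1 :> nat -> b < 40 -> a < d -> nmem st 24 = tidx d ty j b a ->
  (4 * kap * k.+1%:R <= 1)%R ->
  exists2 st', T Mult st cMult st' &
    frame [:: 0; 1; 2; 3; 15; 16] [:: 0; 1; 2; 3] [:: 1; 7] st st' /\ leaf_inv st' /\
    prog st0 (e + eta)%R k.+1 (Y *m givens j j' ty (2 * pi * (a%:R / d%:R ^+ b.+1))) st'.
Proof.
move=> hi; have [hc hL ht] := hi; move=> [[p1 p2] p3 [Ls p4 p4'] p5 [p6 p7]] uY jj hb ha h24 hk1.
have [W [w1 w2 w3 w4] hW] := ht ty j j' b a jj hb ha.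
set e0 := tidx d ty j b a in w1 w2 w3 w4 h24.
set wv := word_eval G (lastw G st) in p6 p7.
have kap0 : (0 <= kap)%R by rewrite /kap divr_ge0 // ?exprn_ge0 // (le_trans ler01).
have kap4 : (0 <= 4 * kap)%R by apply: mulr_ge0 kap0; exact: ler0n.
have kk : (4 * kap * k%:R <= 4 * kap * k.+1%:R)%R by apply: ler_wpM2l kap4 _ _ _; rewrite ler_nat leqnSn.
have k41 : (4 * kap <= 1)%R.
  by apply: le_trans hk1; rewrite ler_peMr // ler1n.
have uwv : unitary wv by exact: word_unitary.
have uW : unitary W by rewrite -w4; exact: word_unitary.
have n1 : (nrm (reg d st 1) <= 2)%R.
  have -> : reg d st 1 = (reg d st 1 - wv + wv)%R by rewrite subrK.
  by have := nrmD_le p6 (nrm_unitary uwv); move: kk hk1; lra.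
have n2 : (nrm (reg d st (16 + e0)) <= 2)%R by rewrite w1; have := nrm_unitary uW; lra.
have [||||||s1 t1 [f1 e1]] := @T_packmul R d m p G U eps search T0 S d1 S64 rm B X B1 Bz Xz Xbig tableReg (16 + e0) st (cPM tableReg d) hc.
- by move=> st' h; rewrite /= h // h24.
- by [].
- by [].
- exact: n1.
- exact: n2.
- exact: leqnn.
rewrite w1 in e1.
have v24 : nmem s1 24 = e0 by rewrite (same_n f1).
have vL : nmem s1 43 = Lam by rewrite (same_n f1).
have vl : nmem s1 LLV = (size (slp st)).-1 by rewrite (same_n f1).
have lo1 : lines_ok s1 by rewrite /lines_ok (same_slp f1) (same_n f1).
have sz : 0 < size (slp st) by rewrite p4 size_cat p4' addnS.
have w2' : (e0 + 1) * Lam - 1 < size (slp st) by move: w2 Lam0; clear; nia.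
have [||| s2 t2 [f2 [lo2 ll2 an2 [x sl2] lw2]]] := @T_emitline MultLine s1 (lastw G st ++ wd G (slp st) ((e0 + 1) * Lam - 1)) 100 lo1.
- by rewrite /= vl v24 vL (same_slp f1) w2' prednK // leqnn.
- by rewrite /= vl v24 vL (same_slp f1) cats0.
- by rewrite !big_cons big_nil.
exists s2; first exact: T_seq t1 t2 (leqnn _).
have f12 : frame [:: 0; 1; 2; 3; 15; 16] [:: 0; 1; 2; 3] [:: 1; 7] st s2.
  by apply: (frame_trans (st2 := s1)); [apply: frame_sub (same_frame f1)|apply: frame_sub f2]; sub.
rewrite (same_slp f1) in sl2.
split => //; split.
  by apply: (leaf_inv_step (Ls := [:: x]) hi f12); [sub|by []|sub|sub|rewrite sl2 cats1].
split.
- by [].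
- by rewrite an2 (same_ans f1).
- exists (rcons Ls x); first by rewrite sl2 p4 rcons_cat.
  by rewrite size_rcons p4'.
- by rewrite lw2 size_cat mulSn addnC leq_add.
rewrite lw2 word_eval_cat w4 -/wv; split; last by apply: pclose_mul.
rewrite (frame_reg d0 f2) // e1.
have q1 : (nrm (qmx B (reg d st 1) - wv) <= kap + 4 * kap * k%:R)%R.
  by apply: le_trans (nrm_tri (reg d st 1) _ _) _; apply: lerD p6; exact: qmx_near.
have q2 : (nrm (qmx B W - W) <= kap)%R by exact: qmx_near.
rewrite mxid_mul_sub.
apply: le_trans (nrmD_le (nrmD_le (nrmM_le q1 q2) (nrmM_le q1 (nrm_unitary uW))) (nrmM_le (nrm_unitary uwv) q2)) _.
rewrite -[k.+1]addn1 natrD mulrDr.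
have : ((kap + 4 * kap * k%:R) * kap <= 1 * kap)%R.
  rewrite ler_wpM2r //; move: hk1; rewrite -[k.+1]addn1 natrD mulrDr; move: kap0; lra.
lra.
Qed.

Lemma T_digits a z st nb : rmem st 23 = (a%:R + z)%R -> (0 <= z < 1)%R -> 30 * a.+1 <= nb ->
  exists2 st', T DigitLoop st nb st' & same [:: 23] [:: 23] [::] st st' /\
    rmem st' 23 = z /\ nmem st' 23 = nmem st 23 + a.
Proof.
elim: a st nb => [|a IH] st nb hz /andP[z0 z1] hnb.
  exists st; last by split; [exact: same_refl|rewrite hz add0r addn0].
  apply: T_while_end; first by rewrite /= hz add0r -ltNge.
  by apply: leq_trans hnb.
set s1 := ev (Seq (SetR 23 (RSub (RV 23) (rn 1))) (SetN 23 (NAdd (NV 23) (NConst 1)))) st.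
have t1 : T (Seq (SetR 23 (RSub (RV 23) (rn 1))) (SetN 23 (NAdd (NV 23) (NConst 1)))) st 20 s1 by apply: T_sl.
have f1 : same [:: 23] [:: 23] [::] st s1.
  by apply: same_setn_in => //; apply: same_setr_in => //; exact: same_refl.
have e1 : rmem s1 23 = (a%:R + z)%R by rewrite /s1 /= /upd /= hz -[a.+1]addn1 natrD addrAC addrK.
have n1 : nmem s1 23 = nmem st 23 + 1 by [].
clearbody s1.
have [||s2 t2 [f2 [e2 n2]]] := IH s1 (30 * a.+1) e1; [by rewrite z0|exact: leqnn|].
exists s2.
  apply: T_while_step t1 t2 _; last by move: hnb; rewrite [bexp_cost _]/=; clear; lia.
  by rewrite /= hz -[a.+1]addn1 natrD -addrA addrCA lerDl addr_ge0 // ler0n.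
split; first exact: same_trans f1 f2.
by rewrite e2 n2 n1 -addnA add1n.
Qed.

Definition RN := [:: 0; 1; 2; 3; 15; 16; 22; 23; 24].
Definition RS := [:: 0; 1; 2; 3; 21; 22; 23].
Definition RM := [:: 0; 1; 6; 7].

Hypothesis kapN : (4 * kap * (80 * d ^ 2)%:R <= 1)%R.

Definition cDigit := 30 * d.+1 + cMult + 100.

Lemma T_digit st0 e k Y st (ty : bool) (j j' : 'I_d) b (y : R) : leaf_inv st -> prog st0 e k Y st -> unitary Y ->
  j' = j.+1 :> nat -> b < 40 -> k < 80 * d ^ 2 -> (0 <= y < 1)%R ->
  nmem st 20 = ty -> nmem st 21 = j -> nmem st 22 = b -> rmem st 23 = y ->
  exists2 st', T DigitStep st cDigit st' &
    frame [:: 0; 1; 2; 3; 15; 16; 23; 24] [:: 0; 1; 2; 3; 23] [:: 1; 7] st st' /\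
    leaf_inv st' /\ exists a, [/\ (0 <= d%:R * y - a%:R < 1)%R, rmem st' 23 = (d%:R * y - a%:R)%R &
    prog st0 (e + eta)%R k.+1 (Y *m givens j j' ty (2 * pi * (a%:R / d%:R ^+ b.+1))) st'].
Proof.
move=> hi hp uY jj hb hk /andP[y0 y1] h20 h21 h22 h23.
have dR : (0 < d%:R :> R)%R by rewrite ltr0n.
have dy0 : (0 <= d%:R * y)%R by rewrite mulr_ge0 // ltW.
pose a := Num.truncn (d%:R * y)%R.
have /andP[a1 a2] : (a%:R <= d%:R * y < a.+1%:R)%R by exact: truncn_itv.
have ad : a < d.
  by rewrite -(ltr_nat R); apply: le_lt_trans a1 _; rewrite gtr_pMr.
have za : (0 <= d%:R * y - a%:R < 1)%R by rewrite subr_ge0 a1 ltrBlDr -natr1 addrC in a2 *.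
set s1 := ev (Seq (SetR 23 (RMul (RV 23) (RNat NDim))) (SetN 23 (NConst 0))) st.
have t1 : T (Seq (SetR 23 (RMul (RV 23) (RNat NDim))) (SetN 23 (NConst 0))) st 20 s1 by apply: T_sl.
have f1 : same [:: 23] [:: 23] [::] st s1.
  by apply: same_setn_in => //; apply: same_setr_in => //; exact: same_refl.
have e1 : rmem s1 23 = (a%:R + (d%:R * y - a%:R))%R by rewrite /s1 /= /upd /= h23 mulrC addrC subrK.
have n1 : nmem s1 23 = 0 by [].
clearbody s1.
have [|s2 t2 [f2 [e2 n2]]] := T_digits e1 za (nb := 30 * d.+1); first by move: ad; clear; lia.
have f12 : same [:: 23] [:: 23] [::] st s2 by exact: same_trans f1 f2.
set s3 := ev SetIndex s2.
have t3 : T SetIndex s2 40 s3 by apply: T_sl.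
have f3 : same [:: 24] [::] [::] s2 s3 by apply: same_setn_in => //; exact: same_refl.
have f13 : same [:: 23; 24] [:: 23] [::] st s3.
  by apply: (same_trans (st2 := s2)); [apply: same_sub f12|apply: same_sub f3]; sub.
have n3 : nmem s3 24 = tidx d ty j b a.
  rewrite /s3 /= /upd /= /tidx n2 n1 add0n.
  by rewrite !(same_n f12) // h20 h21 h22.
have e3 : rmem s3 23 = (d%:R * y - a%:R)%R by rewrite /s3 /= e2.
clearbody s3.
have hi3 : leaf_inv s3.
  apply: (leaf_inv_step (Ls := [::]) hi (same_frame f13)); [by sub|by []|by sub|by sub|by rewrite (same_slp f13) cats0].
have hp3 : prog st0 e k Y s3 by exact: prog_same f13 _ _ _ hp.
have hk3 : (4 * kap * k.+1%:R <= 1)%R.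
  apply: le_trans kapN; apply: ler_wpM2l; last by rewrite ler_nat.
  by apply: mulr_ge0; [exact: ler0n|rewrite /kap divr_ge0 // ?exprn_ge0 // (le_trans ler01)].
have [s4 t4 [f4 [i4 p4]]] := T_mult hi3 hp3 uY jj hb ad n3 hk3.
exists s4.
  by apply: T_seq t1 (T_seq t2 (T_seq t3 t4 (leqnn _)) (leqnn _)) _; rewrite /cDigit; clear; lia.
split.
  by apply: (frame_trans (st2 := s3)); [apply: frame_sub (same_frame f13)|apply: frame_sub f4]; sub.
split => //; exists a; split => //.
by rewrite (frame_sc f4).
Qed.

Definition cRot := slcost SetTrig + cMx (ccost RotE) d + cMx 200 d + 100 + 40 * (cDigit + 60).

(** Taking the rotation by t off the remaining matrix means appending the one by -t to the word. Its
    forty digits cost eta each and the truncated tail another eta, hence 41. *)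
Lemma T_rotate st0 e k Y st (ty : bool) (j j' : 'I_d) t : leaf_inv st -> prog st0 e k Y st -> unitary Y ->
  j' = j.+1 :> nat -> k + 40 <= 80 * d ^ 2 -> (`|t| <= pi)%R ->
  nmem st 20 = ty -> nmem st 21 = j -> rmem st 20 = t ->
  exists2 st', T Rotate st cRot st' & frame RN RS RM st st' /\
    [/\ leaf_inv st', reg d st' 0 = givens j j' ty t *m reg d st 0 &
      prog st0 (e + 41%:R * eta)%R (k + 40) (Y *m givens j j' ty (- t)) st'].
Proof.
move=> hi hp uY jj hk tpi h20 h21 ht.
have jn : j != j' by rewrite -val_eqE /= jj neq_ltn ltnSn.
have [s1 t1 [f1 e1]] := T_rotateA h20 h21 jj ht.
have [hc _ _] := hi.
have pi0 := @pi_gt0 R.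
set s2 := ev SetTurn s1.
have t2 : T SetTurn s1 60 s2 by apply: T_sl.
have f2 : same [::] [:: 23] [::] s1 s2.
  by rewrite /s2 /=; case: ifP => _; do !apply: same_setr_in => //; exact: same_refl.
pose y0 := turn (- t).
have /andP[yge ylt] : (0 <= y0 < 1)%R by apply: turn_itv; rewrite normrN.
have e2 : rmem s2 23 = y0.
  have h40 : rmem s1 40 = pi by rewrite (same_sc f1) //; case: hc.
  have ht1 : rmem s1 20 = t by rewrite (same_sc f1).
  by rewrite /s2 /= /upd /= h40 ht1 /y0 /turn sub0r; case: ifP => _ //=; rewrite addrC.
clearbody s2.
have f12 : same [:: 0; 1] [:: 0; 1; 21; 22; 23] [:: 0; 6] st s2.
  by apply: (same_trans (st2 := s1)); [apply: same_sub f1|apply: same_sub f2]; sub.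
have r2 : reg d s2 0 = givens j j' ty t *m reg d st 0 by rewrite (same_reg d0 f2).
pose N2 := [:: 0; 1; 2; 3; 15; 16; 22; 23; 24].
pose I i st' := frame N2 [:: 0; 1; 2; 3; 23] [:: 1; 7] s2 st' /\ leaf_inv st' /\
  exists y, [/\ (0 <= y < 1)%R, rmem st' 23 = y &
    prog st0 (e + i%:R * eta)%R (k + i) (Y *m givens j j' ty (2 * pi * (y0 - y / d%:R ^+ i))) st'].
have hi2 : leaf_inv s2.
  apply: (leaf_inv_step (Ls := [::]) hi (same_frame f12)); [by sub|by []|by sub|by sub|by rewrite (same_slp f12) cats0].
have dn0 : (d%:R != 0 :> R)%R by rewrite pnatr_eq0 -lt0n.
have [|||||s3 t3 [f3 [i3 [y [/andP[y1 y2] _ p3]]]]] := @T_for R d m p G U eps search T0 S S64 I 22 (NConst 40) DigitStep s2 40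
  cDigit (100 + 40 * (cDigit + 40)) isT.
- move=> i st' x [f [hi' [y [h1 h2 h3]]]].
  have fs : same [:: 22] [::] [::] st' (setn st' 22 x) by exact: same_setn.
  split; first by apply: frame_trans f (frame_sub _ _ _ (same_frame fs)); sub.
  split; first by apply: (leaf_inv_step (Ls := [::]) hi' (same_frame fs)); [sub|by []|sub|sub|rewrite cats0].
  by exists y; split => //; apply: prog_same fs _ _ _ h3.
- by [].
- split; first exact: frame_refl.
  split => //; exists y0; split => //; first by rewrite yge.
  rewrite mul0r addr0 addn0 expr0 divr1 subrr mulr0 givens0 mulmx1.
  exact: prog_same f12 _ _ _ hp.
- move=> i st' hi40 [f [hi' [y [hy h23 hp']]]] v22.
  have ff : frame (N2 ++ [:: 0; 1]) ([:: 0; 1; 2; 3; 23] ++ [:: 0; 1; 21; 22; 23]) ([:: 1; 7] ++ [:: 0; 6]) st st'.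
    by apply: (frame_trans (st2 := s2)); [apply: frame_sub (same_frame f12)|apply: frame_sub f]; sub.
  have [||||st2 tt [ff2 [hi2' [a [ha h23' hp2]]]]] := @T_digit st0 _ _ _ st' ty j j' i y hi' hp' _ jj hi40 _ hy _ _ v22 h23.
  + by apply: unitaryM uY (rot_unitary jn _ _).
  + by move: hk hi40; clear; lia.
  + by rewrite (frame_n ff).
  + by rewrite (frame_n ff).
  exists st2 => //; split; first by rewrite (frame_n ff2).
  split; first by apply: frame_trans f (frame_sub _ _ _ ff2); sub.
  split; first exact: hi2'.
  exists (d%:R * y - a%:R)%R; split; [exact: ha|exact: h23'|].
  have EA : (2 * pi * (y0 - y / d%:R ^+ i) + 2 * pi * (a%:R / d%:R ^+ i.+1) =
    2 * pi * (y0 - (d%:R * y - a%:R) / d%:R ^+ i.+1) :> R)%R.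
    by rewrite exprS; apply: digit_angle => //; rewrite expf_neq0.
  have EE : (e + i.+1%:R * eta = e + i%:R * eta + eta)%R by rewrite -natr1 mulrDl mul1r addrA.
  have EY : Y *m givens j j' ty (2 * pi * (y0 - y / d%:R ^+ i)) *m givens j j' ty (2 * pi * (a%:R / d%:R ^+ i.+1)) =
    Y *m givens j j' ty (2 * pi * (y0 - (d%:R * y - a%:R) / d%:R ^+ i.+1)).
    exact: etrans (esym (mulmxA _ _ _)) (congr1 (mulmx Y) (etrans (givens_add jn ty _ _) (congr1 (givens j j' ty) EA))).
  by move: hp2; rewrite EY EE addnS => hp2; exact: hp2.
- by rewrite [nexp_cost _]/=; clear; lia.
exists s3.
  by apply: T_seq t1 (T_seq t2 t3 (leqnn _)) _; rewrite /cRot; clear; lia.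
split.
  by apply: (frame_trans (st2 := s2)); [apply: frame_sub (same_frame f12)|apply: frame_sub f3]; sub.
split; [exact: i3|by rewrite (frame_reg d0 f3)|].
have [q1 q2 q3 q4 [q5 q6]] := p3; split; [exact: q1|exact: q2|exact: q3|exact: q4|split; first exact: q5].
have -> : (e + 41%:R * eta = eta + (e + 40%:R * eta))%R by rewrite -[41]/(1 + 40) natrD mulrDl mul1r addrCA.
apply: pclose_trans_l q6.
(* The remaining fraction y is less than 1, so the part of the angle not yet written is below $2\pi
   d^{-40}$. *)
rewrite -mulmxBr nrm_mulU //.
have -> : (2 * pi * (y0 - y / d%:R ^+ 40) = 2 * pi * y0 + - (2 * pi * (y / d%:R ^+ 40)))%R by rewrite mulrBr.
rewrite -givens_add // rot_turn -{1}[givens j j' ty (- t)]mulmx1 -mulmxBr nrm_mulU; last exact: rot_unitary.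
rewrite nrmBC; apply: le_trans (rot_sub1 jn _ _) _; apply: le_trans eta_turn.
rewrite ler_wpM2l ?exprn_ge0 // ler_wpM2l // normrN ger0_norm.
  by apply: ltW; apply: frac_lt; rewrite ?mulr_gt0 ?exprn_gt0 ?ltr0n.
by apply: mulr_ge0; [apply: mulr_ge0 => //; exact: ltW|apply: divr_ge0 => //; exact: exprn_ge0].
Qed.

(* Invariant of the leaf routine after r rotations: register 0 holds what remains
   of A0, and the word is close to the part already taken off. *)
Definition work st0 (A0 : M) r st := [/\ leaf_inv st, unitary (reg d st 0), \det (reg d st 0) = \det A0 &
  prog st0 ((41 * r)%:R * eta)%R (40 * r) (A0 *m dag (reg d st 0)) st].

Lemma work_same st0 A0 r N Sc st st' : same N Sc [::] st st' -> {subset N <= iota 17 26 ++ iota 0 15} ->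
  {subset Sc <= iota 0 40} -> work st0 A0 r st -> work st0 A0 r st'.
Proof.
move=> s hN hS [h1 h2 h3 h4].
have nN k : k \notin iota 17 26 ++ iota 0 15 -> k \notin N by move=> hk; apply/negP => /hN; exact/negP.
split; rewrite ?(same_reg d0 s) //.
  apply: (leaf_inv_step (Ls := [::]) h1 (same_frame s)) => //; last by rewrite cats0 (same_slp s).
  - by move=> k /hN; rewrite !mem_cat !mem_iota inE mem_iota; clear; lia.
  - exact: nN.
by apply: prog_same s _ _ _ h4 => //; exact: nN.
Qed.

Lemma T_rotate_work st0 A0 r st (ty : bool) (j j' : 'I_d) t : unitary A0 -> work st0 A0 r st ->
  j' = j.+1 :> nat -> r < 2 * d ^ 2 -> (`|t| <= pi)%R ->
  nmem st 20 = ty -> nmem st 21 = j -> rmem st 20 = t ->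
  exists2 st', T Rotate st cRot st' & frame RN RS RM st st' /\
    reg d st' 0 = givens j j' ty t *m reg d st 0 /\ work st0 A0 r.+1 st'.
Proof.
move=> uA [hi u1 dt hp] jj hr ht h20 h21 hrt.
have jn : j != j' by rewrite -val_eqE /= jj neq_ltn ltnSn.
have uY : unitary (A0 *m dag (reg d st 0)) by apply: unitaryM uA (unitary_dag u1).
have [|st' t' [f' [i' r' p']]] := T_rotate hi hp uY jj _ ht h20 h21 hrt; first by move: hr; clear; lia.
exists st' => //; split => //; split => //; split => //.
- by rewrite r'; apply: unitaryM u1; exact: rot_unitary.
- by rewrite r' det_mulmx rot_det // mul1r.
move: p'; rewrite r' dagM rot_dag -mulmxA.
have -> : ((41 * r)%:R * eta + 41%:R * eta = (41 * r.+1)%:R * eta)%R by rewrite -mulrDl -natrD mulnS addnC.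
by rewrite (mulnS 40 r) (addnC 40); apply.
Qed.

Lemma T_argto e k st z : k < 64 -> rmem st 40 = pi -> ceval st e = z ->
  (forall x, ceval (setr st 10 x) e = z) ->
  exists2 st', T (ArgTo e k) st (slcost (ArgTo e 0)) st' &
    same [::] [:: 10; 11; 12; 13; 14; 15; k] [::] st st' /\ rmem st' k = arg z.
Proof.
move=> hk h40 he he'.
pose s2 := setr (setr st 10 (rev st e.1)) 11 (rev (setr st 10 (rev st e.1)) e.2).
exists (ev (ArgTo e k) st); first by apply: T_sl => //=; rewrite hk.
have f3 : same [::] [:: 10; 11; 12; 13; 14; 15; k] [::] st (ev ArgR s2).
  rewrite /ArgR /=; case: ifP => _; do !apply: same_setr_in => //; exact: same_refl.
split; first by apply: same_setr_in => //; rewrite !inE eqxx !orbT.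
have z1 : rev st e.1 = complex.Re z by rewrite -he.
have z2 : rev (setr st 10 (rev st e.1)) e.2 = complex.Im z by rewrite -(he' (rev st e.1)).
have -> : rmem (ev (ArgTo e k) st) k = rmem (ev ArgR s2) 12 by rewrite /= /upd eqxx.
have r10 : rmem s2 10 = complex.Re z by rewrite -z1.
have r11 : rmem s2 11 = complex.Im z by rewrite -z2.
have r40 : rmem s2 40 = pi by [].
clearbody s2.
have -> : arg z = (if rmem s2 10 / Num.sqrt (rmem s2 10 * rmem s2 10 + rmem s2 11 * rmem s2 11) <= 0%:R - 1%:R then rmem s2 40 else
  2%:R * atan (rmem s2 11 / Num.sqrt (rmem s2 10 * rmem s2 10 + rmem s2 11 * rmem s2 11) /
    (1%:R + rmem s2 10 / Num.sqrt (rmem s2 10 * rmem s2 10 + rmem s2 11 * rmem s2 11))))%R.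
  rewrite /arg /ang r10 r11 r40 sub0r -!expr2.
  by case: (z) => a b.
by rewrite /ArgR /= /upd /=; case: ifP.
Qed.

Lemma ceval_AE st i l : ceval st (AE i l) = regn d st 0 (nev st i) (nev st l).
Proof. exact: ceval_CE. Qed.

Lemma ceval_AE10 st i l x : nev st i < d -> nev st l < d -> nev (setr st 10 x) i = nev st i ->
  nev (setr st 10 x) l = nev st l -> ceval (setr st 10 x) (AE i l) = ceval st (AE i l).
Proof. by move=> h1 h2 e1 e2; rewrite !ceval_AE e1 e2 regn_setr. Qed.

Definition cGiv := slcost (ArgTo (AE VJ' (NV 25)) 0) + slcost (ArgTo (AE (NV 21) (NV 25)) 0) + 100 + 2 * cRot +
  slcost (ArgTo (ModE (AE (NV 21) (NV 25)), ModE (AE VJ' (NV 25))) 0).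
Definition GN := 20 :: RN.
Definition GS := [:: 10; 11; 12; 13; 14; 15; 16; 17; 20] ++ RS.

Lemma T_givens st0 A0 r st (j j' c : 'I_d) : unitary A0 -> work st0 A0 r st ->
  j' = j.+1 :> nat -> r.+1 < 2 * d ^ 2 -> nmem st 21 = j -> nmem st 25 = c ->
  exists2 st', T GivensStep st cGiv st' & frame GN GS RM st st' /\ work st0 A0 r.+2 st' /\
   [/\ reg d st' 0 j' c = 0%R,
     forall i l, i != j -> i != j' -> reg d st' 0 i l = reg d st 0 i l &
     forall l, reg d st 0 j l = 0%R -> reg d st 0 j' l = 0%R -> reg d st' 0 j l = 0%R /\ reg d st' 0 j' l = 0%R].
Proof.
move=> uA hw jj hr h21 h25.
have jn : j != j' by rewrite -val_eqE /= jj neq_ltn ltnSn.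
have pi40 st1 r1 : work st0 A0 r1 st1 -> rmem st1 40 = pi by case=> [[[]]].
have vj' st1 : nmem st1 21 = j -> nev st1 VJ' = j' by move=> /= ->; rewrite jj addn1.
have at' st1 : nmem st1 21 = j -> nmem st1 25 = c -> ceval st1 (AE VJ' (NV 25)) = reg d st1 0 j' c.
  by move=> h h'; rewrite ceval_AE vj' // -regE /= h'.
have at0 st1 : nmem st1 21 = j -> nmem st1 25 = c -> ceval st1 (AE (NV 21) (NV 25)) = reg d st1 0 j c.
  by move=> h h'; rewrite ceval_AE -regE /= h h'.
have r10 st1 x : reg d (setr st1 10 x) 0 = reg d st1 0 by apply: (frame_reg d0 (same_frame (same_setr d st1 x (isT : 10 < 64)))).
have [||s1 t1 [f1 e1]] := @T_argto (AE VJ' (NV 25)) 16 st (reg d st 0 j' c) isT (pi40 _ _ hw).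
- exact: at'.
- by move=> x; rewrite at' // r10.
have w1 : work st0 A0 r s1 by apply: work_same f1 _ _ hw; sub.
have R1 : reg d s1 0 = reg d st 0 by rewrite (same_reg d0 f1).
have n1 : nmem s1 21 = j /\ nmem s1 25 = c by rewrite !(same_n f1).
have [||s2 t2 [f2 e2]] := @T_argto (AE (NV 21) (NV 25)) 17 s1 (reg d st 0 j c) isT (pi40 _ _ w1).
- by rewrite -R1; case: n1 => ? ?; exact: at0.
- by move=> x; case: n1 => ? ?; rewrite at0 // r10 R1.
have w2 : work st0 A0 r s2 by apply: work_same f2 _ _ w1; sub.
set s3 := ev (Seq (SetR 20 (RDiv (RSub (RV 16) (RV 17)) (rn 2))) (SetN 20 (NConst 0))) s2.
have t3 : T (Seq (SetR 20 (RDiv (RSub (RV 16) (RV 17)) (rn 2))) (SetN 20 (NConst 0))) s2 20 s3 by apply: T_sl.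
have f3 : same [:: 20] [:: 20] [::] s2 s3.
  by apply: same_setn_in => //; apply: same_setr_in => //; exact: same_refl.
have w3 : work st0 A0 r s3 by apply: work_same f3 _ _ w2; sub.
pose t := ((arg (reg d st 0 j' c) - arg (reg d st 0 j c)) / 2)%R.
have e3 : rmem s3 20 = t by rewrite /s3 /= /upd /= e2 (same_sc f2) // e1.
have n20 : nmem s3 20 = false by [].
clearbody s3.
have f13 : same [:: 20] [:: 10; 11; 12; 13; 14; 15; 16; 17; 20] [::] st s3.
  same_via s1 f1.
  by apply: (same_trans (st2 := s2)); [apply: same_sub f2|apply: same_sub f3]; sub.
have ht : (`|t| <= pi)%R.
  have := arg_bound (reg d st 0 j' c); have := arg_bound (reg d st 0 j c); rewrite /t; exact: half_diff_bound.
have [||s4 t4 [f4 [e4 w4]]] := T_rotate_work uA w3 jj _ ht n20 _ e3.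
- exact: ltnW.
- by rewrite (same_n f13).
have f14 : frame GN GS RM st s4.
  by apply: (frame_trans (st2 := s3)); [apply: frame_sub (same_frame f13)|apply: frame_sub f4]; sub.
have n4 : nmem s4 21 = j /\ nmem s4 25 = c by rewrite !(frame_n f14).
have [n41 n42] := n4.
have mod st1 x : rev st1 (ModE x) = normc (ceval st1 x).
  by rewrite [LHS]/= -!expr2.
pose z := (normc (reg d s4 0 j c) +i* normc (reg d s4 0 j' c))%C.
have [||s5 t5 [f5 e5]] := @T_argto (ModE (AE (NV 21) (NV 25)), ModE (AE VJ' (NV 25))) 20 s4 z isT (pi40 _ _ w4).
- by rewrite ceval_def /z -(at0 _ n41 n42) -(at' _ n41 n42) -!mod.
- by move=> x; rewrite /z -(r10 s4 x) -(at0 (setr s4 10 x)) // -(at' (setr s4 10 x)) // -!mod.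
have w5 : work st0 A0 r.+1 s5 by apply: work_same f5 _ _ w4; sub.
set s6 := setn s5 20 1.
have t6 : T (SetN 20 (NConst 1)) s5 10 s6 by apply: (@T_setn _ _ _ _ _ _ _ _ _ _ S64).
have f6 : same [:: 20] [::] [::] s5 s6 by exact: same_setn.
have w6 : work st0 A0 r.+1 s6 by apply: work_same f6 _ _ w5; sub.
have f56 : same [:: 20] [:: 10; 11; 12; 13; 14; 15; 20] [::] s4 s6.
  by apply: (same_trans (st2 := s5)); [apply: same_sub f5|apply: same_sub f6]; sub.
have R6 : reg d s6 0 = reg d s4 0 by rewrite (same_reg d0 f56).
have [|||s7 t7 [f7 [e7 w7]]] := T_rotate_work (ty := true) uA w6 jj hr (arg_bound z) _ _ _.
- by [].
- by rewrite (same_n f56).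
- by rewrite -e5.
exists s7.
  by apply: T_seq t1 (T_seq t2 (T_seq t3 (T_seq t4 (T_seq t5 (T_seq t6 t7 (leqnn _)) (leqnn _)) (leqnn _)) (leqnn _)) (leqnn _)) _;
    rewrite /cGiv; clear; lia.
split.
  apply: (frame_trans (st2 := s4)) f14 _; apply: (frame_trans (st2 := s6)); first by apply: frame_sub (same_frame f56); sub.
  by apply: frame_sub f7; sub.
have E4 : reg d s4 0 = givens j j' false t *m reg d st 0.
  exact: etrans e4 (congr1 (mulmx _) (frame_reg d0 (same_frame f13) isT)).
split; first exact: w7.
rewrite e7 R6; split.
- exact: (givens_zeroB jn (erefl t) E4).
- by move=> i l ij ij'; rewrite rot_other // E4 rot_other.
- move=> l h1 h2; have [h3 h4] := rot_zeros jn false t h1 h2.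
  by rewrite -E4 in h3 h4; exact: (rot_zeros jn true (arg z) h3 h4).
Qed.

Definition CN := [:: 21; 26] ++ GN.
Definition cCol := 100 + (d - 1) * (cGiv + 100).

(** The row just cleared is not touched again in this column, and in the earlier columns both
    rotated rows are already zero below the diagonal, which rotation preserves. *)
Lemma T_colstep st0 A0 r st (c : 'I_d) : unitary A0 -> work st0 A0 r st -> nmem st 25 = c ->
  r + 2 * (d - 1 - c) < 2 * d ^ 2 ->
  (forall i l : 'I_d, l < c -> l < i -> reg d st 0 i l = 0%R) ->
  exists2 st', T ColStep st cCol st' & frame CN GS RM st st' /\ work st0 A0 (r + 2 * (d - 1 - c)) st' /\
    forall i l : 'I_d, l < c.+1 -> l < i -> reg d st' 0 i l = 0%R.
Proof.
move=> uA hw h25 hr hz.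
pose I jj st' := [/\ frame CN GS RM st st', work st0 A0 (r + 2 * jj) st' &
  forall i l : 'I_d, (l < c -> l < i -> reg d st' 0 i l = 0%R) /\
    (l = c :> nat -> d - 1 - jj < i -> reg d st' 0 i l = 0%R)].
have [|||||st' t' [f' w' z']] := @T_for R d m p G U eps search T0 S S64 I 26 (NSub (NSub NDim (NConst 1)) (NV 25))
   (Seq (SetN 21 (NSub (NSub NDim (NConst 2)) (NV 26))) GivensStep) st (d - 1 - c) (cGiv + 20) cCol isT.
- move=> i st' x [f w z]; have fs : same [:: 26] [::] [::] st' (setn st' 26 x) by exact: same_setn.
  split; first by apply: frame_trans f (frame_sub _ _ _ (same_frame fs)); sub.
    by apply: work_same fs _ _ w; sub.
  by move=> a l; rewrite (same_reg d0 fs).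
- by move=> i st' [f _ _]; rewrite /= (frame_n f) // h25.
- split; [exact: frame_refl|by rewrite addn0|move=> i l; split; first exact: hz].
  by move=> _; have := ltn_ord i; lia.
- move=> jj st' hjj [f w z] v26.
  have jd : d - 2 - jj < d by lia.
  have jd' : d - 1 - jj < d by lia.
  set s1 := setn st' 21 (d - 2 - jj).
  have t1 : T (SetN 21 (NSub (NSub NDim (NConst 2)) (NV 26))) st' 20 s1.
    by have := @T_setn R d m p G U eps search T0 S S64 21 (NSub (NSub NDim (NConst 2)) (NV 26)) st' 20 isT isT; rewrite /= v26.
  have f1 : same [:: 21] [::] [::] st' s1 by exact: same_setn.
  have w1 : work st0 A0 (r + 2 * jj) s1 by apply: work_same f1 _ _ w; sub.
  have n25 : nmem s1 25 = c by rewrite (same_n f1) // (frame_n f).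
  have cj : c <= d - 2 - jj by lia.
  have r2 : (r + 2 * jj).+1 < 2 * d ^ 2 by move: hr hjj; clear; lia.
  have jj1 : Ordinal jd' = (Ordinal jd).+1 :> nat by move: hjj d1; rewrite /=; clear; lia.
  have [s2 t2 [f2 [w2 [z1 z2 z3]]]] := @T_givens st0 A0 _ s1 (Ordinal jd) (Ordinal jd') c uA w1 jj1 r2 erefl n25.
  exists s2; first by apply: T_seq t1 t2 _; rewrite addnC.
  split; first by rewrite (frame_n f2) // (same_n f1).
  have R1 : reg d s1 0 = reg d st' 0 by rewrite (same_reg d0 f1).
  split.
  + apply: (frame_trans (st2 := st')) f _; apply: (frame_trans (st2 := s1)).
      by apply: frame_sub (same_frame f1); sub.
    by apply: frame_sub f2; sub.
  + by rewrite mulnS addnCA; move: w2; rewrite -addn2 addnC.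
  move=> i l; have [zl zc] := z i l; rewrite R1 in z2 z3.
  have [ij|ij] := eqVneq i (Ordinal jd).
    split; last by move=> _; rewrite ij /=; move: hjj; clear; lia.
    move=> lc li; rewrite ij; apply: (proj1 (z3 l _ _)).
      by apply: (proj1 (z _ _)) => //; move: lc cj; rewrite /=; clear; lia.
    by apply: (proj1 (z _ _)) => //; move: lc cj; rewrite /=; clear; lia.
  have [ij'|ij'] := eqVneq i (Ordinal jd').
    split; last by move=> lc _; rewrite ij'; have -> : l = c by apply: val_inj.
    move=> lc li; rewrite ij'; apply: (proj2 (z3 l _ _)).
      by apply: (proj1 (z _ _)) => //; move: lc cj; rewrite /=; clear; lia.
    by apply: (proj1 (z _ _)) => //; move: lc cj; rewrite /=; clear; lia.
  rewrite z2 //; split => // lc hi; apply: zc => //.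
  have : (i : nat) != d - 1 - jj by rewrite -val_eqE in ij'.
  by move: hi; clear; lia.
- rewrite [nexp_cost _]/= /cCol.
  have : (d - 1 - c) * (cGiv + 100) <= (d - 1) * (cGiv + 100) by rewrite leq_mul2r leq_subr orbT.
  by clear; lia.
exists st' => //; split => //; split => // i l; rewrite ltnS leq_eqVlt => /orP[/eqP lc|lc] li.
  by apply: (proj2 (z' i l)) => //; move: li lc (ltn_ord c); clear; lia.
exact: (proj1 (z' i l)).
Qed.

Definition ncol (c : nat) := \sum_(k < c) (d - 1 - k).

Lemma ncol_le (c : nat) : ncol c <= c * (d - 1).
Proof.
apply: (@leq_trans (\sum_(k < c) (d - 1))); first by apply: leq_sum => k _; exact: leq_subr.
by rewrite sum_nat_const card_ord.
Qed.

Lemma nrot_lt (c : nat) : c <= d -> 2 * ncol c + (d - 1) < 2 * d ^ 2.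
Proof.
move=> hc; have h := ncol_le c; have : c * (d - 1) <= d * (d - 1) by rewrite leq_mul2r hc orbT.
by move: h d1; clear; nia.
Qed.

Definition cDiag := 200 + d * (slcost (ArgTo (AE (NV 25) (NV 25)) 0) + 100).

Lemma T_diagsum st : rmem st 40 = pi -> exists2 st', T DiagSum st cDiag st' &
  same [:: 25] [:: 10; 11; 12; 13; 14; 15; 17; 18] [::] st st' /\
  rmem st' 18 = (\sum_(a < d) arg (reg d st 0 a a))%R.
Proof.
move=> hpi.
pose I i st' := same [:: 25] [:: 10; 11; 12; 13; 14; 15; 17; 18] [::] st st' /\
  rmem st' 18 = (\sum_(a < i) arg (regn d st 0 a a))%R.
set s1 := setr st 18 0%:R.
have t1 : T (SetR 18 (rn 0)) st 20 s1 by apply: (@T_setr _ _ _ _ _ _ _ _ _ _ S64).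
have f1 : same [::] [:: 18] [::] st s1 by exact: same_setr.
have [|||||st' t' [s' e']] := @T_for R d m p G U eps search T0 S S64 I 25 NDim
  (Seq (ArgTo (AE (NV 25) (NV 25)) 17) (SetR 18 (RAdd (RV 18) (RV 17)))) s1 d
  (slcost (ArgTo (AE (NV 25) (NV 25)) 0) + 20) (100 + d * (slcost (ArgTo (AE (NV 25) (NV 25)) 0) + 100)) isT.
- by move=> i st' x [s e]; split => //; exact: same_setn_in.
- by [].
- by split; [apply: same_sub f1; sub|rewrite big_ord0 /s1 /= /upd].
- move=> i st' id [s e] v25.
  have h40 : rmem st' 40 = pi by rewrite (same_sc s).
  have v10 x : nmem (setr st' 10 x) 25 = i by [].
  have [||s2 t2 [f2 e2]] := @T_argto (AE (NV 25) (NV 25)) 17 st' (regn d st 0 i i) isT h40.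
  + by rewrite ceval_AE /= v25 (same_regn d0 s).
  + by move=> x; rewrite ceval_AE10 /= ?v25 // ceval_AE /= v25 (same_regn d0 s).
  set s3 := setr s2 18 (rmem s2 18 + rmem s2 17)%R.
  have t3 : T (SetR 18 (RAdd (RV 18) (RV 17))) s2 20 s3 by apply: (@T_setr _ _ _ _ _ _ _ _ _ _ S64).
  have f3 : same [::] [:: 18] [::] s2 s3 by exact: same_setr.
  exists s3; first exact: T_seq t2 t3 (leqnn _).
  split; first by rewrite (same_n f3) // (same_n f2).
  split.
    apply: (same_trans (st2 := st')) s _; apply: (same_trans (st2 := s2)).
      by apply: same_sub f2; sub.
    by apply: same_sub f3; sub.
  by rewrite /s3 /= /upd /= e2 (same_sc f2) // e big_ord_recr.
- by rewrite [nexp_cost _]/=; clear; nia.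
exists st'; first by apply: T_seq t1 t' _; rewrite /cDiag; clear; lia.
split; first exact: s'.
by rewrite e'; apply: eq_bigr => a _; rewrite regE.
Qed.

Definition cPh := slcost (ArgTo (Cmul (CS 24) (Cconj (AE (NV 25) (NV 25)))) 0) + cRot + 40.
Definition PN' := 25 :: 21 :: GN.

(* The diagonal matrix left over is turned into the scalar matrix v. *)
Lemma T_phases st0 A0 r st (v : R[i]) : unitary A0 -> work st0 A0 r st -> normc v = 1%R ->
  rmem st 24 +i* rmem st 25 = v -> (v ^+ d = \det A0)%R -> r + (d - 1) < 2 * d ^ 2 ->
  (forall a b : 'I_d, a != b -> reg d st 0 a b = 0%R) -> (forall a, normc (reg d st 0 a a) = 1%R) ->
  exists2 st', T (For 25 (NSub NDim (NConst 1)) PhaseStep) st (100 + d * (cPh + 40)) st' &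
    frame PN' GS RM st st' /\ work st0 A0 (r + (d - 1)) st' /\ reg d st' 0 = (v *: 1%:M)%R.
Proof.
move=> uA hw v1 hv vd hr od un.
pose I i st' := [/\ frame PN' GS RM st st', work st0 A0 (r + i) st',
  forall a b : 'I_d, a != b -> reg d st' 0 a b = 0%R, forall a, normc (reg d st' 0 a a) = 1%R &
  forall a : 'I_d, a < i -> reg d st' 0 a a = v].
have [|||||st' t' [f' w' o' u' e']] := @T_for R d m p G U eps search T0 S S64 I 25 (NSub NDim (NConst 1)) PhaseStep st (d - 1)
  cPh (100 + d * (cPh + 40)) isT.
- move=> i st' x [f w o u e]; have fs : same [:: 25] [::] [::] st' (setn st' 25 x) by exact: same_setn.
  have Rx : reg d (setn st' 25 x) 0 = reg d st' 0 by rewrite (same_reg d0 fs).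
  split; rewrite ?Rx //.
  by apply: frame_trans f (frame_sub _ _ _ (same_frame fs)); sub.
- by [].
- by split => //; rewrite addn0.
- move=> i st' hi [f w o u e] v25.
  have id : i < d by lia.
  have id' : i.+1 < d by lia.
  pose j := Ordinal id; pose j' := Ordinal id'.
  have jn : j != j' by rewrite -val_eqE /= neq_ltn ltnSn.
  set A := reg d st' 0 in o u e *.
  have h40 : rmem st' 40 = pi by case: w => [[[]]].
  have hvv st2 : rmem st2 24 = rmem st 24 -> rmem st2 25 = rmem st 25 -> nmem st2 25 = i -> reg d st2 0 = A ->
      ceval st2 (Cmul (CS 24) (Cconj (AE (NV 25) (NV 25)))) = (v * (A j j)^*)%R.
    move=> h1 h2 h3 h4; rewrite ceval_Cmul ceval_Cconj ceval_CS ceval_AE /= h1 h2 h3 hv -h4.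
    by rewrite -[in RHS]regE.
  have h24 : rmem st' 24 = rmem st 24 by rewrite (frame_sc f).
  have h25 : rmem st' 25 = rmem st 25 by rewrite (frame_sc f).
  pose z := (v * (A j j)^*)%R.
  have z1 : normc z = 1%R by rewrite normcM normc_conj u v1 mul1r.
  have [||s1 t1 [f1 e1]] := @T_argto (Cmul (CS 24) (Cconj (AE (NV 25) (NV 25)))) 20 st' z isT h40.
  + exact: hvv.
  + move=> x; apply: hvv => //.
  set s2 := ev (Seq (SetN 21 (NV 25)) (SetN 20 (NConst 0))) s1.
  have t2 : T (Seq (SetN 21 (NV 25)) (SetN 20 (NConst 0))) s1 20 s2 by apply: T_sl.
  have f2 : same [:: 21; 20] [::] [::] s1 s2 by do !apply: same_setn_in => //; exact: same_refl.
  have n20 : nmem s2 20 = false by [].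
  have n21 : nmem s2 21 = j by rewrite /s2 /= /upd /= (same_n f1).
  have r20 : rmem s2 20 = arg z by [].
  clearbody s2.
  have f12 : same [:: 21; 20] [:: 10; 11; 12; 13; 14; 15; 20] [::] st' s2.
    by apply: (same_trans (st2 := s1)); [apply: same_sub f1|apply: same_sub f2]; sub.
  have w2 : work st0 A0 (r + i) s2 by apply: work_same f12 _ _ w; sub.
  have ri : r + i < 2 * d ^ 2 by move: hr hi; clear; lia.
  have [s3 t3 [f3 [e3 w3]]] := @T_rotate_work st0 A0 (r + i) s2 false j j' (arg z) uA w2 erefl ri (arg_bound z) n20 n21 r20.
  exists s3; first by apply: T_seq t1 (T_seq t2 t3 (leqnn _)) _; rewrite /cPh; clear; lia.
  split; first by rewrite (frame_n f3) // (same_n f12).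
  have R2 : reg d s2 0 = A by rewrite (same_reg d0 f12).
  rewrite R2 in e3.
  split.
  + apply: (frame_trans (st2 := st')) f _; apply: (frame_trans (st2 := s2)).
      by apply: frame_sub (same_frame f12); sub.
    by apply: frame_sub f3; sub.
  + by rewrite addnS.
  + move=> a b ab; rewrite e3; have [aj|aj] := eqVneq a j; first by have q := o a b ab; rewrite aj in q *; rewrite rotZ_j // q mulr0.
    have [aj'|aj'] := eqVneq a j'; first by have q := o a b ab; rewrite aj' in q *; rewrite rotZ_j' // q mulr0.
    by rewrite rot_other // o.
  + move=> a; rewrite e3; have [aj|aj] := eqVneq a j; first by rewrite aj rotZ_j // normcM normc_cis mul1r u.
    have [aj'|aj'] := eqVneq a j'; first by rewrite aj' rotZ_j' // normcM normc_cis mul1r u.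
    by rewrite rot_other // u.
  + move=> a ai; rewrite e3; have [aj|aj] := eqVneq a j.
      rewrite aj rotZ_j // cis_arg // /z -mulrA [((A j j)^* * _)%R]mulrC.
      by rewrite -sqr_normc -normcE' u rmorph1 expr1n mulr1.
    have aj' : a != j' by rewrite -val_eqE /= neq_ltn ai.
    rewrite rot_other // e //; move: ai; rewrite ltnS leq_eqVlt => /orP[/eqP ai|//].
    by case/eqP: aj; apply: val_inj.
- rewrite [nexp_cost _]/=; have : (d - 1) * (cPh + 40) <= d * (cPh + 40) by rewrite leq_mul2r leq_subr orbT.
  by clear; lia.
exists st' => //; split => //; split => //.
have [_ _ dt _] := w'.
have dlast : d.-1 < d by lia.
pose l := Ordinal dlast.
have ne : forall a : 'I_d, a != l -> reg d st' 0 a a = v.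
  move=> a al; apply: e'; have : (a : nat) != d.-1 by rewrite -val_eqE in al.
  by have := ltn_ord a; lia.
have v0 : v != 0%R by apply: contraTneq isT => hv0; move: v1; rewrite hv0 normc0 => /eqP; rewrite eq_sym oner_eq0.
(* The last entry is forced: the product of all d entries is $v^d$ and the others equal v, which is
   not zero. *)
have el : reg d st' 0 l l = v.
  move: dt; rewrite (det_offdiag0 o') (bigD1 l) //= (eq_bigr (fun=> v)) => [|a al]; last exact: ne.
  rewrite prodr_const -vd.
  have -> : #|(fun a : 'I_d => a != l)| = d.-1 by rewrite -[in RHS](card_ord d) -(cardC1 l); apply: eq_card.
  rewrite -[in RHS](prednK d0) exprS => /mulIf; apply.
  by rewrite expf_neq0.
apply/matrixP => a b; rewrite mxZE [(1%:M : M) a b]mxE; have [->|ab] := eqVneq a b; last by rewrite o' // mulr0.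
by rewrite mulr1; have [->|bl] := eqVneq b l; [exact: el|exact: ne].
Qed.

Definition nrot := 2 * ncol d + (d - 1).
Definition cLf := cMx 200 d + (100 + d * (cCol + 40)) + cDiag + (100 + d * (cPh + 40)) + 300.
Definition LfN := [:: 0; 1; 2; 3; 15; 16; 20; 21; 22; 23; 24; 25; 26].
Definition LfS := iota 0 26.

Lemma T_leaf st : leaf_inv st -> lines_ok st -> unitary (reg d st 0) ->
  exists2 st', T Leaf st cLf st' & frame LfN LfS [:: 0; 1; 6; 7] st st' /\
    sk_result G st st' (4 * kap * (40 * nrot)%:R)%R ((41 * nrot)%:R * eta)%R (40 * nrot).+1 (40 * nrot * lt) (reg d st 0).
Proof.
move=> hi lo uA; set A0 := reg d st 0 in uA *.
have [|||s1 t1 [f1 e1]] := @mxset R d m p G U eps search T0 S d1 S64 rm 1 (CR (RNat (ndelta (NV 0) (NV 1)))) st (cMx 200 d)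
  (fun k l => (k == l)%:R%R).
- exact: room_le rm.
- move=> k l st' kd ld s v0 v1 _; rewrite ceval_CR [rev _ _]/= (delta_nat d1 S64 rm) v0 v1.
  by rewrite (rmorph_nat (real_complex R)).
- exact: cMx_le.
have E1 : reg d s1 1 = 1%:M by rewrite e1; apply/matrixP => k l; rewrite !mxE.
have lo1 : lines_ok s1 by rewrite /lines_ok (same_slp f1) (same_n f1).
have [||| s2 t2 [f2 [lo2 ll2 an2 [x sl2] lw2]]] := @T_emitline [::] s1 [::] 20 lo1 => //; first by rewrite big_nil.
have f12 : frame [:: 0; 1; 15; 16] [:: 0; 1] [:: 1] st s2.
  by apply: (frame_trans (st2 := s1)); [apply: frame_sub (same_frame f1)|apply: frame_sub f2]; sub.
have R2 : reg d s2 0 = A0 by rewrite (frame_reg d0 f12).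
rewrite (same_slp f1) in sl2.
have w2 : work st A0 0 s2.
  split; rewrite ?R2 //.
    by apply: (leaf_inv_step (Ls := [:: x]) hi f12); [sub|by []|sub|sub|rewrite sl2 cats1].
  rewrite muln0 mul0r unitary_dagr //; split.
  - by [].
  - by rewrite an2 (same_ans f1).
  - by exists [:: x]; rewrite ?sl2 ?cats1.
  - by rewrite lw2.
  rewrite lw2 mulr0 (frame_reg d0 f2) // E1; split; first by rewrite subrr nrm0.
  exact: pclose_refl.
pose I (c : nat) st' := [/\ frame LfN LfS RM s2 st', work st A0 (2 * ncol c) st' &
  forall i l : 'I_d, l < c -> l < i -> reg d st' 0 i l = 0%R].
have [|||||s3 t3 [f3 w3 z3]] := @T_for R d m p G U eps search T0 S S64 I 25 NDim ColStep s2 d cCol (100 + d * (cCol + 40)) isT.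
- move=> i st' y [f w z]; have fs : same [:: 25] [::] [::] st' (setn st' 25 y) by exact: same_setn.
  have Rx : reg d (setn st' 25 y) 0 = reg d st' 0 by rewrite (same_reg d0 fs).
  split; [|by apply: work_same fs _ _ w; sub|by rewrite Rx].
  by apply: frame_trans f (frame_sub _ _ _ (same_frame fs)); sub.
- by [].
- by split; [exact: frame_refl|rewrite /ncol big_ord0|].
- move=> c st' cd [f w z] v25.
  have cS : ncol c.+1 = ncol c + (d - 1 - c) by rewrite /ncol big_ord_recr.
  have hr : 2 * ncol c + 2 * (d - 1 - c) < 2 * d ^ 2.
    by rewrite -mulnDr -cS; apply: leq_ltn_trans (nrot_lt cd); exact: leq_addr.
  have [s t [f' [w' z']]] := @T_colstep st A0 _ st' (Ordinal cd) uA w v25 hr z.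
  exists s => //; split; first by rewrite (frame_n f').
  split; [|by rewrite cS mulnDr|exact: z'].
  by apply: frame_trans f (frame_sub _ _ _ f'); sub.
- by rewrite [nexp_cost _]/=; clear; lia.
have [hi3 u3 dt3 p3] := w3.
have [od un] := unitary_triangular u3 (fun i l hl => z3 i l (ltn_ord l) hl).
have h40 : rmem s3 40 = pi by case: hi3 => [[]].
have [s4 t4 [f4 e4]] := T_diagsum h40.
have w4 : work st A0 (2 * ncol d) s4 by apply: work_same f4 _ _ w3; sub.
set s5 := ev SetV s4.
have t5 : T SetV s4 60 s5 by apply: T_sl.
have f5 : same [::] [:: 19; 24; 25] [::] s4 s5 by do !apply: same_setr_in => //; exact: same_refl.
set A := reg d s3 0 in od un dt3 e4 *.
pose th := ((\sum_(a < d) arg (A a a)) / d%:R)%R.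
have e5 : rmem s5 24 +i* rmem s5 25 = cis th by rewrite /s5 /= /upd /= e4.
clearbody s5.
have w5 : work st A0 (2 * ncol d) s5 by apply: work_same f5 _ _ w4; sub.
have R5 : reg d s5 0 = A by rewrite (same_reg d0 f5) // (same_reg d0 f4).
have vd : (cis th ^+ d = \det A0)%R.
  rewrite cis_exp /th mulrC mulfVK ?pnatr_eq0 -?lt0n // cis_sum -dt3 (det_offdiag0 od).
  by apply: eq_bigr => a _; exact: cis_arg.
have [|| s6 t6 [f6 [w6 e6]]] := T_phases uA w5 (normc_cis th) e5 vd (nrot_lt (leqnn d)).
- by move=> a b ab; rewrite R5; exact: od.
- by move=> a; rewrite R5; exact: un.
exists s6.
  by apply: T_seq t1 (T_seq t2 (T_seq t3 (T_seq t4 (T_seq t5 t6 (leqnn _)) (leqnn _)) (leqnn _)) (leqnn _)) _;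
    rewrite /cLf; clear; lia.
split.
  apply: (frame_trans (st2 := s2)); first by apply: frame_sub f12; sub.
  apply: (frame_trans (st2 := s3)); first by apply: frame_sub f3; sub.
  apply: (frame_trans (st2 := s4)); first by apply: frame_sub (same_frame f4); sub.
  by apply: (frame_trans (st2 := s5)); [apply: frame_sub (same_frame f5)|apply: frame_sub f6]; sub.
have [_ _ _ [p1 p2 p4 p5 [p6 p7]]] := w6.
split; [exact: p1|exact: p2|exact: p4|exact: p5|split; first exact: p6].
(* What remains of A0 is a scalar matrix, so A0 differs only by a phase from the product of the
   rotations taken off. *)
have -> : A0 = (cis th *: (A0 *m dag (reg d s6 0)))%R.
  rewrite e6 dagZ dag1 -scalemxAr mulmx1 scalerA -[LHS]scale1r; congr (_ *: _)%R.
  exact: esym (etrans (congr1 (fun u => cis th * u)%R (cis_conj th)) (cisN th)).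
exact: pclose_phase_l (normc_cis th) p7.
Qed.
End Leaf.

Local Open Scope ring_scope.
Local Open Scope sesquilinear_scope.
Local Open Scope complex_scope.

Lemma cube_inv (F : fieldType) (c r : F) : c != 0 -> r != 0 ->
  1 / (c ^+ 2 * (c * (r ^+ 2 * r))) = (1 / (c * r)) ^+ 3 /\ 1 / (c ^+ 2 * r ^+ 2) = (1 / (c * r)) ^+ 2.
Proof. by move=> h1 h2; split; field; rewrite h1 h2. Qed.

Lemma three_halves (F : realFieldType) (q : F) : q *+ 3 = 3 / 2 * (q *+ 2).
Proof. by rewrite -(mulr_natl q 3) -(mulr_natl q 2); lra. Qed.

(** * Depth of the recursion as a function of the tolerance *)

Section Levels.
Variable R : realType.

Lemma sqrt_le_sqr (x y : R) : 0 <= y -> x <= y ^+ 2 -> Num.sqrt x <= y.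
Proof. by move=> y0 h; rewrite -(ger0_norm y0) -sqrtr_sqr ler_wsqrtr. Qed.

(* Error after s rounds of the recursion. *)
Fixpoint eseq s : R :=
  if s is s'.+1 then 320 * (eseq s' * Num.sqrt (eseq s')) else (1 / 512) ^+ 2.

Lemma eseq_gt0 s : 0 < eseq s.
Proof.
elim: s => [|s IH]; first by apply: exprn_gt0; exact: divr_gt0 ltr01 (ltr0Sn _ _).
by apply: mulr_gt0 (ltr0Sn _ _) (mulr_gt0 IH _); rewrite sqrtr_gt0.
Qed.

Lemma ln_inv_le (x y : R) : 0 < x -> x <= y -> ln (1 / y) <= ln (1 / x).
Proof.
move=> x0 xy; have y0 : 0 < y by exact: lt_le_trans x0 xy.
by rewrite !div1r !lnV ?posrE // lerN2 ler_ln ?posrE.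
Qed.

(** An error of at most $2^{-18}$ has a square root of at most 1/512, so each round contracts by
    320/512 = 5/8. This geometric rate gives existence of a depth; its size comes from [ln_eseq]. *)
Lemma eseq_bound s : eseq s <= (5 / 8) ^+ s * (1 / 512) ^+ 2.
Proof.
have key s' : eseq s' <= (1 / 512) ^+ 2 -> eseq s'.+1 <= 5 / 8 * eseq s'.
  move=> h; have hs : Num.sqrt (eseq s') <= 1 / 512.
    by apply: sqrt_le_sqr; [exact: divr_ge0 ler01 (ler0n _ _)|].
  have : eseq s' * Num.sqrt (eseq s') <= eseq s' * (1 / 512) by rewrite ler_pM2l ?eseq_gt0.
  by rewrite /=; lra.
elim: s => [|s IH]; first by rewrite expr0 mul1r.
have e1 : eseq s <= (1 / 512) ^+ 2.
  apply: le_trans IH _; rewrite ler_piMl ?sqr_ge0 // exprn_ile1 //; lra.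
apply: le_trans (key _ e1) _; rewrite exprS -(mulrA (5 / 8) _ _); apply: ler_wpM2l IH; lra.
Qed.

Lemma eseq_decr s t : (s <= t)%N -> eseq t <= eseq s.
Proof.
elim: t => [|t IH]; first by rewrite leqn0 => /eqP ->.
rewrite leq_eqVlt => /orP[/eqP -> //|]; rewrite ltnS => /IH; apply: le_trans.
have e1 : eseq t <= (1 / 512) ^+ 2.
  apply: le_trans (eseq_bound t) _; rewrite ler_piMl ?sqr_ge0 // exprn_ile1 //; lra.
have hs : Num.sqrt (eseq t) <= 1 / 512.
  by apply: sqrt_le_sqr; [exact: divr_ge0 ler01 (ler0n _ _)|].
have : eseq t * Num.sqrt (eseq t) <= eseq t * (1 / 512) by rewrite ler_pM2l ?eseq_gt0.
by have := eseq_gt0 t; rewrite /=; lra.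
Qed.

Definition depth_of (tol : R) (T : nat) := eseq T <= tol /\ forall s, (s < T)%N -> tol < eseq s.

Lemma depth_exists tol : 0 < tol -> exists T, depth_of tol T.
Proof.
move=> t0.
have bern n : 1 + n%:R * (3 / 5) <= (8 / 5 : R) ^+ n.
  elim: n => [|n IH]; first by rewrite mul0r addr0.
  have := ler0n R n; rewrite exprS -natr1; move: IH; set q := (8 / 5 : R) ^+ n; lra.
have ex : exists T, eseq T <= tol.
  have h0 : 0 < 2 / tol by rewrite divr_gt0.
  have /andP[_ h] := truncn_itv (ltW h0).
  (* Any n above 2/tol works, by the Bernoulli estimate for $(8/5)^n$. *)
  exists (Num.truncn (2 / tol)).+1; set n := (Num.truncn _).+1 in h *.
  apply: le_trans (eseq_bound n) _.
  have p1 : 0 < (8 / 5 : R) ^+ n by apply: exprn_gt0; lra.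
  have -> : (5 / 8 : R) ^+ n = ((8 / 5) ^+ n)^-1 by rewrite -exprVn; congr (_ ^+ _); field.
  rewrite mulrC ler_pdivrMr //.
  have b := bern n; move: h; rewrite ltr_pdivrMr // => h.
  have : tol * (1 + n%:R * (3 / 5)) <= tol * (8 / 5) ^+ n by rewrite ler_pM2l.
  by rewrite mulrDr mulr1 expr2; nra.
case: (ex_minnP ex) => T hT hmin; exists T; split => // s sT.
by rewrite ltNge; apply/negP => /hmin; rewrite leqNgt sT.
Qed.

(** The scaled error $320^2e_s$ is raised exactly to the power 3/2 in each round, and it starts at
    $320^2/512^2=25/64$. *)
Lemma ln_eseq s : ln (1 / (320 ^+ 2 * eseq s)) = (3 / 2) ^+ s * ln (64 / 25).
Proof.
elim: s => [|s IH].
  have -> : 1 / (320 ^+ 2 * eseq 0) = 64 / 25 by rewrite [eseq 0]/=; field.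
  by rewrite expr0 mul1r.
have e0 := eseq_gt0 s; have s0 : 0 < Num.sqrt (eseq s) by rewrite sqrtr_gt0.
rewrite [(3 / 2) ^+ _]exprS -(mulrA (3 / 2)) -IH.
have sE : eseq s = Num.sqrt (eseq s) ^+ 2 by rewrite sqr_sqrtr // ltW.
set r := Num.sqrt (eseq s) in s0 sE.
have eS : eseq s.+1 = 320 * (eseq s * r) by [].
have c0 : 320 != 0 :> R by rewrite pnatr_eq0.
have r0 : r != 0 by rewrite gt_eqF.
have [i3 i2] := cube_inv c0 r0.
rewrite eS sE i3 i2.
have p0 : 0 < 1 / (320 * r) by apply: divr_gt0 ltr01 (mulr_gt0 (ltr0Sn _ _) s0).
by rewrite !(lnXn _ p0); exact: three_halves.
Qed.

(** By minimality the error at depth T - 1 still exceeds tol. Together with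
    $\ln(64/25)\ge1-25/64\ge\tfrac12$ this costs a factor $2\cdot\tfrac32=3$. *)
Lemma depth_log tol T : 0 < tol -> tol <= 1 / 4 -> depth_of tol T ->
  (3 / 2) ^+ T <= 3 * ln (1 / tol).
Proof.
move=> t0 t4 [_ hT].
have lb (x : R) : 0 < x -> 1 - x <= ln (1 / x).
  by move=> x0; rewrite div1r lnV ?posrE //; have := @le_ln1Dx R (x - 1); rewrite (addrC 1) subrK => h; have := h _; lra.
have base : 1 / 2 <= ln (64 / 25 : R).
  have := lb (25 / 64); have -> : 1 / (25 / 64) = 64 / 25 :> R by field.
  by move=> h; have := h _; lra.
case: T hT => [_|T hT].
  by rewrite expr0; have := lb tol t0; lra.
have := hT T (ltnSn T) => h.
have : ln (1 / (320 ^+ 2 * eseq T)) <= ln (1 / tol).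
  apply: ln_inv_le t0 _; have e0 := eseq_gt0 T; apply: le_trans (ltW h) _.
  by apply: ler_peMl; [exact: ltW|apply: exprn_ege1; rewrite ler1n].
rewrite ln_eseq exprS.
have p0 : 0 <= (3 / 2 : R) ^+ T by apply: exprn_ge0; lra.
by nra.
Qed.

(** Source of the exponents: $b^T=((3/2)^T)^{\ln b/\ln(3/2)}$, applied with b = 3 to times and b = 5
    to lengths. *)
Lemma pow_log (b y : R) T : 1 < b -> (3 / 2) ^+ T <= y -> b ^+ T <= y `^ (ln b / ln (3 / 2)).
Proof.
move=> b1 hy; have b0 : 0 < b by apply: lt_trans b1.
have l32 : 0 < ln (3 / 2 : R) by apply: ln_gt0; lra.
have p0 : 0 < (3 / 2 : R) ^+ T by apply: exprn_gt0; lra.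
have -> : b ^+ T = ((3 / 2) ^+ T) `^ (ln b / ln (3 / 2)).
  apply: ln_inj; rewrite ?posrE ?exprn_gt0 ?powR_gt0 //.
  rewrite ln_powR !lnXn //.
  by rewrite mulrnAr divfK // gt_eqF.
apply: ge0_ler_powR => //.
- by rewrite divr_ge0 ?ltW // ln_gt0.
- by rewrite nnegrE ltW.
by rewrite nnegrE; apply: le_trans hy; exact: ltW.
Qed.
End Levels.

(** * The preprocessing program *)

Local Open Scope nat_scope.

Section Code.
Definition Depth (tolE : rexp) := Seq (Seq (SetR 46 (RMul (RDiv (rn 1) (rn 512)) (RDiv (rn 1) (rn 512)))) (SetN VT (NConst 0)))
  (While (BNot (RLe (RV 46) tolE)) (Seq (SetR 46 (RMul (rn 320) (RMul (RV 46) (RFun Sqrt (RV 46)))))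
     (SetN VT (NAdd (NV VT) (NConst 1))))).
Definition SearchLeaf := Seq (Search (nRbase (NConst 0)) (nRbase (NConst 1)) (NConst LLV)) (SetN NLV (NAdd (NV LLV) (NConst 1))).
Definition NTE := NMul (NConst 80) (NMul (NSub NDim (NConst 1)) NDim).
(** The value $2^{-25}/d^2$, which does not refer to the precision. Its constant comes from
    [leaf_error]; the nested products keep the numerals small. *)
Definition tolPre : rexp := RDiv (rn 1) (RMul (RMul (rn 32) (RMul (rn 32) (RMul (rn 32) (RMul (rn 32) (rn 32))))) (RMul (RNat NDim) (RNat NDim))).
Definition LamLoopPre := For 50 (NV VT) (SetN 43 (NAdd (NMul (NConst 3) (NV 43)) (NConst 1))).
Definition InitPre := seqs [:: SetN 51 (NConst 0); SetN 52 (NConst 0); SetN 53 (NConst 0); SetN 54 (NConst 0); SetR 45 (RNat NDim);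
  SetN 40 (NConst 0); SetN 41 (NAdd (NConst 16) NTE)].
Definition SetEntry := seqs [:: SetN 20 (NV 51); SetN 21 (NV 52);
  SetR 20 (RMul (RMul (rn 2) (RV 40)) (RDiv (RNat (NV 54)) (RV 45)))].
Definition SetCall := Seq (SetN VM (NConst 0)) (Seq (SetN VS (NV VT)) (SetN VG (NConst 0))).
(** Counters 51 to 54 are the digits of the running table index; carrying them along replaces
    division with remainder. Scalar 45 follows as d to the power of the digit position. *)
Definition Odometer := Seq (SetN 54 (NAdd (NV 54) (NConst 1)))
  (If (NLe NDim (NV 54)) (Seq (SetN 54 (NConst 0)) (Seq (SetN 53 (NAdd (NV 53) (NConst 1)))
    (Seq (SetR 45 (RMul (RV 45) (RNat NDim)))
    (If (NLe (NConst 40) (NV 53)) (Seq (SetN 53 (NConst 0)) (Seq (SetR 45 (RNat NDim))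
      (Seq (SetN 52 (NAdd (NV 52) (NConst 1)))
      (If (NLe (NSub NDim (NConst 1)) (NV 52)) (Seq (SetN 52 (NConst 0)) (SetN 51 (NAdd (NV 51) (NConst 1)))) Skip)))) Skip)))) Skip).
Definition SetId := MxSet (NConst 0) (CR (RNat (ndelta (NV 0) (NV 1)))).
Definition ZeroH := MxSet (NConst 5) (CR (rn 0)).
Definition EntryStep := Seq SetId (Seq SetEntry (Seq RotateA (Seq (Copy 14 0) (Seq ZeroH (Seq SetCall
  (Seq (SK ExactPush ExactPop SearchLeaf) (Seq (MxSet (NAdd (NConst 16) (NV 50)) (CE01 1)) Odometer))))))).
Definition Pre := Seq (SetR 40 (RMul (rn 4) (RFun Atan (rn 1)))) (Seq (Depth tolPre) (Seq (SetN 43 (NConst 1)) (Seq LamLoopPre (Seq InitPre (For 50 NTE EntryStep))))).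
End Code.

Lemma nrm_le0 (R : realType) n (A : 'M[R[i]]_n) : (nrm A <= 0)%R -> A = 0%R.
Proof.
move=> h; apply/matrixP => i j; rewrite mxE; apply: eq0_normc; apply/eqP.
by rewrite eq_le normc_ge0 andbT; apply: le_trans (entry_le_nrm _ _ _) h.
Qed.

Lemma pow5_inv (F : fieldType) (x y : F) : (1 / (x * (x * (x * (x * x))) * (y * y)) = (x ^+ 5 * y ^+ 2)^-1)%R.
Proof. by rewrite div1r !exprS !expr0 !mulr1. Qed.

Lemma mulnD_inj d x y a b : a < d -> b < d -> x * d + a = y * d + b -> x = y /\ a = b.
Proof.
move=> ad bd e; have d0 : 0 < d by exact: leq_ltn_trans ad.
have h : (x * d + a) %/ d = (y * d + b) %/ d by rewrite e.
have h' : (x * d + a) %% d = (y * d + b) %% d by rewrite e.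
by move: h h'; rewrite !divnMDl // !modnMDl !divn_small // !modn_small // !addn0.
Qed.

Lemma tidx_inj d (ty ty' : bool) j j' b b' a a' : j < d - 1 -> j' < d - 1 -> b < 40 -> b' < 40 -> a < d -> a' < d ->
  tidx d ty j b a = tidx d ty' j' b' a' -> [/\ ty = ty', j = j', b = b' & a = a'].
Proof.
move=> h1 h2 h3 h4 h5 h6; rewrite /tidx => /(mulnD_inj h5 h6)[/(mulnD_inj h3 h4)[/(mulnD_inj h1 h2)[e1 e2] e3] e4].
by split => //; case: ty ty' e1 => -[].
Qed.

(** * Correctness of the preprocessing *)

Section Pre.
Variables (R : realType) (d m p : nat).
Variables (G : 'I_m -> 'M[R[i]]_d) (U : 'I_p -> 'M[R[i]]_d) (eps : R).
Variables (search : 'M[R[i]]_d -> seq 'I_m) (T0 S : nat).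
Implicit Types (st : state R) (c : cmd).
Hypothesis d1 : 1 < d.
Let d0 : 0 < d := ltnW d1.
Hypothesis S64 : 64 <= S.
Hypothesis rm : room d S 14.
Hypothesis hG : instruction_set G.
Local Notation T := (T G U eps search T0 S).
Local Notation nev := (@neval R d m p).
Local Notation rev := (@reval R d m p G U eps).
Local Notation bev := (@beval R d m p G U eps).
Local Notation ceval := (ceval G U eps).
Local Notation ev := (ev G U eps).
Local Notation same := (same d).
Local Notation frame := (frame d).
Local Notation M := 'M[R[i]]_d.

Definition cDepth tolE Tt := 60 + Tt.+1 * (rexp_cost tolE + 60).

Lemma T_depth tolE (tol : R) Tt st : depth_of tol Tt ->
  (forall st', same [:: VT] [:: 46] [::] st st' -> rev st' tolE = tol) ->
  exists2 st', T (Depth tolE) st (cDepth tolE Tt) st' & same [:: VT] [:: 46] [::] st st' /\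
    nmem st' VT = Tt /\ rmem st' 46 = eseq R Tt.
Proof.
move=> [hT hmin] htol.
set s1 := ev (Seq (SetR 46 (RMul (RDiv (rn 1) (rn 512)) (RDiv (rn 1) (rn 512)))) (SetN VT (NConst 0))) st.
have t1 : T (Seq (SetR 46 (RMul (RDiv (rn 1) (rn 512)) (RDiv (rn 1) (rn 512)))) (SetN VT (NConst 0))) st 20 s1 by apply: T_sl.
have f1 : same [:: VT] [:: 46] [::] st s1.
  by apply: same_setn_in => //; apply: same_setr_in => //; exact: same_refl.
have n1 : nmem s1 VT = 0 by [].
have e1 : rmem s1 46 = eseq R 0 by [].
clearbody s1.
suff loop : forall k s st1, s + k = Tt -> same [:: VT] [:: 46] [::] st st1 -> nmem st1 VT = s -> rmem st1 46 = eseq R s ->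
    exists2 st', T (While (BNot (RLe (RV 46) tolE)) (Seq (SetR 46 (RMul (rn 320) (RMul (RV 46) (RFun Sqrt (RV 46)))))
     (SetN VT (NAdd (NV VT) (NConst 1))))) st1 (k.+1 * (rexp_cost tolE + 60)) st' & same [:: VT] [:: 46] [::] st st' /\
    nmem st' VT = Tt /\ rmem st' 46 = eseq R Tt.
  have [s2 t2 [f2 e2]] := loop Tt 0 s1 (add0n _) f1 n1 e1.
  by exists s2 => //; apply: T_seq t1 t2 _; rewrite /cDepth; clear; lia.
elim=> [|k IH] s st1 sk f n e.
  rewrite addn0 in sk; rewrite sk in n e.
  exists st1 => //; apply: T_while_end; last by rewrite /=; clear; lia.
  by rewrite /= e htol // negbK.
set s2 := ev (Seq (SetR 46 (RMul (rn 320) (RMul (RV 46) (RFun Sqrt (RV 46))))) (SetN VT (NAdd (NV VT) (NConst 1)))) st1.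
have t2 : T (Seq (SetR 46 (RMul (rn 320) (RMul (RV 46) (RFun Sqrt (RV 46))))) (SetN VT (NAdd (NV VT) (NConst 1)))) st1 30 s2 by apply: T_sl.
have f2 : same [:: VT] [:: 46] [::] st s2 by apply: same_setn_in => //; apply: same_setr_in.
have n2 : nmem s2 VT = s.+1 by rewrite /s2 /= /upd /= n addn1.
have e2 : rmem s2 46 = eseq R s.+1 by rewrite /s2 /= /upd /= e.
clearbody s2.
have [|s3 t3 h3] := IH s.+1 s2 _ f2 n2 e2; first by rewrite addSnnS.
exists s3 => //; apply: T_while_step t2 t3 _; last by rewrite /=; clear; lia.
by rewrite /= e htol // -ltNge; apply: hmin; move: sk; clear; lia.
Qed.

Variables (eps0 : R) (l0 : nat).
Hypothesis heps0 : (eps0 <= eseq R 0)%R.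
Hypothesis hsearch : forall V : M, SU V -> size (search V) <= l0 /\ (nrm (V - word_eval G (search V)) <= eps0)%R.

(** The search also returns the matrix of its word, so the numerical error of this leaf is exactly
    zero. *)
Lemma T_searchleaf st : True -> lines_ok st -> unitary (reg d st 0) -> (true -> \det (reg d st 0) = 1%R) ->
  exists2 st', T SearchLeaf st (T0 + 100) st' & frame LN MS (iota 0 11) st st' /\
    sk_result G st st' 0%R (eseq R 0) 1 l0 (reg d st 0).
Proof.
move=> _ lo u0 /(_ isT) det0.
have [|||s1 t1 [f1 r1 n1 [sl1 an1]]] := @T_search R d m p G U eps search T0 S d0 S64 (NConst 0) (NConst 1) LLV st (T0 + 60).
- exact: room_le rm.
- by [].
- by rewrite /=; clear; lia.
set w := search _ in r1 sl1.
have [] : size w <= l0 /\ (nrm (reg d st 0 - word_eval G w) <= eps0)%R.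
  by apply: hsearch; split => //; exact/unitarymxE.
move=> hw1 hw2.
set s2 := setn s1 NLV (size (slp s1)).
have t2 : T (SetN NLV (NAdd (NV LLV) (NConst 1))) s1 10 s2.
  have := @T_setn R d m p G U eps search T0 S S64 NLV (NAdd (NV LLV) (NConst 1)) s1 10 isT isT.
  by rewrite /= n1 addn1 /s2 sl1 size_rcons.
exists s2; first by apply: T_seq t1 t2 _; clear; lia.
split.
  apply: (frame_trans (st2 := s1)); first by apply: frame_sub f1; sub.
  have fs : same [:: NLV] [::] [::] s1 s2 by exact: same_setn.
  by apply: frame_sub (same_frame fs); sub.
have lw : lastw G s2 = w.
  rewrite /lastw /s2 /= sl1 size_rcons /= wd_rcons -map_comp.
  by elim: (w) => // x w' IH; rewrite /= IH valK.
split.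
- by split; rewrite /lines_ok /s2 /= /upd //= n1 sl1 size_rcons.
- by rewrite /s2 /= an1.
- by exists [:: [seq GateRef false (\val j) | j <- w]] => //; rewrite /s2 /= sl1 cats1.
- by rewrite lw.
rewrite lw; split.
  by rewrite -[reg d s2 1]/(reg d s1 1) r1 subrr nrm0.
exists 1%R; first exact: normc1.
by rewrite scale1r; apply: le_trans hw2 heps0.
Qed.

Variable Tp : nat.
Definition tolp : R := ((32%:R ^+ 5 * d%:R ^+ 2)^-1)%R.
Hypothesis hTp : depth_of tolp Tp.
Definition NT := 80 * ((d - 1) * d).
Definition base0 := 16 + NT.
Hypothesis rmB : room d S (base0 + 3 * Tp).
Let b14 : 14 < base0. Proof. by []. Qed.
Let xm14 k : k \in XM base0 Tp -> 10 < k /\ k != 14.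
Proof.
rewrite mem_iota => /andP[h _]; have h14 : 14 < k by exact: leq_trans b14 h.
by split; [exact: leq_trans h14|rewrite gtn_eqF].
Qed.
(** Each table entry takes exactly this many lines, so the line of an entry is found by arithmetic
    instead of being stored. *)
Definition Lamp := lam 1 Tp.
Definition ltp := 5 ^ Tp * l0.

Lemma e0_bound : (0 <= eseq R 0 <= (1 / 512) ^+ 2)%R.
Proof. by rewrite lexx andbT ltW // eseq_gt0. Qed.

Lemma T_presk st A : nmem st VM = 0 -> nmem st VS = Tp -> nmem st VT = Tp -> nmem st VG = 0 ->
  reg d st 5 = 0%R -> lines_ok st -> reg d st 14 = A -> unitary A -> \det A = 1%R -> @xstk R d base0 Tp st [::] ->
  exists2 st', T (SK ExactPush ExactPop SearchLeaf) st (tau d (cExact d) (T0 + 100) Tp + 40) st' &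
    frame MN MS (MM (XM base0 Tp)) st st' /\ @xstk R d base0 Tp st' [::] /\
    sk_result G st st' 0%R (eseq R Tp) Lamp ltp A.
Proof.
move=> vm vs vt vg r5 lo r14 uA dA hx.
have z0 s : s <= Tp -> (12 ^+ s * 0 <= eseq R s ^+ 2)%R by rewrite mulr0 sqr_ge0.
have tE : target st 0 0%R = A by [].
have [|||||st' t' [f' [vm' vs' _ k' res]]] := @call_spec R d m p G U eps search T0 S d1 S64 rm hG ExactPush ExactPop SearchLeaf
  (XM base0 Tp) xm14 (@xstk R d base0 Tp) id Tp (cExact d) 0%R (xstk_frame d1 S64 rm b14 rmB)
  (fun st L s g hk hL _ _ _ _ _ => exact_push G U eps search T0 d1 S64 rm b14 rmB s g hk hL)
  (fun st f L hk => exact_pop G U eps search T0 d1 S64 rm b14 rmB hk) (fun _ h => h) (fun _ => erefl _) _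
  (eseq R) Tp 1 l0 (T0 + 100) (fun _ => erefl _) e0_bound (lexx _) z0 (leqnn _) isT (fun=> True) (fun _ _ _ _ _ _ => I) true
  T_searchleaf Tp (leqnn _) st [::] 0 0%R vm vs vt vg isT r5 (dag0 _ _ _) _ erefl I lo _ _ hx _.
- by move=> A'; rewrite subrr nrm0.
- by rewrite nrm0.
- by rewrite tE.
- by rewrite tE.
- by [].
rewrite tE /rho mulr0 in res.
exists st' => //.
have := @T_SK R d m p G U eps search T0 S d1 S64 rm ExactPush ExactPop SearchLeaf Tp 0%R (eseq R) Tp 1 e0_bound (lexx _) (leqnn _) isT
  st _ st' (tau d (cExact d) (T0 + 100) Tp + 40) t'.
apply; last by rewrite leq_add2l.
by rewrite guardE vm' vs' (frame_n (k := VT) f' isT) vt !leqnn.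
Qed.

Definition ptable e st := forall (ty : bool) (j j' : 'I_d) b a, j' = j.+1 :> nat -> b < 40 -> a < d ->
  tidx d ty j b a < e -> exists2 W, entry_ok G Lamp ltp st (tidx d ty j b a) W &
    pclose tolp (givens j j' ty (2 * pi * (a%:R / d%:R ^+ b.+1))) W.
Definition pcore e st := [/\ rmem st 40 = pi, nmem st VT = Tp, nmem st 43 = Lamp, @xstk R d base0 Tp st [::] &
  lines_ok st /\ size (slp st) = e * Lamp].
Definition pdec e st := exists t j b a, [/\ e = ((t * (d - 1) + j) * 40 + b) * d + a, [/\ j < d - 1, b < 40 & a < d],
  [/\ nmem st 51 = t, nmem st 52 = j, nmem st 53 = b & nmem st 54 = a] & rmem st 45 = (d%:R ^+ b.+1)%R].

Lemma T_odometer e st : pdec e st -> exists2 st', T Odometer st 100 st' &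
  same [:: 51; 52; 53; 54] [:: 45] [::] st st' /\ pdec e.+1 st'.
Proof.
move=> [t [j [b [a [he [hj hb ha] [h1 h2 h3 h4] h5]]]]].
exists (ev Odometer st); first by apply: T_sl.
have q : same (wn Odometer) (wr Odometer) [::] st (ev Odometer st) by apply: same_ev.
split; first by apply: same_sub q; sub.
have uS (f : nat -> nat) k x : upd f k x k = x by rewrite /upd eqxx.
rewrite /Odometer /= /upd /= h4 addn1; case: (leqP d a.+1) => ha'; last first.
  by exists t, j, b, a.+1; split => //=; rewrite he addnS.
have {ha'} ha' : a.+1 = d by apply/eqP; rewrite eqn_leq ha.
rewrite h3 addn1; case: (leqP 40 b.+1) => hb'; last first.
  exists t, j, b.+1, 0; split => //=; last by rewrite h5 -exprSr.
  by rewrite he -addnS ha' addn0 [in RHS]addnS mulSn addnC.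
have {hb'} hb' : b = 39 by move: hb hb'; clear; lia.
rewrite h2 addn1; case: (leqP (d - 1) j.+1) => hj'; last first.
  exists t, j.+1, 0, 0; split => //=.
  by rewrite he hb' -addnS ha' !addn0 [in RHS]addnS mulSn !mulnDl; clear; lia.
exists t.+1, 0, 0, 0; split => //=; last by rewrite h1 addn1.
  have -> : t.+1 * (d - 1) = t * (d - 1) + j + 1 by move: hj hj'; rewrite mulSn; clear; lia.
  by rewrite he hb' -addnS ha' !addn0 !mulnDl; clear; lia.
by split=> //; move: d1; clear; lia.
Qed.

Definition cEntry := cMx 300 d + slcost SetEntry + (slcost SetTrig + cMx (ccost RotE) d + cMx 200 d) + cMx 200 d + cMx 300 d +
  100 + (tau d (cExact d) (T0 + 100) Tp + 40) + cMx 300 d + 200.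

Lemma Lamp_gt0 : 0 < Lamp.
Proof. by rewrite /Lamp; elim: Tp => //= s IH; rewrite addn1. Qed.

Lemma T_entry e st : e < NT -> nmem st 50 = e -> pcore e st -> pdec e st -> ptable e st ->
  exists2 st', T EntryStep st cEntry st' & nmem st' 50 = e /\ [/\ pcore e.+1 st', pdec e.+1 st' & ptable e.+1 st'].
Proof.
move=> eNT h50 [c1 c2 c3 c4 [c5 c6]] hd ht.
have [t [j [b [a [he [hj hb ha] [n1 n2 n3 n4] n5]]]]] := hd.
have t2 : t < 2.
  rewrite ltnNge; apply/negP => ht2; move: eNT; rewrite he /NT.
  have : 2 * (d - 1) <= t * (d - 1) by rewrite leq_mul2r ht2 orbT.
  by move: d0; clear; nia.
pose ty := t == 1.
have tyE : t = ty by rewrite /ty; move: t2; clear; case: t => [|[|]].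
have jd : j < d by lia.
have jd' : j.+1 < d by lia.
pose J := Ordinal jd; pose J' := Ordinal jd'.
have jn : J != J' by rewrite -val_eqE /= neq_ltn ltnSn.
have eE : e = tidx d ty J b a by rewrite he /tidx tyE.
have [|||s1 t1 [f1 e1]] := @mxset R d m p G U eps search T0 S d1 S64 rm 0 (CR (RNat (ndelta (NV 0) (NV 1)))) st (cMx 300 d)
  (fun k l => (k == l)%:R%R).
- exact: room_le rm.
- move=> k l st' kd ld s v0 v1 _; rewrite ceval_CR [rev _ _]/= (delta_nat d1 S64 rm) v0 v1.
  by rewrite (rmorph_nat (real_complex R)).
- exact: cMx_le.
have E1 : reg d s1 0 = 1%:M by rewrite e1; apply/matrixP => k l; rewrite !mxE.
set s2 := ev SetEntry s1.
have t2' : T SetEntry s1 (slcost SetEntry) s2 by apply: T_sl.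
have f2 : same [:: 20; 21] [:: 20] [::] s1 s2.
  by apply: same_setr_in => //; do !apply: same_setn_in => //; exact: same_refl.
have n20 : nmem s2 20 = ty by rewrite /s2 /= /upd /= (same_n f1) // n1.
have n21 : nmem s2 21 = J by rewrite /s2 /= /upd /= (same_n f1) // n2.
pose th := (2 * pi * (a%:R / d%:R ^+ b.+1) : R)%R.
have r20 : rmem s2 20 = th.
  by rewrite /s2 /= /upd /= !(same_sc f1) // (same_n f1) // c1 n4 n5.
clearbody s2.
have [s3 t3 [f3 e3]] := @T_rotateA R d m p G U eps search T0 S d1 S64 rm s2 ty J J' th n20 n21 erefl r20.
have E3 : reg d s3 0 = givens J J' ty th by rewrite e3 (same_reg d0 f2) // E1 mulmx1.
have [||| s4 t4 [f4 e4]] := @T_copy R d m p G U eps search T0 S d1 S64 rm 14 0 s3 (cMx 200 d) => //.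
have [|| s5 t5 [f5 e5]] := @T_const R d m p G U eps search T0 S d1 S64 rm 5 (CR (rn 0)) 0%R s4 (cMx 300 d) isT.
- by move=> st' _; rewrite ceval_CR.
- exact: cMx_le.
set s6 := ev SetCall s5.
have t6 : T SetCall s5 60 s6 by apply: T_sl.
have f6 : same [:: VM; VS; VG] [::] [::] s5 s6 by do !apply: same_setn_in => //; exact: same_refl.
have f05 : same [:: 0; 1; 20; 21] [:: 0; 1; 20; 21; 22] [:: 0; 6; 14; 5] st s5.
  same_via s1 f1.
  same_via s2 f2.
  same_via s3 f3.
  same_via s4 f4.
  by apply: same_sub f5; sub.
have q6 : [/\ nmem s6 VM = 0, nmem s6 VS = Tp, nmem s6 VT = Tp & nmem s6 VG = 0].
  by rewrite /s6 /= /upd /= !(same_n f05).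
clearbody s6; have [q1 q2 q3 q4] := q6.
have f06 : same [:: 0; 1; 20; 21; VM; VS; VG] [:: 0; 1; 20; 21; 22] [:: 0; 6; 14; 5] st s6.
  by apply: (same_trans (st2 := s5)); [apply: same_sub f05|apply: same_sub f6]; sub.
have x6 : @xstk R d base0 Tp s6 [::].
  have [y1 y2 y3 y4] := c4; split => //; by rewrite (same_n f06).
have lo6 : lines_ok s6 by rewrite /lines_ok (same_slp f06) (same_n f06).
have r14 : reg d s6 14 = givens J J' ty th.
  by rewrite (same_reg d0 f6) // (same_reg d0 f5) // e4.
have r5 : reg d s6 5 = 0%R.
  by rewrite (same_reg d0 f6) // e5; apply/matrixP => k l; rewrite !mxE.
have [s7 t7 [f7 [x7 [[lo7 ll7] an7 [Ls sl7 zl7] sw7 [hr7 hp7]]]]] :=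
  T_presk q1 q2 q3 q4 r5 lo6 r14 (rot_unitary jn ty th) (rot_det jn ty th) x6.
have n50 : nmem s7 50 = e by rewrite (frame_n f7) // (same_n f06).
have [||||||||s8 t8 [f8 e8]] := @T_mxset R d m p G U eps search T0 S d0 S64 (NAdd (NConst 16) (NV 50)) (CE01 1) s7 [::] [:: 0; 1]
  (cMx 300 d) (fun i j => regn d s7 1 i j).
- by rewrite [nev _ _]/= n50; apply: room_le rmB; move: eNT; rewrite /base0; clear; lia.
- by [].
- by [].
- by [].
- by [].
- by move=> st' s; rewrite /= (same_n s).
- move=> i l st' id ld s v0 v1 _; rewrite (@ceval_CE01 R d m p G U eps st' 1 _ _ v0 v1).
  by rewrite (same_regn d0 s).
- by rewrite /cMx /ccost /=; clear; nia.
rewrite [nev _ _]/= n50 in f8 e8.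
have f08 : frame (MN ++ [:: VM; VS; VG]) (MS ++ [:: 0; 1]) ((16 + e) :: MM (XM base0 Tp) ++ [:: 14]) st s8.
  apply: (frame_trans (st2 := s6)).
    by apply: frame_sub (same_frame f06); [sub|sub|move=> k hk; rewrite inE mem_cat [k \in [:: 14]]inE; move: hk; rewrite !inE => /or4P[] /eqP ->; rewrite ?eqxx ?orbT // (@sub_MM _ [:: 0; 5; 6]) ?orbT].
  apply: (frame_trans (st2 := s7)).
    by apply: frame_sub f7; [sub|sub|move=> k hk; rewrite inE mem_cat hk orbT].
  by apply: frame_sub (same_frame f8); [sub|sub|move=> k; rewrite !inE => ->].
have d8 : pdec e s8.
  exists t, j, b, a; split => //; last by rewrite (frame_sc f08).
  by split; rewrite (frame_n f08).
have [s9 t9 [f9 d9]] := T_odometer d8.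
exists s9.
  by apply: T_seq t1 (T_seq t2' (T_seq t3 (T_seq t4 (T_seq t5 (T_seq t6 (T_seq t7 (T_seq t8 t9 (leqnn _)) (leqnn _))
    (leqnn _)) (leqnn _)) (leqnn _)) (leqnn _)) (leqnn _)) _; rewrite /cEntry; clear; lia.
have slE : slp s9 = slp st ++ Ls by rewrite (same_slp f9) (same_slp f8) sl7 (same_slp f06).
have f89 : frame [:: 51; 52; 53; 54] [:: 45] ((16 + e) :: MM (XM base0 Tp) ++ [:: 14]) s8 s9.
  by apply: frame_sub (same_frame f9); [sub|sub|].
have R9 k : k != 16 + e -> k \notin MM (XM base0 Tp) -> k != 14 -> reg d s9 k = reg d st k.
  move=> h1 h2 h3; have hk : k \notin (16 + e) :: MM (XM base0 Tp) ++ [:: 14].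
    by rewrite inE negb_or h1 mem_cat negb_or h2 inE.
  by rewrite (frame_reg d0 f89) // (frame_reg d0 f08).
split; first by rewrite (frame_n f89) // (frame_n f08).
split.
- split.
  + by rewrite (frame_sc f89) // (frame_sc f08).
  + by rewrite (frame_n f89) // (frame_n f08).
  + by rewrite (frame_n f89) // (frame_n f08).
  + have [y1 y2 y3 y4] := x7; split => //.
      by rewrite (frame_n f89) // (same_n f8).
    by rewrite (frame_n f89) // (same_n f8).
  + rewrite /lines_ok (same_slp f9) (same_slp f8) (frame_n f89) // (same_n f8) //.
    by split; [exact: lo7|rewrite sl7 size_cat zl7 (same_slp f06) c6 mulSn addnC].
- exact: d9.
move=> ty' K K' b' a' kk hb' ha'; rewrite ltnS leq_eqVlt => /orP[/eqP te|te].
  have [|e1' e2' e3' e4'] := @tidx_inj d ty' ty K J b' b a' a _ hj hb' hb ha' ha (etrans te eE).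
    by have := ltn_ord K'; rewrite kk; clear; lia.
  have KJ : K = J by apply: val_inj.
  have KJ' : K' = J' by apply: val_inj; rewrite /= kk e2'.
  rewrite KJ KJ' e1' e3' e4' -[tidx _ _ _ _ _]eE.
  have Lg := Lamp_gt0.
  have szE : (e + 1) * Lamp - 1 = (size (slp s7)).-1.
    by rewrite sl7 size_cat zl7 (same_slp f06) c6 mulnDl mul1n subn1.
  have wE : wd G (slp s9) ((e + 1) * Lamp - 1) = lastw G s7.
    by rewrite szE (same_slp f9) (same_slp f8).
  exists (word_eval G (lastw G s7)).
    split; rewrite ?wE //.
      (* Nothing is rounded on the exact stack, so the error bound is 0 and the table contains the
         exact values of its words. *)
      have h0 : reg d s7 1 = word_eval G (lastw G s7) by apply/eqP; rewrite -subr_eq0; apply/eqP; exact: nrm_le0 hr7.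
      rewrite (same_reg d0 f9) // e8 -h0.
      by apply/matrixP => k l; rewrite !mxE.
    by rewrite slE size_cat zl7 c6 mulnDl mul1n.
  by apply: pclose_le hp7; case: hTp.
have [W [w1 w2 w3 w4] hW] := ht ty' K K' b' a' kk hb' ha' te.
set e' := tidx _ _ _ _ _ in te w1 w2 w3 w4 *.
have wE : wd G (slp s9) ((e' + 1) * Lamp - 1) = wd G (slp st) ((e' + 1) * Lamp - 1).
  by rewrite slE wd_cat //; move: w2 Lamp_gt0; clear; nia.
exists W => //; split; rewrite ?wE //.
  rewrite R9 //; first by rewrite eqn_add2l neq_ltn te.
    rewrite mem_cat negb_or mem_iota /= mem_iota negb_and -!ltnNge; apply/orP; left.
    by move: te eNT; rewrite /base0; clear; lia.
by rewrite slE size_cat (leq_trans w2) // leq_addr.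
Qed.

Definition cPre := 200 + slcost InitPre + cDepth tolPre Tp + (100 + Tp * 100) + (100 + NT * (cEntry + 100)).

Lemma T_pre : exists2 st', T Pre (init_state R) cPre st' & pcore NT st' /\ ptable NT st'.
Proof.
set s0 := init_state R.
set s1 := ev (SetR 40 (RMul (rn 4) (RFun Atan (rn 1)))) s0.
have t1 : T (SetR 40 (RMul (rn 4) (RFun Atan (rn 1)))) s0 20 s1 by apply: T_sl.
have p1 : rmem s1 40 = pi.
  by rewrite /s1 /= /upd /= mulr1n atan1 mulrC divfK // pnatr_eq0.
have z1 : [/\ nmem s1 NLV = 0, slp s1 = [::] & forall k, nmem s1 k = 0] by [].
clearbody s1.
have [|s2 t2 [f2 [v2 _]]] := @T_depth tolPre tolp Tp s1 hTp.
  by move=> st' _; exact: pow5_inv.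
set s3 := setn s2 43 1.
have t3 : T (SetN 43 (NConst 1)) s2 10 s3 by apply: (@T_setn _ _ _ _ _ _ _ _ _ _ S64).
have f3 : same [:: 43] [::] [::] s2 s3 by exact: same_setn.
pose I i st' := same [:: 43; 50] [::] [::] s3 st' /\ nmem st' 43 = lam 1 i.
have [|||||s4 t4 [f4 e4]] := @T_for R d m p G U eps search T0 S S64 I 50 (NV VT) (SetN 43 (NAdd (NMul (NConst 3) (NV 43)) (NConst 1)))
  s3 Tp 20 (100 + Tp * 60) isT.
- by move=> i st' x [f e]; split => //; exact: same_setn_in.
- move=> i st' [f e]; rewrite /= (frame_n (k := VT) (same_frame f)) // (frame_n (k := VT) (same_frame f3)) //.
- by split; [exact: same_refl|].
- move=> i st' iT [f e] v50; exists (setn st' 43 (3 * nmem st' 43 + 1)).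
    by have := @T_setn R d m p G U eps search T0 S S64 43 (NAdd (NMul (NConst 3) (NV 43)) (NConst 1)) st' 20 isT isT.
  split; first by [].
  by split; [exact: same_setn_in|rewrite /= /upd /= e].
- by rewrite /=; clear; lia.
set s5 := ev InitPre s4.
have t5 : T InitPre s4 (slcost InitPre) s5 by apply: T_sl.
have f14 : same [:: VT; 43; 50] [:: 46] [::] s1 s4.
  same_via s2 f2.
  by apply: (same_trans (st2 := s3)); [apply: same_sub f3|apply: same_sub f4]; sub.
have f5 : same [:: 51; 52; 53; 54; 40; 41] [:: 45] [::] s4 s5.
  have q : same (wn InitPre) (wr InitPre) [::] s4 s5 by apply: same_ev.
  by apply: same_sub q; sub.
have h5 : [/\ nmem s5 51 = 0, nmem s5 52 = 0, nmem s5 53 = 0 & nmem s5 54 = 0] by [].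
have h5' : [/\ nmem s5 40 = 0, nmem s5 41 = base0 & rmem s5 45 = d%:R%R] by [].
clearbody s5; have [n51 n52 n53 n54] := h5; have [n40 n41 r45] := h5'; have [zl zs zn] := z1.
have f15 : same [:: VT; 43; 50; 51; 52; 53; 54; 40; 41] [:: 46; 45] [::] s1 s5.
  by apply: (same_trans (st2 := s4)); [apply: same_sub f14|apply: same_sub f5]; sub.
pose J e st' := [/\ pcore e st', pdec e st' & ptable e st'].
have [|||||s6 t6 [q1 q2 q3]] := @T_for R d m p G U eps search T0 S S64 J 50 NTE EntryStep s5 NT cEntry (100 + NT * (cEntry + 100)) isT.
- by move=> i st' x [h1 h2 h3]; split; [exact: h1|exact: h2|exact: h3].
- by [].
- split; last by move=> ty j j' b a _ _ _.
    split; rewrite ?(same_sc f15) //.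
    + by rewrite (frame_n (k := VT) (same_frame f5)) // (frame_n (k := VT) (same_frame f4)) // (frame_n (k := VT) (same_frame f3)).
    + by rewrite (frame_n (k := 43) (same_frame f5)).
    + by rewrite /lines_ok (same_slp f15) (frame_n (k := NLV) (same_frame f15)) // zl zs.
  exists 0, 0, 0, 0; split => //; first by split => //; rewrite subn_gt0.
- by move=> i st' iN [h1 h2 h3] v50; have [st2 tt [h4 h5'']] := T_entry iN v50 h1 h2 h3; exists st2.
- by rewrite [nexp_cost _]/=; clear; nia.
exists s6 => //.
by apply: T_seq t1 (T_seq t2 (T_seq t3 (T_seq t4 (T_seq t5 t6 (leqnn _)) (leqnn _)) (leqnn _)) (leqnn _)) _; rewrite /cPre; clear; lia.
Qed.

Lemma tidx_lt (ty : bool) j b a : j < d - 1 -> b < 40 -> a < d -> tidx d ty j b a < NT.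
Proof.
move=> hj hb ha; rewrite /tidx /NT.
have h1 : ty * (d - 1) + j < 2 * (d - 1) by case: (ty); move: hj; rewrite ?mul1n ?mul0n; clear; lia.
have h2 : (ty * (d - 1) + j) * 40 + b < 80 * (d - 1) by move: h1 hb; clear; lia.
by rewrite mulnA; move: h2 ha; clear; nia.
Qed.
End Pre.

(** * The main program *)

Section Code.
Definition LoadU := MxSet (NConst 6) (REntryT (NV 50) (NV 0) (NV 1) false, REntryT (NV 50) (NV 0) (NV 1) true).
Definition DiagU := Diag NDim (nRbase (NConst 6)) (nRbase (NConst 15)) (nRbase (NConst 8)).
Definition prodE := Cmul (CS 2) (CE (NConst 8) (NConst 0) (NV 3)).
Definition ProdStep := SetC 2 prodE.
Definition Products := Seq (Seq (SetR 2 (rn 1)) (SetR 3 (rn 0)))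
  (For 3 NDim (Seq ProdStep (PutSet (NConst 9) (NConst 0) (NV 3) (CS 2)))).
Definition RootV := Seq (MxSet (NConst 10) (Cmul (CE (NConst 9) (NConst 0) (NV 0)) (CE (NConst 15) (NV 0) (NV 1))))
  (MulReg 14 true 15 false 10).
(** Cyclic predecessor by truncated subtraction: the second summand is d - 1 for row 0 and vanishes
    for all others. *)
Definition prevIdx := NAdd (NSub (NV 0) (NConst 1)) (NMul (NSub NDim (NConst 1)) (NSub (NConst 1) (NV 0))).
Definition RootW := Seq (MxSet (NConst 10) (CE (NConst 15) prevIdx (NV 1))) (MulReg 14 true 15 false 10).
Definition Pow k n e := Seq (SetR k (rn 1)) (For 57 n (SetR k (RMul (RV k) e))).
Definition d4 := NMul (NMul NDim NDim) (NMul NDim NDim).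
(** An integer not below the required scale: doubling makes the rounded value integral even at a
    half-integer, and adding 2 compensates for rounding down. *)
Definition BE := RAdd (RMul (rn 2) (rndX (RV 47))) (rn 2).
(** The leaf has numerical error at most $4(d^2/B)\cdot80d^2=320d^4/B$; requiring this times $12^T$
    to be at most $e_T^2$ gives the lower bound for B. Scalar 43 is the base for products and
    exceeds $2d^2(8B+2)^2$. *)
Definition Scales := seqs [:: SetR 47 (RDiv (RMul (RMul (rn 320) (RNat d4)) (RV 48)) (RMul (RV 46) (RV 46)));
  SetR 41 BE; SetR 42 (RAdd (RMul (rn 8) (RV 41)) (rn 4));
  SetR 43 (RAdd (RMul (rn 2) (RMul (RNat (NMul NDim NDim)) (RMul (RAdd (RMul (rn 8) (RV 41)) (rn 2)) (RAdd (RMul (rn 8) (RV 41)) (rn 2))))) (rn 1))].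
Definition Consts := Seq (Pow 48 (NV VT) (rn 12)) (Seq Scales (Pow 44 (NSub NDim (NConst 1)) (RV 43))).
Definition ZeroReg k := MxSet (NConst k) (CR (rn 0)).
Definition MainSK v := Seq ZeroH (Seq SetCall (Seq (SK PackPush PackPop Leaf) (SetN v (NV LLV)))).
Definition CommFinal : seq (ref nexp) :=
  [:: LineRef false (NV 55); LineRef false (NV 56); LineRef true (NV 55); LineRef true (NV 56)].
Definition MainStep := Seq LoadU (Seq DiagU (Seq Products (Seq RootV (Seq (Depth (RDiv RPrecision (rn 4)))
  (Seq Consts (Seq (ZeroReg 11) (Seq (ZeroReg 12) (Seq (ZeroReg 13) (Seq (MainSK 55) (Seq RootW (Seq (MainSK 56)
  (Seq (EmitLine CommFinal) (Answer (NV 50) (NV LLV)))))))))))))).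
Definition Main := For 50 NTargets MainStep.
End Code.

Lemma pow_split (F : fieldType) (x c : F) : (x != 0 -> x ^+ 2 * (2 * (2 * c * (x ^+ 40)^-1)) = (4 * c * (x ^+ 36)^-1) * (x ^+ 2)^-1)%R.
Proof.
move=> x0; have -> : (x ^+ 40 = x ^+ 36 * x ^+ 2 * x ^+ 2)%R by rewrite -!exprD.
by field; rewrite x0.
Qed.

Lemma pow2_bound (F : realFieldType) : (16%:R * (2 ^+ 36)^-1 <= (32%:R ^+ 5)^-1 :> F)%R.
Proof.
have e16 : (16%:R = 2 ^+ 4 :> F)%R by rewrite -natrX.
have e32 : (32%:R = 2 ^+ 5 :> F)%R by rewrite -natrX.
have p k : (0 < 2 ^+ k :> F)%R by apply: exprn_gt0.
rewrite e16 e32 -exprM ler_pdivrMr // mulrC ler_pdivlMr // -exprD.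
by rewrite ler_weXn2l // ler1n.
Qed.

Lemma leaf_const (F : realFieldType) : (128%:R * (32%:R ^+ 5)^-1 <= (1 / 512%:R) ^+ 2 :> F)%R.
Proof.
have e128 : (128%:R = 2 ^+ 7 :> F)%R by rewrite -natrX.
have e32 : (32%:R = 2 ^+ 5 :> F)%R by rewrite -natrX.
have e512 : (512%:R = 2 ^+ 9 :> F)%R by rewrite -natrX.
have p k : (0 < 2 ^+ k :> F)%R by apply: exprn_gt0.
rewrite e128 e32 e512 div1r exprVn -!exprM ler_pdivrMr // mulrC ler_pdivlMr // -exprD.
by rewrite ler_weXn2l // ler1n.
Qed.

Lemma zeta_alg (F : fieldType) (q x b : F) : (q * (4 * (x ^+ 2 / b) * (80%:R * x ^+ 2)) = (320%:R * x ^+ 4 * q) / b)%R.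
Proof. by rewrite -[320]/(4 * 80) natrM (exprD x 2 2); ring. Qed.

Lemma conj4 (K : nzRingType) n (q q' a b a' b' : 'M[K]_n) : q *m q' = 1%:M ->
  q' *m (a *m q) *m (q' *m (b *m q)) *m (q' *m (a' *m q)) *m (q' *m (b' *m q)) = q' *m (a *m (b *m a' *m b')) *m q.
Proof.
move=> h; have c (x y : 'M[K]_n) : x *m q *m q' *m y = x *m y by rewrite -(mulmxA x) h mulmx1.
by rewrite !mulmxA !c.
Qed.

Lemma unitary_diag_entry (R : realType) n (v : 'rV[R[i]]_n) : unitary (diag_mx v) -> forall j, normc (v 0%R j) = 1%R.
Proof.
move=> h j; have [|_ h1] := unitary_triangular h; last by have := h1 j; rewrite mxE eqxx mulr1n.
by move=> a b ba; rewrite mxE -val_eqE gtn_eqF.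
Qed.

(** * A special unitary matrix as a commutator *)

Section CommutatorFactors.
Variables (R : realType) (n : nat) (Q : 'M[R[i]]_n) (u : 'I_n -> R[i]).
Hypothesis uQ : unitary Q.
Hypothesis u1 : forall j, normc (u j) = 1%R.
Hypothesis pu : (\prod_j u j = 1)%R.

Definition pprod (j : 'I_n) : R[i] := (\prod_(k < n | (k <= j)%N) u k)%R.
Definition facV : 'M[R[i]]_n := dag Q *m (diag_mx (\row_j pprod j) *m Q).
Definition facW : 'M[R[i]]_n := dag Q *m (dag (cycmx R n) *m Q).

Lemma normc_pprod j : normc (pprod j) = 1%R.
Proof.
by rewrite /pprod; elim/big_ind: _ => [|x y hx hy|k _]; rewrite ?normc1 ?normcM ?hx ?hy ?mulr1.
Qed.

Lemma facV_unitary : unitary facV.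
Proof.
have ud : unitary (diag_mx (\row_j pprod j)) by apply: unitary_diag => j; rewrite mxE normc_pprod.
by apply: unitaryM; [exact: unitary_dag|exact: unitaryM].
Qed.

Lemma facW_unitary : unitary facW.
Proof. by apply: unitaryM; [exact: unitary_dag|apply: unitaryM uQ; apply: unitary_dag; exact: cycmx_unitary]. Qed.

(** At index 0 the cyclic predecessor is the last index, and the identity holds there because the
    full product is 1: this is where determinant one enters. *)
Lemma pprod_pred j : (pprod j * (pprod (ord_pred j))^*%C = u j)%R.
Proof.
have cz (z : R[i]) : normc z = 1%R -> (z * z^*%C = 1)%R.
  by move=> h; rewrite -sqr_normc -normcE' h rmorph1 expr1n.
have [j0|j0] := posnP j.
  have -> : pprod (ord_pred j) = 1%R.
    rewrite -pu /pprod; apply: eq_bigl => k; rewrite /= j0 add0n modn_small ?prednK ?(ltn_predL, leq_ltn_trans _ (ltn_ord j)) //.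
      by have := ltn_ord k; have := ltn_ord j; clear; lia.
  rewrite conjc1 mulr1 /pprod (bigD1 j) /= ?leqnn // big1 ?mulr1 // => k /andP[h1 h2].
  by case/eqP: h2; apply: val_inj; move: h1; rewrite /= j0 leqn0 => /eqP.
have pj : ord_pred j = j.-1 :> nat.
  by rewrite /=; have := ltn_ord j; move: j0; case: (j : nat) => // a _ ha; rewrite addSn /= addnC modnDl modn_small // ltnW.
have -> : pprod j = (u j * pprod (ord_pred j))%R.
  rewrite /pprod (bigD1 j) /= ?leqnn //; congr (_ * _)%R; apply: eq_bigl => k.
  by rewrite -val_eqE /= -[X in _ = (_ <= X)]/(ord_pred j : nat) pj; move: j0; clear; lia.
by rewrite -mulrA cz ?mulr1 // normc_pprod.
Qed.

(** In the eigenbasis, conjugation by the cyclic permutation shifts the diagonal of partial products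
    by one place; dividing by the shifted diagonal leaves the single eigenvalues. *)
Lemma gcomm_factors : gcomm facV facW = dag Q *m diag_mx (\row_j u j) *m Q.
Proof.
set D := diag_mx (\row_j pprod j); set E := dag (cycmx R n).
have dD : D *m (E *m dag D *m dag E) = diag_mx (\row_j u j).
  rewrite /D dag_diag; apply/matrixP => a b; rewrite mul_diag_mx [LHS]mxE [in LHS]mxE.
  have -> : (E *m diag_mx (\row_j ((\row_j pprod j) 0%R j)^*%C) *m dag E) a b = ((pprod (ord_pred a))^*%C *+ (a == b))%R.
    rewrite /E dagK mul_mx_diag mxE (bigD1 (ord_pred a)) //= big1 => [|k hk].
      rewrite addr0 /cycmx !(dag_entry, mxE) eqxx (inj_eq (can_inj (@ord_predK n))) conjc1 mul1r.
      by case: (a == b); rewrite ?mulr1 ?mulr0.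
    by rewrite /cycmx !(dag_entry, mxE) (negPf hk) conjc0 !mul0r.
  rewrite [RHS]mxE mxE; case: eqVneq => [_|_]; last by rewrite !mulr0n mulr0.
  by rewrite !mulr1n pprod_pred.
have QQ := unitary_dagr uQ.
have cj A : dag (dag Q *m (A *m Q)) = dag Q *m (dag A *m Q) by rewrite !dagM dagK mulmxA.
rewrite /gcomm /facV /facW -/D -/E !cj -dD; exact: conj4 QQ.
Qed.
End CommutatorFactors.

(** * Correctness of the main program *)

Section MainSpec.
Variables (R : realType) (d m p : nat).
Variables (G : 'I_m -> 'M[R[i]]_d) (U : 'I_p -> 'M[R[i]]_d) (eps : R).
Variables (search : 'M[R[i]]_d -> seq 'I_m) (T0 S : nat).
Implicit Types (st : state R) (c : cmd).
Hypothesis d1 : 1 < d.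
Let d0 : 0 < d := ltnW d1.
Hypothesis S64 : 64 <= S.
Hypothesis rm : room d S 14.
Hypothesis hG : instruction_set G.
Local Notation T := (T G U eps search T0 S).
Local Notation nev := (@neval R d m p).
Local Notation rev := (@reval R d m p G U eps).
Local Notation bev := (@beval R d m p G U eps).
Local Notation ceval := (ceval G U eps).
Local Notation ev := (ev G U eps).
Local Notation same := (same d).
Local Notation frame := (frame d).
Local Notation M := 'M[R[i]]_d.
Variables (Lam lt : nat).
Hypothesis Lam0 : 0 < Lam.
Local Notation eta := (tolp R d).

Lemma ler_tolp : (eta <= (32%:R ^+ 5)^-1)%R.
Proof.
have h32 : (0 < 32%:R ^+ 5 :> R)%R by apply: exprn_gt0; exact: ltr0Sn.
have hd : (1 <= d%:R ^+ 2 :> R)%R by apply: exprn_ege1; rewrite ler1n.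
rewrite /tolp lef_pV2 ?posrE //; first by rewrite ler_peMr // ltW.
by apply: mulr_gt0 h32 (lt_le_trans ltr01 hd).
Qed.

(** Forty digits leave $4\pi d^{-36}$ against $2^{-25}$; already for d = 2 this is at most
    $2^{4-36}$. *)
Lemma eta_turn : (d%:R ^+ 2 * (2 * (2 * pi * (d%:R ^+ 40)^-1)) <= eta)%R.
Proof.
have dR : (2 <= d%:R :> R)%R by rewrite ler_nat.
have dp : (0 < d%:R :> R)%R by apply: lt_le_trans dR.
have p4 : (pi <= 4%:R :> R)%R by have /andP[_] := @pihalf_02 R; rewrite ltr_pdivrMr // => h; apply: ltW; move: h; lra.
have h : (2 ^+ 36 <= d%:R ^+ 36 :> R)%R by rewrite ler_pXn2r ?nnegrE.
rewrite /tolp [leRHS]invfM.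
have -> : (d%:R ^+ 2 * (2 * (2 * pi * (d%:R ^+ 40)^-1)) = (4 * pi * (d%:R ^+ 36)^-1) * (d%:R ^+ 2)^-1 :> R)%R.
  exact: pow_split (lt0r_neq0 dp).
apply: ler_wpM2r; first by rewrite invr_ge0 exprn_ge0 // ltW.
have hp : (0 < 2 ^+ 36 :> R)%R by exact: exprn_gt0.
apply: (@le_trans _ _ (16%:R * (2 ^+ 36)^-1)%R).
  apply: ler_pM => //; [by rewrite mulr_ge0 // pi_ge0|by move: p4; lra|].
  by rewrite lef_pV2 ?posrE // (lt_le_trans hp).
exact: pow2_bound.
Qed.

(** Fewer than $2d^2$ rotations at 41 tolerances each are below $128d^2$ tolerances, that is
    $2^7\cdot2^{-25}=2^{-18}$. *)
Lemma leaf_error : ((41 * nrot d)%:R * eta <= eseq R 0)%R.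
Proof.
have h : ((41 * nrot d)%:R <= 128%:R * d%:R ^+ 2 :> R)%R.
  rewrite -natrX -natrM ler_nat; have := nrot_lt d1 (leqnn d); rewrite -/(nrot d); clear; lia.
have t0 : (0 <= eta)%R by rewrite /tolp invr_ge0 mulr_ge0 // exprn_ge0.
apply: le_trans (ler_wpM2r t0 h) _; rewrite /tolp invfM mulrACA divff ?mulr1; last first.
  by rewrite expf_neq0 // pnatr_eq0 -lt0n.
exact: leaf_const.
Qed.

Section Call.
Variables (B X beta : R) (Tt : nat).
Hypothesis B1 : (1 <= B)%R.
Hypothesis Bz : B \is a Num.int.
Hypothesis Xz : X \is a Num.int.
Hypothesis Xbig : (2 * (d%:R ^+ 2 * (8 * B + 2) ^+ 2) < X)%R.
Hypothesis bz : beta \is a Num.int.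
Hypothesis bB : (8 * B + 4 <= beta)%R.
Hypothesis hB : (320%:R * d%:R ^+ 4 * 12 ^+ Tt <= B * eseq R Tt ^+ 2)%R.

Definition zeta : R := (4 * (d%:R ^+ 2 / B) * (80 * d ^ 2)%:R)%R.

Let Bp : (0 < B)%R. Proof. exact: lt_le_trans B1. Qed.

Lemma zeta_ge0 : (0 <= zeta)%R.
Proof. by rewrite /zeta !mulr_ge0 // ?invr_ge0 ?exprn_ge0 // ltW. Qed.

(** The deepest level is the critical one, since $12^s$ grows while $e_s$ decreases; there the claim
    is the choice of B. *)
Lemma zeta_e s : s <= Tt -> (12 ^+ s * zeta <= eseq R s ^+ 2)%R.
Proof.
move=> sT; have h1 : (eseq R Tt ^+ 2 <= eseq R s ^+ 2)%R.
  by rewrite ler_pXn2r ?nnegrE ?(ltW (eseq_gt0 _ _)) //; exact: eseq_decr.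
apply: le_trans h1; have h2 : (12 ^+ s * zeta <= 12 ^+ Tt * zeta)%R.
  by apply: (ler_wpM2r zeta_ge0); rewrite ler_weXn2l // ler1n.
apply: le_trans h2 _.
have -> : (12 ^+ Tt * zeta = (320%:R * d%:R ^+ 4 * 12 ^+ Tt) / B)%R.
  rewrite /zeta natrM natrX; exact: zeta_alg.
by rewrite ler_pdivrMr // [leRHS]mulrC.
Qed.

Lemma zeta_le1 : (zeta <= 1)%R.
Proof.
have := zeta_e (leq0n Tt); rewrite expr0 mul1r => h; apply: le_trans h _.
have /andP[h0 h1] := e0_bound R d; apply: exprn_ile1 => //; apply: le_trans h1 _.
by apply: exprn_ile1; [exact: divr_ge0 ler01 (ler0n _ _)|rewrite ler_pdivrMr ?ltr0Sn // mul1r ler1n].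
Qed.

Lemma kap_le_zeta : (d%:R ^+ 2 / B <= zeta)%R.
Proof.
have k0 : (0 <= d%:R ^+ 2 / B :> R)%R by rewrite divr_ge0 ?exprn_ge0 // ltW.
have h : (1 <= (80 * d ^ 2)%:R :> R)%R by rewrite ler1n muln_gt0 expn_gt0 d0.
by rewrite /zeta; move: k0 h; set k := (_ / B)%R; set n := (_%:R)%R; nra.
Qed.

Let inv := leaf_inv G B X eta Lam lt.

Lemma inv_steps st st' Ls : inv st -> frame MN MS (MM [:: 11; 12; 13]) st st' -> slp st' = slp st ++ Ls -> inv st'.
Proof.
move=> hi f hs; apply: (leaf_inv_step d1 S64 rm B1 Bz Xz Xbig eta_turn Lam0 hi f _ _ _ _ hs); [by sub|by []|by sub|by sub].
Qed.

Lemma T_mainleaf st : inv st -> lines_ok st -> unitary (reg d st 0) -> (false -> \det (reg d st 0) = 1%R) ->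
  exists2 st', T Leaf st (cLf d) st' & frame LN MS (iota 0 11) st st' /\
    sk_result G st st' zeta (eseq R 0) (40 * nrot d).+1 (80 * d ^ 2 * lt) (reg d st 0).
Proof.
move=> hi lo uA _.
have [st' t' [f' [h1 h2 h3 h4 [h5 h6]]]] := @T_leaf R d m p G U eps search T0 S d1 S64 rm hG B X B1 Bz Xz Xbig eta Lam lt
  eta_turn Lam0 zeta_le1 st hi lo uA.
exists st' => //; split; first by apply: frame_sub f'; sub.
have hn : 40 * nrot d <= 80 * d ^ 2 by have := nrot_lt d1 (leqnn d); rewrite -/(nrot d); clear; lia.
split; [exact: h1|exact: h2|exact: h3|apply: leq_trans h4 _; by rewrite leq_mul2r hn orbT|split].
  apply: le_trans h5 _; rewrite /zeta ler_wpM2l ?ler_nat //.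
  by rewrite mulr_ge0 // divr_ge0 ?exprn_ge0 // ltW.
by apply: pclose_le h6; exact: leaf_error.
Qed.

Lemma qmx0 : qmx B (0 : M) = 0%R.
Proof. by apply/matrixP => i j; rewrite !mxE /qc /= mulr0 rnd0 mul0r. Qed.

Definition cMainSK := cMx 300 d + 60 + (tau d (cPack d) (cLf d) Tt + 40) + 20.

Lemma T_mainsk v st A : v < 64 -> v \notin MN -> 49 < v -> inv st -> lines_ok st -> nmem st VT = Tt ->
  reg d st 14 = A -> unitary A -> pstk B beta st ([::] : seq (M * M * M)) ->
  exists2 st', T (MainSK v) st cMainSK st' &
    frame (v :: MN) MS (MM [:: 11; 12; 13]) st st' /\ pstk B beta st' ([::] : seq (M * M * M)) /\
    [/\ inv st', lines_ok st', ans st' = ans st,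
      exists2 Ls, slp st' = slp st ++ Ls & nmem st' v < size (slp st') &
      size (wd G (slp st') (nmem st' v)) <= 5 ^ Tt * (80 * d ^ 2 * lt) /\
      pclose (eseq R Tt) A (word_eval G (wd G (slp st') (nmem st' v)))].
Proof.
move=> v64 vM v49 hi lo vt r14 uA hx.
have [|| s1 t1 [f1 e1]] := @T_const R d m p G U eps search T0 S d1 S64 rm 5 (CR (rn 0)) 0%R st (cMx 300 d) isT.
- by move=> st' _; rewrite ceval_CR.
- exact: cMx_le.
set s2 := ev SetCall s1.
have t2 : T SetCall s1 60 s2 by apply: T_sl.
have f2 : same [:: VM; VS; VG] [::] [::] s1 s2 by do !apply: same_setn_in => //; exact: same_refl.
have [q1 q2 q3 q4] : [/\ nmem s2 VM = 0, nmem s2 VS = Tt, nmem s2 VT = Tt & nmem s2 VG = 0].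
  by rewrite /s2 /= /upd /= !(same_n f1).
clearbody s2.
have f12 : same [:: 0; 1; VM; VS; VG] [:: 0; 1] [:: 5] st s2.
  by apply: (same_trans (st2 := s1)); [apply: same_sub f1|apply: same_sub f2]; sub.
have r5 : reg d s2 5 = 0%R.
  by rewrite (same_reg d0 f2) // e1; apply/matrixP => k l; rewrite !mxE.
have R14 : reg d s2 14 = A by rewrite (same_reg d0 f12).
have lo2 : lines_ok s2 by rewrite /lines_ok (same_slp f12) (same_n f12).
have hi2 : inv s2.
  apply: (inv_steps (Ls := [::]) hi); last by rewrite (same_slp f12) cats0.
  by apply: frame_sub (same_frame f12); sub.
have hx2 : pstk B beta s2 ([::] : seq (M * M * M)).
  by apply: (pstk_frame d1) hx; apply: frame_sub (same_frame f12); sub.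
have z0 := zeta_ge0.
have PM14 k : k \in [:: 11; 12; 13] -> 10 < k /\ k != 14 by rewrite !inE => /or3P[] /eqP ->.
have tE : target s2 0 0%R = A by [].
have [||||s3 t3 [f3 [vm3 vs3 _ k3 res]]] := @call_spec R d m p G U eps search T0 S d1 S64 rm hG PackPush PackPop Leaf
  [:: 11; 12; 13] PM14 (pstk B beta) (qmx B) Tt (cPack d) zeta (fun st st' L f => pstk_frame d1 f)
  (fun st L s g hk _ n2 n3 hs hg h4 => pack_push G U eps search T0 d1 S64 rm B1 Bz bB hk n2 n3 hs hg h4)
  (fun st f L hk => pack_pop G U eps search T0 d1 S64 rm B1 bz bB hk) (fun A h => qmx_dag B h) (qmx_idem B1)
  (fun A => le_trans (qmx_near B1 A) kap_le_zeta)
  (eseq R) Tt (40 * nrot d).+1 (80 * d ^ 2 * lt) (cLf d) (fun _ => erefl _) (e0_bound R d) z0 zeta_e (leqnn _) isT inv inv_steps false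
  T_mainleaf Tt (leqnn _) s2 [::] 0 0%R q1 q2 q3 q4 isT r5 (dag0 _ _ _) _ qmx0 hi2 lo2 _ _ hx2 _.
- by rewrite nrm0.
- by rewrite tE.
- by [].
- by [].
rewrite tE in res; have [[lo3 ll3] an3 [Ls sl3 zl3] sw3 [_ hp3]] := res.
have t3' : T (SK PackPush PackPop Leaf) s2 (tau d (cPack d) (cLf d) Tt + 40) s3.
  have := @T_SK R d m p G U eps search T0 S d1 S64 rm PackPush PackPop Leaf Tt zeta (eseq R) Tt (40 * nrot d).+1 (e0_bound R d) z0 (leqnn _) isT
    s2 _ s3 (tau d (cPack d) (cLf d) Tt + 40) t3.
  apply; last by rewrite leq_add2l.
  by rewrite guardE vm3 vs3 (frame_n (k := VT) f3 isT) q3 !leqnn.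
set s4 := setn s3 v (nmem s3 LLV).
have t4 : T (SetN v (NV LLV)) s3 10 s4 by apply: (@T_setn _ _ _ _ _ _ _ _ _ _ S64).
have f4 : same [:: v] [::] [::] s3 s4 by exact: same_setn.
exists s4.
  by apply: T_seq t1 (T_seq t2 (T_seq t3' t4 (leqnn _)) (leqnn _)) _; rewrite /cMainSK; clear; lia.
have n4 : nmem s4 v = (size (slp s3)).-1 by rewrite /s4 /= /upd eqxx ll3.
have sz : 0 < size (slp s3) by rewrite sl3 size_cat zl3; case: (Tt) => [|t]; rewrite /= ?addn1 addnS.
split.
  apply: (frame_trans (st2 := s2)); first by apply: frame_sub (same_frame f12); [move=> k hk; rewrite inE; apply/orP; right; move: k hk; apply/allP|sub|sub].
  apply: (frame_trans (st2 := s3)); first by apply: frame_sub f3 => // k hk; rewrite inE hk orbT.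
  by apply: frame_sub (same_frame f4) => // k; rewrite !inE => /eqP ->; rewrite eqxx.
have slE : slp s4 = slp st ++ Ls by rewrite -(same_slp f12).
have n4k k : k < 49 -> nmem s4 k = nmem s3 k.
  by move=> hk; rewrite (same_n f4) // inE ltn_eqF // (ltn_trans hk) // ltnW.
split.
  have [[y1 y2 y3] [y4 y5 y6]] := k3; by split.
split.
- have [[c1 c2 c3 c4] hn ht] : inv s3 by apply: (inv_steps hi2 f3 sl3).
  split; [by split|by rewrite n4k|exact: ht].
- by rewrite /lines_ok n4k.
- by rewrite /= an3 (same_ans f12).
- by exists Ls => //; rewrite n4 /= prednK.
by rewrite n4.
Qed.
End Call.

Lemma entryE n q (F : 'I_n -> 'M[R[i]]_q) (i : 'I_n) (j k : 'I_q) b :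
  entry F i j k b = if b then complex.Im (F i j k) else complex.Re (F i j k).
Proof. by rewrite /entry !valK. Qed.

Lemma T_loadu st (k : 'I_p) : nmem st 50 = k -> exists2 st', T LoadU st (cMx 300 d) st' &
  same [:: 0; 1] [:: 0; 1] [:: 6] st st' /\ reg d st' 6 = U k.
Proof.
move=> h50.
have [|||s t [f e]] := @mxset R d m p G U eps search T0 S d1 S64 rm 6 (REntryT (NV 50) (NV 0) (NV 1) false, REntryT (NV 50) (NV 0) (NV 1) true)
  st (cMx 300 d) (fun a b => entry U k a b false +i* entry U k a b true)%C.
- exact: room_le rm.
- by move=> a b st' _ _ s v0 v1 _; rewrite ceval_def /= v0 v1 (same_n s) // h50.
- exact: cMx_le.
exists s => //; split => //; rewrite e; apply/matrixP => a b; rewrite mxE !entryE.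
by case: (U k a b).
Qed.

Definition cProd := 200 + d * (400 + slcost ProdStep).

Lemma T_products st : exists2 st', T Products st cProd st' &
  same [:: 3] [:: 0; 1; 2; 3] [:: 9] st st' /\
  forall l, l < d -> regn d st' 9 0 l = (\prod_(k < l.+1) regn d st 8 0 k)%R.
Proof.
set s1 := ev (Seq (SetR 2 (rn 1)) (SetR 3 (rn 0))) st.
have t1 : T (Seq (SetR 2 (rn 1)) (SetR 3 (rn 0))) st 20 s1 by apply: T_sl.
have f1 : same [::] [:: 2; 3] [::] st s1 by do !apply: same_setr_in => //; exact: same_refl.
have e1 : (rmem s1 2 +i* rmem s1 3)%C = 1%R :> R[i] by [].
clearbody s1.
pose I i st' := [/\ same [:: 3] [:: 0; 1; 2; 3] [:: 9] st st', (rmem st' 2 +i* rmem st' 3)%C = (\prod_(k < i) regn d st 8 0 k)%R &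
  forall l, l < i -> regn d st' 9 0 l = (\prod_(k < l.+1) regn d st 8 0 k)%R].
have [|||||s2 t2 [f2 _ e2]] := @T_for R d m p G U eps search T0 S S64 I 3 NDim (Seq ProdStep (PutSet (NConst 9) (NConst 0) (NV 3) (CS 2)))
  s1 d (slcost ProdStep + 300) (100 + d * (slcost ProdStep + 340)) isT.
- by move=> i st' x [h1 h2 h3]; split => //; exact: same_setn_in.
- by [].
- by split; [apply: same_sub f1; sub|rewrite big_ord0|].
- move=> i st' id [h1 h2 h3] v3.
  have cE st2 : nmem st2 3 = i -> rmem st2 2 = rmem st' 2 -> rmem st2 3 = rmem st' 3 -> regn d st2 8 0 i = regn d st 8 0 i ->
    ceval st2 prodE = (\prod_(k < i.+1) regn d st 8 0 k)%R.
    by move=> q1 q2 q3 q4; rewrite ceval_Cmul ceval_CS ceval_CE q2 q3 h2 [nev _ (NV 3)]/= q1 q4 big_ord_recr.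
  have r8 : regn d st' 8 0 i = regn d st 8 0 i by rewrite (same_regn d0 h1).
  set s3 := ev ProdStep st'.
  have t3 : T ProdStep st' (slcost ProdStep) s3 by apply: T_sl.
  have f3 : same [::] [:: 0; 1; 2; 3] [::] st' s3 by do !apply: same_setr_in => //; exact: same_refl.
  have e3 : (rmem s3 2 +i* rmem s3 3)%C = (\prod_(k < i.+1) regn d st 8 0 k)%R.
    pose x := rev st' prodE.1.
    have -> : (rmem s3 2 +i* rmem s3 3)%C = (x +i* rev (setr st' 0 x) prodE.2)%C by [].
    have q1 := cE st' v3 erefl erefl r8.
    have [] := (cE (setr st' 0 x) v3 erefl erefl _, tt); first by rewrite regn_setr.
    set P := (\prod_(k < i.+1) _)%R in q1 * => q2 _.
    have -> : rev (setr st' 0 x) prodE.2 = complex.Im P by rewrite -q2.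
    have -> : x = complex.Re P by rewrite -q1.
    by case: (P).
  clearbody s3.
  have n3 : nmem s3 3 = i by rewrite (same_n f3).
  have [|||||| s4 t4 [f4 e4]] := @T_putset R d m p G U eps search T0 S d1 S64 rm (NConst 9) (NConst 0) (NV 3) (CS 2) s3 200
    (\prod_(k < i.+1) regn d st 8 0 k)%R.
  + exact: room_le rm.
  + exact: d0.
  + by rewrite /= n3.
  + exact: e3.
  + by move=> x; exact: e3.
  + by [].
  exists s4; first by apply: T_seq t3 t4 _; clear; lia.
  split; first by rewrite (same_n f4).
  split.
  + apply: (same_trans (st2 := st')) h1 _; apply: (same_trans (st2 := s3)).
      by apply: same_sub f3; sub.
    by apply: same_sub f4; sub.
  + by rewrite -e3 !(same_sc f4).
  + move=> l li; rewrite e4 //; last by apply: leq_ltn_trans id.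
    rewrite [nev _ (NConst 0)]/= [nev _ (NV 3)]/= n3 eqxx /=.
    case: eqVneq => [->|ne] //; rewrite (same_regn d0 f3) //; last by apply: leq_ltn_trans id.
    by apply: h3; rewrite ltn_neqAle ne.
- by rewrite [nexp_cost _]/=; clear; nia.
exists s2; first by apply: T_seq t1 t2 _; rewrite /cProd; clear; nia.
by split.
Qed.

Definition cRoot := cMx 300 d + cMul 400 d.

Lemma T_root e st (F : nat -> nat -> R[i]) : cMx (ccost e) d <= cMx 300 d ->
  (forall i j st', i < d -> j < d -> same [:: 0; 1] [:: 0; 1] [:: 10] st st' -> nmem st' 0 = i -> nmem st' 1 = j ->
     ceval st' e = F i j) ->
  exists2 st', T (Seq (MxSet (NConst 10) e) (MulReg 14 true 15 false 10)) st cRoot st' &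
  same [:: 0; 1; 2] [:: 0; 1; 2; 3] [:: 10; 14] st st' /\
  reg d st' 14 = dag (reg d st 15) *m \matrix_(i, j) F i j.
Proof.
move=> hc he.
have [|||s1 t1 [f1 e1]] := @mxset R d m p G U eps search T0 S d1 S64 rm 10 e st (cMx 300 d) F.
- exact: room_le rm.
- by move=> i j st' id jd s v0 v1 _; exact: he.
- exact: hc.
have [||||s2 t2 [f2 e2]] := @T_mulreg R d m p G U eps search T0 S d1 S64 rm 14 true 15 false 10 s1 (cMul 400 d) => //.
exists s2; first by apply: T_seq t1 t2 (leqnn _).
split.
  by apply: (same_trans (st2 := s1)); [apply: same_sub f1|apply: same_sub f2]; sub.
by rewrite e2 /= e1 (same_reg d0 f1).
Qed.

Definition cPow n e N := 100 + N * (rexp_cost e + nexp_cost n + 100) + 2 * nexp_cost n.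

Lemma T_powr k n e N (x : R) st : k < 64 -> (forall st', same [:: 57] [:: k] [::] st st' -> nev st' n = N /\ rev st' e = x) ->
  exists2 st', T (Pow k n e) st (cPow n e N) st' & same [:: 57] [:: k] [::] st st' /\ rmem st' k = (x ^+ N)%R.
Proof.
move=> k64 he.
set s1 := setr st k 1%:R.
have t1 : T (SetR k (rn 1)) st 20 s1 by apply: (@T_setr _ _ _ _ _ _ _ _ _ _ S64).
have f1 : same [:: 57] [:: k] [::] st s1 by apply: same_setr_in; rewrite ?inE //; exact: same_refl.
have e1 : rmem s1 k = 1%R by rewrite /s1 /= /upd eqxx.
clearbody s1.
pose I i st' := same [:: 57] [:: k] [::] st st' /\ rmem st' k = (x ^+ i)%R.
have [|||||s2 t2 h2] := @T_for R d m p G U eps search T0 S S64 I 57 n (SetR k (RMul (RV k) e)) s1 N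
  (rexp_cost e + 20) (60 + nexp_cost n + N * (rexp_cost e + nexp_cost n + 60)) isT.
- by move=> i st' y [h1 h2]; split => //; exact: same_setn_in.
- by move=> i st' [h1 h2]; case: (he _ h1).
- by split.
- move=> i st' iN [h1 h2] v; have [_ hx] := he _ h1.
  exists (setr st' k (rmem st' k * x)%R).
    have := @T_setr R d m p G U eps search T0 S S64 k (RMul (RV k) e) st' (rexp_cost e + 20) k64.
    by rewrite [rev st' _]/= hx; apply; rewrite /=; clear; lia.
  split=> //; split; first by apply: same_setr_in; rewrite ?inE.
  by rewrite /= /upd eqxx h2 exprSr.
- by clear; nia.
exists s2 => //; apply: T_seq t1 t2 _; rewrite /cPow; clear; nia.
Qed.

Section Step.
Variable Tt : nat.
Hypothesis e0 : (0 < eps)%R.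
Hypothesis hTt : depth_of (eps / 4)%R Tt.
Hypothesis rm15 : room d S 15.

Definition Bof (y : R) : R := (2 * rnd y + 2)%R.
Definition betaof (y : R) : R := (8 * Bof y + 4)%R.
Definition Xof (y : R) : R := (2 * ((d * d)%:R * ((8 * Bof y + 2) * (8 * Bof y + 2))) + 1)%R.
Definition Braw : R := (320%:R * (d * d * (d * d))%:R * 12%:R ^+ Tt / (eseq R Tt * eseq R Tt))%R.

Lemma Bof_int y : Bof y \is a Num.int.
Proof. by rewrite /Bof rpredD ?rnd2_intz ?rpred_nat. Qed.

Lemma betaof_int y : betaof y \is a Num.int.
Proof. by apply: rpredD; [apply: rpredM (rpred_nat _ _) (Bof_int y)|exact: rpred_nat]. Qed.

Lemma Xof_int y : Xof y \is a Num.int.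
Proof.
have h : (8 * Bof y + 2)%R \is a Num.int by apply: rpredD; [apply: rpredM (rpred_nat _ _) (Bof_int y)|exact: rpred_nat].
apply: rpredD; last exact: rpred1.
by apply: rpredM (rpred_nat _ _) (rpredM (rpred_nat _ _) (rpredM h h)).
Qed.

Lemma Bof_ge y : (0 <= y)%R -> (y <= Bof y)%R.
Proof. by move=> y0; have := rnd_near y; rewrite ler_norml => /andP[h _]; move: y0 h; rewrite /Bof; set r := rnd y; lra. Qed.

Lemma Braw_ge1 : (1 <= Braw)%R.
Proof.
have ep := eseq_gt0 R Tt; have /andP[_ eb] := e0_bound R d.
have e1 : (eseq R Tt <= 1)%R.
  apply: le_trans (eseq_decr R (leq0n Tt)) (le_trans eb _).
  by apply: exprn_ile1; [exact: divr_ge0 ler01 (ler0n _ _)|rewrite ler_pdivrMr ?ltr0Sn // mul1r ler1n].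
have h1 : (1 <= 320%:R * (d * d * (d * d))%:R * 12%:R ^+ Tt :> R)%R.
  by rewrite -natrX -!natrM ler1n !muln_gt0 !expn_gt0 d0.
rewrite /Braw ler_pdivlMr ?mulr_gt0 // mul1r; apply: le_trans h1.
by rewrite -[leRHS]mulr1; apply: ler_pM => //; exact: ltW.
Qed.

Lemma Braw_ge0 : (0 <= Braw)%R.
Proof. exact: le_trans ler01 Braw_ge1. Qed.

Definition cConsts := cPow (NV VT) (rn 12) Tt + slcost Scales + cPow (NSub NDim (NConst 1)) (RV 43) d.

Lemma T_consts st : rmem st 40 = pi -> nmem st VT = Tt -> rmem st 46 = eseq R Tt ->
  exists2 st', T Consts st cConsts st' & same [:: 57] [:: 48; 47; 41; 42; 43; 44] [::] st st' /\
    [/\ rmem st' 41 = Bof Braw, rmem st' 42 = betaof Braw, rmem st' 43 = Xof Braw & rmem st' 44 = (Xof Braw ^+ d.-1)%R].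
Proof.
move=> h40 hv h46.
have [|s1 t1 [f1 e1]] := @T_powr 48 (NV VT) (rn 12) Tt (12%:R)%R st isT.
  by move=> st' s; rewrite /= (frame_n (k := VT) (same_frame s)).
set s2 := ev Scales s1.
have t2 : T Scales s1 (slcost Scales) s2 by apply: T_sl.
have f2 : same [::] [:: 47; 41; 42; 43] [::] s1 s2 by do !apply: same_setr_in => //; exact: same_refl.
have h40' : rmem s1 40 = pi by rewrite (same_sc f1).
have h46' : rmem s1 46 = eseq R Tt by rewrite (same_sc f1).
have [g1 g2 g3] : [/\ rmem s2 41 = Bof Braw, rmem s2 42 = betaof Braw & rmem s2 43 = Xof Braw].
  rewrite /s2 /Scales /seqs /= /upd /= h40' h46' e1.
  by split; rewrite /Xof /betaof /Bof /rnd /Braw.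
clearbody s2.
have [|s3 t3 [f3 e3]] := @T_powr 44 (NSub NDim (NConst 1)) (RV 43) (d - 1) (Xof Braw) s2 isT.
  by move=> st' s; split => //; rewrite /= (same_sc s).
exists s3.
  have h : cPow (NSub NDim (NConst 1)) (RV 43) (d - 1) <= cPow (NSub NDim (NConst 1)) (RV 43) d.
    by rewrite /cPow !leq_add2r leq_add2l leq_mul2r leq_subr orbT.
  by apply: T_seq t1 (T_seq t2 t3 (leqnn _)) _; move: h; rewrite /cConsts; clear; lia.
split.
  same_via s1 f1.
  by apply: (same_trans (st2 := s2)); [apply: same_sub f2|apply: same_sub f3]; sub.
by split; [rewrite (same_sc f3) ?g1|rewrite (same_sc f3) ?g2|rewrite (same_sc f3) ?g3|rewrite e3 subn1].
Qed.

Definition answered st k := exists n, [/\ ans st (nat_of_ord k) = Some n, n < size (slp st),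
  (nrm (U k - word_eval G (wd G (slp st) n)) <= eps)%R & size (wd G (slp st) n) <= 4 * (5 ^ Tt * (80 * d ^ 2 * lt))].

Definition minv i st := [/\ rmem st 40 = pi, nmem st 43 = Lam, table_ok G eta Lam lt st, lines_ok st &
  forall k : 'I_p, k < i -> answered st k].

Definition cStep := cMx 300 d + (d ^ 3 + 200) + cProd + cRoot + cDepth (RDiv RPrecision (rn 4)) Tt + cConsts + 3 * cMx 300 d +
  2 * cMainSK Tt + cRoot + 200.

Lemma T_mainstep st (k : 'I_p) : SU (U k) -> nmem st 50 = k -> minv k st ->
  exists2 st', T MainStep st cStep st' & nmem st' 50 = k /\ minv k.+1 st'.
Proof.
move=> [hu hdet] h50 [m1 m2 m3 m4 m5].
have uU : unitary (U k) by apply/unitarymxE.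
have [s1 t1 [f1 e1]] := T_loadu h50.
have nU : U k \is normalmx by apply/normalmxP; rewrite dagE (unitary_dagr uU) (unitary_dagl uU).
have [|||||s2 t2 [f2 Q2 u2]] := @T_diag R d m p G U eps search T0 S d0 S64 (NConst 6) (NConst 15) (NConst 8) s1 (d ^ 3 + 200).
- by rewrite [nev _ _]/= e1.
- exact: rm15.
- exact: room_le rm.
- by [].
- by rewrite /=; clear; lia.
rewrite ![nev _ _]/= e1 in f2 Q2 u2.
set Q := spectralmx (U k) in Q2; pose u (j : 'I_d) := spectral_diag (U k) 0%R j.
have uQ : unitary Q by exact: spectral_unitary.
have UE : U k = dag Q *m diag_mx (\row_j u j) *m Q.
  have -> : \row_j u j = spectral_diag (U k) by apply/rowP => j; rewrite mxE.
  exact: normal_spectral.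
have udiag : unitary (diag_mx (\row_j u j)).
  have -> : diag_mx (\row_j u j) = Q *m U k *m dag Q.
    by rewrite UE !mulmxA (unitary_dagr uQ) mul1mx -mulmxA (unitary_dagr uQ) mulmx1.
  by apply: unitaryM; [exact: unitaryM|exact: unitary_dag].
have u1 j : normc (u j) = 1%R by have := unitary_diag_entry udiag j; rewrite mxE.
have pu : (\prod_j u j = 1)%R.
  transitivity (\det (U k)); last exact: hdet.
  rewrite UE !det_mulmx mulrAC -det_mulmx (unitary_dagl uQ) det1 mul1r det_diag.
  by apply: eq_bigr => j _; rewrite mxE.
have [s3 t3 [f3 e3]] := T_products s2.
have D3 (j : 'I_d) : regn d s3 9 0 j = pprod u j.
  rewrite e3 // /pprod (big_ord_widen d (fun l => regn d s2 8 0 l)) //.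
  by apply: eq_big => [l|l _]; rewrite ?ltnS // u2.
have [||s4 t4 [f4 e4]] := @T_root (Cmul (CE (NConst 9) (NConst 0) (NV 0)) (CE (NConst 15) (NV 0) (NV 1))) s3
  (fun a b => regn d s3 9 0 a * regn d s3 15 a b)%R.
- exact: cMx_le.
- move=> a b st' ad bd s v0 v1; rewrite ceval_Cmul !ceval_CE ![nev _ _]/= v0 v1.
  by rewrite !(same_regn d0 s).
have Q3 : reg d s3 15 = Q by rewrite (same_reg d0 f3).
have V4 : reg d s4 14 = facV Q u.
  rewrite e4 Q3 /facV; congr (_ *m _); apply/matrixP => a b.
  by rewrite mul_diag_mx [LHS]mxE [RHS]mxE mxE D3 regE Q3.
have [|s5 t5 [f5 [v5 r5]]] := @T_depth R d m p G U eps search T0 S S64 (RDiv RPrecision (rn 4)) (eps / 4)%R Tt s4 hTt.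
  by [].
have f15 : same [:: 0; 1; 2; 3; VT] [:: 0; 1; 2; 3; 46] [:: 6; 15; 8; 9; 10; 14] st s5.
  same_via s1 f1.
  same_via s2 f2.
  same_via s3 f3.
  same_via s4 f4.
  by apply: same_sub f5; sub.
have p5 : rmem s5 40 = pi by rewrite (same_sc f15).
have [s6 t6 [f6 [c41 c42 c43 c44]]] := T_consts p5 v5 r5.
have [||s7 t7 [f7 e7]] := @T_const R d m p G U eps search T0 S d1 S64 rm 11 (CR (rn 0)) 0%R s6 (cMx 300 d) isT.
- by move=> st' _; rewrite ceval_CR.
- exact: cMx_le.
have [||s8 t8 [f8 e8]] := @T_const R d m p G U eps search T0 S d1 S64 rm 12 (CR (rn 0)) 0%R s7 (cMx 300 d) isT.
- by move=> st' _; rewrite ceval_CR.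
- exact: cMx_le.
have [||s9 t9 [f9 e9]] := @T_const R d m p G U eps search T0 S d1 S64 rm 13 (CR (rn 0)) 0%R s8 (cMx 300 d) isT.
- by move=> st' _; rewrite ceval_CR.
- exact: cMx_le.
have f69 : same [:: 0; 1] [:: 0; 1] [:: 11; 12; 13] s6 s9.
  same_via s7 f7.
  by apply: (same_trans (st2 := s8)); [apply: same_sub f8|apply: same_sub f9]; sub.
have f19 : same [:: 0; 1; 2; 3; VT; 57] [:: 0; 1; 2; 3; 46; 48; 47; 41; 42; 43; 44] [:: 6; 15; 8; 9; 10; 14; 11; 12; 13] st s9.
  same_via s5 f15.
  by apply: (same_trans (st2 := s6)); [apply: same_sub f6|apply: same_sub f69]; sub.
pose B := Bof Braw; pose X := Xof Braw; pose beta := betaof Braw.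
have B1 : (1 <= B)%R by apply: le_trans Braw_ge1 (Bof_ge Braw_ge0).
have Bz : B \is a Num.int by exact: Bof_int.
have Xz : X \is a Num.int by exact: Xof_int.
have bz : beta \is a Num.int by exact: betaof_int.
have bB : (8 * B + 4 <= beta)%R by [].
have Xbig : (2 * (d%:R ^+ 2 * (8 * B + 2) ^+ 2) < X)%R.
  by rewrite /X /Xof -/B natrM -!expr2 ltrDl.
have hB : (320%:R * d%:R ^+ 4 * 12%:R ^+ Tt <= B * eseq R Tt ^+ 2)%R.
  have := Bof_ge Braw_ge0; rewrite -/B {1}/Braw ler_pdivrMr ?mulr_gt0 ?eseq_gt0 //.
  by rewrite !natrM -!expr2 -exprM.
have pk9 : packc d B X s9.
  by split; rewrite (same_sc f69) // (same_sc f6).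
have hi9 : leaf_inv G B X eta Lam lt s9.
  split; [exact: pk9|by rewrite (same_n f19)|].
  move=> ty j j' b a h1 h2 h3; have [W [w1 w2 w3 w4] w5] := m3 ty j j' b a h1 h2 h3.
  exists W => //; split; rewrite ?(same_slp f19) //.
  by rewrite (same_reg d0 f19) //; rewrite !inE !negb_or !neq_ltn; repeat (apply/andP; split); lia.
have lo9 : lines_ok s9 by rewrite /lines_ok (same_slp f19) (frame_n (k := NLV) (same_frame f19)).
have pst9 : pstk B beta s9 ([::] : seq (M * M * M)).
  have zr j s (h : reg d s j = const_mx 0%R) : zreg B beta s j ([::] : seq M).
    by split => //; rewrite h; apply/matrixP => a b; rewrite !mxE.
  split.
    by case: pk9 => q1 q2 _ _; split => //; rewrite (same_sc f69).
  split; apply: zr.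
  - by rewrite (same_reg d0 f9) // (same_reg d0 f8).
  - by rewrite (same_reg d0 f9).
  - exact: e9.
have V9 : reg d s9 14 = facV Q u.
  by rewrite (same_reg d0 f69) // (same_reg d0 f6) // (same_reg d0 f5).
have v9 : nmem s9 VT = Tt by rewrite (frame_n (k := VT) (same_frame f69)) // (frame_n (k := VT) (same_frame f6)).
have [sA tA [fA [pstA [hiA loA anA [LA slA szA] [lenA cA]]]]] := T_mainsk B1 Bz Xz Xbig bz bB hB (isT : 55 < 64) isT isT hi9 lo9 v9 V9
  (facV_unitary uQ u1) pst9.
have QA : reg d sA 15 = Q.
  rewrite (frame_reg d0 fA) // (same_reg d0 f69) // (same_reg d0 f6) //.
  by rewrite (same_reg d0 f5) // (same_reg d0 f4).
have [||sB tB [fB eB]] := @T_root (CE (NConst 15) prevIdx (NV 1)) sA (fun a b => regn d sA 15 ((a + d).-1 %% d) b).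
- exact: cMx_le.
- move=> a b st' ad bd s v0 v1; rewrite ceval_CE.
  have -> : nev st' prevIdx = (a + d).-1 %% d.
    rewrite /= v0; case: a ad {v0} => [|a] ad; first by rewrite add0n modn_small ?prednK // sub0n subn0 muln1 add0n subn1.
    have -> : (a.+1 + d).-1 = d + a by rewrite addSn addnC.
    by rewrite modnDl (modn_small (ltnW ad)) subn1 subSS sub0n muln0 addn0.
  by rewrite [nev _ (NV 1)]/= v1 [nev _ _]/= (same_regn d0 s) // ltn_pmod.
have WB : reg d sB 14 = facW Q.
  rewrite eB QA /facW; congr (_ *m _); apply/matrixP => a b.
  rewrite !mxE (bigD1 (ord_pred a)) //= big1 => [|l hl]; last by rewrite dag_entry mxE (negPf hl) conjc0 mul0r.
  by rewrite dag_entry mxE eqxx conjc1 mul1r addr0 -QA -regE.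
have stepB (P : Prop) : P -> P by [].
have hiB : leaf_inv G B X eta Lam lt sB.
  apply: (leaf_inv_step d1 S64 rm B1 Bz Xz Xbig eta_turn Lam0 (Ls := [::]) hiA (same_frame fB)); [by sub|by []|by sub|by sub|by rewrite (same_slp fB) cats0].
have loB : lines_ok sB by rewrite /lines_ok (same_slp fB) (frame_n (k := NLV) (same_frame fB)).
have vB : nmem sB VT = Tt by rewrite (frame_n (k := VT) (same_frame fB)) // (frame_n (k := VT) fA).
have pstB : pstk B beta sB ([::] : seq (M * M * M)).
  have [[q1 q2 q3] [q4 q5 q6]] := pstA.
  split; first by split; rewrite (same_sc fB).
  by split; apply: (zreg_frame d1 (same_frame fB)).
have [sC tC [fC [pstC [hiC loC anC [LC slC szC] [lenC cC]]]]] := T_mainsk B1 Bz Xz Xbig bz bB hB (isT : 56 < 64) isT isT hiB loB vB WB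
  (facW_unitary uQ) pstB.
have n55 : nmem sC 55 = nmem sA 55 by rewrite (frame_n fC) // (same_n fB).
have slBC : slp sC = slp sA ++ LC by rewrite slC (same_slp fB).
have w55 : wd G (slp sC) (nmem sC 55) = wd G (slp sA) (nmem sA 55) by rewrite slBC n55 wd_cat.
have sz55 : nmem sC 55 < size (slp sC) by rewrite n55 slBC size_cat (leq_trans szA) // leq_addr.
set w1 := wd G (slp sA) (nmem sA 55) in lenA cA w55.
set w2 := wd G (slp sC) (nmem sC 56) in lenC cC.
have [|||sD tD [fD [loD llD anD [x slD] lwD]]] := @T_emitline R d m p G U eps search T0 S d1 S64 CommFinal sC
  (w1 ++ w2 ++ inv_word G w1 ++ inv_word G w2) 100 loC.
- by rewrite /= sz55 szC.
- by rewrite /= -/(wd G (slp sC) (nmem sC 55)) -/(wd G (slp sC) (nmem sC 56)) w55 cats0.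
- by rewrite !big_cons big_nil.
have szD : nmem sD LLV < size (slp sD) by rewrite llD slD size_rcons.
set sE := set_ans sD (upd (ans sD) (nmem sD 50) (Some (nmem sD LLV))).
have tE : T (Answer (NV 50) (NV LLV)) sD 20 sE.
  by apply: (@T_answer R d m p G U eps search T0 S d0 S64 (NV 50) (NV LLV)).
have k50 : nmem sD 50 = k.
  rewrite (frame_n fD) // (frame_n fC) // (same_n fB) // (frame_n fA) // (same_n f19) //.
exists sE.
  by apply: T_seq t1 (T_seq t2 (T_seq t3 (T_seq t4 (T_seq t5 (T_seq t6 (T_seq t7 (T_seq t8 (T_seq t9 (T_seq tA (T_seq tB (T_seq tC
    (T_seq tD tE (leqnn _)) (leqnn _)) (leqnn _)) (leqnn _)) (leqnn _)) (leqnn _)) (leqnn _)) (leqnn _)) (leqnn _)) (leqnn _)) (leqnn _)) (leqnn _)) _;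
    rewrite /cStep; clear; lia.
have slE : slp sE = slp st ++ (LA ++ LC ++ [:: x]).
  by rewrite /sE /= slD slBC slA (same_slp f19) -cats1 !catA.
have anE j : ans sE j = if j == k then Some (nmem sD LLV) else ans st j.
  by rewrite /sE /= /upd k50 anD anC (same_ans fB) anA (same_ans f19).
split; first by [].
have [_ hn tok] := hiC.
split.
- have [[q1 _ _ _] _ _] := hiC; by rewrite -[rmem sE 40]/(rmem sD 40) (frame_sc fD).
- by rewrite -[nmem sE 43]/(nmem sD 43) (frame_n fD).
- have iD : leaf_inv G B X eta Lam lt sD.
    by apply: (leaf_inv_step d1 S64 rm B1 Bz Xz Xbig eta_turn Lam0 (Ls := [:: x]) hiC fD); [by sub|by []|by sub|by sub|by rewrite slD cats1].
  by case: iD.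
- exact: loD.
move=> j; rewrite ltnS leq_eqVlt => /orP[/eqP jk|jk]; last first.
  have [n [a1 a2 a3 a4]] := m5 j jk; exists n.
  rewrite anE (ltn_eqF jk); split=> //; rewrite ?slE ?wd_cat //.
  by rewrite size_cat (leq_trans a2) // leq_addr.
have -> : j = k by apply: val_inj.
exists (nmem sD LLV); rewrite anE eqxx.
have wE : wd G (slp sE) (nmem sD LLV) = w1 ++ w2 ++ inv_word G w1 ++ inv_word G w2.
  by rewrite -lwD /lastw -llD.
rewrite wE; split => //.
  rewrite -[w1 ++ _]/([::] ++ w1 ++ _) (word_eval_comm hG) mul1mx.
  have uw1 : unitary (word_eval G w1) by exact: word_unitary.
  have uw2 : unitary (word_eval G w2) by exact: word_unitary.
  have [V' [uV' nV' [z1 hz1 eV']]] := pclose_phase_unitary uw1 cA.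
  have [W' [uW' nW' [z2 hz2 eW']]] := pclose_phase_unitary uw2 cC.
  (* Here the errors up to a phase become errors in operator norm: the commutator forgets the phases
     of both approximants, and its Lipschitz constant 4 meets the tolerance [eps / 4]. *)
  have -> : gcomm (word_eval G w1) (word_eval G w2) = gcomm V' W' by rewrite eV' eW' gcomm_phase.
  have -> : U k = gcomm (facV Q u) (facW Q) by rewrite (gcomm_factors uQ u1 pu).
  apply: le_trans (gcomm_lipschitz (facV_unitary uQ u1) (facW_unitary uQ) uV' uW' nV' nW') _.
  by have [h _] := hTt; move: h e0; lra.
rewrite !size_cat !size_inv_word; move: lenA lenC; clear; lia.
Qed.

Lemma T_main st : (forall k, SU (U k)) -> minv 0 st -> exists2 st', T Main st (100 + p * (cStep + 100)) st' & minv p st'.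
Proof.
move=> hU h.
have [|||||st' t' h'] := @T_for R d m p G U eps search T0 S S64 minv 50 NTargets MainStep st p cStep (100 + p * (cStep + 100)) isT.
- by move=> i st' x [h1 h2 h3 h4 h5]; split; [exact: h1|exact: h2|exact: h3|exact: h4|exact: h5].
- by [].
- exact: h.
- move=> i st' ip hi v50.
  by have [s t [q1 q2]] := @T_mainstep st' (Ordinal ip) (hU _) v50 hi; exists s.
- by rewrite [nexp_cost _]/=; clear; nia.
by exists st'.
Qed.
End Step.
End MainSpec.

(** * Cost estimates *)

Definition polyO k (f : nat -> nat) := exists K, forall n, 0 < n -> f n <= K * n ^ k.

Lemma polyO_const c : polyO 0 (fun=> c).
Proof. by exists c => n _; rewrite expn0 muln1. Qed.

Lemma polyO_id : polyO 1 (fun n => n).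
Proof. by exists 1 => n _; rewrite expn1 mul1n. Qed.

Lemma polyO_le k l f : k <= l -> polyO k f -> polyO l f.
Proof.
move=> kl [K h]; exists K => n n0; apply: leq_trans (h n n0) _.
by rewrite leq_mul2l leq_pexp2l ?orbT.
Qed.

Lemma polyO_add k l f g : polyO k f -> polyO l g -> polyO (maxn k l) (fun n => f n + g n).
Proof.
move=> /(polyO_le (leq_maxl k l)) [K h] /(polyO_le (leq_maxr k l)) [L h']; exists (K + L) => n n0.
by rewrite mulnDl leq_add ?h ?h'.
Qed.

Lemma polyO_mul k l f g : polyO k f -> polyO l g -> polyO (k + l) (fun n => f n * g n).
Proof.
move=> [K h] [L h']; exists (K * L) => n n0.
by rewrite expnD mulnACA leq_mul ?h ?h'.
Qed.

Lemma polyO_exp k : polyO k (fun n => n ^ k).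
Proof. by exists 1 => n _; rewrite mul1n. Qed.

Lemma polyO_subn k f g : polyO k f -> polyO k (fun n => f n - g n).
Proof. by move=> [K h]; exists K => n n0; apply: leq_trans (h n n0); exact: leq_subr. Qed.

Lemma polyO_succ k f : polyO k f -> polyO k (fun n => (f n).+1).
Proof.
move=> [K h]; exists K.+1 => n n0; rewrite mulSn -add1n leq_add ?h //.
by rewrite expn_gt0 n0.
Qed.

Ltac polyO_deg := lazymatch goal with
  | |- polyO _ (fun _ => ?c) => exact: polyO_const
  | |- polyO _ (fun n => n) => exact: polyO_id
  | |- polyO _ (fun n => n ^ _) => exact: polyO_exp
  | |- polyO _ (fun n => @?f n + @?g n) => apply: (@polyO_add _ _ f g); polyO_deg
  | |- polyO _ (fun n => @?f n * @?g n) => apply: (@polyO_mul _ _ f g); polyO_deg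
  | |- polyO _ (fun n => @?f n - _) => apply: (@polyO_subn _ f); polyO_deg
  | |- polyO _ (fun n => (@?f n).+1) => apply: (@polyO_succ _ f); polyO_deg
  end.
Ltac polyO_auto := eapply polyO_le; [|polyO_deg]; by [].

Lemma polyO_cMx c : polyO 2 (cMx c).
Proof. rewrite /cMx; polyO_auto. Qed.
Lemma polyO_cBal : polyO 3 cBal.
Proof. rewrite /cBal /cMx /cMul; polyO_auto. Qed.
Lemma polyO_cB0 f : polyO 3 f -> exists K, forall n, 0 < n -> cB0 (f n) n <= K * n ^ 3.
Proof.
move=> [K1 h1]; have [K2 h2] : polyO 3 (fun n => cB0 0 n).
  rewrite /cB0 /cBal /cRes /cMx /cMul; polyO_auto.
exists (4 * K1 + K2) => n n0; rewrite mulnDl -mulnA; have := h1 n n0; have := h2 n n0.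
by rewrite /cB0; set y := n ^ 3; clear; lia.
Qed.
Lemma polyO_cPack : polyO 3 cPack.
Proof. rewrite /cPack /cPush /cPopA /cMx; polyO_auto. Qed.
Lemma polyO_cX : polyO 3 cExact.
Proof. rewrite /cExact /cMx; polyO_auto. Qed.
Definition tauC d cP cL := cLeaf cL d + cG + (4 * cB0 cP d + 4 * cG + 120).

(** Computing [LAM] adds a cost linear in the level. Adding a constant and 120 s to the bound gives
    a potential that at most triples from one level to the next, so this cost does not affect the
    power. *)
Lemma tau_le d cP cL s : tau d cP cL s <= 3 ^ s * tauC d cP cL.
Proof.
suff : tau d cP cL s + (4 * cB0 cP d + 4 * cG + 120) + 120 * s <= 3 ^ s * tauC d cP cL.
  by apply: leq_trans; rewrite -addnA leq_addr.
elim: s => [|s IH]; first by rewrite expn0 mul1n muln0 addn0.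
rewrite expnS -mulnA [tau _ _ _ _]/=; move: IH; set b := cB0 _ _; set g := cG; set t := tau _ _ _ _; set P := (3 ^ s * _).
by clear; lia.
Qed.

Lemma distr4 a b c y q : (a + b + c + 2 * y) * q = a * q + b * q + c * q + 2 * (y * q).
Proof. by lia. Qed.

Lemma distr5 s k z q : (200 + s + 60 + k + 200 + 400 + 80 * z) * q = 860 * q + s * q + k * q + 80 * z * q.
Proof. by lia. Qed.

(** At most $80d^2$ table entries, each one run of the recursion with $3^{T'}$ leaves of cost $T_0$
    and steps of cost $O(d^3)$. *)
Lemma pre_cost : exists K, forall d T0 Tp, 0 < d -> cPre d T0 Tp + 300 <= K * (d ^ 2 * (T0 + d ^ 3) * 3 ^ Tp).
Proof.
have [K1 h1] : polyO 3 (fun n => cMx 300 n + slcost SetEntry + (slcost SetTrig + cMx (ccost RotE) n + cMx 200 n) + cMx 200 n +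
   cMx 300 n + 100 + 40 + cMx 300 n + 200 + 100) by rewrite /cMx; polyO_auto.
have [K2 h2] := polyO_cBal; have [K3 h3] := polyO_cB0 polyO_cX; have [K4 h4] := polyO_cMx 200.
pose K5 := rexp_cost tolPre + 60.
exists (200 + slcost InitPre + 60 + K5 + 200 + 400 + 80 * (K1 + K2 + 4 * K3 + K4 + 5 * cG + 400)) => d T0 Tp dp.
set q := T0 + d ^ 3; set e := 3 ^ Tp.
have d3 : 0 < d ^ 3 by rewrite expn_gt0 dp.
have d2 : 0 < d ^ 2 by rewrite expn_gt0 dp.
have q3 : d ^ 3 <= q by rewrite leq_addl.
have q1 : 0 < q by exact: leq_trans q3.
have e1 : Tp < e by exact: ltn_expl.
have e0 : 0 < e by exact: leq_ltn_trans e1.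
have NTle : NT d <= 80 * d ^ 2.
  by rewrite /NT leq_mul2l /= expnS expn1 leq_mul2r leq_subr orbT.
have tb : tauC d (cExact d) (T0 + 100) <= (K2 + 4 * K3 + K4 + 5 * cG + 400) * q.
  have b2 := h2 d dp; have b3 := h3 d dp; have b4 : cMx 200 d <= K4 * d ^ 3.
    by apply: leq_trans (h4 d dp) _; rewrite leq_mul2l leq_pexp2l ?orbT.
  have m2 : K2 * d ^ 3 <= K2 * q by rewrite leq_mul2l q3 orbT.
  have m3 : K3 * d ^ 3 <= K3 * q by rewrite leq_mul2l q3 orbT.
  have m4 : K4 * d ^ 3 <= K4 * q by rewrite leq_mul2l q3 orbT.
  have m5 : cG * 1 <= cG * q by rewrite leq_mul2l q1 orbT.
  have m6 : T0 <= q by rewrite leq_addr.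
  rewrite /tauC /cLeaf !mulnDl -!mulnA.
  by move: b2 b3 b4 m2 m3 m4 m5 m6 q1; clearbody q; clear; set g := cG; lia.
have eb : cEntry d T0 Tp + 100 <= (K1 + K2 + 4 * K3 + K4 + 5 * cG + 400) * (q * e).
  have := tau_le d (cExact d) (T0 + 100) Tp; rewrite -/e => t1.
  have t2 : e * tauC d (cExact d) (T0 + 100) <= e * ((K2 + 4 * K3 + K4 + 5 * cG + 400) * q) by rewrite leq_mul2l tb orbT.
  have b1 := h1 d dp.
  have m1 : K1 * d ^ 3 <= K1 * (q * e) by rewrite leq_mul2l (leq_trans q3) ?orbT // leq_pmulr.
  rewrite /cEntry; move: b1 m1 t1 t2; set c := 5 * cG.
  have -> : e * ((K2 + 4 * K3 + K4 + c + 400) * q) = (K2 + 4 * K3 + K4 + c + 400) * (q * e) by rewrite mulnC -mulnA.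
  have -> : K1 + K2 + 4 * K3 + K4 + c + 400 = K1 + (K2 + 4 * K3 + K4 + c + 400) by clear; lia.
  rewrite [(K1 + _) * _]mulnDl; set z := (_ + c + 400) * _; set tt := tau _ _ _ _; set et := e * _; set k1 := K1 * _; set k1' := K1 * _.
  by clear; lia.
set P := d ^ 2 * q * e.
have P1 : 0 < P by rewrite muln_gt0 muln_gt0 d2 q1 e0.
have eP : e <= P by rewrite leq_pmull // muln_gt0 d2 q1.
have nb : NT d * (cEntry d T0 Tp + 100) <= 80 * (K1 + K2 + 4 * K3 + K4 + 5 * cG + 400) * P.
  apply: leq_trans (leq_mul NTle eb) _; rewrite /P; set k := (_ + 400).
  by rewrite mulnACA -(mulnA (d ^ 2)).
have k5 : K5 * Tp.+1 <= K5 * P by rewrite leq_mul2l (leq_trans e1) ?orbT.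
have i1 : slcost InitPre * 1 <= slcost InitPre * P by rewrite leq_mul2l P1 orbT.
have tP : Tp <= P by apply: leq_trans (ltnW e1) eP.
rewrite /cPre /cDepth -/K5 [Tp.+1 * K5]mulnC distr5.
move: nb k5 i1 tP P1; clearbody K5; set w := NT d * _; set y := 80 * _ * P; set z := K5 * P; set z' := K5 * _; set s := slcost _ * P; set s' := slcost _.
by clearbody w y z z' s; rewrite /s' muln1; clear; lia.
Qed.

(** A leaf costs $O(d^4)$: there are $O(d^2)$ rotations of forty digits, and each digit takes one
    packed product of cost $O(d^2)$. The steps of the recursion are cheaper, of order $d^3$. *)
Lemma main_cost : exists K, forall d Tt, 0 < d -> cStep d Tt + 100 <= K * (d ^ 4 * 3 ^ Tt).
Proof.
have [K1 h1] : polyO 4 (fun n => cMx 300 n + (n ^ 3 + 200) + cProd n + cRoot n + 60 + (100 + n * (rexp_cost (RV 43) + nexp_cost (NSub NDim (NConst 1)) + 100)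
   + 2 * nexp_cost (NSub NDim (NConst 1))) + slcost Scales + 100 + 2 * nexp_cost (NV VT) + 3 * cMx 300 n + 2 * (cMx 300 n + 60 + 40 + 20) + cRoot n + 200 + 100).
  by rewrite /cProd /cRoot /cMx /cMul; polyO_auto.
have [K2 h2] : polyO 4 (fun n => cLeaf (cLf n) n).
  rewrite /cLeaf /cLf /cCol /cDiag /cPh /cGiv /cRot /cDigit /cMult /cPM /cPk /cBal /cMx /cMul; polyO_auto.
have [K3 h3] := polyO_cB0 polyO_cPack.
pose K5 := rexp_cost (RDiv RPrecision (rn 4)) + 60.
pose K6 := rexp_cost (rn 12) + nexp_cost (NV VT) + 100.
exists (K1 + K5 + K6 + 2 * (K2 + 4 * K3 + 5 * cG + 120)) => d Tt dp.
set e := 3 ^ Tt; set q := d ^ 4.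
have q1 : 0 < q by rewrite expn_gt0 dp.
have q3 : d ^ 3 <= q by rewrite leq_pexp2l.
have e1 : Tt < e by exact: ltn_expl.
have e0 : 0 < e by exact: leq_ltn_trans e1.
have tb : tauC d (cPack d) (cLf d) <= (K2 + 4 * K3 + 5 * cG + 120) * q.
  have b2 := h2 d dp; have b3 := h3 d dp; rewrite -/q in b2.
  have m3 : K3 * d ^ 3 <= K3 * q by rewrite leq_mul2l q3 orbT.
  have m5 : cG * 1 <= cG * q by rewrite leq_mul2l q1 orbT.
  rewrite /tauC !mulnDl -!mulnA; move: b2 b3 m3 m5 q1; clearbody q; set g := cG; set l := cLeaf _ _.
  by clearbody l; clear; lia.
have eP : e <= q * e by rewrite leq_pmull.
have qP : q <= q * e by rewrite leq_pmulr.
have := tau_le d (cPack d) (cLf d) Tt; rewrite -/e => t1.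
have t2 : e * tauC d (cPack d) (cLf d) <= (K2 + 4 * K3 + 5 * cG + 120) * (q * e).
  by rewrite mulnC mulnA leq_mul2r tb orbT.
have b1 := h1 d dp; rewrite -/q in b1.
have m1 : K1 * q <= K1 * (q * e) by rewrite leq_mul2l qP orbT.
have k5 : K5 * Tt.+1 <= K5 * (q * e) by rewrite leq_mul2l (leq_trans e1) ?orbT.
have k6 : K6 * Tt <= K6 * (q * e) by rewrite leq_mul2l (leq_trans (ltnW e1)) ?orbT.
rewrite /cStep /cDepth /cConsts /cPow /cMainSK -/K5 -/K6 [Tt.+1 * K5]mulnC [Tt * K6]mulnC distr4.
move: t1 t2 b1 m1 k5 k6; clearbody K5 K6; set W := (_ + 120) * _; set P1 := K1 * (q * e); set P5 := K5 * (q * e); set P6 := K6 * (q * e).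
set x5 := K5 * _; set x6 := K6 * _; set tt := tau _ _ _ _; set et := e * _; set x1 := K1 * q.
by clear; lia.
Qed.

Lemma sq_le (F : realFieldType) (x y : F) : (0 <= x -> x <= y -> x ^+ 2 <= y ^+ 2)%R.
Proof. by move=> x0 xy; rewrite ler_pXn2r ?nnegrE // (le_trans x0). Qed.

(** * Numerical constants and logarithmic depth bounds *)

Section Numerics.
Variable R : realType.

Lemma nrm_opnorm n (A : 'M[R[i]]_n) : nrm A = opnorm A.
Proof. by rewrite unlock. Qed.

Lemma tolp_gt0 d : 0 < d -> (0 < tolp R d)%R.
Proof. by move=> d0; rewrite invr_gt0; apply: mulr_gt0; apply: exprn_gt0; rewrite ltr0n. Qed.

Lemma ln_le_natr d : 0 < d -> (ln d%:R <= d%:R :> R)%R.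
Proof.
move=> d0; have dp : (0 < d%:R :> R)%R by rewrite ltr0n.
have := @le_ln1Dx R (d%:R - 1)%R; rewrite (addrC 1%R) subrK => h.
by apply: le_trans (h _) _; [rewrite ltrBrDr addNr|rewrite lerBlDr lerDl].
Qed.

(** Three times $25\ln2+2\ln d$, with $\ln2\le\ln d$, is at most $81\ln d$. *)
Lemma tolp_log d Tp : 1 < d -> depth_of (tolp R d) Tp -> ((3 / 2) ^+ Tp <= 81%:R * ln d%:R :> R)%R.
Proof.
move=> d1 h; have d0 : 0 < d by exact: ltnW.
have dp : (0 < d%:R :> R)%R by rewrite ltr0n.
have h32 : (32%:R = 2 ^+ 5 :> R)%R by rewrite -natrX.
have t4 : (tolp R d <= 1 / 4)%R.
  apply: le_trans (ler_tolp R d1) _; rewrite div1r lef_pV2 ?posrE ?exprn_gt0 //.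
  have -> : (4 = 2 ^+ 2 :> R)%R by rewrite -natrX.
  by rewrite h32 -exprM ler_weXn2l // ler1n.
apply: le_trans (depth_log (tolp_gt0 d0) t4 h) _.
have -> : (1 / tolp R d = 2 ^+ 25 * d%:R ^+ 2 :> R)%R by rewrite /tolp div1r invrK h32 -exprM.
rewrite lnM ?posrE ?exprn_gt0 // !lnXn // -(mulr_natl (ln 2) 25) -(mulr_natl (ln d%:R) 2).
have : (ln 2 <= ln d%:R :> R)%R by rewrite ler_ln ?posrE // ler_nat.
by set a := ln 2; set b := ln _; lra.
Qed.

(** For a precision of at most 1/4 the logarithm of 4 is absorbed, so
    $3\ln(4/\varepsilon)\le6\ln(1/\varepsilon)$. *)
Lemma eps_log (eps : R) Tt : (0 < eps)%R -> (eps <= 1 / 4)%R -> depth_of (eps / 4)%R Tt ->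
  ((3 / 2) ^+ Tt <= 6 * ln (1 / eps))%R.
Proof.
move=> e0 e4 h; have t0 : (0 < eps / 4)%R by rewrite divr_gt0.
apply: le_trans (depth_log t0 _ h) _; first by lra.
have -> : (1 / (eps / 4) = 4 * (1 / eps))%R by field; rewrite gt_eqF.
have p1 : (0 < 1 / eps)%R by rewrite divr_gt0.
rewrite lnM ?posrE //.
have : (ln 4 <= ln (1 / eps))%R.
  by rewrite ler_ln ?posrE // ler_pdivlMr // -ler_pdivlMl //; move: e4; lra.
lra.
Qed.

Lemma depth_lin T y : ((3 / 2) ^+ T <= y :> R)%R -> (T%:R <= 2 * y)%R.
Proof.
move=> h; have : (1 + T%:R / 2 <= (3 / 2 : R) ^+ T)%R.
  elim: T {h} => [|T IH]; first by rewrite expr0 mul0r addr0.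
  have := ler0n R T; rewrite exprS -natr1; move: IH; set q := ((3 / 2) ^+ T)%R; lra.
move: h; set q := ((3 / 2) ^+ T)%R; lra.
Qed.

Lemma pow_le_powR (b c x : R) T : (1 < b)%R -> (0 <= c)%R -> (0 <= x)%R -> ((3 / 2) ^+ T <= c * x)%R ->
  (b ^+ T <= c `^ (ln b / ln (3 / 2)) * x `^ (ln b / ln (3 / 2)))%R.
Proof. by move=> b1 c0 x0 h; rewrite -powRM //; exact: pow_log. Qed.

(** From $\pi\ge2$ the last summand is at least $64^{3/2}=512$; hence the bound $1/c^2$ on the net
    radius is at most $2^{-18}$. *)
Lemma sk_const_ge (C : R) : (1 <= C)%R -> (512%:R <= sk_const C)%R.
Proof.
move=> C1; have p2 := @pi_ge2 R.
have h64 : (512%:R <= (32%:R * pi) `^ (3 / 2) :> R)%R.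
  have -> : (512%:R = (8 ^+ 2) `^ (3 / 2) :> R)%R.
    rewrite -powR_mulrn // -powRrM.
    have -> : (2%:R * (3 / 2) = 3%:R :> R)%R by field.
    by rewrite powR_mulrn // -natrX.
  have hb : (8 ^+ 2 <= 32%:R * pi :> R)%R.
    have -> : (8 ^+ 2 = 32%:R * 2 :> R)%R by rewrite -natrX -natrM.
    by rewrite ler_pM2l.
  apply: ge0_ler_powR; rewrite ?nnegrE ?exprn_ge0 // ?divr_ge0 //.
  by apply: le_trans hb; exact: exprn_ge0.
have := ler_pM (ler0n _ _) ler01 h64 C1; rewrite mulr1 => h.
rewrite /sk_const; apply: le_trans h _; rewrite lerDr !addr_ge0 // ?mulr_ge0 ?sqrtr_ge0 // ?pi_ge0 //.
Qed.

Lemma eps0_bound (delta0 C eps0 : R) : (1 <= C)%R ->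
  (0 < eps0 < Num.min (1 / sk_const C ^+ 2) (delta0 ^+ 2 / (32 * pi)))%R -> (eps0 <= eseq R 0)%R.
Proof.
move=> C1 /andP[_]; rewrite lt_min => /andP[h _]; apply: le_trans (ltW h) _.
have h5 := sk_const_ge C1; have p5 : (0 < 512%:R :> R)%R by rewrite ltr0n.
have -> : (eseq R 0 = 1 / 512%:R ^+ 2)%R by rewrite [eseq _ _]/= expr_div_n expr1n.
rewrite !div1r lef_pV2 ?posrE; [|apply: exprn_gt0; exact: lt_le_trans h5|exact: exprn_gt0].
exact: sq_le (ler0n _ _) h5.
Qed.
End Numerics.

Local Open Scope ring_scope.

Theorem corollary4p29 (R : realType) (delta0 C eps0 : R)
  (hBCH : bch_constants delta0 C)
  (heps0 : 0 < eps0 < Num.min (1 / sk_const C ^+ 2) (delta0 ^+ 2 / (32 * pi))) :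
  exists (pre main : cmd) (K eps1 : R),
    [/\ oblivious pre, search_free main, 0 < K, 0 < eps1 &
    forall (d m : nat) (G : 'I_m -> 'M[R[i]]_d) (l0 T0 S0 : nat)
           (search : 'M[R[i]]_d -> seq 'I_m)
           (p : nat) (U : 'I_p -> 'M[R[i]]_d) (eps : R),
      (2 <= d)%N ->
      instruction_set G -> universal G ->
      eps_net eps0 (words_upto G l0) ->
      (forall V, SU V ->
         (size (search V) <= l0)%N /\
         opnorm (V - word_eval G (search V)) <= eps0) ->
      (forall i, SU (U i)) -> 0 < eps ->
      exists (t S : nat) (st : state R),
        [/\ runs G U eps search T0 S (Seq pre main) t st,
            forall i : 'I_p, exists2 w, circuit G st i = Some w &
              opnorm (U i - word_eval G w) <= eps /\
              (eps <= eps1 ->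
               (size w)%:R <= K * (l0%:R * d%:R `^ (19 / 2)
                 * ln d%:R `^ k_length R * ln (1 / eps) `^ k_length R)),
            eps <= eps1 ->
              t%:R <= K * (d%:R ^+ 2 * (T0%:R + d%:R ^+ 3) * ln d%:R `^ k_time R
                + p%:R * d%:R ^+ 4 * ln (1 / eps) `^ k_time R)
          & eps <= eps1 -> (S.*2 + S0)%:R <= K * (S0%:R + d%:R ^+ 4)]].
Proof.
have [_ C1 _] := hBCH.
have e00 := eps0_bound C1 heps0.
have [K1 hK1] := pre_cost; have [K2 hK2] := main_cost.
(* The numbers 81 and 6 are the constants of [tolp_log] and [eps_log], raised to the two
   exponents. *)
pose c1 : R := ((81%:R) `^ k_time R); pose c2 : R := (6 `^ k_time R).
pose c3 : R := ((81%:R) `^ k_length R); pose c4 : R := (6 `^ k_length R).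
pose KA : R := (K1%:R * c1 + K2%:R * c2); have [k320 [k0 kE]] : exists x : R, (0 <= x) /\ x = 320%:R by exists 320%:R; split; first exact: ler0n.
have [K0 [K0p K0E]] : exists x : R, (0 < x) /\ x = 4096%:R by exists 4096%:R; split; first by rewrite ltr0n.
pose KB : R := (k320 * c3 * c4).
have [p1 p2 p3 p4] : [/\ 0 <= c1, 0 <= c2, 0 <= c3 & 0 <= c4] by split; exact: powR_ge0.
have KA0 : (0 <= KA) by rewrite addr_ge0 ?mulr_ge0.
have KB0 : (0 <= KB) by exact: mulr_ge0 (mulr_ge0 k0 p3) p4.
have K0n := ltW K0p.
have a0 : (0 <= K1%:R * c1) by exact: mulr_ge0 (ler0n _ _) p1.
have b0 : (0 <= K2%:R * c2) by exact: mulr_ge0 (ler0n _ _) p2.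
have KBle : (KB <= KA + KB + K0) by rewrite -addrA addrCA lerDl; exact: addr_ge0.
have K0le : (K0 <= KA + KB + K0) by rewrite lerDr; exact: addr_ge0.
have Kale : (K1%:R * c1 <= KA + KB + K0) by rewrite /KA -!addrA lerDl; exact: addr_ge0 b0 (addr_ge0 KB0 K0n).
have Kble : (K2%:R * c2 <= KA + KB + K0) by rewrite /KA -!addrA addrCA lerDl; exact: addr_ge0 a0 (addr_ge0 KB0 K0n).
(* One constant serves all three estimates, so the constants for time, length and space are added;
   1/4 is the threshold required by [eps_log]. *)
exists Pre, Main, (KA + KB + K0), (1 / 4); split=> //.
  exact: ltr_wpDl (addr_ge0 KA0 KB0) K0p.
move=> d m G l0 T0 S0 search p U eps d1 hG _ _ hs hU e0.
have d0 : (0 < d)%N by exact: ltnW.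
have [Tp hTp] := depth_exists (tolp_gt0 R d0).
have [Tt hTt] := depth_exists (divr_gt0 e0 (ltr0Sn R 3)).
(* Room for the table and, behind it, for the exact stack of the preprocessing. The main phase needs
   only registers 0 to 15 and the table, so the precision does not enter. *)
pose S := (64 + (base0 d + 3 * Tp).+1 * rsz d)%N.
have S64 : (64 <= S)%N by rewrite leq_addr.
have rmB : room d S (base0 d + 3 * Tp) by exact: leqnn.
have rm15 : room d S 15 by apply: room_le rmB; rewrite /base0 -addnA.
have rm : room d S 14 by apply: room_le rm15.
have hs' V : SU V -> (size (search V) <= l0)%N /\ (nrm (V - word_eval G (search V)) <= eps0).
  by move=> hV; rewrite nrm_opnorm; exact: hs.
have [s1 t1 [[h40 _ h43 _ [lo1 _]] tab]] := @T_pre R d m p G U eps search T0 S d1 S64 rm hG eps0 l0 e00 hs' Tp hTp rmB.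
have tok : table_ok G (tolp R d) (Lamp Tp) (ltp l0 Tp) s1.
  move=> ty j j' b a jj hb ha; apply: tab => //; apply: tidx_lt => //.
  by have := ltn_ord j'; rewrite jj; clear; lia.
have mi : minv G U eps (Lamp Tp) (ltp l0 Tp) Tt 0 s1 by split.
have [s2 t2 [_ _ _ _ hans]] := @T_main R d m p G U eps search T0 S d1 S64 rm hG (Lamp Tp) (ltp l0 Tp) (Lamp_gt0 d Tp) Tt e0 hTt rm15 s1 hU mi.
have [t tn ex] := T_seq t1 t2 (leqnn _).
have lnd : (0 <= ln d%:R :> R) by rewrite ln_ge0 // ler1n.
have dR : (1 <= d%:R :> R) by rewrite ler1n.
have plog := tolp_log d1 hTp.
exists t, S, s2; split => //.
- move=> i; have [n [a1 a2 a3 a4]] := hans i (ltn_ord i).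
  exists (wd G (slp s2) n); first by rewrite /circuit a1.
  split; first by rewrite -nrm_opnorm.
  move=> e4; have elog := eps_log e0 e4 hTt.
  have lne : (0 <= ln (1 / eps)).
    by rewrite ln_ge0 // ler_pdivlMr // mul1r (le_trans e4) // ler_pdivrMr ?mul1r ?ler1n.
  have q1 : (5 ^+ Tp <= c3 * ln d%:R `^ k_length R) by apply: pow_le_powR; rewrite ?ltr1n.
  have q2 : (5 ^+ Tt <= c4 * ln (1 / eps) `^ k_length R) by apply: pow_le_powR; rewrite ?ltr1n.
  (* The length bound actually obtained has $d^2$ in place of $d^{19/2}$. *)
  have q3 : (d%:R ^+ 2 <= d%:R `^ (19 / 2) :> R).
    by rewrite -powR_mulrn // ler_powR // ler_pdivlMr // -natrM ler_nat.
  apply: (@le_trans _ _ (k320 * (l0%:R * d%:R ^+ 2 * 5 ^+ Tp * 5 ^+ Tt))).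
    apply: (@le_trans _ _ (4 * (5 ^ Tt * (80 * d ^ 2 * ltp l0 Tp)))%N%:R); first by rewrite ler_nat.
    have -> : (4 * (5 ^ Tt * (80 * d ^ 2 * ltp l0 Tp)) = 320 * (l0 * d ^ 2 * 5 ^ Tp * 5 ^ Tt))%N.
      by rewrite /ltp; set x := (5 ^ Tt)%N; set y := (5 ^ Tp)%N; set z := (d ^ 2)%N; clear; lia.
    by rewrite natrM -kE !natrM !natrX.
  have b1 : (l0%:R * d%:R ^+ 2 * 5 ^+ Tp * 5 ^+ Tt <= l0%:R * d%:R `^ (19 / 2) * (c3 * ln d%:R `^ k_length R) * (c4 * ln (1 / eps) `^ k_length R)).
    by rewrite !ler_pM ?mulr_ge0 ?exprn_ge0.
  set W := (_ * ln (1 / eps) `^ k_length R).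
  have W0 : (0 <= W) by rewrite /W !mulr_ge0 ?powR_ge0.
  apply: (@le_trans _ _ (KB * W)); last exact: ler_wpM2r W0 _ _ KBle.
  apply: le_trans (ler_wpM2l k0 b1) _; rewrite /KB /W le_eqVlt; apply/orP; left; apply/eqP.
  set x1 := (_ `^ (19 / 2)); set x2 := (ln d%:R `^ _); set x3 := (ln (1 / eps) `^ _).
  ring.
- move=> e4; have elog := eps_log e0 e4 hTt.
  have lne : (0 <= ln (1 / eps)).
    by rewrite ln_ge0 // ler_pdivlMr // mul1r (le_trans e4) // ler_pdivrMr ?mul1r ?ler1n.
  have q1 : (3 ^+ Tp <= c1 * ln d%:R `^ k_time R) by apply: pow_le_powR; rewrite ?ltr1n.
  have q2 : (3 ^+ Tt <= c2 * ln (1 / eps) `^ k_time R) by apply: pow_le_powR; rewrite ?ltr1n.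
  have h1 := hK1 d T0 Tp d0; have h2 := hK2 d Tt d0.
  have tle : (t <= K1 * (d ^ 2 * (T0 + d ^ 3) * 3 ^ Tp) + p * (K2 * (d ^ 4 * 3 ^ Tt)))%N.
    apply: leq_trans tn _; have : (p * (cStep d Tt + 100) <= p * (K2 * (d ^ 4 * 3 ^ Tt)))%N by rewrite leq_mul2l h2 orbT.
    by move: h1; clear; lia.
  apply: (@le_trans _ _ (K1%:R * (d%:R ^+ 2 * (T0%:R + d%:R ^+ 3) * 3 ^+ Tp) + p%:R * (K2%:R * (d%:R ^+ 4 * 3 ^+ Tt)))).
    by rewrite -!natrX -natrD -!natrM -natrD ler_nat.
  set Y1 := (d%:R ^+ 2 * (T0%:R + d%:R ^+ 3)); set Y2 := (p%:R * d%:R ^+ 4).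
  have Y10 : (0 <= Y1) by rewrite /Y1 mulr_ge0 ?addr_ge0 ?exprn_ge0.
  have Y20 : (0 <= Y2) by rewrite /Y2 mulr_ge0 ?exprn_ge0.
  set L1 := (ln d%:R `^ k_time R) in q1 *; set L2 := (ln (1 / eps) `^ k_time R) in q2 *.
  have [L10 L20] : (0 <= L1) /\ (0 <= L2) by split; exact: powR_ge0.
  have b1 : (K1%:R * (Y1 * 3 ^+ Tp) <= K1%:R * c1 * (Y1 * L1)).
    by rewrite -(mulrA K1%:R) ler_wpM2l // mulrCA ler_wpM2l.
  have b2 : (p%:R * (K2%:R * (d%:R ^+ 4 * 3 ^+ Tt)) <= K2%:R * c2 * (Y2 * L2)).
    have -> : (p%:R * (K2%:R * (d%:R ^+ 4 * 3 ^+ Tt)) = K2%:R * (Y2 * 3 ^+ Tt) :> R) by rewrite /Y2; ring.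
    by rewrite -(mulrA K2%:R) ler_wpM2l // mulrCA ler_wpM2l.
  apply: le_trans (lerD b1 b2) _; rewrite mulrDr.
  by apply: lerD; [exact: ler_wpM2r (mulr_ge0 Y10 L10) _ _ Kale|exact: ler_wpM2r (mulr_ge0 Y20 L20) _ _ Kble].
- move=> _.
  (* Very crude, but a stack of O(d) frames takes $O(d^3)$ cells, still less than the table. *)
  have Tl : (Tp <= 162 * d)%N.
    rewrite -(ler_nat R) natrM; apply: le_trans (depth_lin plog) _.
    have := ln_le_natr R d0; set x := ln _; have -> : (162%:R = 2 * 81%:R :> R) by rewrite -natrM.
    by rewrite -mulrA !ler_pM2l.
  have sb : (S.*2 + S0 <= 4096 * (S0 + d ^ 4))%N.
    rewrite /S /base0 /NT /rsz -muln2.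
    have hd2 : ((d - 1) * d <= d * d)%N by rewrite leq_mul2r leq_subr orbT.
    have -> : (d ^ 4 = d * d * (d * d))%N by rewrite (expnD d 2 2) !expnS expn0 muln1.
    set w := (d * d)%N in hd2 *; set v := ((d - 1) * d)%N in hd2 *.
    have w4 : (4 <= w)%N by rewrite /w; apply: (leq_mul d1 d1).
    have dw : (d <= w)%N by rewrite /w leq_pmulr.
    have b1 : ((16 + 80 * v + 3 * Tp).+1 <= 577 * w)%N by move: hd2 Tl dw w4; clear; lia.
    have b2 : ((16 + 80 * v + 3 * Tp).+1 * (2 * w) <= 577 * w * (2 * w))%N by rewrite leq_mul2r b1 orbT.
    have b3 : (w <= w * w)%N by rewrite leq_pmulr // (leq_trans _ w4).
    by move: b2 b3 w4; set u := (_.+1 * _)%N; clearbody u; clear; lia.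
  apply: (@le_trans _ _ (4096 * (S0 + d ^ 4))%N%:R); first by rewrite ler_nat.
  rewrite natrM -K0E natrD natrX; apply: ler_wpM2r; first by rewrite addr_ge0 ?exprn_ge0.
  exact: K0le.
Qed.
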